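(* Let $\Gamma$ be a cofinite Fuchsian group, and let $\delta>1$ be a real number. For every cusp $\mathfrak{c}$ of $\Gamma$, let $\epsilon_{\mathfrak c}'>\epsilon_{\mathfrak c}>0$ be real numbers satisfying $$\epsilon_{\mathfrak c}'\bigl(\delta+\sqrt{\delta^2-1}\bigr)^{1/2}\le\min_{\gamma\in\Gamma,\ \gamma\notin\Gamma_{\mathfrak c}}C_{\mathfrak c}(\gamma)\quad\text{and}\quad\bigl(\delta+\sqrt{\delta^2-1}\bigr)\epsilon_{\mathfrak c}\le\epsilon_{\mathfrak c}'$$ and small enough such that the discs $D_{\mathfrak c}(\epsilon_{\mathfrak c}')$ are pairwise disjoint. Let $Y=(\Gamma\backslash\mathbf{H})\setminus\bigsqcup_{\mathfrak c}D_{\mathfrak c}(\epsilon_{\mathfrak c})$. Let $A$ and $B$ be real numbers satisfying $$A\le\mathrm{gr}_\Gamma(z,w)+\sum_{\gamma\in\Gamma,\ u(z,\gamma w)\le\delta}\bigl(L(u(z,\gamma w))-L(\delta)\bigr)\le B\quad\text{for all }z,w\in Y.$$ (a) If $\mathfrak{c}$ is a cusp such that $z\in D_{\mathfrak c}(\epsilon_{\mathfrak c})$, $w\in Y$ and $w\notin D_{\mathfrak c}(\epsilon_{\mathfrak c}')$, then $$A\le\mathrm{gr}_\Gamma(z,w)-\frac{1}{\mathrm{vol}_\Gamma}\log(\epsilon_{\mathfrak c}y_{\mathfrak c}(z))\le B.$$ (a$'$) If $\mathfrak{c}$ is a cusp such that $w\in D_{\mathfrak c}(\epsilon_{\mathfrak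 c})$, $z\in Y$ and $z\notin D_{\mathfrak c}(\epsilon_{\mathfrak c}')$, then $$A\le\mathrm{gr}_\Gamma(z,w)-\frac{1}{\mathrm{vol}_\Gamma}\log(\epsilon_{\mathfrak c}y_{\mathfrak c}(w))\le B.$$ (b) If $\mathfrak{c},\mathfrak{d}$ are two distinct cusps such that $z\in D_{\mathfrak c}(\epsilon_{\mathfrak c})$ and $w\in D_{\mathfrak d}(\epsilon_{\mathfrak d})$, then $$A\le\mathrm{gr}_\Gamma(z,w)-\frac{1}{\mathrm{vol}_\Gamma}\log(\epsilon_{\mathfrak c}y_{\mathfrak c}(z))-\frac{1}{\mathrm{vol}_\Gamma}\log(\epsilon_{\mathfrak d}y_{\mathfrak d}(w))\le B.$$ (c) If $\mathfrak{c}$ is a cusp such that $z,w\in D_{\mathfrak c}(\epsilon_{\mathfrak c}')$, then $$\tilde A_{\mathfrak c}\le\mathrm{gr}_\Gamma(z,w)-\#(\Gamma\cap\{\pm1\})\cdot\frac{1}{2\pi}\log|q_{\mathfrak c}(z)-q_{\mathfrak c}(w)|-\frac{1}{\mathrm{vol}_\Gamma}\log(\epsilon_{\mathfrak c}'y_{\mathfrak c}(z))-\frac{1}{\mathrm{vol}_\Gamma}\log(\epsilon_{\mathfrak c}'y_{\mathfrak c}(w))\le\tilde B_{\mathfrak c},$$ where $$\tilde A_{\mathfrak c}=A+\#(\Gamma\cap\{\pm1\})\Bigl[\frac{1}{\epsilon_{\mathfrak c}'}\Bigl(1-\frac2\pi\arctan\sqrt{\frac{\delta-1}{2}}\Bigr)-\epsilon_{\mathfrak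 c}'r_\delta\Bigr],$$ $$\tilde B_{\mathfrak c}=B+\#(\Gamma\cap\{\pm1\})\Bigl[\frac{1}{\epsilon_{\mathfrak c}'}\Bigl(1-\frac2\pi\arctan\sqrt{\frac{\delta-1}{2}}\Bigr)+\epsilon_{\mathfrak c}'r_\delta\Bigr],$$ and $r_\delta=\frac{1}{24\pi}\Bigl(\sqrt{\frac{2}{\delta-1}}+\arctan\sqrt{\frac{\delta-1}{2}}\Bigr)$.
   Context: **Green function.** $\mathbf{H}$ is the complex upper half-plane with the hyperbolic metric $(dx^2+dy^2)/y^2$, volume form $\mu_{\mathbf H}=dx\wedge dy/y^2$ and Laplace operator $\Delta=y^2(\partial_x^2+\partial_y^2)$; $\mathrm{SL}_2(\mathbf{R})$ acts by Möbius transformations. $u(z,w)=1+\frac{|z-w|^2}{2(\Im z)(\Im w)}$, and $L(u)=\frac{1}{4\pi}\log\frac{u+1}{u-1}$ for $u>1$. A cofinite Fuchsian group is a discrete subgroup $\Gamma\subset\mathrm{SL}_2(\mathbf{R})$ with $\Gamma\backslash\mathbf{H}$ of finite volume. Integration over $\Gamma\backslash\mathbf{H}$ is $1/\#(\Gamma\cap\{\pm1\})$ times the usual integral over the Riemann surface; $\mathrm{vol}_\Gamma=\int_{\Gamma\backslash\mathbf{H}}\mu_{\mathbf H}$. $\Delta_\Gamma$ is the self-adjoint extension to $L^2(\Gamma\backslash\mathbf{H})$ of $\Delta$ on smooth bounded $\Gamma$-invariant functions. There is a unique bounded self-adjoint operator $G_\Gamma$ on $L^2(\Gamma\backslash\mathbf{H})$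 such that for smooth bounded $f$, $\Delta_\Gamma G_\Gamma f=f-\frac{1}{\mathrm{vol}_\Gamma}\int f\mu_{\mathbf H}$ and $\int G_\Gamma f\,\mu_{\mathbf H}=0$. $\mathrm{gr}_\Gamma$ is the unique function on $\mathbf{H}\times\mathbf{H}$ that is $\Gamma$-invariant in each variable, symmetric, smooth except for logarithmic singularities at points $(z,\gamma z)$, with $G_\Gamma f(z)=\int_{w\in\Gamma\backslash\mathbf{H}}\mathrm{gr}_\Gamma(z,w)f(w)\mu_{\mathbf H}(w)$ for all smooth bounded $\Gamma$-invariant $f$. At points $z\in\Gamma w$, the expression in the hypothesis on $A,B$ and the expression in (c) are understood by continuous extension (the logarithmic singularities cancel). **Cusps.** Cusps $\mathfrak{c}$ of $\Gamma$ correspond to conjugacy classes of non-trivial maximal parabolic subgroups of $\Gamma$; for each cusp let $\Gamma_{\mathfrak c}$ be the stabiliser in $\Gamma$ of the fixed point in $\mathbf{P}^1(\mathbf{R})$ of a chosen representative, and fix $\sigma_{\mathfrak c}\in\mathrm{SL}_2(\mathbf{R})$ such that $\sigma_{\mathfrak c}\infty$ is that fixed point and $\{\pm1\}\sigma_{\mathfrak c}^{-1}\Gamma_{\mathfrak c}\sigma_{\mathfrak c}=\{\pm1\}\{\begin{pmatrix}1&b\\0&1\end{pmatrix}: b\in\mathbf{Z}\}$. Put $q_{\mathfrak c}(z)=\exp(2\pi i\sigma_{\mathfrak c}^{-1}z)$, $y_{\mathfrak c}(z)=\Im(\sigma_{\mathfrak c}^{-1}z)$, and $C_{\mathfrak c}(\gamma)=|c|$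 if $\sigma_{\mathfrak c}^{-1}\gamma\sigma_{\mathfrak c}=\begin{pmatrix}a&b\\c&d\end{pmatrix}$; then $\Gamma_{\mathfrak c}=\{\gamma\in\Gamma: C_{\mathfrak c}(\gamma)=0\}$. For $0<\epsilon\le\min_{\gamma\in\Gamma\setminus\Gamma_{\mathfrak c}}C_{\mathfrak c}(\gamma)$, $D_{\mathfrak c}(\epsilon)$ is the image in $\Gamma\backslash\mathbf{H}$ of $\{z\in\mathbf{H}: y_{\mathfrak c}(z)>1/\epsilon\}$ (a punctured open disc around $\mathfrak{c}$, on which $q_{\mathfrak c}$ is a coordinate). **Conventions.** For $z\in\mathbf{H}$ and $S\subseteq\Gamma\backslash\mathbf{H}$, ''$z\in S$'' means that the image of $z$ in $\Gamma\backslash\mathbf{H}$ lies in $S$. For a point of $D_{\mathfrak c}(\epsilon)$, the quantities $y_{\mathfrak c}$ and $q_{\mathfrak c}$ are evaluated at a representative in $\mathbf{H}$ with $y_{\mathfrak c}>1/\epsilon$ (this does not depend on the choice). *)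

(* Defs.v *)
From HB Require Import structures.
From mathcomp Require Import all_boot all_order all_algebra.
From mathcomp Require Import finmap.
From mathcomp Require Import complex.
From mathcomp Require Import all_classical all_reals all_analysis.
From mathcomp Require Import measurable_realfun.

Set Implicit Arguments.
Unset Strict Implicit.
Unset Printing Implicit Defensive.
Import Order.TTheory GRing.Theory Num.Theory.
Import numFieldNormedType.Exports.
Local Open Scope classical_set_scope.
Local Open Scope ring_scope.

(* A point x + iy of the plane is the pair (x, y) : R * R; this carries the
   product topology, norm and Lebesgue measure of the library. Functions on the
   upper half-plane are functions on R * R whose values outside [upper] never
   matter, and functions on Gamma\H are Gamma-invariant functions on [upper]. *)
Definition upper (R : realType) : set (R * R) := [set z | 0 < z.2].
Arguments upper {R}.

Definition toC (R : realType) (z : R * R) : R[i] := Complex z.1 z.2.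

Definition cexp (R : realType) (z : R[i]) : R[i] :=
  let: Complex x y := z in Complex (expR x * cos y) (expR x * sin y).

Definition smooth_on (R : realType) (E : normedModType R) (U : set E)
    (f : E -> R) : Prop :=
  forall (s : seq E) (x : E), U x ->
    differentiable (foldr (fun v g => 'D_v g) f s : E -> R^o) x.

Section HyperbolicPlane.
Variable R : realType.
Implicit Types (z w : R * R) (f : R * R -> R) (g : 'M[R]_2).

Definition mat2 (a b c d : R) : 'M[R]_2 :=
  \matrix_(i, j) nth 0 (nth [::] [:: [:: a; b]; [:: c; d]] i) j.

Definition mobius g z : R * R :=
  let q := (real_complex R (g 0 0) * toC z + real_complex R (g 0 1)) /
           (real_complex R (g 1 0) * toC z + real_complex R (g 1 1)) in
  (complex.Re q, complex.Im q).

(* The projective line is [option R], with [None] the point at infinity. *)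
Definition P1act g (p : option R) : option R :=
  match p with
  | None => if g 1 0 == 0 then None else Some (g 0 0 / g 1 0)
  | Some x => if g 1 0 * x + g 1 1 == 0 then None
              else Some ((g 0 0 * x + g 0 1) / (g 1 0 * x + g 1 1))
  end.

Definition hmeasure (A : set (measurableTypeR R * measurableTypeR R)) : \bar R :=
  (\int[(@lebesgue_measure R \x @lebesgue_measure R)%E]_(z in A `&` upper)
     ((z.2 ^+ 2)^-1)%:E)%E.

Lemma measurable_upper :
  measurable (@upper R : set (measurableTypeR R * measurableTypeR R)).
Proof.
have -> : @upper R = setT `*` `]0, +oo[%classic.
  apply/seteqP; split => -[x y] /=; rewrite /upper /= in_itv/= andbT; first by split.
  by case.
exact: measurableX.
Qed.

Let hmeasure0 : hmeasure set0 = 0%E.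
Proof. by rewrite /hmeasure set0I integral_set0. Qed.

Let hmeasure_ge0 A : (0 <= hmeasure A)%E.
Proof.
by apply: integral_ge0 => z _; rewrite lee_fin invr_ge0 sqr_ge0.
Qed.

Let hmeasure_sigma_additive : semi_sigma_additive hmeasure.
Proof.
move=> /= F mF tF mUF; rewrite /hmeasure; apply: cvg_toP.
  apply: ereal_nondecreasing_is_cvgn => m n mn.
  by apply: lee_sum_nneg_natr => // k _ _; exact: hmeasure_ge0.
rewrite setI_bigcupl ge0_integral_bigcup//=.
- by move=> k; apply: measurableI => //; exact: measurable_upper.
- apply: (@measurable_funS _ _ _ _ upper); first exact: measurable_upper.
    by move=> z [k _ []].
  apply/measurable_EFinP.
  apply: (@eq_measurable_fun _ _ _ _ _ (fun z : R * R => z.2 `^ (- 2))).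
    move=> z; rewrite inE /upper /= => z0.
    by rewrite powRN -[2]/(2%:R) powR_mulrn// ltW.
  apply/measurable_funTS.
  have mid : measurable_fun setT
      ((fun x : measurableTypeR R => x) : measurableTypeR R -> R).
    by move=> _ B mB; rewrite setTI; exact: mB.
  exact: (@measurableT_comp _ _ _ _ _ _ _ _ _ (measurable_powR (R:=R) (- 2))
    (measurableT_comp mid
      (@measurable_snd _ _ (measurableTypeR R) (measurableTypeR R)))).
- by move=> z _; rewrite lee_fin invr_ge0 sqr_ge0.
- move=> i j _ _ [z [[Fi _] [Fj _]]].
  by apply: tF => //; exists z.
Qed.

HB.instance Definition _ := isMeasure.Build _ _ _ hmeasure
  hmeasure0 hmeasure_ge0 hmeasure_sigma_additive.

Definition hlaplacian f z : R :=
  z.2 ^+ 2 * ('D_((1, 0) : R * R) ('D_((1, 0) : R * R) (f : R * R -> R^o)) z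
            + 'D_((0, 1) : R * R) ('D_((0, 1) : R * R) (f : R * R -> R^o)) z).

Definition upt z w : R :=
  1 + ComplexField.Normc.normc (toC z - toC w) ^+ 2 / (2 * z.2 * w.2).

Definition Lfn (u : R) : R := (4 * pi)^-1 * ln ((u + 1) / (u - 1)).

End HyperbolicPlane.

Section FuchsianGroups.
Variable R : realType.
Implicit Types (z w : R * R) (f h k : R * R -> R) (g s : 'M[R]_2).
Implicit Types (Gamma P Q S : set 'M[R]_2) (F : set (R * R)).

Definition is_subgroup_SL2 P : Prop :=
  [/\ P 1%:M, (forall g, P g -> \det g = 1),
      (forall g1 g2, P g1 -> P g2 -> P (g1 *m g2)) & (forall g, P g -> P (invmx g))].

Definition is_fuchsian Gamma : Prop :=
  is_subgroup_SL2 Gamma /\ (forall g, Gamma g -> isolated Gamma g).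

Definition same_orbit Gamma z w : Prop := exists2 g, Gamma g & z = mobius g w.

Definition invariant Gamma f : Prop :=
  forall g z, Gamma g -> upper z -> f (mobius g z) = f z.

(* A Borel set of representatives: it meets every orbit exactly once. *)
Definition is_fundamental_domain Gamma F : Prop :=
  [/\ measurable (F : set (measurableTypeR R * measurableTypeR R)),
      F `<=` upper
    & forall z, upper z -> exists! w, F w /\ same_orbit Gamma w z].

Definition is_cofinite_fuchsian Gamma F : Prop :=
  [/\ is_fuchsian Gamma, is_fundamental_domain Gamma F
    & (hmeasure F < +oo)%E].

(* The order of Gamma `&` {1, -1}. *)
Definition ncenter Gamma : nat :=
  #|` fset_set (Gamma `&` [set 1%:M; - 1%:M])|.

(* Integration over Gamma\H, computed on the set of representatives F. *)
Definition qint Gamma F f : R :=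
  (ncenter Gamma)%:R^-1 * \int[@hmeasure R]_(z in F) f z.

Definition qvol Gamma F : R :=
  (ncenter Gamma)%:R^-1 * fine (hmeasure F).

Definition ip Gamma F f h : R := qint Gamma F (fun z => f z * h z).

(* Elements of the real Hilbert space L^2(Gamma\H) are represented by functions
   satisfying [in_L2]; two of them are identified when equal almost everywhere. *)
Definition in_L2 Gamma F f : Prop :=
  [/\ invariant Gamma f,
      measurable_fun (upper : set (measurableTypeR R * measurableTypeR R)) f
    & (\int[@hmeasure R]_(z in F) ((f z ^+ 2)%:E) < +oo)%E].

Definition ae_same f h : Prop := ae_eq (@hmeasure R) upper f h.

Definition smooth_bounded Gamma f : Prop :=
  [/\ invariant Gamma f, smooth_on upper f
    & exists M, forall z, upper z -> `|f z| <= M].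

(* [T f h] says that f is in the domain of the unbounded operator T and that
   T f = h; the last clause is the equality of T with its adjoint. *)
Definition is_laplacian Gamma F (T : (R * R -> R) -> (R * R -> R) -> Prop) :=
  [/\ (forall f h, T f h -> in_L2 Gamma F f /\ in_L2 Gamma F h),
      (forall f, smooth_bounded Gamma f -> in_L2 Gamma F (hlaplacian f) ->
         T f (hlaplacian f))
    & forall f h, in_L2 Gamma F f -> in_L2 Gamma F h ->
        (T f h <->
         forall f' h', T f' h' -> ip Gamma F f h' = ip Gamma F h f')].

Definition is_bounded_selfadjoint Gamma F (G : (R * R -> R) -> R * R -> R) :=
  [/\ (forall f, in_L2 Gamma F f -> in_L2 Gamma F (G f)),
      (forall f h, in_L2 Gamma F f -> in_L2 Gamma F h ->
         ae_same f h -> ae_same (G f) (G h)),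
      (forall (a : R) f h, in_L2 Gamma F f -> in_L2 Gamma F h ->
         ae_same (G (fun z => a * f z + h z)) (fun z => a * G f z + G h z)),
      (exists M : R, forall f, in_L2 Gamma F f ->
         ip Gamma F (G f) (G f) <= M * ip Gamma F f f)
    & (forall f h, in_L2 Gamma F f -> in_L2 Gamma F h ->
         ip Gamma F (G f) h = ip Gamma F f (G h))].

Definition is_green_operator Gamma F T G : Prop :=
  is_bounded_selfadjoint Gamma F G /\
  (forall f, smooth_bounded Gamma f ->
     T (G f) (fun z => f z - (qvol Gamma F)^-1 * qint Gamma F f) /\
     qint Gamma F (G f) = 0).

Definition offdiag Gamma : set ((R * R) * (R * R)) :=
  [set p | [/\ upper p.1, upper p.2 & ~ same_orbit Gamma p.1 p.2]].

(* Since L(u(z, w)) is -(1/2pi) log|z - w| plus a smooth function, this says that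
   gr is smooth on the complement of the pairs (z, gamma z), with logarithmic
   singularities there: one term for each gamma in Gamma mapping w0 to z0, the
   coefficient being the one for which the singularities in the statement
   cancel. If z0 is not in the orbit of w0, the sum is empty near (z0, w0). *)
Definition log_singular Gamma (gr : R * R -> R * R -> R) : Prop :=
  forall z0 w0, upper z0 -> upper w0 ->
  exists (U : set ((R * R) * (R * R))) (r : (R * R) * (R * R) -> R),
    [/\ open U, U (z0, w0), smooth_on U r
      & forall z w, U (z, w) -> offdiag Gamma (z, w) ->
        gr z w = r (z, w) -
          \sum_(g \in [set g | Gamma g /\ mobius g w0 = z0])
             Lfn (upt z (mobius g w))].

(* The values of gr at pairs (z, gamma z) are irrelevant. *)
Definition is_green_function Gamma F (gr : R * R -> R * R -> R) : Prop :=
  [/\ (forall g z w, Gamma g -> offdiag Gamma (z, w) ->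
          gr (mobius g z) w = gr z w /\ gr z (mobius g w) = gr z w),
      (forall z w, offdiag Gamma (z, w) -> gr z w = gr w z),
      log_singular Gamma gr,
      (forall z, upper z -> (@hmeasure R).-integrable F (EFin \o gr z))
    & exists T G, [/\ is_laplacian Gamma F T, is_green_operator Gamma F T G
        & forall f, smooth_bounded Gamma f ->
            ae_same (G f) (fun z => qint Gamma F (fun w => gr z w * f w))]].

(* Extension by continuity to pairs of Gamma-equivalent points of an expression
   in (z, w) that has meaning at the other pairs. *)
Definition cont_ext Gamma (E : R * R -> R * R -> R) z w : R :=
  if `[< same_orbit Gamma z w >]
  then lim (E p.1 p.2 @[p --> within (offdiag Gamma) (nbhs (z, w))])
  else E z w.

(* In a subgroup of SL_2(R) whose elements all have trace 2 or -2, every element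
   other than 1 and -1 is parabolic. *)
Definition is_parabolic_subgroup Gamma P : Prop :=
  [/\ is_subgroup_SL2 P, P `<=` Gamma & forall g, P g -> `|\tr g| = 2].

Definition is_max_parabolic Gamma P : Prop :=
  [/\ is_parabolic_subgroup Gamma P,
      (exists g, [/\ P g, g <> 1%:M & g <> - 1%:M])
    & forall Q, is_parabolic_subgroup Gamma Q -> P `<=` Q -> Q = P].

Definition conjugate g P : set 'M[R]_2 :=
  [set g *m p *m invmx g | p in P].

Definition pm S : set 'M[R]_2 := [set g | S g \/ S (- g)].

(* For s = sigma_c the following are Gamma_c, C_c, q_c, y_c and D_c(eps); the
   latter is represented by its inverse image in the upper half-plane. *)
Definition cusp_stab Gamma s : set 'M[R]_2 :=
  [set g | Gamma g /\ P1act g (P1act s None) = P1act s None].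

Definition Ccusp s g : R := `|(invmx s *m g *m s) 1 0|.

Definition qcusp s z : R[i] :=
  cexp (Complex 0 (2 * pi) * toC (mobius (invmx s) z)).

Definition ycusp s z : R := (mobius (invmx s) z).2.

Definition cusp_disc Gamma s (eps : R) : set (R * R) :=
  [set z | upper z /\ exists2 g, Gamma g & eps^-1 < ycusp s (mobius g z)].

(* The type C indexes the cusps: [par c] is the chosen representative of the
   conjugacy class of maximal parabolic subgroups corresponding to c, and
   [sigma c] maps infinity to its fixed point. *)
Definition is_cusp_system Gamma (C : Type) (par : C -> set 'M[R]_2)
    (sigma : C -> 'M[R]_2) : Prop :=
  [/\ (forall c, is_max_parabolic Gamma (par c)),
      (forall P, is_max_parabolic Gamma P ->
         exists! c, exists2 g, Gamma g & P = conjugate g (par c)),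
      (forall c, \det (sigma c) = 1),
      (forall c g, par c g ->
         P1act g (P1act (sigma c) None) = P1act (sigma c) None)
    & forall c,
        pm (conjugate (invmx (sigma c)) (cusp_stab Gamma (sigma c))) =
        pm [set mat2 1 b%:~R 0 1 | b in [set: int]]].

Definition cusp_complement Gamma (C : Type) (sigma : C -> 'M[R]_2)
    (eps : C -> R) : set (R * R) :=
  upper `\` \bigcup_c cusp_disc Gamma (sigma c) (eps c).

Definition rdelta (delta : R) : R :=
  (24 * pi)^-1 * (Num.sqrt (2 / (delta - 1)) +
                  atan (Num.sqrt ((delta - 1) / 2))).

Definition Atilde Gamma (A delta eps' : R) : R :=
  A + (ncenter Gamma)%:R *
    (eps'^-1 * (1 - 2 / pi * atan (Num.sqrt ((delta - 1) / 2)))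
     - eps' * rdelta delta).

Definition Btilde Gamma (B delta eps' : R) : R :=
  B + (ncenter Gamma)%:R *
    (eps'^-1 * (1 - 2 / pi * atan (Num.sqrt ((delta - 1) / 2)))
     + eps' * rdelta delta).

End FuchsianGroups.

(* Main.v *)
(* Tested against small bumps and unfolded to H, the defining property of gr
   becomes the equation Delta_w gr(z, w) = -1/vol off the orbit of z. Hence, in
   the coordinate of a cusp, gr - (1/vol) log y is harmonic and 1-periodic, and
   integrability of gr over a fundamental domain forces it to be bounded near
   the cusp. The maximum principle then carries bounds from a horocycle to the
   whole disc inside it. This gives (a), (a') and (b), because the hypotheses on
   eps and eps' make u(z, gamma w) >= delta for all gamma on the boundary, where
   the sum in the hypothesis on A and B then contributes nothing.
   For (c) the same extension is applied in each variable to
   gr - (n/2pi) log|q(z) - q(w)| - (1/vol) (log y(z) + log y(w)), with n the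
   order of the center. On the boundary y(z) = y(w) = y = 1/eps' only the
   stabilizer of the cusp contributes to the sum, which becomes (n/4pi) times
   sum_(|x + b| <= X) (log(1 + 4y^2/(x + b)^2) - log(1 + 4y^2/X^2)) for an
   explicit X. It is compared with -2 log|2 sin(pi x)| through Stirling's formula
   with remainder, the reflection formula for the Gamma function and
   Euler-Maclaurin for convex functions; the error is the term eps' r_delta. *)
Require Import Defs.
From HB Require Import structures.
From mathcomp Require Import all_boot all_order all_algebra.
From mathcomp Require Import finmap.
From mathcomp Require Import complex ring lra zify.
From mathcomp Require Import all_classical all_reals all_analysis.
From mathcomp Require Import measurable_realfun.

Set Implicit Arguments.
Unset Strict Implicit.
Unset Printing Implicit Defensive.
Import Order.TTheory GRing.Theory Num.Theory.
Import numFieldNormedType.Exports.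
Local Open Scope classical_set_scope.
Local Open Scope ring_scope.

(** * Moebius transformations and Fuchsian groups *)

(** The Green function is known only through the operator it represents, almost everywhere in z, so
    its equation is proved by contradiction: a defect at (z0, w0) keeps its sign on a product of two
    small balls, and one bump on each ball detects it. Near a cusp no Fourier series is needed:
    horizontal means of a convex function of a periodic harmonic function are convex in y, and
    integrability against dy / y^2 excludes linear growth. In (c) the function is undefined where
    the singularities cancel; there a small multiple of log |q(z) - q(w)| is the barrier in the
    maximum principle. The number delta + sqrt(delta^2 - 1) is exp(arcosh delta), and u >= delta as
    soon as two heights have at least this ratio. Hence both conditions: one separates the horocycle
    of height 1/eps from all points outside D(eps'), the other separates points of height 1/eps'
    from their images under elements outside the stabilizer. The number X is the horizontal distance
    at height y for which u = delta, that is 2 y sqrt((delta - 1) / 2). In r_delta, 24 pi = 4 pi * 3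
    * 2: the factor of L, the error 1/3 of the sum over translations, and 1 / (2 y). *)

Section Mobius.
Variable R : realType.
Implicit Types (z w : R * R) (g h : 'M[R]_2).

(** The squared modulus |cz + d|^2 of the automorphy factor. *)
Definition mden g z : R := (g 1 0 * z.1 + g 1 1) ^+ 2 + (g 1 0 * z.2) ^+ 2.

Lemma det2 g : \det g = g 0 0 * g 1 1 - g 0 1 * g 1 0.
Proof.
rewrite (expand_det_row _ 0) !big_ord_recl big_ord0 addr0 /cofactor !det_mx11 !mxE /=.
have -> : lift ord0 ord0 = 1 :> 'I_2 by apply/val_inj.
have -> : lift 1 ord0 = 0 :> 'I_2 by apply/val_inj.
have -> : ord0 = 0 :> 'I_2 by apply/val_inj.
by rewrite /bump /= addn0 addn1 expr0 expr1 mul1r mulN1r mulrN.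
Qed.

Lemma mden_gt0 g z : \det g = 1 -> upper z -> 0 < mden g z.
Proof.
rewrite /mden /upper /= det2 => d1 y0.
have [c0|c0] := eqVneq (g 1 0) 0.
  rewrite c0 !mul0r add0r expr0n addr0 exprn_even_gt0//=.
  by apply/eqP => d0; move: d1; rewrite c0 d0 !mulr0 subrr => /eqP; rewrite eq_sym oner_eq0.
by rewrite ltr_wpDl ?sqr_ge0// exprn_even_gt0//= mulf_neq0// gt_eqF.
Qed.

Lemma mobiusE g z : \det g = 1 -> upper z -> mobius g z =
  (((g 0 0 * z.1 + g 0 1) * (g 1 0 * z.1 + g 1 1) + g 0 0 * g 1 0 * z.2 ^+ 2) / mden g z,
   z.2 / mden g z).
Proof.
move=> d1 z0; have D0 := mden_gt0 d1 z0.
have := d1; rewrite det2 => {}d1.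
have Dn0 : mden g z != 0 by rewrite gt_eqF.
have -> : z.2 / mden g z = (g 0 0 * g 1 1 - g 0 1 * g 1 0) * z.2 / mden g z by rewrite d1 mul1r.
rewrite /mobius /toC /real_complex_def /=; case: z z0 D0 Dn0 => x y /= z0 D0 Dn0.
rewrite /mden /= in D0 Dn0 *.
by congr pair; field;
  rewrite ?addr0 ?mul0r ?subr0 ?add0r ?mulr0 ?subr0 ?addr0 //= ; do ?split => //.
Qed.

Lemma toC_inj z w : toC z = toC w -> z = w.
Proof. by case: z w => [a b] [c d] [] /= -> ->. Qed.

Lemma toC_mobius g z : toC (mobius g z) =
  (real_complex R (g 0 0) * toC z + real_complex R (g 0 1)) /
           (real_complex R (g 1 0) * toC z + real_complex R (g 1 1)).
Proof.
rewrite /mobius; set q : R[i] := _ / _.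
by move: q => [a b].
Qed.

Lemma upper_mobius g z : \det g = 1 -> upper z -> upper (mobius g z).
Proof.
by move=> d1 z0; rewrite mobiusE// /upper /= divr_gt0// mden_gt0.
Qed.

Lemma cden_neq0 g z : \det g = 1 -> upper z ->
  real_complex R (g 1 0) * toC z + real_complex R (g 1 1) != 0.
Proof.
move=> d1 z0; have := mden_gt0 d1 z0; rewrite /mden.
case: z z0 => x y z0 /=; rewrite /real_complex_def /= => D0.
apply/eqP => -[]; rewrite !mul0r !subr0 !addr0 => e1 e2.
by move: D0; rewrite e1 e2 !expr0n /= addr0 ltxx.
Qed.

Lemma mobius1 z : mobius 1%:M z = z.
Proof.
apply: toC_inj; rewrite toC_mobius !mxE /=.
by rewrite !(rmorph0, rmorph1, mul1r, mul0r, addr0, add0r, divr1).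
Qed.

Lemma mobiusN g z : mobius (- g) z = mobius g z.
Proof.
apply: toC_inj; rewrite !toC_mobius !mxE !rmorphN !mulNr -!opprD.
by rewrite invrN mulrNN.
Qed.

Lemma mobiusM g h z : \det g = 1 -> \det h = 1 -> upper z ->
  mobius (g *m h) z = mobius g (mobius h z).
Proof.
move=> dg dh z0.
have N1 := cden_neq0 dh z0.
have dgh : \det (g *m h) = 1 by rewrite det_mulmx dg dh mulr1.
have N2 := cden_neq0 dgh z0.
have N3 := cden_neq0 dg (upper_mobius dh z0).
apply: toC_inj; move: N2 N3; rewrite !toC_mobius !mxE !big_ord_recl !big_ord0 !addr0.
have -> : lift ord0 ord0 = 1 :> 'I_2 by apply/val_inj.
rewrite !rmorphD !rmorphM => N2 N3.
field; do ?[apply/andP; split] => //.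
apply: contra_neq N3 => e.
rewrite mulrA -{1}(mulfK N1 (real_complex R (g 1 1))) -mulrDl.
by apply/eqP; rewrite mulf_eq0 e eqxx.
Qed.

Variant ord2_spec : 'I_2 -> Type := Ord2_0 : ord2_spec 0 | Ord2_1 : ord2_spec 1.

Lemma ord2P (i : 'I_2) : ord2_spec i.
Proof.
case: i => -[|[|//]] i.
  have -> : Ordinal i = 0 :> 'I_2 by apply/val_inj.
  exact: Ord2_0.
have -> : Ordinal i = 1 :> 'I_2 by apply/val_inj.
exact: Ord2_1.
Qed.

Lemma invmxE2 g : \det g = 1 ->
  [/\ invmx g 0 0 = g 1 1, invmx g 0 1 = - g 0 1,
      invmx g 1 0 = - g 1 0 & invmx g 1 1 = g 0 0].
Proof.
move=> d1.
have E : invmx g = \matrix_(i, j) (if i == 0 then (if j == 0 then g 1 1 else - g 0 1)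
    else (if j == 0 then - g 1 0 else g 0 0)); last by rewrite E !mxE.
have U : g \in unitmx by rewrite unitmxE d1 unitr1.
apply: (can_inj (mulKmx U)); rewrite mulmxV//.
rewrite det2 in d1.
have s1 : lift ord0 ord0 = 1 :> 'I_2 by apply/val_inj.
apply/matrixP => i j; rewrite !mxE !big_ord_recl !big_ord0 !addr0 !mxE /= s1.
by case: (ord2P i); case: (ord2P j) => /=; rewrite -?d1; ring.
Qed.

Lemma det_invmx1 g : \det g = 1 -> \det (invmx g) = 1.
Proof. by move=> d1; rewrite det_inv d1 invr1. Qed.

Lemma unitmx_det1 g : \det g = 1 -> g \in unitmx.
Proof. by move=> d1; rewrite unitmxE d1 unitr1. Qed.

Lemma mobiusK g z : \det g = 1 -> upper z -> mobius (invmx g) (mobius g z) = z.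
Proof.
by move=> d1 z0; rewrite -mobiusM ?det_invmx1// mulVmx ?unitmx_det1// mobius1.
Qed.

Lemma mobiusKV g z : \det g = 1 -> upper z -> mobius g (mobius (invmx g) z) = z.
Proof.
by move=> d1 z0; rewrite -mobiusM ?det_invmx1// mulmxV ?unitmx_det1// mobius1.
Qed.

Lemma normc_toC z : ComplexField.Normc.normc (toC z) ^+ 2 = z.1 ^+ 2 + z.2 ^+ 2.
Proof. by case: z => x y /=; rewrite sqr_sqrtr// addr_ge0// sqr_ge0. Qed.

Lemma uptE z w : upt z w =
  1 + ((z.1 - w.1) ^+ 2 + (z.2 - w.2) ^+ 2) / (2 * z.2 * w.2).
Proof. by rewrite /upt -[in RHS](normc_toC (z.1 - w.1, z.2 - w.2)). Qed.

Lemma upt_sym z w : upt z w = upt w z.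
Proof. by rewrite !uptE mulrAC -sqrrN opprB -(sqrrN (z.2 - _)) opprB. Qed.

Lemma upt_ge1 z w : upper z -> upper w -> 1 <= upt z w.
Proof.
move=> z0 w0; rewrite uptE lerDl divr_ge0 ?addr_ge0 ?sqr_ge0//.
by rewrite !mulr_ge0// ltW.
Qed.

Lemma upt_eq1 z w : upper z -> upper w -> upt z w = 1 -> z = w.
Proof.
move=> z0 w0; rewrite uptE => /eqP; rewrite addrC -subr_eq0 addrK.
rewrite mulf_eq0 invr_eq0 !mulf_eq0 pnatr_eq0/= (gt_eqF z0) (gt_eqF w0) !orbF.
rewrite paddr_eq0 ?sqr_ge0// !sqrf_eq0 !subr_eq0 => /andP[/eqP a /eqP b].
by case: z w a b {z0 w0} => [? ?] [? ?] /= -> ->.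
Qed.

Lemma uptxx z : upt z z = 1.
Proof. by rewrite uptE !subrr expr0n addr0 mul0r addr0. Qed.

Lemma upt_mobius g z w : \det g = 1 -> upper z -> upper w ->
  upt (mobius g z) (mobius g w) = upt z w.
Proof.
move=> d1 z0 w0; rewrite !uptE !mobiusE//=.
have Z := gt_eqF (mden_gt0 d1 z0); have W := gt_eqF (mden_gt0 d1 w0).
have y0 := gt_eqF z0; have v0 := gt_eqF w0.
rewrite det2 in d1.
set Z' := mden g z in Z *; set W' := mden g w in W *.
(* The correction by det^2 - 1 turns this into an identity in the entries of g, valid without det g
   = 1, so that [ring] can prove it. *)
have E : ((((g 0 0 * z.1 + g 0 1) * (g 1 0 * z.1 + g 1 1) + g 0 0 * g 1 0 * z.2 ^+ 2) * W'
   - ((g 0 0 * w.1 + g 0 1) * (g 1 0 * w.1 + g 1 1) + g 0 0 * g 1 0 * w.2 ^+ 2) * Z') ^+ 2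
  + (z.2 * W' - w.2 * Z') ^+ 2)
  = (g 0 0 * g 1 1 - g 0 1 * g 1 0) ^+ 2 * ((z.1 - w.1) ^+ 2 + (z.2 - w.2) ^+ 2) * Z' * W'
   - ((g 0 0 * g 1 1 - g 0 1 * g 1 0) ^+ 2 - 1) * (z.2 * W' - w.2 * Z') ^+ 2.
  by rewrite /Z' /W' /mden; ring.
rewrite d1 expr1n mul1r subrr mul0r subr0 in E.
congr (1 + _); transitivity ((((z.1 - w.1) ^+ 2 + (z.2 - w.2) ^+ 2) * Z' * W') / (2 * z.2 * w.2 * Z' * W')).
  by rewrite -E; field; rewrite Z W y0 v0.
by field; rewrite Z W y0 v0.
Qed.

Lemma im_mobius g z : \det g = 1 -> upper z -> (mobius g z).2 = z.2 / mden g z.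
Proof. by move=> d1 z0; rewrite mobiusE. Qed.

(** The left side is the value of u for two points of these heights on one vertical line, the
    hyperbolic cosine of the difference of the logarithms of the heights. *)
Lemma upt_im z w : upper z -> upper w -> (z.2 / w.2 + w.2 / z.2) / 2 <= upt z w.
Proof.
move=> z0 w0; rewrite uptE.
have -> : (z.2 / w.2 + w.2 / z.2) / 2 = 1 + (z.2 - w.2) ^+ 2 / (2 * z.2 * w.2).
  by field; rewrite !gt_eqF.
rewrite lerD2l ler_pM2r ?invr_gt0 ?mulr_gt0// ?lerDr ?sqr_ge0//.
Qed.

Lemma im_ratio_le z w : upper z -> upper w -> z.2 / w.2 <= 2 * upt z w.
Proof.
move=> z0 w0; have := upt_im z0 w0.
have : 0 <= w.2 / z.2 by rewrite divr_ge0 ?ltW.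
lra.
Qed.

(** A polynomial substitute for the triangle inequality of the hyperbolic distance. It is |p - q|^2
    <= 2 |p - z|^2 + 2 |z - q|^2 divided by the heights; the factors 4 u pay for the change of
    height, by [im_ratio_le]. *)
Lemma upt_triangle z p q : upper z -> upper p -> upper q ->
  upt p q - 1 <= 4 * upt z q * (upt p z - 1) + 4 * upt p z * (upt z q - 1).
Proof.
move=> z0 p0 q0.
have h1 := im_ratio_le z0 p0; have h2 := im_ratio_le z0 q0.
rewrite (upt_sym z p) in h1.
have e1 : ((p.1 - z.1) ^+ 2 + (p.2 - z.2) ^+ 2) = 2 * p.2 * z.2 * (upt p z - 1).
  by rewrite uptE addrAC subrr add0r; field; rewrite !gt_eqF.
have e2 : ((z.1 - q.1) ^+ 2 + (z.2 - q.2) ^+ 2) = 2 * z.2 * q.2 * (upt z q - 1).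
  by rewrite uptE addrAC subrr add0r; field; rewrite !gt_eqF.
have k1 : 0 <= upt p z - 1 by rewrite subr_ge0 upt_ge1.
have k2 : 0 <= upt z q - 1 by rewrite subr_ge0 upt_ge1.
rewrite [X in X <= _]( _ : _ = ((p.1 - q.1) ^+ 2 + (p.2 - q.2) ^+ 2) / (2 * p.2 * q.2)); last first.
  by rewrite uptE addrAC subrr add0r.
have h : (p.1 - q.1) ^+ 2 + (p.2 - q.2) ^+ 2 <= 2 * (2 * p.2 * z.2 * (upt p z - 1)) + 2 * (2 * z.2 * q.2 * (upt z q - 1)).
  rewrite -e1 -e2; have := sqr_ge0 ((p.1 - z.1) - (z.1 - q.1)); have := sqr_ge0 ((p.2 - z.2) - (z.2 - q.2)).
  nra.
apply: (@le_trans _ _ ((2 * (2 * p.2 * z.2 * (upt p z - 1)) + 2 * (2 * z.2 * q.2 * (upt z q - 1))) / (2 * p.2 * q.2))).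
  by rewrite ler_pM2r// invr_gt0 !mulr_gt0.
have -> : (2 * (2 * p.2 * z.2 * (upt p z - 1)) + 2 * (2 * z.2 * q.2 * (upt z q - 1))) / (2 * p.2 * q.2) = 2 * (z.2 / q.2) * (upt p z - 1) + 2 * (z.2 / p.2) * (upt z q - 1).
  by field; rewrite !gt_eqF.
apply: lerD; apply: ler_wpM2r => //; lra.
Qed.

End Mobius.

(** * Discreteness: finiteness and separation of orbits *)

Section Discreteness.
Variable R : realType.
Implicit Types (z w p : R * R) (g h : 'M[R]_2) (Gamma : set 'M[R]_2).

Lemma fuchsian_det Gamma g : is_fuchsian Gamma -> Gamma g -> \det g = 1.
Proof. by case=> -[_ + _ _] _; apply. Qed.

Lemma fuchsian_inv Gamma g : is_fuchsian Gamma -> Gamma g -> Gamma (invmx g).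
Proof. by case=> -[_ _ _ +] _; apply. Qed.

Lemma fuchsian_mul Gamma g h :
  is_fuchsian Gamma -> Gamma g -> Gamma h -> Gamma (g *m h).
Proof. by case=> -[_ _ + _] _; apply. Qed.

Lemma fuchsian_one Gamma : is_fuchsian Gamma -> Gamma 1%:M.
Proof. by case=> -[]. Qed.

Lemma fuchsian_isolated1 Gamma : is_fuchsian Gamma ->
  exists2 e : R, 0 < e & forall g, Gamma g ->
    (forall i j, `|g i j - 1%:M i j| < e) -> g = 1%:M.
Proof.
move=> fG; have [_ iso] := fG; have [_ [V nV VG]] := iso _ (fuchsian_one fG).
have /nbhs_ballP[e /= e0 eV] := nV.
exists e => // g Gg ge.
have : (V `&` Gamma) g.
  split=> //; apply: eV; split => // i j.
  by rewrite /ball /= distrC.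
by rewrite VG.
Qed.

(** Isolation of the identity becomes finiteness by the pigeonhole principle: matrices with entries
    in [-M, M] are sorted into finitely many cells, and two elements g, h in one cell have g^-1 h so
    close to 1 that it equals 1. *)
Lemma finite_bounded_entries Gamma (M : R) : is_fuchsian Gamma ->
  finite_set [set g | Gamma g /\ forall i j, `|g i j| <= M].
Proof.
move=> fG; have [e e0 he] := fuchsian_isolated1 fG.
have [M0|M0] := ltP M 0.
  rewrite [X in finite_set X](_ : _ = set0)//; apply/seteqP; split => // g [_ /(_ 0 0)].
  by rewrite leNgt (lt_le_trans M0).
(* The entries of g^-1 are bounded by M too, so g^-1 h - 1 = g^-1 (h - g) has entries at most 2 M /
   N, which is below e because e N = 4 M + 2. *)
pose N : R := (2 * M + 1) / e *+ 2.
have N0 : 0 < N by rewrite mulrn_wgt0// divr_gt0// ltr_wpDl// mulr_ge0.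
pose t (x : R) := Num.truncn ((x + M) * N).
pose f g := ((t (g 0 0), t (g 0 1)), (t (g 1 0), t (g 1 1))).
pose K := (Num.truncn (2 * M * N)).+1.
have tK x : `|x| <= M -> (t x < K)%N.
  move=> xM; rewrite /t /K ltnS; apply: le_truncn.
  by rewrite ler_pM2r//; move: xM; rewrite ler_norml; lra.
have tinj x y : `|x| <= M -> `|y| <= M -> t x = t y -> `|x - y| < N^-1.
  move=> xM yM txy; rewrite -(ltr_pM2r N0) mulVf ?gt_eqF//.
  have x0 : 0 <= (x + M) * N by apply: mulr_ge0; [move: xM; rewrite ler_norml; lra|exact: ltW].
  have y0 : 0 <= (y + M) * N by apply: mulr_ge0; [move: yM; rewrite ler_norml; lra|exact: ltW].
  have := truncn_itv x0; have := truncn_itv y0.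
  rewrite -/(t x) -/(t y) txy -natr1 => /andP[a b] /andP[c d].
  rewrite -{1}(gtr0_norm N0) -normrM ltr_norml; nra.
pose B : set ((nat * nat) * (nat * nat)) := (`I_K `*` `I_K) `*` (`I_K `*` `I_K).
have fB : finite_set B by do ?apply: finite_setX; exact: finite_II.
set S := [set g | _].
have injf : {in S & , injective f}.
  move=> g h; rewrite !inE => -[Gg gM] [Gh hM] [e1 e2 e3 e4].
  have dg := fuchsian_det fG Gg; have dh := fuchsian_det fG Gh.
  have close i j : `|h i j - g i j| < N^-1.
    by rewrite distrC; case: (ord2P i); case: (ord2P j); apply: tinj.
  suff : invmx g *m h = 1%:M.
    by move=> gh; have := mulKVmx (unitmx_det1 dg) h; rewrite gh mulmx1.
  apply: he => [|i j]; first by apply: fuchsian_mul => //; exact: fuchsian_inv.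
  rewrite -(mulVmx (unitmx_det1 dg)) !mxE -sumrB !big_ord_recl big_ord0 addr0 -!mulrBr.
  have iM k l : `|invmx g k l| <= M.
    by have [i1 i2 i3 i4] := invmxE2 dg; case: (ord2P k); case: (ord2P l); rewrite ?(i1,i2,i3,i4) ?normrN.
  apply: (le_lt_trans (ler_normD _ _)); rewrite !normrM.
  apply: (@le_lt_trans _ _ (M * N^-1 + M * N^-1)).
    by apply: lerD; apply: ler_pM => //; exact/ltW/close.
  rewrite -mulrDl ltr_pdivrMr// /N -mulr_natr.
  have -> : e * ((2 * M + 1) / e * 2) = 4 * M + 2 by field; rewrite gt_eqF.
  lra.
rewrite -(eq_finite_set (inj_card_eq injf)).
apply: sub_finite_set fB => _ [g [_ gM] <-] /=.
by split; split; apply: tK.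
Qed.

Lemma sqr_le_bound (x B : R) : x ^+ 2 <= B -> `|x| <= 1 + B.
Proof.
move=> h; rewrite -(real_normK (num_real x)) in h.
have := sqr_ge0 (`|x| - 1); nra.
Qed.

(** If g moves p by a bounded amount, the heights of p and gp are comparable, so |cp + d|^2 is
    bounded, and with it c and d. The inverse gives a, and b follows from |ap + b| = |gp| |cp +
    d|. *)
Lemma bounded_entries_of_upt p (M : R) : upper p ->
  exists K, forall g, \det g = 1 -> upt p (mobius g p) <= M ->
  forall i j, `|g i j| <= K.
Proof.
move=> p0.
pose K1 := (1 + 2 * M); pose K2 := K1 / p.2; pose K3 := K1 + K2 * `|p.1|.
pose w2 := 2 * p.1 ^+ 2 + 2 * (2 * p.2 * (2 * M * p.2) * M) + (2 * M * p.2)^+2.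
pose K4 := 1 + w2 * (2 * M) + K3 * `|p.1|.
exists (K2 + K3 + K4).
have main g : \det g = 1 -> upt p (mobius g p) <= M ->
    [/\ `|g 1 0| <= K2, `|g 1 1| <= K3 & mden g p <= 2 * M].
  move=> dg gM; have gp0 := upper_mobius dg p0.
  have D0 := mden_gt0 dg p0.
  have DM : mden g p <= 2 * M.
    apply: (@le_trans _ _ (2 * upt p (mobius g p))); last by rewrite ler_pM2l.
    have := im_ratio_le p0 gp0; rewrite im_mobius// invf_div mulrC.
    by rewrite -mulrA mulVf ?mulr1// gt_eqF.
  have c1 : (g 1 0 * p.2) ^+ 2 <= 2 * M.
    by apply: le_trans DM; rewrite /mden lerDr sqr_ge0.
  have c2 : (g 1 0 * p.1 + g 1 1) ^+ 2 <= 2 * M.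
    by apply: le_trans DM; rewrite /mden lerDl sqr_ge0.
  have cK : `|g 1 0| <= K2.
    have := sqr_le_bound c1; rewrite normrM (gtr0_norm p0).
    by rewrite /K2 ler_pdivlMr.
  split=> //.
  have -> : g 1 1 = (g 1 0 * p.1 + g 1 1) - g 1 0 * p.1 by ring.
  rewrite (le_trans (ler_normB _ _))// lerD ?sqr_le_bound// normrM.
  by rewrite ler_wpM2r.
move=> g dg gM.
have [cK dK DM] := main g dg gM.
have gp0 := upper_mobius dg p0.
have D0 := mden_gt0 dg p0.
(* The lower right entry of g^-1 is a, and u(p, g^-1 p) = u(p, gp), so the bound on d applied to the
   inverse bounds a. *)
have [_ aK _] : [/\ `|invmx g 1 0| <= K2, `|invmx g 1 1| <= K3 & mden (invmx g) p <= 2 * M].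
  apply: main; first exact: det_invmx1.
  rewrite -(upt_mobius dg)// ?mobiusKV// 1?upt_sym//.
  by apply: upper_mobius => //; exact: det_invmx1.
have [_ _ _ i4] := invmxE2 dg; rewrite i4 in aK.
have M1 : 1 <= M by apply: le_trans gM; exact: upt_ge1.
have K10 : 0 <= K1 by rewrite /K1; lra.
have K20 : 0 <= K2 by rewrite /K2 divr_ge0// ltW.
have K30 : 0 <= K3 by rewrite /K3 addr_ge0// mulr_ge0.
have w20 : 0 <= w2.
  rewrite /w2 !addr_ge0 ?sqr_ge0// mulr_ge0 ?sqr_ge0//.
  by do ?rewrite mulr_ge0 => //; rewrite ?ltW//; lra.
have K40 : 0 <= K4.
  by rewrite /K4 !addr_ge0 ?mulr_ge0//; lra.
have bK : `|g 0 1| <= K4.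
  have -> : g 0 1 = (g 0 0 * p.1 + g 0 1) - g 0 0 * p.1 by ring.
  rewrite (le_trans (ler_normB _ _))// lerD//; last by rewrite normrM ler_wpM2r.
  apply: sqr_le_bound.
  set w := mobius g p.
  have E : (g 0 0 * p.1 + g 0 1) ^+ 2 + (g 0 0 * p.2) ^+ 2 = (w.1 ^+ 2 + w.2 ^+ 2) * mden g p.
    have -> : w = (((g 0 0 * p.1 + g 0 1) * (g 1 0 * p.1 + g 1 1) + g 0 0 * g 1 0 * p.2 ^+ 2) / mden g p,
        (g 0 0 * g 1 1 - g 0 1 * g 1 0) * p.2 / mden g p).
      by rewrite -det2 dg mul1r; exact: mobiusE.
    by move: D0; rewrite /mden /= => D0; field; rewrite gt_eqF.
  have w2M : w.2 <= 2 * M * p.2.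
    have := im_ratio_le gp0 p0; rewrite -/w ler_pdivrMr// => h.
    rewrite (le_trans h)// ler_wpM2r ?(ltW p0)// ler_wpM2l// upt_sym//.
  have wd : (p.1 - w.1) ^+ 2 <= 2 * p.2 * (2 * M * p.2) * M.
    have e1 : ((p.1 - w.1) ^+ 2 + (p.2 - w.2) ^+ 2) = 2 * p.2 * w.2 * (upt p w - 1).
      by rewrite uptE addrAC subrr add0r; field; rewrite !gt_eqF.
    apply: (@le_trans _ _ (2 * p.2 * w.2 * (upt p w - 1))).
      by rewrite -e1 lerDl sqr_ge0.
    have u1 := upt_ge1 p0 gp0; rewrite -/w in gM u1.
    apply: ler_pM; [|lra| |lra].
      by rewrite !mulr_ge0// ltW.
    by rewrite ler_wpM2l// mulr_ge0// ltW.
  have w1 : w.1 ^+ 2 <= 2 * p.1 ^+ 2 + 2 * (2 * p.2 * (2 * M * p.2) * M).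
    have := sqr_ge0 (w.1 - 2 * p.1); move: wd; nra.
  have ww : w.1 ^+ 2 + w.2 ^+ 2 <= w2.
    by rewrite /w2 lerD// ler_sqr// nnegrE ltW//; apply: lt_le_trans w2M.
  apply: (@le_trans _ _ ((w.1 ^+ 2 + w.2 ^+ 2) * mden g p)).
    by rewrite -E lerDl sqr_ge0.
  by apply: ler_pM => //; rewrite ?addr_ge0 ?sqr_ge0// ltW.
by move=> i j; case: (ord2P i); case: (ord2P j); lra.
Qed.

Lemma finite_upt_le Gamma p (M : R) : is_fuchsian Gamma -> upper p ->
  finite_set [set g | Gamma g /\ upt p (mobius g p) <= M].
Proof.
move=> fG p0; have [K hK] := bounded_entries_of_upt M p0.
apply: sub_finite_set (finite_bounded_entries K fG) => g [Gg gM]; split=> //.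
by apply: hK => //; exact: fuchsian_det Gg.
Qed.

Lemma finite_pos_lb (T : choiceType) (S : set T) (f : T -> R) :
  finite_set S -> (forall x, S x -> 0 < f x) ->
  exists2 r : R, 0 < r & forall x, S x -> r <= f x.
Proof.
move=> /finite_seqP[s ->{S}]; elim: s => [|a s IH] f0; first by exists 1.
have [|r r0 rf] := IH; first by move=> x xs; apply: f0; rewrite /= inE xs orbT.
exists (Num.min r (f a)) => [|x].
  by rewrite lt_min r0 f0//= mem_head.
by rewrite /= inE => /orP[/eqP->|/rf]; rewrite ge_min ?lexx ?orbT// => ->.
Qed.

(** Finitely many elements bring p within u <= 2, and r is the least gap among those that move p.
    Elliptic elements may fix p, hence a conclusion about the point and not about g. *)
Lemma orbit_separated Gamma p : is_fuchsian Gamma -> upper p ->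
  exists2 r : R, 0 < r & forall g, Gamma g -> upt p (mobius g p) < 1 + r ->
    mobius g p = p.
Proof.
move=> fG p0.
pose S := [set g | Gamma g /\ upt p (mobius g p) <= 2] `&` [set g | mobius g p <> p].
have fS : finite_set S by apply: sub_finite_set (finite_upt_le 2 fG p0); exact: subIsetl.
have [|r r0 hr] := @finite_pos_lb _ S (fun g => upt p (mobius g p) - 1) fS.
  move=> g [[Gg _] gp]; have dg := fuchsian_det fG Gg.
  have gp0 := upper_mobius dg p0.
  rewrite subr_gt0 lt_neqAle upt_ge1// andbT eq_sym; apply/eqP => /upt_eq1 e.
  by apply: gp; rewrite -e.
exists (Num.min r 1); first by rewrite lt_min r0 ltr01.
move=> g Gg gp; apply: contrapT => gpp.
have : S g.
  split=> //; split=> //; apply/ltW/(lt_le_trans gp).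
  by rewrite -lerBrDl -[X in _ <= X]/(2 - 1) ge_min; apply/orP; right; lra.
move=> /hr; apply/negP; rewrite -ltNge ltrBlDl (lt_le_trans gp)//.
by rewrite lerD2l ge_min lexx.
Qed.

Lemma fuchsian_countable Gamma : is_fuchsian Gamma -> countable Gamma.
Proof.
move=> fG; rewrite (_ : Gamma = \bigcup_n [set g | Gamma g /\ forall i j, `|g i j| <= n%:R]).
  apply: bigcup_countable => // n _; apply: finite_set_countable.
  exact: finite_bounded_entries.
apply/seteqP; split => [g Gg|g [n _ []]//].
pose M := `|g 0 0| + `|g 0 1| + `|g 1 0| + `|g 1 1|.
exists (Num.truncn M).+1 => //; split=> // i j.
apply: ltW; apply: le_lt_trans (truncnS_gt _).
have := normr_ge0 (g 0 0); have := normr_ge0 (g 0 1).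
have := normr_ge0 (g 1 0); have := normr_ge0 (g 1 1).
by rewrite /M; case: (ord2P i); case: (ord2P j); lra.
Qed.

End Discreteness.

(** * The hyperbolic measure and unfolding *)

Section DensityMeasure.
Local Open Scope ereal_scope.
Context d (T : measurableType d) (R : realType).
Variables (mu : {measure set T -> \bar R}) (k : T -> R).
Hypotheses (mk : measurable_fun setT k) (k0 : forall x, (0 <= k x)%R).

Definition density_measure (A : set T) : \bar R := \int[mu]_(x in A) (k x)%:E.

Let density_measure0 : density_measure set0 = 0.
Proof. exact: integral_set0. Qed.

Let density_measure_ge0 A : 0 <= density_measure A.
Proof. by apply: integral_ge0 => x _; rewrite lee_fin. Qed.

Let density_measure_sigma_additive : semi_sigma_additive density_measure.
Proof.
move=> /= F mF tF mUF; rewrite /density_measure; apply: cvg_toP.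
  apply: ereal_nondecreasing_is_cvgn => m n mn.
  by apply: lee_sum_nneg_natr => // i _ _; exact: density_measure_ge0.
rewrite ge0_integral_bigcup//=; last by move=> x _; rewrite lee_fin.
exact/measurable_funTS/measurable_EFinP.
Qed.

HB.instance Definition _ := isMeasure.Build _ _ _ density_measure
  density_measure0 density_measure_ge0 density_measure_sigma_additive.

Import HBNNSimple.

Lemma ge0_integral_densityT (nu : {measure set T -> \bar R}) (f : T -> \bar R) :
  (forall A, measurable A -> nu A = density_measure A) ->
  measurable_fun setT f -> (forall x, 0 <= f x) ->
  \int[nu]_x f x = \int[mu]_x (f x * (k x)%:E).
Proof.
move=> nuE mf f0.
pose f_ := nnsfun_approx measurableT mf.
transitivity (limn (fun n => \int[nu]_x (f_ n x)%:E)).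
  rewrite -monotone_convergence//.
  - apply: eq_integral => y _; apply/esym/cvg_lim => //.
    by apply: cvg_nnsfun_approx=> // *; apply: f0; rewrite inE.
  - by move=> n; exact/measurable_EFinP/measurable_funP.
  - by move=> n y _; rewrite lee_fin.
  - by move=> y _ m n mn; rewrite lee_fin; exact/lefP/nd_nnsfun_approx.
transitivity (limn (fun n => \int[mu]_x ((f_ n x)%:E * (k x)%:E))); last first.
  rewrite -monotone_convergence//; first last.
  - move=> y _ m n mn; apply: lee_wpmul2r; first by rewrite lee_fin.
    by rewrite lee_fin; exact/lefP/nd_nnsfun_approx.
  - by move=> n y _; rewrite mule_ge0// lee_fin.
  - by move=> n; apply: emeasurable_funM; [exact/measurable_EFinP/measurable_funP|exact/measurable_EFinP].
  apply: eq_integral => y _; apply/cvg_lim => //.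
  have cf : EFin \o f_ ^~ y @ \oo --> f y by apply: cvg_nnsfun_approx => // *; apply: f0.
  by apply: cvgeMr.
congr (limn _); apply/funext => n.
transitivity (\sum_(r \in range (f_ n)) r%:E * nu (f_ n @^-1` [set r])).
  under eq_integral do rewrite fimfunE -fsumEFin//.
  rewrite ge0_integral_fsum//; last 2 first.
  - by move=> y; exact/measurable_EFinP/measurable_funM.
  - by move=> y x _; rewrite nnfun_muleindic_ge0.
  by apply: eq_fsbigr => r _; rewrite integralZl_indic_nnsfun// integral_indic// setIT.
transitivity (\sum_(r \in range (f_ n)) \int[mu]_x (r%:E * ((\1_(f_ n @^-1` [set r]) x)%:E * (k x)%:E))).
  apply: eq_fsbigr => r /set_mem [y _ <-].
  have mA : measurable (f_ n @^-1` [set f_ n y]) by [].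
  rewrite nuE// /density_measure integral_mkcond ge0_integralZl//=.
  - congr (_ * _); apply: eq_integral => x _.
    by rewrite patchE indicE; case: ifPn => xA; rewrite ?mul1e ?mul0e.
  - apply: emeasurable_funM; [exact/measurable_EFinP/measurable_indic|exact/measurable_EFinP].
  - by move=> x _; rewrite mule_ge0// lee_fin.
  - by rewrite lee_fin.
rewrite -ge0_integral_fsum//.
- apply: eq_integral => x _.
  rewrite [in RHS]fimfunE -fsumEFin//.
  rewrite ge0_mule_fsuml//; last by move=> r; rewrite nnfun_muleindic_ge0.
  by apply: eq_fsbigr => r _; rewrite muleA EFinM.
- move=> r; apply: measurable_funeM; apply: emeasurable_funM.
    exact/measurable_EFinP/measurable_indic.
  exact/measurable_EFinP.
- move=> r x _; rewrite muleA mule_ge0 ?lee_fin//.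
  by rewrite -lee_fin nnfun_muleindic_ge0.
Unshelve. all: by end_near. Qed.

(** The agreement is asked only for subsets of D, because [hmeasure] has the density y^-2 only
    inside the upper half-plane. *)
Lemma ge0_integral_density (nu : {measure set T -> \bar R}) D (f : T -> \bar R) :
  (forall A, measurable A -> A `<=` D -> nu A = density_measure A) ->
  measurable D -> measurable_fun D f -> (forall x, D x -> 0 <= f x) ->
  \int[nu]_(x in D) f x = \int[mu]_(x in D) (f x * (k x)%:E).
Proof.
move=> nuE mD mf f0.
rewrite integral_mkcond [RHS]integral_mkcond.
transitivity (\int[density_measure]_x (f \_ D) x).
  rewrite -!integral_mkcond; exact: eq_measure_integral.
rewrite (@ge0_integral_densityT density_measure)//.
- apply: eq_integral => x _; rewrite !patchE; case: ifPn => // _.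
  by rewrite mul0e.
- exact/(measurable_restrictT _ _).1.
- by move=> x; rewrite patchE; case: ifPn => // /set_mem /f0.
Qed.

End DensityMeasure.

(** * Lebesgue measure under affine maps and the exponential *)

Section LebesgueTransforms.
Local Open Scope ereal_scope.
Variable R : realType.
Local Notation T := (measurableTypeR R).
Local Notation mu := (@lebesgue_measure R).

Lemma continuous_measurable_funT (f : R -> R) : continuous f ->
  measurable_fun setT (f : T -> T).
Proof.
move=> /continuous_measurable_fun mf _ B mB.
by apply: mf => //; exact: mB.
Qed.

Lemma lebesgue_measure_shift (c : R) (A : set T) : measurable A ->
  mu ((fun x : T => (x + c)%R : T) @^-1` A) = mu A.
Proof.
move=> mA.
have mf : measurable_fun setT (fun x : T => (x + c)%R : T).
  by apply: continuous_measurable_funT => x; apply: cvgD; [exact: cvg_id|exact: cvg_cst].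
rewrite -[LHS]/(pushforward mu (fun x : T => (x + c)%R : T) A).
apply/esym/lebesgue_measure_unique => //= _ [[a b]] _ <-.
rewrite /pushforward/= (_ : _ @^-1` _ = `](a - c)%R, (b - c)%R]%classic).
  rewrite !lebesgue_measure_itv/= !lte_fin ltrD2r.
  by case: ifPn => // _; rewrite -!EFinD; congr EFin; ring.
by apply/seteqP; split => x /=; rewrite !in_itv/= ltrBlDr lerBrDr.
Qed.

Lemma lebesgue_measure_scale (c : R) (A : set T) : (0 < c)%R -> measurable A ->
  mu ((fun x : T => (x * c)%R : T) @^-1` A) = (c^-1)%:E * mu A.
Proof.
move=> c0 mA.
have mf : measurable_fun setT (fun x : T => (x * c)%R : T).
  apply: continuous_measurable_funT => x.
  by apply: cvgM; [exact: cvg_id|exact: cvg_cst].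
suff -> : mu A = mscale (NngNum (ltW c0)) (pushforward mu (fun x : T => (x * c)%R : T)) A.
  by rewrite /mscale /= muleA -EFinM mulVf ?gt_eqF// mul1e.
move=> m; apply: lebesgue_measure_unique => //= _ [[a b]] _ <-.
transitivity (c%:E * mu ((fun x : T => (x * c)%R : T) @^-1` `]a, b])); last by [].
rewrite (_ : _ @^-1` _ = `](a / c)%R, (b / c)%R]%classic).
  rewrite /= !lebesgue_measure_itv/= !lte_fin ltr_pM2r ?invr_gt0//.
  case: ifPn => // _; last by rewrite mule0.
  by rewrite -EFinM; congr EFin; field; rewrite gt_eqF.
by apply/seteqP; split => x /=; rewrite !in_itv/= ltr_pdivrMr// ler_pdivlMr.
Qed.

Lemma lebesgue_measure_reflect (c : R) (A : set T) : measurable A ->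
  mu ((fun x : T => (c - x)%R : T) @^-1` A) = mu A.
Proof.
move=> mA; rewrite -(lebesgue_measure_shift c mA) -lebesgue_measureN.
  by rewrite /pushforward; congr (mu _); apply/seteqP; split => x /=; rewrite opprK addrC.
rewrite -[X in measurable X]setTI.
apply: (continuous_measurable_funT (f := fun x => (c - x)%R)) => // x.
by apply: cvgB; [exact: cvg_cst|exact: cvg_id].
Qed.

Lemma integral_expR_Ny (c : R) :
  \int[mu]_(x in `]-oo, c]) (expR x)%:E = (expR c)%:E.
Proof.
have me : measurable_fun setT ((fun x => (expR x)%:E) : R -> \bar R).
  by apply/measurable_EFinP; exact: measurable_expR.
transitivity (\int[mu]_(x in `[(- c)%R, +oo[) (expR (- x))%:E); last first.
  rewrite (@ge0_continuous_FTC2y _ _ (fun x => - expR (- x))%R _ 0%R).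
  - by rewrite opprK sub0e -EFinN opprK.
  - by move=> x _; rewrite expR_ge0.
  - apply: continuous_subspaceT => x.
    by apply: continuous_comp; [exact: opp_continuous|exact: continuous_expR].
  - rewrite -oppr0; apply: cvgN.
    exact: cvgr_expR.
  - by move=> x _.
  - apply: cvg_at_right_filter; apply: cvgN.
    by apply: continuous_comp; [exact: opp_continuous|exact: continuous_expR].
  - move=> x _; rewrite derive1E deriveN// -derive1E derive1_comp//.
    by rewrite !derive1E (derive_val (f := expR)) deriveN// derive_id mulrN1 opprK.
rewrite (_ : `]-oo, c]%classic = (-%R : T -> T) @^-1` `[(- c)%R, +oo[); last first.
  by rewrite opp_preimage_itvbndy opprK.
transitivity (\int[pushforward mu (-%R : T -> T)]_(x in `[(- c)%R, +oo[) (expR (- x))%:E); last first.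
  by apply: eq_measure_integral => A mA _; exact: lebesgue_measureN.
rewrite ge0_integral_pushforward//=.
  by apply: eq_integral => x _ /=; rewrite opprK.
apply/measurable_funTS/measurable_EFinP.
apply: continuous_measurable_fun => x.
by apply: continuous_comp; [exact: opp_continuous|exact: continuous_expR].
Qed.

Lemma measurable_expR_T : measurable_fun setT (expR : T -> T).
Proof. by apply: continuous_measurable_funT; exact: continuous_expR. Qed.

(* On the positive half-line, Lebesgue measure is the image of e^t dt by exp. *)
Lemma lebesgue_measure_exp (A : set T) : measurable A ->
  mu (A `&` `]0%R, +oo[) =
  \int[mu]_(t in (expR : T -> T) @^-1` A) (expR t)%:E.
Proof.
move=> mA.
have me : measurable_fun setT (expR : T -> R).
  by move=> _ B mB; exact: measurable_expR_T.
have e0 (x : T) : (0 <= expR x)%R by exact: expR_ge0.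
pose dn := density_measure mu (expR : T -> R).
have I0 (c : R) : (0 <= c)%R ->
    dn [set t : T | (expR t <= c)%R] = c%:E.
  rewrite le_eqVlt => /orP[/eqP<-|c0].
    have -> : [set t : T | (expR t <= 0)%R] = set0.
      by apply/seteqP; split => // x /=; rewrite leNgt expR_gt0.
    by rewrite /dn /density_measure integral_set0.
  rewrite -[in RHS](lnK c0) -integral_expR_Ny /dn /density_measure.
  congr integral; apply/seteqP; split => x /=; rewrite in_itv/=.
    by move=> h; rewrite -ler_expR lnK.
  by move=> h; rewrite -(lnK c0) ler_expR.
have mle (c : R) : measurable ([set t : T | (expR t <= c)%R] : set T).
  rewrite (_ : [set _ | _] = (expR : T -> T) @^-1` `]-oo, c]); last first.
    by apply/seteqP; split => x /=; rewrite in_itv.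
  by rewrite -[X in measurable X]setTI; exact: measurable_expR_T.
(* The image of e^t dt lives on the positive half-line. Adding Lebesgue measure on the negative one
   gives a measure with the right value on every half-open interval, so that uniqueness of Lebesgue
   measure applies. *)
pose nu := measure_add (pushforward dn (expR : T -> T)) (mrestr mu (measurable_itv `]-oo, 0%R] : measurable (_ : set T))).
have dnU (A1 A2 : set T) : measurable A1 -> measurable A2 -> A1 `&` A2 = set0 ->
    dn (A1 `|` A2) = dn A1 + dn A2.
  move=> m1 m2 m12; apply: ge0_integral_setU => //.
  - exact/measurable_funTS/measurable_EFinP.
  - by apply/disj_setPS; rewrite m12.
have nuD B : nu me e0 me B = dn ((expR : T -> T) @^-1` B) + mu (B `&` `]-oo, 0%R]).
  by rewrite /nu measure_addE.
suff nuE : forall B : set T, measurable B -> mu B = nu me e0 me B.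
  rewrite nuE; last exact: measurableI.
  rewrite nuD (_ : _ `&` `]-oo, _] = set0); last first.
    apply/seteqP; split => // x /= [[_]]; rewrite !in_itv/= andbT => h1 h2.
    by move: (lt_le_trans h1 h2); rewrite ltxx.
  rewrite measure0 adde0 /dn /density_measure; congr integral.
  by apply/seteqP; split => x /= => [[]|h]; rewrite ?in_itv/= ?andbT ?expR_gt0.
apply: lebesgue_measure_unique => _ [[a b]] _ <-.
transitivity (nu me e0 me `]a, b]%classic); last by [].
rewrite nuD/=.
have [ab|ba] := ltP a b; last first.
  rewrite set_itv_ge ?bnd_simp -?leNgt// preimage_set0 set0I !measure0 adde0.
  by rewrite /dn /density_measure integral_set0.
have [b0|b0] := leP b 0%R.
  rewrite (_ : _ `&` _ = `]a, b]%classic); last first.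
    apply/setIidl => x /=; rewrite !in_itv/= => /andP[_ xb].
    exact: le_trans b0.
  rewrite [dn _](_ : _ = 0) ?add0e//.
  rewrite (_ : _ @^-1` _ = set0) ?/dn /density_measure ?integral_set0//.
  apply/seteqP; split => // x /=; rewrite in_itv/= => /andP[_].
  by rewrite leNgt (le_lt_trans b0)// expR_gt0.
have pE : dn ((expR : T -> T) @^-1` `]a, b]) = (b - Num.max a 0)%:E.
  have /eqP := I0 b (ltW b0).
  rewrite (_ : [set _ | _] = [set t : T | (expR t <= Num.max a 0)%R] `|` (expR : T -> T) @^-1` `]a, b]); last first.
    apply/seteqP; split => x /=; rewrite in_itv/= le_max.
      by move=> ->; rewrite andbT; have [h|h] := ltP a (expR x); [right|left].
    move=> [/orP[xa|]|/andP[]//]; last by rewrite leNgt expR_gt0.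
    by apply: le_trans (ltW ab).
  rewrite dnU//; last 2 first.
  - by rewrite -[X in measurable X]setTI; exact: measurable_expR_T.
  - apply/seteqP; split => // x /= []; rewrite in_itv/= le_max [X in _ || X]leNgt expR_gt0 orbF.
    by move=> h1 /andP[h2 _]; move: (lt_le_trans h2 h1); rewrite ltxx.
  rewrite I0 ?le_max ?lexx ?orbT// => /eqP E.
  by rewrite EFinB -E addeAC -EFinB subrr add0e.
rewrite pE.
have [a0|a0] := leP 0%R a.
  rewrite (_ : _ `&` _ = set0) ?measure0 ?adde0.
    by rewrite lebesgue_measure_itv/= lte_fin ab; case: ltgtP a0 => // ->.
  apply/seteqP; split => // x /= []; rewrite !in_itv/= => /andP[ax _] x0.
  by move: (le_lt_trans a0 (lt_le_trans ax x0)); rewrite ltxx.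
rewrite (_ : _ `&` _ = `]a, 0%R]%classic); last first.
  apply/seteqP; split => x /=; rewrite !in_itv/=.
    by move=> [/andP[-> _] ->].
  by move=> /andP[-> x0]; rewrite x0 (le_trans x0)// ltW.
rewrite !lebesgue_measure_itv/= !lte_fin ab a0.
by rewrite -!EFinD; congr EFin; ring.
Qed.

Lemma ge0_integral_exp (h : R -> \bar R) :
  measurable_fun setT (h : T -> \bar R) -> (forall x, 0 <= h x) ->
  \int[mu]_(y in `]0%R, +oo[) h y = \int[mu]_t (h (expR t) * (expR t)%:E).
Proof.
move=> mh h0.
have me : measurable_fun setT (expR : T -> R).
  by move=> _ B mB; exact: measurable_expR_T.
have e0 (x : T) : (0 <= expR x)%R by exact: expR_ge0.
pose dn := density_measure mu (expR : T -> R).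
transitivity (\int[pushforward dn (expR : T -> T)]_(y in `]0%R, +oo[) h y).
  apply: eq_measure_integral => A mA A0.
  by have := lebesgue_measure_exp mA; rewrite (setIidl A0).
rewrite ge0_integral_pushforward//=; last exact: measurable_funTS.
rewrite (_ : _ @^-1` _ = setT); last first.
  by apply/seteqP; split => x //= _; rewrite in_itv/= expR_gt0.
rewrite (@ge0_integral_density _ _ _ mu (expR : T -> R))//=.
exact: measurableT_comp.
Qed.

End LebesgueTransforms.

(** * Invariance of the hyperbolic measure, and unfolding *)

Section HyperbolicMeasure.
Local Open Scope ereal_scope.
Variable R : realType.
Local Notation T := (measurableTypeR R).
Local Notation mu := (@lebesgue_measure R).
Local Notation mu2 := (mu \x mu).

Lemma measurable_fun_TR d (X : measurableType d) (f : X -> R) :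
  measurable_fun setT f -> measurable_fun setT (f : X -> T).
Proof. by move=> mf _ B mB; apply: mf => //. Qed.

Lemma measurable_fst_R : measurable_fun setT (fun q : T * T => q.1 : R).
Proof. by move=> _ B mB; exact: (@measurable_fst _ _ T T). Qed.

Lemma measurable_snd_R : measurable_fun setT (fun q : T * T => q.2 : R).
Proof. by move=> _ B mB; exact: (@measurable_snd _ _ T T). Qed.

Lemma measurable_pair_TT d (X : measurableType d) (f g : X -> R) :
  measurable_fun setT f -> measurable_fun setT g ->
  measurable_fun setT ((fun x => (f x, g x)) : X -> T * T).
Proof. by move=> mf mg; apply: measurable_fun_pair; exact: measurable_fun_TR. Qed.

Lemma mu2_xsection (A : set (T * T)) : measurable A ->
  mu2 A = \int[mu]_x mu (xsection A x).
Proof. by []. Qed.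

Lemma mu2_ysection (A : set (T * T)) : measurable A ->
  mu2 A = \int[mu]_y mu (ysection A y).
Proof.
move=> mA; transitivity (\int[mu2]_z (\1_A z)%:E).
  by rewrite integral_indic// setIT.
rewrite indic_fubini_tonelli1// indic_fubini_tonelli//.
by rewrite indic_fubini_tonelli_GE.
Qed.

(* In the coordinates p = x / y and t = log y the hyperbolic measure is
   Lebesgue measure dp dt, and Moebius transformations preserve the fibres of
   one of the two projections up to isometries. *)
Definition horo (q : T * T) : T * T := ((q.1 * expR q.2)%R, expR q.2).
Definition horo_inv (z : T * T) : T * T := ((z.1 * expR (- ln z.2))%R, ln z.2).

Lemma measurable_horo : measurable_fun setT horo.
Proof.
apply: measurable_pair_TT.
  apply: measurable_funM; first exact: measurable_fst_R.
  by apply: measurableT_comp; [exact: measurable_expR|exact: measurable_snd_R].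
by apply: measurableT_comp; [exact: measurable_expR|exact: measurable_snd_R].
Qed.

Lemma measurable_horo_inv : measurable_fun setT horo_inv.
Proof.
have ml : measurable_fun setT (fun q : T * T => ln q.2 : R).
  by apply: measurableT_comp; [exact: measurable_ln|exact: measurable_snd_R].
apply: measurable_pair_TT => //.
apply: measurable_funM; first exact: measurable_fst_R.
apply: measurableT_comp; first exact: measurable_expR.
by apply: measurable_funN.
Qed.

Lemma upper_horo q : upper (horo q).
Proof. by rewrite /upper /= expR_gt0. Qed.

Lemma horoK z : upper z -> horo (horo_inv z) = z.
Proof.
case: z => x y; rewrite /upper /= => y0; rewrite /horo /= lnK//.
by rewrite -mulrA expRN lnK// mulVf ?mulr1// gt_eqF.
Qed.

(** Fubini replaces a change of variables in the plane: scaling the horizontal sections contributes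
    a factor y, the substitution y = e^t another one, and together they cancel the density y^-2. *)
Lemma hmeasureE (A : set (T * T)) : measurable A ->
  hmeasure A = mu2 (horo @^-1` A).
Proof.
move=> mA.
have mHA : measurable (horo @^-1` A).
  by rewrite -[X in measurable X]setTI; exact: measurable_horo.
rewrite mu2_ysection// /hmeasure.
have mAU : measurable (A `&` upper) by apply: measurableI => //; exact: measurable_upper.
rewrite integral_mkcond.
pose k (y : R) := (y `^ (- 2))%R.
have mk : measurable_fun setT (k : T -> R).
  by move=> _ B mB; exact: (measurable_powR (- 2)).
have k0 y : (0 <= k y)%R by exact: powR_ge0.
have kE (y : R) : (0 < y)%R -> k y = ((y ^+ 2)^-1)%R.
  by move=> y0; rewrite /k powRN -[2%R]/(2%:R) powR_mulrn// ltW.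
have -> : (fun z : R * R => ((z.2 ^+ 2)^-1)%:E) \_ (A `&` upper) =
    (fun z : T * T => (\1_(A `&` upper) z)%:E * (k z.2)%:E).
  apply/funext => z; rewrite patchE indicE; case: ifPn; last by rewrite mul0e.
  by rewrite inE => -[_ z0]; rewrite mul1e kE.
have mi : measurable_fun setT (fun z : T * T => (\1_(A `&` upper) z)%:E * (k z.2)%:E).
  apply: emeasurable_funM; apply/measurable_EFinP; first exact: measurable_indic.
  by apply: (measurableT_comp mk); exact: measurable_snd.
have i0 z : 0 <= (\1_(A `&` upper) z)%:E * (k z.2)%:E by rewrite mule_ge0 ?lee_fin.
rewrite fubini_tonelli1// fubini_tonelli//.
pose H y := (k y)%:E * mu (ysection A y).
have mH : measurable_fun setT (H : T -> _).
  apply: emeasurable_funM; first exact/measurable_EFinP.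
  exact: measurable_fun_ysection.
have H0 y : 0 <= H y by rewrite mule_ge0 ?lee_fin.
transitivity (\int[mu]_(y in `]0%R, +oo[) H y).
  rewrite [RHS]integral_mkcond; apply: eq_integral => y _.
  rewrite /fubini_G /= patchE; under eq_integral do rewrite muleC.
  rewrite ge0_integralZl//; last 2 first.
  - apply/measurable_EFinP.
    apply: (@measurableT_comp _ _ _ _ _ _ (\1_(A `&` upper) : T * T -> R)).
      exact: measurable_indic.
    exact: measurable_fun_pair.
  - by rewrite lee_fin.
  have := indic_fubini_tonelli_GE mu mAU.
  move=> /(congr1 (fun f => f y)); rewrite /fubini_G /= => ->.
  case: ifPn => y0.
    move: y0; rewrite inE/= in_itv/= andbT => y0.
    congr (_ * mu _); apply/seteqP; split => x; rewrite /ysection /= !inE.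
      by case.
    by move=> Ax; split.
  rewrite (_ : ysection _ _ = set0) ?measure0 ?mule0//.
  apply/seteqP; split => // x; rewrite /ysection /= inE => -[_].
  move=> y1; move/negP: y0; apply.
  by rewrite inE/= in_itv/= andbT.
rewrite ge0_integral_exp//.
apply: eq_integral => t _; rewrite /H kE ?expR_gt0//.
have -> : ysection (horo @^-1` A) t = (fun x : T => (x * expR t)%R : T) @^-1` ysection A (expR t).
  by apply/seteqP; split => x; rewrite /ysection /= !inE.
rewrite lebesgue_measure_scale ?expR_gt0//; last exact: measurable_ysection.
rewrite muleAC -EFinM; congr (_%:E * _).
by rewrite expr2 invfM -mulrA mulVf ?mulr1// gt_eqF// expR_gt0.
Qed.

Definition fibre_preserving (phi : T * T -> T * T) : Prop :=
  measurable_fun setT phi /\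
  forall A, measurable A -> mu2 (phi @^-1` A) = mu2 A.

Lemma fibre_preserving_comp phi psi :
  fibre_preserving phi -> fibre_preserving psi -> fibre_preserving (phi \o psi).
Proof.
move=> [m1 h1] [m2 h2]; split; first exact: measurableT_comp.
move=> A mA; rewrite comp_preimage h2 ?h1//.
by rewrite -[X in measurable X]setTI; exact: m1.
Qed.

Lemma fibre_preserving_shear (h : R -> R) (c : R) : measurable_fun setT h ->
  fibre_preserving (fun q => ((q.1 + h q.2)%R, (q.2 + c)%R)).
Proof.
move=> mh; set phi := (fun q => _).
have mphi : measurable_fun setT phi.
  apply: measurable_pair_TT; apply: measurable_funD.
  - exact: measurable_fst_R.
  - by apply: measurableT_comp; [exact: mh|exact: measurable_snd_R].
  - exact: measurable_snd_R.
  - exact: measurable_cst.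
split=> // A mA.
have mpA : measurable (phi @^-1` A) by rewrite -[X in measurable X]setTI; exact: mphi.
rewrite !mu2_ysection//.
have cm : measurable_fun setT ((fun t : T => (t + c)%R) : T -> T).
  by apply: continuous_measurable_funT => x; apply: cvgD; [exact: cvg_id|exact: cvg_cst].
have -> : \int[mu]_y mu (ysection A y) =
    \int[pushforward mu (fun t : T => (t + c)%R : T)]_y mu (ysection A y).
  by apply: eq_measure_integral => B mB _; exact/esym/lebesgue_measure_shift.
rewrite ge0_integral_pushforward//; last exact: measurable_fun_ysection.
apply: eq_integral => t _ /=.
rewrite -[RHS](lebesgue_measure_shift (h t)); last exact: measurable_ysection.
by congr (mu _); apply/seteqP; split => x; rewrite /ysection /= !inE.
Qed.

Lemma fibre_preserving_flip (h : R -> R) : measurable_fun setT h ->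
  fibre_preserving (fun q => ((- q.1)%R, (h q.1 - q.2)%R)).
Proof.
move=> mh; set phi := (fun q => _).
have mphi : measurable_fun setT phi.
  apply: measurable_pair_TT.
    by apply: measurable_funN; exact: measurable_fst_R.
  apply: measurable_funB; last exact: measurable_snd_R.
  by apply: measurableT_comp; [exact: mh|exact: measurable_fst_R].
split=> // A mA.
have mpA : measurable (phi @^-1` A) by rewrite -[X in measurable X]setTI; exact: mphi.
rewrite !mu2_xsection//.
have cm : measurable_fun setT ((fun t : T => (- t)%R) : T -> T).
  by apply: continuous_measurable_funT; exact: opp_continuous.
have -> : \int[mu]_y mu (xsection A y) =
    \int[pushforward mu (-%R : T -> T)]_y mu (xsection A y).
  by apply: eq_measure_integral => B mB _; exact/esym/lebesgue_measureN.
rewrite ge0_integral_pushforward//; last exact: measurable_fun_xsection.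
apply: eq_integral => t _ /=.
rewrite -[RHS](lebesgue_measure_reflect (h t)); last exact: measurable_xsection.
by congr (mu _); apply/seteqP; split => x; rewrite /xsection /= !inE.
Qed.

Lemma det_mat2 (a b c d : R) : (\det (mat2 a b c d) = a * d - b * c)%R.
Proof. by rewrite det2 !mxE. Qed.

(** Bruhat decomposition. In the coordinates (p, t) translations and dilations have the form (p +
    h(t), t + c), inversions the form (-p, h(p) - t), and both kinds preserve dp dt by Fubini. *)
Lemma mobius_horo (g : 'M[R]_2) : (\det g = 1)%R ->
  exists2 phi, fibre_preserving phi & forall q, mobius g (horo q) = horo (phi q).
Proof.
have prodm (g1 g2 : 'M[R]_2) : (\det g1 = 1)%R -> (\det g2 = 1)%R ->
    (exists2 phi, fibre_preserving phi & forall q, mobius g1 (horo q) = horo (phi q)) ->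
    (exists2 phi, fibre_preserving phi & forall q, mobius g2 (horo q) = horo (phi q)) ->
    (exists2 phi, fibre_preserving phi & forall q, mobius (g1 *m g2) (horo q) = horo (phi q)).
  move=> d1 d2 [phi p1 e1] [psi p2 e2]; exists (phi \o psi).
    exact: fibre_preserving_comp.
  by move=> q; rewrite mobiusM//= ?e2 ?e1//; exact: upper_horo.
have trans (b : R) : exists2 phi, fibre_preserving phi &
    forall q, mobius (mat2 1 b 0 1) (horo q) = horo (phi q).
  exists (fun q => ((q.1 + b * expR (- q.2))%R, (q.2 + 0)%R)).
    apply: (@fibre_preserving_shear (fun t => b * expR (- t))%R).
    apply: measurable_funM => //.
    by apply: measurableT_comp; [exact: measurable_expR|exact: measurable_funN].
  case=> p t; rewrite mobiusE; last 2 first.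
  - by rewrite det_mat2; ring.
  - exact: upper_horo.
  rewrite /mden /horo !mxE /= addr0; congr pair; last by field.
  by rewrite expRN; field; rewrite gt_eqF// expR_gt0.
have dil (a d : R) : (a * d = 1)%R -> exists2 phi, fibre_preserving phi &
    forall q, mobius (mat2 a 0 0 d) (horo q) = horo (phi q).
  move=> ad.
  have d0 : d != 0%R by apply/eqP => d0; move/eqP: ad; rewrite d0 mulr0 eq_sym oner_eq0.
  have aE : a = (d^-1)%R by apply: (mulIf d0); rewrite ad mulVf.
  exists (fun q => ((q.1 + 0)%R, (q.2 + ln (a ^+ 2))%R)).
    exact: (@fibre_preserving_shear (fun=> 0)%R).
  case=> p t; rewrite mobiusE; last 2 first.
  - by rewrite det_mat2 mulr0 subr0.
  - exact: upper_horo.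
  rewrite /mden /horo !mxE /= addr0 expRD lnK; last first.
    by rewrite posrE exprn_even_gt0//= aE invr_eq0.
  by congr pair; rewrite aE; field.
(* This matrix acts by z -> -1 / (c^2 z), which changes the sign of p = x / y and sends y to 1 /
   (c^2 y (1 + p^2)). *)
have inv (c : R) : c != 0%R -> exists2 phi, fibre_preserving phi &
    forall q, mobius (mat2 0 (- c^-1) c 0) (horo q) = horo (phi q).
  move=> c0.
  exists (fun q => ((- q.1)%R, ((- ln (c ^+ 2 * (1 + q.1 ^+ 2))) - q.2)%R)).
    apply: (@fibre_preserving_flip (fun p => - ln (c ^+ 2 * (1 + p ^+ 2)))%R).
    apply: measurable_funN; apply: measurableT_comp; first exact: measurable_ln.
    apply: measurable_funM => //; apply: measurable_funD => //.
    case=> p t; rewrite mobiusE; last 2 first.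
  - by rewrite det_mat2; field.
  - exact: upper_horo.
  have e0 := expR_gt0 t.
  have p0 : (0 < 1 + p ^+ 2)%R by rewrite ltr_pwDl// sqr_ge0.
  rewrite /mden /horo !mxE /= expRD expRN lnK; last first.
    by rewrite posrE mulr_gt0// exprn_even_gt0.
  rewrite expRN.
  have D0 : ((c * (p * expR t) + 0) ^+ 2 + (c * expR t) ^+ 2 = c ^+ 2 * expR t ^+ 2 * (1 + p ^+ 2))%R by ring.
  rewrite D0; congr pair; field; rewrite c0 !gt_eqF//.
move=> dg.
have dg' := dg; rewrite det2 in dg'.
have gE : g = (mat2 (g 0 0) (g 0 1) (g 1 0) (g 1 1))%R.
  by apply/matrixP => i j; rewrite mxE; case: (ord2P i); case: (ord2P j).
have mulE (a b c d a' b' c' d' : R) : (mat2 a b c d *m mat2 a' b' c' d' =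
    mat2 (a * a' + b * c') (a * b' + b * d') (c * a' + d * c') (c * b' + d * d'))%R.
  apply/matrixP => i j; rewrite !mxE !big_ord_recl big_ord0 addr0 !mxE.
  by case: (ord2P i); case: (ord2P j).
have [c0|c0] := eqVneq (g 1 0)%R 0%R.
  rewrite c0 mulr0 subr0 in dg'.
  have -> : (g = mat2 1 (g 0 1 * g 0 0) 0 1 *m mat2 (g 0 0) 0 0 (g 1 1))%R.
    rewrite mulE {1}gE c0; congr mat2; rewrite ?mul0r ?mulr0 ?mul1r ?add0r ?addr0//.
    by rewrite -mulrA dg' mulr1.
  by apply: (prodm) => //; rewrite ?det_mat2 ?mulr0 ?subr0 ?mulr1//; exact: dil.
have -> : (g = mat2 1 (g 0 0 / g 1 0) 0 1 *m (mat2 0 (- (g 1 0)^-1) (g 1 0) 0 *m mat2 1 (g 1 1 / g 1 0) 0 1))%R.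
  have e01 : (g 0 1 = (g 0 0 * g 1 1 - 1) / g 1 0)%R.
    by apply: (mulIf c0); rewrite divfK// -dg'; ring.
  by rewrite !mulE {1}gE e01; congr mat2; field.
apply: (prodm) => //; first by rewrite det_mat2; ring.
  by rewrite mulE det_mat2; field.
apply: (prodm _ _ _ _ (inv _ c0) (trans _)); rewrite det_mat2; first by field.
by ring.
Qed.

Lemma measurable_mobius_preimage (g : 'M[R]_2) (B : set (T * T)) :
  (\det g = 1)%R -> measurable B -> measurable (upper `&` mobius g @^-1` B).
Proof.
move=> dg mB; have [phi [mphi _] e] := mobius_horo dg.
have -> : upper `&` mobius g @^-1` B =
    upper `&` horo_inv @^-1` (phi @^-1` (horo @^-1` B)).
  by apply/seteqP; split => z [z0] /= h; split => //=; move: h; rewrite -e horoK.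
apply: measurableI; first exact: measurable_upper.
rewrite -[X in measurable X]setTI; apply: measurable_horo_inv => //.
rewrite -[X in measurable X]setTI; apply: mphi => //.
by rewrite -[X in measurable X]setTI; exact: measurable_horo.
Qed.

Lemma measurable_fun_mobius (g : 'M[R]_2) : (\det g = 1)%R ->
  measurable_fun (upper : set (T * T)) (mobius g : T * T -> T * T).
Proof. by move=> dg _ B mB; exact: measurable_mobius_preimage. Qed.

Lemma hmeasure_mobius (g : 'M[R]_2) (B : set (T * T)) :
  (\det g = 1)%R -> measurable B ->
  hmeasure (upper `&` mobius g @^-1` B) = hmeasure B.
Proof.
move=> dg mB; have [phi [mphi h] e] := mobius_horo dg.
rewrite !hmeasureE//; last exact: measurable_mobius_preimage.
rewrite -[RHS]h; last by rewrite -[X in measurable X]setTI; exact: measurable_horo.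
congr (mu2 _); apply/seteqP; split => q /=; rewrite e; first by case.
by move=> hq; split => //; exact: upper_horo.
Qed.

Lemma ge0_integral_hmeasure (B : set (T * T)) (f : T * T -> \bar R) :
  measurable B -> measurable_fun B f -> (forall z, B z -> 0 <= f z) ->
  \int[@hmeasure R]_(z in B) f z = \int[mu2]_(q in horo @^-1` B) f (horo q).
Proof.
move=> mB mf f0.
rewrite -(ge0_integral_pushforward measurable_horo mu2)//.
  have mh := measurable_horo.
  by apply: eq_measure_integral => A mA _; exact: hmeasureE.
by move=> z /set_mem; exact: f0.
Qed.

Lemma ge0_integral_mobius (g : 'M[R]_2) (B : set (T * T)) (f : T * T -> \bar R) :
  (\det g = 1)%R -> measurable B -> B `<=` upper -> measurable_fun B f ->
  (forall z, B z -> 0 <= f z) ->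
  \int[@hmeasure R]_(z in upper `&` mobius g @^-1` B) f (mobius g z) =
  \int[@hmeasure R]_(z in B) f z.
Proof.
move=> dg mB Bu mf f0; have [phi [mphi h] e] := mobius_horo dg.
have mgB := measurable_mobius_preimage dg mB.
have mhB : measurable (horo @^-1` B) by rewrite -[X in measurable X]setTI; exact: measurable_horo.
rewrite !ge0_integral_hmeasure//; last 2 first.
- apply: (measurable_comp mB _ mf); first by move=> _ /= [z [_ ?] <-].
  by apply: measurable_funS (measurable_fun_mobius dg); [exact: measurable_upper|move=> z []].
- by move=> z [_]; exact: f0.
have mfh : measurable_fun (horo @^-1` B) (f \o horo).
  apply: (measurable_comp mB _ mf); first by move=> _ /= [z ? <-].
  by apply: measurable_funTS; exact: measurable_horo.
transitivity (\int[mu2]_(q in phi @^-1` (horo @^-1` B)) (f \o horo) (phi q)).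
  rewrite (_ : horo @^-1` _ = phi @^-1` (horo @^-1` B)).
    by apply: eq_integral => q _; rewrite /= e.
  apply/seteqP; split => q /=; rewrite e; first by case.
  by move=> hq; split => //; exact: upper_horo.
transitivity (\int[pushforward mu2 phi]_(q in horo @^-1` B) (f \o horo) q).
  by rewrite ge0_integral_pushforward// => z /set_mem; exact: f0.
by apply: eq_measure_integral => A mA _; exact: h.
Qed.

Definition inj_mod (Gamma : set 'M[R]_2) (V : set (R * R)) : Prop :=
  forall v w, V v -> V w -> same_orbit Gamma v w -> v = w.

Definition saturation (Gamma : set 'M[R]_2) (V : set (R * R)) : set (R * R) :=
  [set z | exists2 g, Gamma g & V (mobius g z)].

(* Unfolding: V is cut along the translates of F, and the pieces are moved
   back into F, where they are disjoint because V is injective. *)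
Lemma unfolding (Gamma : set 'M[R]_2) (F V : set (T * T)) (f : T * T -> \bar R) :
  is_fuchsian Gamma -> is_fundamental_domain Gamma F ->
  measurable V -> V `<=` upper -> inj_mod Gamma V ->
  measurable_fun (upper : set (T * T)) f -> (forall z, upper z -> 0 <= f z) ->
  (forall g z, Gamma g -> upper z -> f (mobius g z) = f z) ->
  measurable (F `&` saturation Gamma V) /\
  \int[@hmeasure R]_(z in F `&` saturation Gamma V) f z =
  \int[@hmeasure R]_(z in V) f z.
Proof.
move=> fG [mF Fu Frep] mV Vu injV mf f0 finv.
have /pfcard_geP[G0|[e]] := fuchsian_countable fG.
  by have := fuchsian_one fG; rewrite G0.
have eG k : Gamma (e k) by have := @funS _ _ _ _ e k I.
have ed k : (\det (e k) = 1)%R by apply: fuchsian_det (eG k).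
pose W k := V `&` (upper `&` mobius (invmx (e k)) @^-1` F).
have mW k : measurable (W k).
  by apply: measurableI => //; apply: measurable_mobius_preimage => //; exact: det_invmx1.
(* Different elements may act alike, as g and -g do, so the pieces W overlap; each point of V is
   kept only in the first piece that contains it. *)
pose Vk := seqDU W.
have mVk k : measurable (Vk k) by exact: seqDU_measurable.
have VkV k : Vk k `<=` V by move=> z [[]].
have VE : \bigcup_k Vk k = V.
  rewrite -seqDU_bigcup_eq; apply/seteqP; split => z; first by move=> [k _ []].
  move=> Vz; have z0 := Vu _ Vz; have [w [[Fw [g Gg wg]] _]] := Frep _ z0.
  have [k _ ek] := 'surj_e (fuchsian_inv fG Gg).
  exists k => //; split => //; split => //=.
  have dg := fuchsian_det fG Gg.
  by rewrite ek invmxK -wg.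
pose Uk k : set (T * T) := upper `&` mobius (e k) @^-1` (Vk k).
have mUk k : measurable (Uk k) by apply: measurable_mobius_preimage.
have UkF k : Uk k `<=` F.
  by move=> z [z0 [[_ [_ +]] _]]; rewrite /= mobiusK.
have UE : \bigcup_k Uk k = F `&` saturation Gamma V.
  apply/seteqP; split => z.
    move=> [k _ Ukz]; split; first exact: UkF Ukz.
    by case: Ukz => z0 /= /VkV h; exists (e k).
  move=> [Fz [g Gg Vgz]].
  have [k _ Vkz] : (\bigcup_k Vk k) (mobius g z) by rewrite VE.
  exists k => //; split; first exact: Fu.
  rewrite /=; suff -> : mobius (e k) z = mobius g z by [].
  have z0 := Fu _ Fz; have dg := fuchsian_det fG Gg.
  have gz0 := upper_mobius dg z0.
  have [_ [_ /= Fw]] := (Vkz).1.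
  have [w [_ uw]] := Frep _ gz0.
  have h1 : w = z.
    apply: uw; split => //; exists (invmx g); first exact: fuchsian_inv.
    by rewrite mobiusK.
  have h2 : w = mobius (invmx (e k)) (mobius g z).
    by apply: uw; split => //; exists (invmx (e k)) => //; exact: fuchsian_inv.
  by rewrite -[in LHS]h1 h2 mobiusKV.
(* A point in two pieces would have two images in V lying in one orbit. By injectivity the images
   coincide, and they would lie in two disjoint pieces Vk. *)
have tU : trivIset setT Uk.
  apply/trivIsetP => i j _ _ ij; apply/seteqP; split => // z [[z0 /= Vi] [_ /= Vj]].
  have : mobius (e i) z = mobius (e j) z.
    apply: injV; [exact: VkV Vi|exact: VkV Vj|].
    exists (e i *m invmx (e j)).
      by apply: fuchsian_mul => //; exact: fuchsian_inv.
    rewrite mobiusM ?mobiusK//; first exact: det_invmx1.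
    exact: upper_mobius.
  move=> E; rewrite -E in Vj.
  have /trivIsetP/(_ i j I I ij) := trivIset_seqDU W.
  by rewrite predeqE => /(_ (mobius (e i) z))[+ _]; apply; split.
rewrite -UE; split; first by apply: bigcup_measurable => k _.
rewrite -[in RHS]VE !ge0_integral_bigcup//.
- apply: eq_eseriesr => k _.
  rewrite -(ge0_integral_mobius (ed k) (mVk k))//.
  + by apply: eq_integral => z /set_mem[z0 _]; rewrite finv.
  + exact: subset_trans (VkV k) Vu.
  + apply: measurable_funS mf; [exact: measurable_upper|].
    exact: subset_trans (VkV k) Vu.
  + by move=> z /VkV/Vu/f0.
- by rewrite VE; apply: measurable_funS mf => //; exact: measurable_upper.
- by move=> z; rewrite VE => /Vu/f0.
- exact: trivIset_seqDU.
- rewrite UE; apply: measurable_funS mf; first exact: measurable_upper.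
  by move=> z [/Fu].
- by move=> z [k _ []] /f0.
Qed.

End HyperbolicMeasure.

(** * Smooth bump profiles *)

Section Gradient.
Variable R : realType.
Implicit Types (z v : R * R) (f g : R * R -> R).

(** The differential with its two partial derivatives in explicit form: gradients of composites are
    assembled from the rules below and compared by [field]. *)
Definition grad_at f z (a b : R) : Prop :=
  is_diff (z : R * R) (f : R * R -> R^o) (fun v => a * v.1 + b * v.2 : R^o).

Lemma grad_differentiable f z a b : grad_at f z a b ->
  differentiable (f : R * R -> R^o) z.
Proof. by move=> h; case: h. Qed.

Lemma grad_derive f z a b v : grad_at f z a b ->
  'D_v (f : R * R -> R^o) z = a * v.1 + b * v.2.
Proof.
move=> h; rewrite deriveE; last exact: grad_differentiable h.
by rewrite (@diff_val _ _ _ _ _ _ _ h).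
Qed.

Lemma grad_ext f z a b a' b' : a = a' -> b = b' ->
  grad_at f z a b -> grad_at f z a' b'.
Proof. by move=> <- <-. Qed.

Lemma grad_cst c z : grad_at (fun=> c) z 0 0.
Proof.
apply: (is_diff_eq (is_diff_cst _ _)); apply/funext => v.
by rewrite !mul0r addr0.
Qed.

Lemma grad_add f g z a b a' b' : grad_at f z a b -> grad_at g z a' b' ->
  grad_at (fun x => f x + g x) z (a + a') (b + b').
Proof.
move=> hf hg; apply: (is_diff_eq (is_diffD hf hg)); apply/funext => v /=.
by rewrite !fctE; ring.
Qed.

Lemma grad_mul f g z a b a' b' : grad_at f z a b -> grad_at g z a' b' ->
  grad_at (fun x => f x * g x) z (f z * a' + g z * a) (f z * b' + g z * b).
Proof.
move=> hf hg; apply: (is_diff_eq (is_diffM hf hg)); apply/funext => v /=.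
by rewrite !fctE /GRing.scale /=; ring.
Qed.

Lemma linear_grad f z (a b : R) :
  (forall v, f v = a * v.1 + b * v.2) -> continuous (f : R * R -> R^o) ->
  grad_at f z a b.
Proof.
move=> fE cf.
have lf : linear (f : R * R -> R^o).
  move=> k [x1 x2] [y1 y2].
  have -> : (k *: (x1, x2) + (y1, y2) : R * R) = (k * x1 + y1, k * x2 + y2) by [].
  by rewrite !fE /GRing.scale /=; ring.
pose fM := GRing.isLinear.Build _ _ _ _ _ lf.
pose fL : {linear _ -> _} := HB.pack (f : R * R -> R^o) fM.
apply: DiffDef; first exact: (@linear_differentiable _ _ _ fL).
by rewrite (@diff_lin _ _ _ fL)//; apply/funext => v; exact: fE.
Qed.

Lemma grad_fst z : grad_at fst z 1 0.
Proof.
by apply: linear_grad => [v|]; [ring|move=> v; exact: cvg_fst].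
Qed.

Lemma grad_snd z : grad_at snd z 0 1.
Proof.
by apply: linear_grad => [v|]; [ring|move=> v; exact: cvg_snd].
Qed.

Lemma grad_comp (h : R -> R) f z (a b c : R) :
  is_derive (f z) 1 h c ->
  grad_at f z a b -> grad_at (fun x => h (f x)) z (c * a) (c * b).
Proof.
move=> hh hf.
have dh : differentiable (h : R^o -> R^o) (f z).
  by apply/derivable1_diffP; case: hh.
have hd : is_diff (f z : R^o) (h : R^o -> R^o) (fun v : R^o => (c * (v : R))%R : R^o).
  apply: DiffDef => //; apply/funext => v.
  have -> : v = v *: (1 : R^o) by rewrite /GRing.scale /= mulr1.
  rewrite linearZ -deriveE// (@derive_val _ _ _ _ _ _ _ hh).
  by rewrite /GRing.scale /= mulr1 mulrC.
apply: (is_diff_eq (is_diff_comp hf hd)); apply/funext => v /=.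
ring.
Qed.

Lemma near_eq_differentiable (V W : normedModType R) (f g : V -> W) (z : V) :
  (\near z, f z = g z) -> differentiable f z -> differentiable g z.
Proof.
move=> fg df.
have E : g \o shift z = cst (g z) + 'd f z +o_ 0 id.
  apply/eqaddoP => e e0; have := diff_locally df => /eqaddoP /(_ e e0).
  have fgz : f z = g z by exact: nbhs_singleton fg.
  have near0 : \forall y \near (0 : V), f (y + z) = g (y + z).
    have cs : (fun y : V => y + z) @ (0 : V) --> z.
      by rewrite -[X in _ --> X]add0r; apply: cvgD; [exact: cvg_id|exact: cvg_cst].
    exact: (cs _ fg).
  apply: filterS2 near0 => y fgy; rewrite !fctE /= -fgy.
  by rewrite fgz.
apply/diff_locallyP; rewrite (diff_unique (diff_continuous df) E); split => //.
exact: diff_continuous.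
Qed.

Lemma grad_opp f z a b : grad_at f z a b -> grad_at (fun x => - f x) z (- a) (- b).
Proof.
move=> hf; apply: (is_diff_eq (is_diffN hf)); apply/funext => v /=.
by rewrite !fctE; ring.
Qed.

Lemma grad_continuous f z a b : grad_at f z a b -> {for z, continuous (f : R * R -> R)}.
Proof. by move=> /grad_differentiable /differentiable_continuous. Qed.

Lemma open_upper : open (@upper R).
Proof.
rewrite (_ : upper = snd @^-1` [set y | 0 < y]) //.
apply: open_comp; last exact: open_gt.
by move=> z _; exact: cvg_snd.
Qed.

Lemma near_upper z : upper z -> \near z, upper z.
Proof. by move=> z0; apply: open_nbhs_nbhs; split => //; exact: open_upper. Qed.

(** The sigma-algebra here is that of the product, generated by rectangles; an open set is the union
    of the countably many rational boxes that it contains. *)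
Lemma open_measurable2 (U : set (R * R)) : open U ->
  measurable (U : set (measurableTypeR R * measurableTypeR R)).
Proof.
move=> oU.
pose B (q : (rat * rat) * (rat * rat)) : set (R * R) :=
  `]ratr q.1.1, ratr q.1.2[%classic `*` `]ratr q.2.1, ratr q.2.2[%classic.
have -> : U = \bigcup_(q in [set q | B q `<=` U]) B q.
  apply/seteqP; split => [[x y] Uxy|z [q qU]]; last exact: qU.
  have /nbhs_ballP[e /= e0 eU] : nbhs (x, y) U by exact: open_nbhs_nbhs.
  have [a ha] := @rat_in_itvoo R (x - e) x ltac:(by rewrite ltrBlDr ltrDl).
  have [b hb] := @rat_in_itvoo R x (x + e) ltac:(by rewrite ltrDl).
  have [c hc] := @rat_in_itvoo R (y - e) y ltac:(by rewrite ltrBlDr ltrDl).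
  have [d hd] := @rat_in_itvoo R y (y + e) ltac:(by rewrite ltrDl).
  move: ha hb hc hd; rewrite !in_itv/= => /andP[a1 a2] /andP[b1 b2] /andP[c1 c2] /andP[d1 d2].
  exists ((a, b), (c, d)) => /=; last by split; rewrite /= in_itv/= ?a2 ?b1 ?c2 ?d1.
  move=> [u v] [] /=; rewrite !in_itv/= => /andP[u1 u2] /andP[v1 v2].
  by apply: eU; split; rewrite /ball /= ltr_norml; lra.
rewrite bigcup_mkcond; apply: countable_bigcupT_measurable; first exact: countableP.
by move=> q; case: ifPn => // _; exact: measurableX.
Qed.

Lemma continuous_upper_measurable (f : R * R -> R) :
  (forall z, upper z -> {for z, continuous f}) ->
  measurable_fun (upper : set (measurableTypeR R * measurableTypeR R)) f.
Proof.
move=> cf; apply: (measurability _ (RGenOpens.measurableE R)).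
move=> _ [_ [a [b ->] <-]]; apply: open_measurable2.
rewrite openE => z [z0 fz].
have : nbhs z (f @^-1` `]a, b[) by apply: cf => //; apply: open_nbhs_nbhs; split=> //; exact: interval_open.
by move=> h; apply: filterI; [exact: near_upper|exact: h].
Qed.

End Gradient.

(** * Rules of differentiation in one variable *)

Section OneVariable.
Variable R : realType.
Implicit Types (f g : R -> R) (x d e : R).

Lemma d1_cst (c x : R) : is_derive x (1 : R) (fun=> c) (0 : R).
Proof. exact: is_derive_cst. Qed.

Lemma d1_id (x : R) : is_derive x (1 : R) (fun t => t) (1 : R).
Proof. exact: is_derive_id. Qed.

Lemma d1_add f g x d e : is_derive x (1 : R) f d -> is_derive x (1 : R) g e ->
  is_derive x (1 : R) (fun t => f t + g t) (d + e).
Proof. by move=> hf hg; exact: is_deriveD. Qed.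

Lemma d1_opp f x d : is_derive x (1 : R) f d -> is_derive x (1 : R) (fun t => - f t) (- d).
Proof. by move=> hf; exact: is_deriveN. Qed.

Lemma d1_mul f g x d e : is_derive x (1 : R) f d -> is_derive x (1 : R) g e ->
  is_derive x (1 : R) (fun t => f t * g t) (f x * e + g x * d).
Proof. by move=> hf hg; exact: is_deriveM. Qed.

Lemma d1_comp f g x d e : is_derive (f x) (1 : R) g e -> is_derive x (1 : R) f d ->
  is_derive x (1 : R) (fun t => g (f t)) (e * d).
Proof.
by move=> hg hf; exact: is_derive1_comp.
Qed.

Lemma d1_inv f x d : f x != 0 -> is_derive x (1 : R) f d ->
  is_derive x (1 : R) (fun t => (f t)^-1) (- (f x) ^- 2 * d).
Proof.
move=> fx0 [df <-]; apply: DeriveDef; first exact: derivableV.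
by rewrite deriveV.
Qed.

Lemma d1_eq f x d e : is_derive x (1 : R) f d -> d = e -> is_derive x (1 : R) f e.
Proof. by move=> h <-. Qed.

Lemma d1_continuous f x d : is_derive x (1 : R) f d -> {for x, continuous f}.
Proof.
by move=> [df _]; apply: (@differentiable_continuous _ R R); exact/derivable1_diffP.
Qed.

End OneVariable.

Section BumpProfile.
Variable R : realType.

(** The flat function e^(-1/t) times powers of 1/t. The factor is included because the family is
    then closed under differentiation, see [is_derive_Th]. *)
Definition Th (k : nat) (t : R) : R :=
  if 0 < t then expR (- t^-1) * t^-1 ^+ k else 0.

Lemma Th_ge0 k t : 0 <= Th k t.
Proof.
rewrite /Th; case: ifPn => // t0.
by rewrite mulr_ge0 ?expR_ge0// exprn_ge0// invr_ge0 ltW.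
Qed.

Lemma Th_le0 k t : t <= 0 -> Th k t = 0.
Proof. by rewrite /Th leNgt => /negbTE ->. Qed.

Lemma Th_gt0 k t : 0 < t -> 0 < Th k t.
Proof.
by move=> t0; rewrite /Th t0 mulr_gt0 ?expR_gt0// exprn_gt0// invr_gt0.
Qed.

Lemma exp_dominates_power (n : nat) (s : R) : 0 <= s ->
  s ^+ n * expR (- s) <= n%:R ^+ n.
Proof.
case: n => [|n] s0; first by rewrite !expr0 mul1r expR_le1 oppr_le0.
have n0 : (0 : R) < n.+1%:R by [].
have h : (s / n.+1%:R) ^+ n.+1 <= expR s.
  have -> : expR s = expR (s / n.+1%:R) ^+ n.+1.
    by rewrite -expRM_natl mulrC divfK// gt_eqF.
  apply: lerXn2r; rewrite ?nnegrE ?divr_ge0 ?expR_ge0//.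
  by apply: le_trans (expR_ge1Dx _); rewrite lerDr.
rewrite expRN ler_pdivrMr ?expR_gt0//.
by rewrite -ler_pdivrMl ?exprn_gt0// mulrC -expr_div_n.
Qed.

(** A quadratic bound is all that is required for a vanishing derivative at 0, by [is_derive0_sqr];
    it comes from the decay of s^(k+2) e^(-s) with s = 1/t. *)
Lemma Th_bound k t : Th k t <= k.+2%:R ^+ k.+2 * t ^+ 2.
Proof.
have [t0|t0] := leP t 0.
  by rewrite Th_le0// mulr_ge0// sqr_ge0.
rewrite /Th t0.
have := @exp_dominates_power k.+2 t^-1; rewrite invr_ge0 (ltW t0) => /(_ isT) h.
have -> : expR (- t^-1) * t^-1 ^+ k = t^-1 ^+ k.+2 * expR (- t^-1) * t ^+ 2.
  by rewrite !exprS; field; rewrite gt_eqF.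
by rewrite ler_wpM2r// sqr_ge0.
Qed.

Lemma is_derive0_sqr (f : R -> R) (C : R) :
  (forall h, `|f h| <= C * h ^+ 2) -> is_derive (0 : R) (1 : R) f (0 : R).
Proof.
move=> fC.
have f0 : f 0 = 0.
  by apply/eqP; rewrite -normr_le0 (le_trans (fC 0))// expr0n mulr0.
have C0 : 0 <= C by have := le_trans (normr_ge0 _) (fC 1); rewrite expr1n mulr1.
have L : h^-1 *: (f (h *: 1 + 0) - f 0) @[h --> 0^'] --> (0 : R).
  apply/cvgr0Pnorm_le => e e0.
  near=> h.
  rewrite f0 subr0 addr0 /GRing.scale /= mulr1 normrM normfV.
  have h0 : 0 < `|h| by rewrite normr_gt0; near: h; exact: nbhs_dnbhs_neq.
  rewrite mulrC ler_pdivrMr// (le_trans (fC h))//.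
  rewrite -real_normK ?num_real// expr2 mulrA ler_wpM2r ?ltW//.
  have : `|h| < e / (C + 1).
    near: h; apply: dnbhs0_lt.
    by rewrite divr_gt0// ltr_wpDl.
  rewrite ltr_pdivlMr ?ltr_wpDl// => h1.
  by apply: le_lt_trans h1; rewrite mulrC ler_wpM2l//; lra.
apply: DeriveDef; first by apply/cvg_ex; exists 0.
exact/cvg_lim.
Unshelve. all: by end_near. Qed.

Lemma is_derive_Th k (t : R) : is_derive t (1 : R) (Th k) (Th k.+2 t - k%:R * Th k.+1 t).
Proof.
have [t0|t0|t0] := ltgtP t 0.
- rewrite !Th_le0 ?ltW// mulr0 subrr.
  apply: (@near_eq_is_derive _ _ _ (cst (0 : R))).
  near=> s; rewrite Th_le0// ltW//.
  by near: s; exact: lt_nbhsl.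
- have nt : \near t, 0 < t by exact: lt_nbhsr.
  elim: k => [|k IH].
    apply: (@near_eq_is_derive _ _ _ (fun t : R => expR (- t^-1))).
      by near=> s; rewrite /Th ifT ?expr0 ?mulr1//; near: s.
    have tn0 : t != 0 by rewrite gt_eqF.
    apply: d1_eq (d1_comp (is_derive_expR _) (d1_opp (d1_inv tn0 (d1_id t)))) _.
    by rewrite /Th t0 mul0r subr0 mulr1 opprK exprVn.
  apply: (@near_eq_is_derive _ _ _ (fun t : R => Th k t * t^-1)).
    near=> s; have s0 : 0 < s by near: s.
    by rewrite /Th s0 exprSr mulrA.
  have tn0 : t != 0 by rewrite gt_eqF.
  apply: d1_eq (d1_mul IH (d1_inv tn0 (d1_id t))) _.
  by rewrite /Th t0 !exprS -natr1; field.
- rewrite t0 !Th_le0// mulr0 subrr.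
  apply: (@is_derive0_sqr _ (k.+2%:R ^+ k.+2)) => h.
  by rewrite ger0_norm ?Th_ge0// Th_bound.
Unshelve. all: by end_near. Qed.

(* Functions on the upper half-plane built from coordinates and the profiles
   [Th]: a class stable under partial derivatives, hence made of smooth functions. *)
Inductive smooth_expr : (R * R -> R) -> Prop :=
| Smooth_cst (c : R) : smooth_expr (fun=> c)
| Smooth_fst : smooth_expr fst
| Smooth_snd : smooth_expr snd
| Smooth_inv : smooth_expr (fun z => z.2^-1)
| Smooth_Th k f : smooth_expr f -> smooth_expr (fun z => Th k (f z))
| Smooth_add f g : smooth_expr f -> smooth_expr g -> smooth_expr (fun z => f z + g z)
| Smooth_mul f g : smooth_expr f -> smooth_expr g -> smooth_expr (fun z => f z * g z).

Lemma smooth_expr_grad f : smooth_expr f ->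
  exists fx fy, [/\ smooth_expr fx, smooth_expr fy &
    forall z, upper z -> grad_at f z (fx z) (fy z)].
Proof.
elim=> [c||||k g sg [gx [gy [sx sy h]]]|g h sg [gx [gy [sx sy e]]] sh [hx [hy [ux uy e']]]
  |g h sg [gx [gy [sx sy e]]] sh [hx [hy [ux uy e']]]].
- exists (fun=> 0), (fun=> 0); split; try exact: Smooth_cst.
  by move=> z _; exact: grad_cst.
- exists (fun=> 1), (fun=> 0); split; try exact: Smooth_cst.
  by move=> z _; exact: grad_fst.
- exists (fun=> 0), (fun=> 1); split; try exact: Smooth_cst.
  by move=> z _; exact: grad_snd.
- exists (fun=> 0), (fun z => -1 * (z.2^-1 * z.2^-1)); split.
  + exact: Smooth_cst.
  + apply: Smooth_mul; first exact: Smooth_cst.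
    by apply: Smooth_mul; exact: Smooth_inv.
  + move=> z z0; have zn0 : z.2 != 0 by rewrite gt_eqF.
    apply: grad_ext (grad_comp (d1_inv zn0 (d1_id _)) (grad_snd z)).
      by rewrite mulr0.
    by case: z zn0 {z0} => x y /= zn0; field.
- exists (fun z => (Th k.+2 (g z) + (- k%:R) * Th k.+1 (g z)) * gx z),
    (fun z => (Th k.+2 (g z) + (- k%:R) * Th k.+1 (g z)) * gy z).
  have S : smooth_expr (fun z => Th k.+2 (g z) + (- k%:R) * Th k.+1 (g z)).
    apply: Smooth_add; first exact: Smooth_Th.
    by apply: Smooth_mul; [exact: Smooth_cst|exact: Smooth_Th].
  split; [exact: Smooth_mul|exact: Smooth_mul|].
  move=> z z0; apply: grad_ext (grad_comp (is_derive_Th k (g z)) (h _ z0)).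
    by rewrite mulNr.
  by rewrite mulNr.
- exists (fun z => gx z + hx z), (fun z => gy z + hy z).
  split; [exact: Smooth_add|exact: Smooth_add|].
  by move=> z z0; apply: grad_add; [exact: e|exact: e'].
- exists (fun z => g z * hx z + h z * gx z), (fun z => g z * hy z + h z * gy z).
  split; [by apply: Smooth_add; exact: Smooth_mul|by apply: Smooth_add; exact: Smooth_mul|].
  by move=> z z0; apply: grad_mul; [exact: e|exact: e'].
Qed.

Lemma smooth_expr_derive f v : smooth_expr f -> exists2 g, smooth_expr g &
  forall z, upper z -> 'D_v (f : R * R -> R^o) z = g z.
Proof.
move=> /smooth_expr_grad[fx [fy [sx sy h]]].
exists (fun z => fx z * v.1 + fy z * v.2).
  by apply: Smooth_add; apply: Smooth_mul => //; exact: Smooth_cst.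
by move=> z z0; exact: grad_derive (h _ z0).
Qed.

(** Induction on the list of directions: a function that agrees near every point with some
    expression of the class has derivatives with the same property. *)
Lemma smooth_on_local (f : R * R -> R) :
  (forall z, upper z -> exists2 g, smooth_expr g & \near z, f z = g z) ->
  smooth_on upper f.
Proof.
move=> H s z z0.
suff [g sg fg] : exists2 g, smooth_expr g &
    \near z, foldr (fun v g => 'D_v g) (f : R * R -> R^o) s z = g z.
  have [gx [gy [_ _ /(_ z z0) gr]]] := smooth_expr_grad sg.
  apply: near_eq_differentiable (grad_differentiable gr).
  by apply: filterS fg => ? ->.
elim: s z z0 => [|v s IH] z z0 /=; first exact: H.
have [g sg fg] := IH z z0.
have [h sh gh] := smooth_expr_derive v sg.
exists h => //.
apply: filterS2 (nbhs_interior fg) (near_upper z0) => y fgy y0.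
by rewrite (near_eq_derive v fgy); exact: gh.
Qed.

Lemma smooth_upt (p : R * R) : upper p -> exists2 g, smooth_expr g &
  forall z, upt z p = g z.
Proof.
move=> p0.
exists (fun z => 1 + ((z.1 + (- p.1)) * (z.1 + (- p.1)) + (z.2 + (- p.2)) * (z.2 + (- p.2))) * (z.2^-1 * (2 * p.2)^-1)).
  have s1 : smooth_expr (fun z : R * R => z.1 + (- p.1)).
    by apply: Smooth_add; [exact: Smooth_fst|exact: Smooth_cst].
  have s2 : smooth_expr (fun z : R * R => z.2 + (- p.2)).
    by apply: Smooth_add; [exact: Smooth_snd|exact: Smooth_cst].
  apply: Smooth_add; first exact: Smooth_cst.
  apply: Smooth_mul; first by apply: Smooth_add; exact: Smooth_mul.
  by apply: Smooth_mul; [exact: Smooth_inv|exact: Smooth_cst].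
by move=> z; rewrite uptE -!expr2 !invfM; ring.
Qed.

Lemma grad_upt (p z : R * R) : upper p -> upper z ->
  grad_at (fun z => upt z p) z ((z.1 - p.1) / (z.2 * p.2))
    ((z.2 - p.2) / (z.2 * p.2) - ((z.1 - p.1) ^+ 2 + (z.2 - p.2) ^+ 2) / (2 * z.2 ^+ 2 * p.2)).
Proof.
move=> p0 z0; have pn0 : p.2 != 0 by rewrite gt_eqF.
have zn0 : z.2 != 0 by rewrite gt_eqF.
have -> : (fun z => upt z p) = (fun z => 1 + ((z.1 + (- p.1)) * (z.1 + (- p.1)) + (z.2 + (- p.2)) * (z.2 + (- p.2))) * (z.2^-1 * (2 * p.2)^-1)).
  by apply/funext => w; rewrite uptE -!expr2 !invfM; ring.
have g1 := grad_add (grad_fst z) (grad_cst (- p.1) z).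
have g2 := grad_add (grad_snd z) (grad_cst (- p.2) z).
have g3 := grad_mul (grad_comp (d1_inv zn0 (d1_id _)) (grad_snd z)) (grad_cst (2 * p.2)^-1 z).
apply: grad_ext (grad_add (grad_cst 1 z) (grad_mul (grad_add (grad_mul g1 g1) (grad_mul g2 g2)) g3)).
  by case: z p {z0 p0 g1 g2 g3} zn0 pn0 => x y [a b] /= *; field; apply/andP.
by case: z p {z0 p0 g1 g2 g3} zn0 pn0 => x y [a b] /= *; field; apply/andP.
Qed.

(* With u = upt z p, the Laplacian of phi(u) is (u^2 - 1) phi'' + 2 u phi'; here phi = Th 0 (c - _). *)
Definition lap_profile (c u : R) : R :=
  (u ^+ 2 - 1) * (Th 4 (c - u) - 2 * Th 3 (c - u)) - 2 * u * Th 2 (c - u).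

Lemma hlaplacian_local (f g : R * R -> R) z : (\near z, f z = g z) ->
  hlaplacian f z = hlaplacian g z.
Proof.
move=> fg; rewrite /hlaplacian.
have h v : \near z, 'D_v (f : R * R -> R^o) z = 'D_v (g : R * R -> R^o) z.
  by apply: filterS (nbhs_interior fg) => y; exact: near_eq_derive.
have e v : 'D_v ('D_v (f : R * R -> R^o)) z = 'D_v ('D_v (g : R * R -> R^o)) z.
  exact: near_eq_derive.
by rewrite (e ((1, 0) : R * R)) (e ((0, 1) : R * R)).
Qed.

Lemma hlaplacian_grad (f fx fy : R * R -> R) z fxx fxy fyx fyy :
  (\near z, grad_at f z (fx z) (fy z)) ->
  grad_at fx z fxx fxy -> grad_at fy z fyx fyy ->
  hlaplacian f z = z.2 ^+ 2 * (fxx + fyy).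
Proof.
move=> gf gx gy; rewrite /hlaplacian.
have -> : 'D_((1, 0) : R * R) ('D_((1, 0) : R * R) (f : R * R -> R^o)) z = fxx.
  transitivity ('D_((1, 0) : R * R) (fx : R * R -> R^o) z).
    apply: near_eq_derive; apply: filterS gf => w gw.
    by rewrite (grad_derive _ gw) mulr1 mulr0 addr0.
  by rewrite (grad_derive _ gx) mulr1 mulr0 addr0.
have -> // : 'D_((0, 1) : R * R) ('D_((0, 1) : R * R) (f : R * R -> R^o)) z = fyy.
transitivity ('D_((0, 1) : R * R) (fy : R * R -> R^o) z).
  apply: near_eq_derive; apply: filterS gf => w gw.
  by rewrite (grad_derive _ gw) mulr1 mulr0 add0r.
by rewrite (grad_derive _ gy) mulr1 mulr0 add0r.
Qed.

Lemma hlaplacian_bump (c : R) (p z : R * R) : upper p -> upper z ->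
  hlaplacian (fun z => Th 0 (c - upt z p)) z = lap_profile c (upt z p).
Proof.
move=> p0 z0.
have pn0 : p.2 != 0 by rewrite gt_eqF.
pose ux (z : R * R) := (z.1 + (- p.1)) * (z.2^-1 * p.2^-1).
pose uy (z : R * R) := (z.2 + (- p.2)) * (z.2^-1 * p.2^-1) + (- (2^-1)) * (((z.1 + (- p.1)) * (z.1 + (- p.1)) + (z.2 + (- p.2)) * (z.2 + (- p.2))) * (z.2^-1 * z.2^-1 * p.2^-1)).
have gu w : upper w -> grad_at (fun z => upt z p) w (ux w) (uy w).
  move=> w0; have wn0 : w.2 != 0 by rewrite gt_eqF.
  apply: grad_ext (grad_upt p0 w0); first by rewrite /ux invfM.
  by rewrite /uy; case: w p {w0 p0 ux uy z0} wn0 pn0 => x y [a b] /= *; field; apply/andP.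
pose fx w := - Th 2 (c - upt w p) * ux w.
pose fy w := - Th 2 (c - upt w p) * uy w.
have gTh k w : upper w -> grad_at (fun w => Th k (c - upt w p)) w
   (- (Th k.+2 (c - upt w p) - k%:R * Th k.+1 (c - upt w p)) * ux w)
   (- (Th k.+2 (c - upt w p) - k%:R * Th k.+1 (c - upt w p)) * uy w).
  move=> w0; apply: grad_ext (grad_comp (is_derive_Th k _) (grad_add (grad_cst c w) (grad_opp (gu _ w0)))); by ring.
have gf w : upper w -> grad_at (fun z => Th 0 (c - upt z p)) w (fx w) (fy w).
  by move=> w0; apply: grad_ext (gTh 0 w w0); rewrite mul0r subr0.
have zn0 : z.2 != 0 by rewrite gt_eqF.
have g1 := grad_add (grad_fst z) (grad_cst (- p.1) z).
have g2 := grad_add (grad_snd z) (grad_cst (- p.2) z).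
have gi := grad_comp (d1_inv zn0 (d1_id _)) (grad_snd z).
have gux := grad_mul g1 (grad_mul gi (grad_cst p.2^-1 z)).
have guy := grad_add (grad_mul g2 (grad_mul gi (grad_cst p.2^-1 z)))
  (grad_mul (grad_cst (- 2^-1) z) (grad_mul (grad_add (grad_mul g1 g1) (grad_mul g2 g2)) (grad_mul (grad_mul gi gi) (grad_cst p.2^-1 z)))).
have gT := grad_opp (gTh 2 z z0).
have gn : \near z, grad_at (fun z => Th 0 (c - upt z p)) z (fx z) (fy z).
  by apply: filterS (near_upper z0); exact: gf.
rewrite (hlaplacian_grad gn (grad_mul gT gux) (grad_mul gT guy)).
rewrite /lap_profile.
set t2 := Th 2 _; set t3 := Th 3 _; set t4 := Th 4 _.
clearbody t2 t3 t4; rewrite /ux /uy uptE.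
case: z p {z0 p0 g1 g2 gi gux guy gT gTh gf gn gu fx fy ux uy} zn0 pn0 => x y [a b] /= zn0 pn0.
by field; apply/andP.
Qed.

End BumpProfile.

(** * Invariant bump functions *)

Section HyperbolicBalls.
Variable R : realType.
Implicit Types (z w p q : R * R) (g : 'M[R]_2) (Gamma : set 'M[R]_2).

Definition hball p (r : R) : set (R * R) := [set z | upper z /\ upt z p < 1 + r].

Lemma upt_continuous p z : upper p -> upper z -> {for z, continuous (fun z => upt z p)}.
Proof. by move=> p0 z0; exact: grad_continuous (grad_upt p0 z0). Qed.

Lemma near_upt_lt p z (c : R) : upper p -> upper z -> upt z p < c ->
  \near z, upt z p < c.
Proof.
move=> p0 z0 h; have := upt_continuous p0 z0.
by move=> /(_ [set y | y < c]); apply; exact: lt_nbhsl.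
Qed.

Lemma open_hball p r : upper p -> open (hball p r).
Proof.
move=> p0; rewrite openE => z [z0 zr].
exact: filterI (near_upper z0) (near_upt_lt p0 z0 zr).
Qed.

Lemma hball_center p r : upper p -> 0 < r -> hball p r p.
Proof. by move=> p0 r0; split => //; rewrite uptxx ltrDl. Qed.

Lemma hball_nbhs p r : upper p -> 0 < r -> nbhs p (hball p r).
Proof.
move=> p0 r0; apply: open_nbhs_nbhs; split; first exact: open_hball.
exact: hball_center.
Qed.

Lemma hball_dist p (r : R) z : upper p -> r <= 1 -> hball p r z ->
  (z.1 - p.1) ^+ 2 + (z.2 - p.2) ^+ 2 <= 8 * p.2 ^+ 2 * r.
Proof.
move=> p0 r1 [z0 zr].
have e1 : ((z.1 - p.1) ^+ 2 + (z.2 - p.2) ^+ 2) = 2 * z.2 * p.2 * (upt z p - 1).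
  by rewrite uptE addrAC subrr add0r; field; rewrite !gt_eqF.
have h : z.2 <= 4 * p.2.
  have := im_ratio_le z0 p0; rewrite ler_pdivrMr// => /le_trans; apply.
  by rewrite ler_wpM2r ?(ltW p0)//; lra.
have u1 := upt_ge1 z0 p0.
rewrite e1 (_ : 8 * p.2 ^+ 2 * r = 2 * (4 * p.2) * p.2 * r); last by ring.
apply: ler_pM; [|lra| |lra].
  by rewrite !mulr_ge0// ltW.
by rewrite ler_wpM2r ?(ltW p0)// ler_wpM2l.
Qed.

Lemma hball_sub p (U : set (R * R)) : upper p -> nbhs p U ->
  exists2 r : R, 0 < r & hball p r `<=` U.
Proof.
move=> p0 /nbhs_ballP[e /= e0 eU].
exists (Num.min 1 (e ^+ 2 / (16 * p.2 ^+ 2))).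
  rewrite lt_min ltr01/= divr_gt0 ?exprn_gt0//.
  by rewrite mulr_gt0// exprn_gt0.
move=> z zB; apply: eU.
have m1 : Num.min 1 (e ^+ 2 / (16 * p.2 ^+ 2)) <= 1 by rewrite ge_min lexx.
have h := hball_dist p0 m1 zB.
have {h} : (z.1 - p.1) ^+ 2 + (z.2 - p.2) ^+ 2 < e ^+ 2.
  apply: (le_lt_trans h).
  apply: (@le_lt_trans _ _ (8 * p.2 ^+ 2 * (e ^+ 2 / (16 * p.2 ^+ 2)))).
    rewrite ler_wpM2l//; last by rewrite ge_min lexx orbT.
    by rewrite mulr_ge0// sqr_ge0.
  have -> : 8 * p.2 ^+ 2 * (e ^+ 2 / (16 * p.2 ^+ 2)) = e ^+ 2 / 2.
    by field; rewrite gt_eqF.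
  by rewrite ltr_pdivrMr// ltr_pMr ?exprn_gt0//; lra.
move=> h; have := sqr_ge0 (z.1 - p.1); have := sqr_ge0 (z.2 - p.2) => h1 h2.
have aux (x : R) : x ^+ 2 < e ^+ 2 -> `|x| < e.
  by rewrite -(real_normK (num_real x)) ltr_sqr ?nnegrE// ltW.
by split; rewrite /ball /= distrC; apply: aux; lra.
Qed.

Lemma upt_mobiusl g z w : \det g = 1 -> upper z -> upper w ->
  upt (mobius g z) w = upt z (mobius (invmx g) w).
Proof.
move=> d1 z0 w0; rewrite -[in LHS](mobiusKV d1 w0) upt_mobius//.
by apply: upper_mobius => //; exact: det_invmx1.
Qed.

Section Fuchsian.
Variable (Gamma : set 'M[R]_2).
Hypothesis fG : is_fuchsian Gamma.

Lemma same_orbit_upper z w : upper w -> same_orbit Gamma z w -> upper z.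
Proof. by move=> w0 [g Gg ->]; exact: upper_mobius (fuchsian_det fG Gg) w0. Qed.

Lemma same_orbit_refl z : same_orbit Gamma z z.
Proof. by exists 1%:M; [exact: fuchsian_one|rewrite mobius1]. Qed.

Lemma same_orbit_sym z w : upper w -> same_orbit Gamma z w -> same_orbit Gamma w z.
Proof.
move=> w0 [g Gg ->]; exists (invmx g); first exact: fuchsian_inv.
by rewrite mobiusK// (fuchsian_det fG).
Qed.

Lemma same_orbit_trans z w v : upper v ->
  same_orbit Gamma z w -> same_orbit Gamma w v -> same_orbit Gamma z v.
Proof.
move=> v0 [g Gg ->] [h Gh ->]; exists (g *m h); first exact: fuchsian_mul.
by rewrite mobiusM// (fuchsian_det fG).
Qed.

Lemma same_orbit_mobius g z : Gamma g -> same_orbit Gamma (mobius g z) z.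
Proof. by move=> Gg; exists g. Qed.

(** The factor 10 leaves a margin between this radius and the radius r of the supports below, so
    that a function summed over the orbit is, near any point, either a single term or zero. *)
Definition separated_at p (r : R) : Prop := forall q q' z,
  upper z -> same_orbit Gamma q p -> same_orbit Gamma q' p ->
  upt z q < 1 + 10 * r -> upt z q' < 1 + 10 * r -> q = q'.

Lemma separated_atP p : upper p -> exists2 r0 : R, 0 < r0 <= 10^-1 &
  forall r, 0 < r <= r0 -> separated_at p r.
Proof.
move=> p0; have [rho rho0 hr] := orbit_separated fG p0.
(* With 10 r <= 1 both values of u are below 2, so [upt_triangle] gives u(q, q') - 1 <= 160 r <
   rho. *)
exists (Num.min 10^-1 (rho / 200)).
  rewrite ge_min lexx andbT lt_min invr_gt0 ltr0n /=; clear -rho0; lra.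
move=> r /andP[r0]; rewrite le_min => /andP[r1 r2] q q' z z0 oq oq' h1 h2.
have q0 := same_orbit_upper p0 oq; have q0' := same_orbit_upper p0 oq'.
have : upt q q' < 1 + rho.
  have := upt_triangle z0 q0 q0'; rewrite (upt_sym q z) => h.
  have u1 := upt_ge1 z0 q0; have u2 := upt_ge1 z0 q0'.
  have : 4 * upt z q' * (upt z q - 1) <= 4 * 2 * (10 * r).
    by apply: ler_pM; lra.
  have : 4 * upt z q * (upt z q' - 1) <= 4 * 2 * (10 * r).
    by apply: ler_pM; lra.
  lra.
have [g Gg qE] := oq; have [h Gh qE'] := oq'.
have dg := fuchsian_det fG Gg; have dh := fuchsian_det fG Gh.
rewrite qE qE' upt_mobiusl//; last exact: upper_mobius.
rewrite -mobiusM ?det_invmx1// => /hr e.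
have := e (fuchsian_mul fG (fuchsian_inv fG Gg) Gh).
rewrite mobiusM ?det_invmx1// => /(congr1 (mobius g)).
by rewrite (mobiusKV dg (upper_mobius dh p0)) => ->.
Qed.

Definition per p r (F : R -> R) z : R :=
  if pselect (exists q, same_orbit Gamma q p /\ upt z q < 1 + r) is left h
  then F (upt z (projT1 (cid h))) else 0.

Section Periodized.
Variables (p : R * R) (r : R) (F : R -> R).
Hypotheses (p0 : upper p) (r01 : 0 < r <= 10^-1) (sp : separated_at p r).
Hypothesis F0 : forall u, 1 + r <= u -> F u = 0.

Let r0 : 0 < r. Proof. by case/andP: r01. Qed.

Let r1 : r <= 10^-1.
Proof. by case/andP: r01. Qed.

Let r10 : 1 + r <= 1 + 10 * r. Proof. by move: r0; lra. Qed.

Lemma perE z q : upper z -> same_orbit Gamma q p -> upt z q < 1 + 10 * r ->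
  per p r F z = F (upt z q).
Proof.
move=> z0 oq zq; rewrite /per; case: pselect => [h|h]; last first.
  rewrite F0// leNgt; apply/negP => h'; apply: h; exists q; split => //.
case: (cid h) => q' /= [oq' zq'].
have zq2 : upt z q' < 1 + 10 * r by exact: lt_le_trans r10.
by rewrite (sp z0 oq oq' zq zq2).
Qed.

Lemma per_eq0 z : (forall q, same_orbit Gamma q p -> 1 + r <= upt z q) ->
  per p r F z = 0.
Proof.
move=> h; rewrite /per; case: pselect => // h'; exfalso; case: h' => q [oq].
by rewrite ltNge h.
Qed.

(** If no point of the orbit is within 10 r of z, then none is within r of a point w with u(w, z) <
    1 + r/10, as 8 (r/10) + 8 r < 10 r. *)
Lemma per_local z : upper z ->
  (exists2 q, same_orbit Gamma q p & \near z, per p r F z = F (upt z q)) \/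
  (\near z, per p r F z = 0).
Proof.
move=> z0.
have [[q [oq zq]]|h] := pselect (exists q, same_orbit Gamma q p /\ upt z q < 1 + 10 * r).
  left; exists q => //; have q0 := same_orbit_upper p0 oq.
  apply: filterS2 (near_upper z0) (near_upt_lt q0 z0 zq) => w w0 wq.
  exact: perE.
right.
have e0 : 0 < r / 10 by rewrite divr_gt0.
have z1 : upt z z < 1 + r / 10 by rewrite uptxx ltrDl.
apply: filterS2 (near_upper z0) (near_upt_lt z0 z0 z1) => w w0 wz.
apply: per_eq0 => q oq; rewrite leNgt; apply/negP => wq.
apply: h; exists q; split => //; have q0 := same_orbit_upper p0 oq.
have := upt_triangle w0 z0 q0; rewrite (upt_sym z w) => h.
have u1 := upt_ge1 w0 q0; have u2 := upt_ge1 w0 z0.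
have [r0' r1'] : 0 < r /\ r <= 10^-1 by split; [exact: r0|exact: r1].
have : 4 * upt w q * (upt w z - 1) <= 4 * 2 * (r / 10).
  by apply: ler_pM; lra.
have : 4 * upt w z * (upt w q - 1) <= 4 * 2 * r.
  by apply: ler_pM; lra.
lra.
Qed.

Lemma per_invariant : Defs.invariant Gamma (per p r F).
Proof.
move=> g z Gg z0; have dg := fuchsian_det fG Gg; have gz0 := upper_mobius dg z0.
have dgi := det_invmx1 dg.
have [[q [oq zq]]|h] := pselect (exists q, same_orbit Gamma q p /\ upt z q < 1 + r).
  have q0 := same_orbit_upper p0 oq.
  have zq' : upt z q < 1 + 10 * r by exact: lt_le_trans r10.
  rewrite (perE z0 oq)// (@perE _ (mobius g q)) ?upt_mobius//.
  exact: same_orbit_trans (same_orbit_mobius _ Gg) oq.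
rewrite !per_eq0// => q oq; rewrite leNgt; apply/negP => zq; apply: h.
  by exists q.
have q0 := same_orbit_upper p0 oq.
exists (mobius (invmx g) q); split; last by rewrite -upt_mobiusl.
apply: same_orbit_trans p0 (same_orbit_mobius _ _) oq.
exact: fuchsian_inv.
Qed.

Lemma per_support z : upper z -> per p r F z != 0 -> saturation Gamma (hball p r) z.
Proof.
move=> z0; have [[q [oq zq]]|h] := pselect (exists q, same_orbit Gamma q p /\ upt z q < 1 + r).
  move=> _; have q0 := same_orbit_upper p0 oq.
  have [g Gg qE] := oq; have dg := fuchsian_det fG Gg.
  exists (invmx g); first exact: fuchsian_inv.
  split; first by apply: upper_mobius => //; exact: det_invmx1.
  by rewrite upt_mobiusl ?det_invmx1// invmxK -qE.
rewrite per_eq0 ?eqxx// => q oq; rewrite leNgt; apply/negP => zq; apply: h.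
by exists q.
Qed.

Lemma per_hball z : hball p (10 * r) z -> per p r F z = F (upt z p).
Proof. by move=> [z0 zp]; apply: perE => //; exact: same_orbit_refl. Qed.

Hypothesis Fs : forall q, upper q -> exists2 g, smooth_expr g & forall z, F (upt z q) = g z.
Hypothesis FM : exists M, forall u, 1 <= u -> `|F u| <= M.

Lemma per_smooth_bounded : smooth_bounded Gamma (per p r F).
Proof.
split; first exact: per_invariant.
  apply: smooth_on_local => z z0; have [[q oq h]|h] := per_local z0.
    have [g sg gE] := Fs (same_orbit_upper p0 oq); exists g => //.
    by apply: filterS h => w ->.
  by exists (fun=> 0) => //; exact: Smooth_cst.
have [M hM] := FM; exists M => z z0.
have [[q [oq zq]]|h] := pselect (exists q, same_orbit Gamma q p /\ upt z q < 1 + r).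
  rewrite (perE z0 oq); last exact: lt_le_trans r10.
  by apply: hM; apply: upt_ge1 => //; exact: same_orbit_upper oq.
rewrite per_eq0 ?normr0//.
  exact: le_trans (normr_ge0 _) (hM 1 (lexx 1)).
by move=> q oq; rewrite leNgt; apply/negP => zq; apply: h; exists q.
Qed.

End Periodized.

Lemma bump_profile0 (r u : R) : 1 + r <= u -> Th 0 (1 + r - u) = 0.
Proof. by move=> h; rewrite Th_le0// subr_le0. Qed.

Lemma lap_profile0 (r u : R) : 1 + r <= u -> lap_profile (1 + r) u = 0.
Proof.
by move=> h; rewrite /lap_profile !Th_le0 ?subr_le0//; ring.
Qed.

Lemma Th_le1 k (t : R) : t <= 1 -> Th k t <= k.+2%:R ^+ k.+2.
Proof.
move=> t1; have [t0|t0] := leP t 0; first by rewrite Th_le0// exprn_ge0.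
apply: le_trans (Th_bound _ _) _; rewrite ler_piMr ?exprn_ge0//.
by rewrite expr_le1// ltW.
Qed.

Lemma per_bump_smooth p r : upper p -> 0 < r <= 10^-1 -> separated_at p r ->
  smooth_bounded Gamma (per p r (fun u => Th 0 (1 + r - u))).
Proof.
move=> p0 r01 sp; apply: per_smooth_bounded => //.
- by move=> u; exact: bump_profile0.
- move=> q q0; have [g sg gE] := smooth_upt q0.
  exists (fun z => Th 0 ((1 + r) + (-1) * g z)).
    apply/Smooth_Th/Smooth_add; first exact: Smooth_cst.
    by apply: Smooth_mul => //; exact: Smooth_cst.
  by move=> z; rewrite gE mulN1r.
- exists (2 ^+ 2) => u u1; rewrite ger0_norm ?Th_ge0//.
  by apply: (@Th_le1 0); case/andP: r01; lra.
Qed.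

Lemma per_lap_smooth p r : upper p -> 0 < r <= 10^-1 -> separated_at p r ->
  smooth_bounded Gamma (per p r (lap_profile (1 + r))).
Proof.
move=> p0 r01 sp; have /andP[r0 r1] := r01; apply: per_smooth_bounded => //.
- by move=> u; exact: lap_profile0.
- move=> q q0; have [g sg gE] := smooth_upt q0.
  pose c z := (1 + r) + (-1) * g z.
  have sc : smooth_expr c.
    by apply: Smooth_add; [exact: Smooth_cst|apply: Smooth_mul => //; exact: Smooth_cst].
  exists (fun z => (g z * g z + (-1)) * (Th 4 (c z) + (-2) * Th 3 (c z)) + (-2) * (g z * Th 2 (c z))).
    apply: Smooth_add; apply: Smooth_mul.
    - by apply: Smooth_add; [exact: Smooth_mul|exact: Smooth_cst].
    - apply: Smooth_add; first exact: Smooth_Th.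
      by apply: Smooth_mul; [exact: Smooth_cst|exact: Smooth_Th].
    - exact: Smooth_cst.
    - by apply: Smooth_mul => //; exact: Smooth_Th.
  by move=> z; rewrite /lap_profile gE /c mulN1r; ring.
- pose A : R := 6%:R ^+ 6 + 2 * 5%:R ^+ 5; pose B : R := 4%:R ^+ 4.
  exists (3 * A + 4 * B) => u u1.
  have [ur|ur] := leP (1 + r) u.
    by rewrite lap_profile0// normr0 addr_ge0// mulr_ge0// ?addr_ge0// ?mulr_ge0// exprn_ge0.
  have h k : 0 <= Th k (1 + r - u) <= k.+2%:R ^+ k.+2.
    by rewrite Th_ge0 Th_le1//; lra.
  have /andP[a1 a2] := h 4; have /andP[b1 b2] := h 3; have /andP[c1 c2] := h 2.
  rewrite /lap_profile (le_trans (ler_normB _ _))// lerD// normrM.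
    apply: ler_pM => //; first by rewrite ger0_norm; nra.
    by rewrite (le_trans (ler_normB _ _))// lerD// ger0_norm ?mulr_ge0// ler_wpM2l.
  apply: ler_pM => //; first by rewrite ger0_norm; lra.
  by rewrite ger0_norm.
Qed.

Lemma hlaplacian_per p r z : upper p -> 0 < r <= 10^-1 -> separated_at p r -> upper z ->
  hlaplacian (per p r (fun u => Th 0 (1 + r - u))) z = per p r (lap_profile (1 + r)) z.
Proof.
move=> p0 r01 sp z0; have r0 : 0 < r by case/andP: r01.
have [[q [oq zq]]|h] := pselect (exists q, same_orbit Gamma q p /\ upt z q < 1 + 10 * r).
  have q0 := same_orbit_upper p0 oq.
  rewrite (perE r01 sp (@lap_profile0 r) z0 oq zq).
  transitivity (hlaplacian (fun z => Th 0 (1 + r - upt z q)) z); last exact: hlaplacian_bump.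
  apply: hlaplacian_local.
  apply: filterS2 (near_upper z0) (near_upt_lt q0 z0 zq) => w w0 wq.
  by apply: perE => // u; exact: bump_profile0.
have zr q : same_orbit Gamma q p -> 1 + r <= upt z q.
  move=> oq; rewrite leNgt; apply/negP => zq; apply: h; exists q; split=> //.
  by apply: (lt_le_trans zq); lra.
rewrite [RHS]per_eq0//.
have [[q oq hq]|hq] := per_local p0 r01 sp (@bump_profile0 r) z0.
  have q0 := same_orbit_upper p0 oq.
  by rewrite (hlaplacian_local hq) hlaplacian_bump// lap_profile0// zr.
rewrite (hlaplacian_local hq).
have gc w : grad_at (fun=> 0 : R) w 0 0 by exact: grad_cst.
rewrite (@hlaplacian_grad _ _ (fun=> 0) (fun=> 0) z 0 0 0 0)//.
  by rewrite addr0 mulr0.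
by apply: filterS (near_upper z0) => w _; exact: gc.
Qed.

End Fuchsian.
End HyperbolicBalls.

(** * Integration by parts *)

Section Rectangle.
Variable R : realType.
Implicit Types (f g k : R * R -> R) (a b c d : R).
Local Notation lam := (@lebesgue_measure R).
Local Notation T2 := (measurableTypeR R * measurableTypeR R)%type.

Lemma pointwise_continuous_measurable (D : set (R * R)) f :
  measurable (D : set T2) -> (forall z, D z -> {for z, continuous f}) ->
  measurable_fun (D : set T2) f.
Proof.
move=> mD cf; apply: (measurability _ (RGenOpens.measurableE R)).
move=> _ [_ [a [b ->] <-]].
rewrite (_ : _ `&` _ = D `&` (f @^-1` `]a, b[)°).
  apply: measurableI => //; apply: open_measurable2; exact: open_interior.
apply/seteqP; split => z [Dz fz]; split => //; last exact: interior_subset fz.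
apply: (cf z Dz); apply: open_nbhs_nbhs; split => //; exact: interval_open.
Qed.

Definition rect a b c d : set (R * R) := `[a, b]%classic `*` `[c, d]%classic.

Lemma measurable_rect a b c d : measurable (rect a b c d : set T2).
Proof. exact: measurableX. Qed.

Lemma rect_fin a b c d : ((lam \x lam)%E (rect a b c d) < +oo)%E.
Proof.
rewrite /rect product_measure1E//.
have fin (u v : R) : (lam `[u, v]%classic < +oo)%E.
  by rewrite lebesgue_measure_itv/= lte_fin; case: ifPn => _; rewrite ?ltry.
apply: lte_mul_pinfty; [exact: measure_ge0| |exact: fin].
by rewrite ge0_fin_numE ?measure_ge0//; exact: fin.
Qed.

Lemma continuous_rect_integrable a b c d k :
  (forall z, rect a b c d z -> {for z, continuous k}) ->
  (lam \x lam)%E.-integrable (rect a b c d : set T2) (EFin \o k).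
Proof.
move=> ck; apply: measurable_bounded_integrable.
- exact: measurable_rect.
- exact: rect_fin.
- by apply: pointwise_continuous_measurable => //; exact: measurable_rect.
have : compact (k @` rect a b c d).
  apply: continuous_compact.
    by apply: continuous_in_subspaceT => z; rewrite inE; exact: ck.
  by apply: compact_setX; exact: segment_compact.
move=> /compact_bounded [M [Mr hM]]; exists M; split => // x Mx z zW.
by apply: hM => //; exists z.
Qed.

Lemma rect_integral_x0 a b c d k :
  (forall z, rect a b c d z -> {for z, continuous k}) ->
  (forall y, c <= y <= d -> (\int[lam]_(x in `[a, b]) (k (x, y))%:E)%E = 0%E) ->
  (\int[(lam \x lam)%E]_(z in (rect a b c d : set T2)) (k z)%:E)%E = 0%E.
Proof.
move=> ck h; rewrite integral_mkcond -integral21_prod_meas1; last first.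
  by apply/(integrable_mkcond _ (@measurable_rect a b c d)); exact: continuous_rect_integrable.
apply: integral0_eq => y _; rewrite /fubini_G.
    have [ycd|ycd] := boolP (c <= y <= d).
      rewrite -[RHS](h y ycd) [RHS]integral_mkcond; apply: eq_integral => x _.
      rewrite !patchE; case: ifPn; case: ifPn => //; rewrite ?inE /rect /= !in_itv/= ?notin_setE /=.
        by move=> h1 [h2 _]; case: h1; rewrite in_itv.
      by move=> h1 h2; case: h2; split => //; rewrite in_itv.
    apply: integral0_eq => x _; rewrite patchE; case: ifPn => //.
    by rewrite inE /rect /= !in_itv/= => -[_]; rewrite (negbTE ycd).
Qed.

Lemma rect_integral_y0 a b c d k :
  (forall z, rect a b c d z -> {for z, continuous k}) ->
  (forall x, a <= x <= b -> (\int[lam]_(y in `[c, d]) (k (x, y))%:E)%E = 0%E) ->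
  (\int[(lam \x lam)%E]_(z in (rect a b c d : set T2)) (k z)%:E)%E = 0%E.
Proof.
move=> ck h; rewrite integral_mkcond -integral12_prod_meas1; last first.
  by apply/(integrable_mkcond _ (@measurable_rect a b c d)); exact: continuous_rect_integrable.
apply: integral0_eq => x _; rewrite /fubini_F.
    have [xab|xab] := boolP (a <= x <= b).
      rewrite -[RHS](h x xab) [RHS]integral_mkcond; apply: eq_integral => y _.
      rewrite !patchE; case: ifPn; case: ifPn => //; rewrite ?inE /rect /= !in_itv/= ?notin_setE /=.
        by move=> h1 [_ h2]; case: h1; rewrite in_itv.
      by move=> h1 h2; case: h2; split => //; rewrite in_itv.
    apply: integral0_eq => y _; rewrite patchE; case: ifPn => //.
    by rewrite inE /rect /= !in_itv/= => -[]; rewrite (negbTE xab).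
Qed.

Lemma integral_derive (h k : R -> R) a b : a < b ->
  (forall x, a <= x <= b -> is_derive x (1 : R) h (k x)) ->
  (forall x, a <= x <= b -> {for x, continuous k}) ->
  (\int[lam]_(x in `[a, b]) (k x)%:E = (h b)%:E - (h a)%:E)%E.
Proof.
move=> ab dh ck.
have ch x : a <= x <= b -> {for x, continuous h} by move=> /dh /d1_continuous.
apply: continuous_FTC2 => //.
- by apply: continuous_in_subspaceT => x; rewrite inE /= in_itv/=; exact: ck.
- split.
  + by move=> x; rewrite in_itv/= => /andP[ax xb]; have [] := dh x; rewrite ?(ltW ax)// ltW.
  + by apply: cvg_at_right_filter; apply: ch; rewrite lexx ltW.
  + by apply: cvg_at_left_filter; apply: ch; rewrite lexx ltW.
- move=> x; rewrite in_itv/= => /andP[ax xb]; rewrite derive1E.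
  have axb : a <= x <= b by rewrite !ltW.
  by have [_] := dh x axb.
Qed.

Lemma grad_sect1 f x y p q : grad_at f (x, y) p q ->
  is_derive x (1 : R) (fun x => f (x, y)) p.
Proof.
move=> h; have := diff_derivable (v := (1, 0) : R * R) (grad_differentiable h).
have := grad_derive (1, 0) h; rewrite /= mulr1 mulr0 addr0.
have E : (fun t : R => t^-1 *: (((f : R * R -> R^o) \o shift (x, y)) (t *: ((1, 0) : R * R)) - f (x, y))) =
    (fun t : R => t^-1 *: (((fun x => f (x, y) : R^o) \o shift x) (t *: (1 : R)) - f (x, y))).
  apply/funext => t /=; congr (_ *: (f _ - _)).
  by transitivity ((t * 1 + x, t * 0 + y) : R * R) => //; rewrite mulr0 add0r.
rewrite /derive /derivable E => <- dv.
by apply: DeriveDef.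
Qed.

Lemma grad_sect2 f x y p q : grad_at f (x, y) p q ->
  is_derive y (1 : R) (fun y => f (x, y)) q.
Proof.
move=> h; have := diff_derivable (v := (0, 1) : R * R) (grad_differentiable h).
have := grad_derive (0, 1) h; rewrite /= mulr1 mulr0 add0r.
have E : (fun t : R => t^-1 *: (((f : R * R -> R^o) \o shift (x, y)) (t *: ((0, 1) : R * R)) - f (x, y))) =
    (fun t : R => t^-1 *: (((fun y => f (x, y) : R^o) \o shift y) (t *: (1 : R)) - f (x, y))).
  apply/funext => t /=; congr (_ *: (f _ - _)).
  by transitivity ((t * 0 + x, t * 1 + y) : R * R) => //; rewrite mulr0 add0r.
rewrite /derive /derivable E => <- dv.
by apply: DeriveDef.
Qed.

Lemma sect1_continuous f (x y : R) : {for (x, y), continuous f} ->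
  {for x, continuous (fun x => f (x, y))}.
Proof.
move=> cf; apply: (@continuous_comp _ _ _ (fun t : R => (t, y) : R * R) f); last exact: cf.
have h : (fun t : R => (t, y) : R * R) t @[t --> x] --> (x, y) by exact: (cvg_pair (@cvg_id _ (nbhs x)) (cvg_cst y)).
exact: h.
Qed.

Lemma sect2_continuous f (x y : R) : {for (x, y), continuous f} ->
  {for y, continuous (fun y => f (x, y))}.
Proof.
move=> cf; apply: (@continuous_comp _ _ _ (fun t : R => (x, t) : R * R) f); last exact: cf.
have h : (fun t : R => (x, t) : R * R) t @[t --> y] --> (x, y) by exact: (cvg_pair (cvg_cst x) (@cvg_id _ (nbhs y))).
exact: h.
Qed.

Definition C2_on (W : set (R * R)) f fx fy fxx fxy fyx fyy : Prop :=
  forall z, W z -> [/\ grad_at f z (fx z) (fy z), grad_at fx z (fxx z) (fxy z),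
    grad_at fy z (fyx z) (fyy z), {for z, continuous fxx} & {for z, continuous fyy}].

Lemma continuousMD (W : set (R * R)) (z : R * R) (f1 f2 f3 f4 : R * R -> R) :
  {for z, continuous f1} -> {for z, continuous f2} ->
  {for z, continuous f3} -> {for z, continuous f4} ->
  {for z, continuous (fun z => f1 z * f2 z - f3 z * f4 z)}.
Proof.
move=> c1 c2 c3 c4; apply: (@continuousB _ R^o); exact: (@continuousM R).
Qed.

(** The difference fxx g - f gxx is the x-derivative of fx g - f gx, which vanishes on the vertical
    sides; the same holds for y. So each half integrates to zero along lines. *)
Lemma rect_green a b c d f fx fy fxx fxy fyx fyy g gx gy gxx gxy gyx gyy :
  a < b -> c < d ->
  C2_on (rect a b c d) f fx fy fxx fxy fyx fyy ->
  C2_on (rect a b c d) g gx gy gxx gxy gyx gyy ->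
  (forall y, c <= y <= d -> [/\ f (a, y) = 0, fx (a, y) = 0, f (b, y) = 0 & fx (b, y) = 0]) ->
  (forall x, a <= x <= b -> [/\ f (x, c) = 0, fy (x, c) = 0, f (x, d) = 0 & fy (x, d) = 0]) ->
  (\int[(lam \x lam)%E]_(z in (rect a b c d : set T2))
     ((fxx z + fyy z) * g z - f z * (gxx z + gyy z))%:E)%E = 0%E.
Proof.
move=> ab cd Cf Cg fab fcd.
pose k1 z := fxx z * g z - f z * gxx z.
pose k2 z := fyy z * g z - f z * gyy z.
have ck1 z : rect a b c d z -> {for z, continuous k1}.
  move=> Wz; have [h1 _ _ c1 _] := Cf _ Wz; have [h2 _ _ c2 _] := Cg _ Wz.
  by apply: (@continuousMD setT) => //; [exact: grad_continuous h2|exact: grad_continuous h1].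
have ck2 z : rect a b c d z -> {for z, continuous k2}.
  move=> Wz; have [h1 _ _ _ c1] := Cf _ Wz; have [h2 _ _ _ c2] := Cg _ Wz.
  by apply: (@continuousMD setT) => //; [exact: grad_continuous h2|exact: grad_continuous h1].
transitivity (\int[(lam \x lam)%E]_(z in (rect a b c d : set T2)) ((k1 z)%:E + (k2 z)%:E))%E.
  by apply: eq_integral => z _; rewrite -EFinD; congr EFin; rewrite /k1 /k2; ring.
rewrite integralD//=; first last.
- exact: continuous_rect_integrable.
- exact: continuous_rect_integrable.
- exact: measurable_rect.
rewrite rect_integral_x0//; last first.
  move=> y ycd; have Wy x : a <= x <= b -> rect a b c d (x, y) by move=> xab; split; rewrite /= in_itv.
  have dk x : a <= x <= b -> is_derive x (1 : R) (fun x => fx (x, y) * g (x, y) - f (x, y) * gx (x, y)) (k1 (x, y)).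
    move=> /Wy Wxy; have [h1 h2 _ _ _] := Cf _ Wxy; have [h3 h4 _ _ _] := Cg _ Wxy.
    apply: d1_eq (d1_add (d1_mul (grad_sect1 h2) (grad_sect1 h3)) (d1_opp (d1_mul (grad_sect1 h1) (grad_sect1 h4)))) _.
    by rewrite /k1; ring.
  rewrite (integral_derive ab dk) => [|x /Wy Wxy]; last by apply: sect1_continuous; exact: ck1.
  by have [-> -> -> ->] := fab _ ycd; rewrite !mul0r subrr -EFinB subrr.
rewrite rect_integral_y0 ?adde0//.
move=> x xab; have Wx y : c <= y <= d -> rect a b c d (x, y) by move=> ycd; split; rewrite /= in_itv.
have dk y : c <= y <= d -> is_derive y (1 : R) (fun y => fy (x, y) * g (x, y) - f (x, y) * gy (x, y)) (k2 (x, y)).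
  move=> /Wx Wxy; have [h1 _ h2 _ _] := Cf _ Wxy; have [h3 _ h4 _ _] := Cg _ Wxy.
  apply: d1_eq (d1_add (d1_mul (grad_sect2 h2) (grad_sect2 h3)) (d1_opp (d1_mul (grad_sect2 h1) (grad_sect2 h4)))) _.
  by rewrite /k2; ring.
rewrite (integral_derive cd dk) => [|y /Wx Wxy]; last by apply: sect2_continuous; exact: ck2.
by have [-> -> -> ->] := fcd _ xab; rewrite !mul0r subrr -EFinB subrr.
Qed.

End Rectangle.

(** * The differential equation of the Green function *)

Section Slices.
Variable R : realType.
Local Notation E := (R * R)%type.
Implicit Types (f : E -> R) (r : E * E -> R) (z w v : E).

Definition nderive (V : normedModType R) (f : V -> R) (s : seq V) : V -> R^o :=
  foldr (fun (v : V) (g : V -> R^o) => 'D_v g) f s.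

Lemma differentiable_pairl z w : differentiable (fun w : E => (z, w) : E * E) w.
Proof.
pose L (w : E) : E * E := (0, w).
have lL : linear L.
  by move=> k x y; congr pair; rewrite /= scaler0 addr0.
pose lf := GRing.isLinear.Build _ _ _ _ L lL.
pose LL : {linear (R * R)%type -> ((R * R) * (R * R))%type} := HB.pack L lf.
have cL : continuous LL.
  by move=> x; exact: (cvg_pair (cvg_cst (0 : E)) (@cvg_id _ (nbhs x))).
have -> : (fun w : E => (z, w) : E * E) = cst ((z, 0) : E * E) + LL.
  by apply/funext => x; congr pair; rewrite /= ?addr0 ?add0r.
apply: differentiableD; first exact: differentiable_cst.
exact: linear_differentiable.
Qed.

Lemma derive_slice r z w v :
  'D_v (fun w => r (z, w) : R^o) w = 'D_((0, v) : E * E) (r : E * E -> R^o) (z, w).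
Proof.
have e : (fun t : R => t^-1 *: (((fun w => r (z, w) : R^o) \o shift w) (t *: v) - r (z, w))) =
   (fun t : R => t^-1 *: (((r : E * E -> R^o) \o shift (z, w)) (t *: ((0, v) : E * E)) - r (z, w))).
  apply/funext => t /=; congr (_ *: (r _ - _)).
  transitivity ((t *: 0 + z, t *: v + w) : E * E) => //.
  by rewrite scaler0 add0r.
by rewrite /derive e.
Qed.

Lemma nderive_slice r z (s : seq E) :
  nderive (fun w => r (z, w)) s = (fun w => nderive r [seq ((0, v) : E * E) | v <- s] (z, w)).
Proof.
elim: s => [//|v s IH] /=; rewrite IH; apply/funext => w; exact: (derive_slice (nderive r _)).
Qed.

Lemma smooth_on_slice (U : set (E * E)) r z : smooth_on U r ->
  smooth_on [set w | U (z, w)] (fun w => r (z, w)).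
Proof.
move=> sr s w Uzw; rewrite -/(nderive _ s) nderive_slice.
apply: (@differentiable_comp _ _ _ _ (fun w : E => (z, w) : E * E)).
  exact: differentiable_pairl.
exact: sr.
Qed.

Lemma nderive_near (V : normedModType R) (f g : V -> R) (s : seq V) (x : V) :
  (\near x, f x = g x) -> \near x, nderive f s x = nderive g s x.
Proof.
elim: s x => [//|v s IH] x fg /=.
by apply: filterS (nbhs_interior (IH _ fg)) => y; exact: near_eq_derive.
Qed.

Lemma smooth_on_near (V : normedModType R) (U : set V) (f : V -> R) :
  (forall x, U x -> exists W (g : V -> R), [/\ smooth_on W g, W x & \near x, f x = g x]) ->
  smooth_on U f.
Proof.
move=> H s x Ux; have [W [g [sg Wx fg]]] := H x Ux.
apply: near_eq_differentiable (sg s x Wx).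
by apply: filterS (nderive_near s fg) => y; rewrite /nderive => ->.
Qed.

Lemma smooth_on_continuous (V : normedModType R) (U : set V) (f : V -> R) (s : seq V) x :
  smooth_on U f -> U x -> {for x, continuous (nderive f s)}.
Proof. by move=> sf Ux; apply: differentiable_continuous; exact: sf. Qed.

Local Notation D1 f := ('D_((1, 0) : E) (f : E -> R^o)).
Local Notation D2 f := ('D_((0, 1) : E) (f : E -> R^o)).

Lemma differentiable_grad f z : differentiable (f : E -> R^o) z -> grad_at f z (D1 f z) (D2 f z).
Proof.
move=> df; apply: DiffDef => //; apply/funext => -[a b].
have e : ((a, b) : E) = a *: ((1, 0) : E) + b *: ((0, 1) : E).
  by transitivity ((a * 1 + b * 0, a * 0 + b * 1) : E) => //; rewrite !mulr0 !mulr1 addr0 add0r.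
rewrite /= !deriveE// [in LHS]e linearD !linearZ.
by congr (_ + _); rewrite /GRing.scale /= mulrC.
Qed.

Definition C2 (W : set E) f : Prop :=
  C2_on W f (D1 f) (D2 f) (D1 (D1 f)) (D2 (D1 f)) (D1 (D2 f)) (D2 (D2 f)).

Lemma smooth_on_C2 (W : set E) f : smooth_on W f -> C2 W f.
Proof.
move=> sf z Wz; split.
- exact/differentiable_grad/(sf [::]).
- exact/differentiable_grad/(sf [:: (1, 0)]).
- exact/differentiable_grad/(sf [:: (0, 1)]).
- exact: (@smooth_on_continuous _ W f [:: ((1, 0) : E); (1, 0)] z sf Wz).
- exact: (@smooth_on_continuous _ W f [:: ((0, 1) : E); (0, 1)] z sf Wz).
Qed.

Lemma C2_hlaplacian (W : set E) f z :
  hlaplacian f z = z.2 ^+ 2 * (D1 (D1 f) z + D2 (D2 f) z).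
Proof. by []. Qed.

Lemma near_slice (U : set (E * E)) z w : nbhs (z, w) U -> \forall w \near w, U (z, w).
Proof. by move=> nU; exact: (cvg_pair (cvg_cst z) (@cvg_id _ (nbhs w)) nU). Qed.

Lemma hlaplacian_nderive f w : hlaplacian f w =
  w.2 ^+ 2 * (nderive f [:: ((1, 0) : E); (1, 0)] w + nderive f [:: ((0, 1) : E); (0, 1)] w).
Proof. by rewrite /hlaplacian /nderive /=. Qed.

Lemma hlaplacian_slice r z w : hlaplacian (fun w => r (z, w)) w =
  w.2 ^+ 2 * (nderive r [:: ((0, (1, 0)) : E * E); (0, (1, 0))] (z, w)
            + nderive r [:: ((0, (0, 1)) : E * E); (0, (0, 1))] (z, w)).
Proof.
by rewrite hlaplacian_nderive !nderive_slice.
Qed.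

End Slices.

Section GreenFunction.
Variable R : realType.
Variables (Gamma : set 'M[R]_2) (F : set (R * R)).
Hypothesis hG : is_cofinite_fuchsian Gamma F.
Local Notation T2 := (measurableTypeR R * measurableTypeR R)%type.
Let fG : is_fuchsian Gamma. Proof. by case: hG. Qed.

(** By [upt_triangle] through z0, elements with u(z0, g w0) <= 2 move w0 by a bounded amount, so
    they are finitely many, and the least of the positive gaps is positive. *)
Lemma orbit_gap z0 w0 : upper z0 -> upper w0 -> ~ same_orbit Gamma z0 w0 ->
  exists2 r : R, 0 < r & forall g, Gamma g -> 1 + r <= upt z0 (mobius g w0).
Proof.
move=> z00 w00 no.
pose S := [set g | Gamma g /\ upt z0 (mobius g w0) <= 2].
have fS : finite_set S.
  apply: sub_finite_set (finite_upt_le (1 + 4 * 2 * (upt z0 w0 - 1) + 4 * upt z0 w0 * (2 - 1)) fG w00).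
  move=> g [Gg h]; split=> //; have dg := fuchsian_det fG Gg.
  have gw := upper_mobius dg w00.
  have := upt_triangle z00 w00 gw; rewrite (upt_sym w0 z0).
  have := upt_ge1 z00 w00; have := upt_ge1 z00 gw; set a := upt _ _; set b := upt z0 w0.
  move=> a1 b1 tri; have a2 : a <= 2 := h.
  have : 4 * a * (b - 1) <= 4 * 2 * (b - 1) by rewrite ler_wpM2r ?subr_ge0// ler_wpM2l.
  have : 4 * b * (a - 1) <= 4 * b * (2 - 1).
    by rewrite ler_wpM2l ?lerB// mulr_ge0//; lra.
  lra.
have [|r r0 hr] := @finite_pos_lb _ _ S (fun g => upt z0 (mobius g w0) - 1) fS.
  move=> g [Gg _]; have dg := fuchsian_det fG Gg; have gw := upper_mobius dg w00.
  rewrite lt_neqAle eq_sym subr_eq0 subr_ge0 upt_ge1// andbT; apply/eqP => h.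
  by apply: no; exists g => //; apply/upt_eq1.
exists (Num.min 1 r) => [|g Gg]; first by rewrite lt_min ltr01.
have m1 : Num.min 1 r <= 1 by rewrite ge_min lexx.
have mr : Num.min 1 r <= r by rewrite ge_min lexx orbT.
have [h|h] := leP (upt z0 (mobius g w0)) 2; last by lra.
by have := hr g (conj Gg h); lra.
Qed.

Lemma offdiag_near z0 w0 : offdiag Gamma (z0, w0) ->
  exists2 r : R, 0 < r & forall z w, hball z0 r z -> hball w0 r w -> offdiag Gamma (z, w).
Proof.
move=> [/= z00 w00 no]; have [r r0 hr] := orbit_gap z00 w00 no.
exists (Num.min 1 (r / 20)); first by rewrite lt_min ltr01 divr_gt0.
set s := Num.min _ _.
have s0 : 0 < s by rewrite lt_min ltr01 divr_gt0.
have s1 : s <= 1 by rewrite ge_min lexx.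
have sr : s <= r / 20 by rewrite ge_min lexx orbT.
move=> z w [zu zs] [wu ws]; split => // -[g Gg ze].
have dg := fuchsian_det fG Gg; have gw := upper_mobius dg w00.
have := hr g Gg; have := upt_triangle zu z00 gw.
have -> : upt z (mobius g w0) = upt w w0 by rewrite [z]ze upt_mobius.
rewrite (upt_sym z0 z).
have := upt_ge1 wu w00; have := upt_ge1 zu z00.
set a := upt w w0 in ws *; set b := upt z z0 in zs *; move=> b1 a1 tri h.
have : 4 * a * (b - 1) <= 4 * 2 * s by apply: ler_pM; lra.
have : 4 * b * (a - 1) <= 4 * 2 * s by apply: ler_pM; lra.
lra.
Qed.

Lemma offdiag_nbhs z0 w0 : offdiag Gamma (z0, w0) -> nbhs (z0, w0) (offdiag Gamma).
Proof.
move=> o; have [r r0 h] := offdiag_near o; have [/= z00 w00 _] := o.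
exists (hball z0 r, hball w0 r); first by split; exact: hball_nbhs.
by move=> [z w] [/= hz hw]; exact: h.
Qed.

Lemma offdiag_open : open (offdiag Gamma).
Proof. by rewrite openE => -[z w]; exact: offdiag_nbhs. Qed.

Lemma offdiag_nbhs2 z w0 : offdiag Gamma (z, w0) -> \near w0, offdiag Gamma (z, w0).
Proof.
move=> o; have [r r0 h] := offdiag_near o; have [/= z00 w00 _] := o.
apply: filterS (hball_nbhs w00 r0) => w; apply: h; exact: hball_center.
Qed.

Variable gr : R * R -> R * R -> R.
Hypothesis hgr : is_green_function Gamma F gr.

(** At a pair of inequivalent points the index set of the singular sum is empty, so gr coincides
    with its smooth part. *)
Lemma green_local z0 w0 : offdiag Gamma (z0, w0) ->
  exists U r, [/\ open U, U (z0, w0), U `<=` offdiag Gamma, smooth_on U r &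
    forall z w, U (z, w) -> gr z w = r (z, w)].
Proof.
move=> o; have [/= z00 w00 no] := o; have [_ _ lg _ _] := hgr.
have [U [r [oU Uzw sr h]]] := lg z0 w0 z00 w00.
exists (U `&` offdiag Gamma), r; split.
- exact: openI oU offdiag_open.
- by [].
- exact: subIsetr.
- by move=> s x [Ux _]; exact: sr.
- move=> z w [/= Uzw' ozw]; rewrite h//.
  rewrite (_ : [set g | _] = set0) ?fsbig_set0 ?subr0//.
  by rewrite -subset0 => g [Gg e]; apply: no; exists g.
Qed.

Lemma green_smooth z : smooth_on [set w | offdiag Gamma (z, w)] (gr z).
Proof.
apply: smooth_on_near => w0 /= o; have [U [r [oU Uzw UO sr h]]] := green_local o.
exists [set w | U (z, w)], (fun w => r (z, w)); split => //; first exact: smooth_on_slice.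
apply: filterS (near_slice (open_nbhs_nbhs (conj oU Uzw))) => w; exact: h.
Qed.

(** Continuity in both variables jointly is what allows a defect of the equation at one pair to
    persist on a product of balls. *)
Lemma green_hlaplacian_continuous z0 w0 : offdiag Gamma (z0, w0) ->
  {for (z0, w0), continuous (fun p : (R * R) * (R * R) => hlaplacian (gr p.1) p.2)}.
Proof.
move=> o; have [U [r [oU Uzw UO sr h]]] := green_local o.
pose c (p : (R * R) * (R * R)) := p.2.2 ^+ 2 *
  (nderive r [:: ((0, (1, 0)) : (R * R) * (R * R)); (0, (1, 0))] p
   + nderive r [:: ((0, (0, 1)) : (R * R) * (R * R)); (0, (0, 1))] p).
have cE : \forall p \near (z0, w0), c p = hlaplacian (gr p.1) p.2.
  apply: filterS (open_nbhs_nbhs (conj oU Uzw)) => -[z w] /= Uzw'.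
  transitivity (hlaplacian (fun w => r (z, w)) w); first by rewrite hlaplacian_slice.
  apply: hlaplacian_local.
  apply: filterS (near_slice (open_nbhs_nbhs (conj oU Uzw'))) => w' Uw'; exact/esym/h.
suff cc : {for (z0, w0), continuous c}.
  rewrite /prop_for /continuous_at -(nbhs_singleton cE); apply: cvg_trans cc.
  exact: near_eq_cvg.
apply: (@continuousM R).
  apply: (@continuous_comp _ _ _ (fun p : (R * R) * (R * R) => p.2.2) (fun y : R => y ^+ 2)); last exact: exprn_continuous.
  apply: (@continuous_comp _ _ _ (fun p : (R * R) * (R * R) => p.2) (fun y => y.2)); exact: cvg_snd.
apply: (@continuousD R R^o).
  exact: (@smooth_on_continuous _ _ U r [:: (0, (1, 0)) : (R * R) * (R * R); (0, (1, 0))] _ sr Uzw).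
exact: (@smooth_on_continuous _ _ U r [:: (0, (0, 1)) : (R * R) * (R * R); (0, (0, 1))] _ sr Uzw).
Qed.

End GreenFunction.

(** * Integrals over a fundamental domain *)

Section HyperbolicIntegrals.
Variable R : realType.
Local Notation T2 := (measurableTypeR R * measurableTypeR R)%type.
Local Notation lam := (@lebesgue_measure R).
Local Notation hm := (@hmeasure R).
Implicit Types (V : set (R * R)) (f k : R * R -> R).

Lemma integral_hmeasure_density V f : measurable (V : set T2) -> V `<=` upper ->
  measurable_fun (V : set T2) f ->
  (\int[hm]_(z in (V : set T2)) (f z)%:E = \int[(lam \x lam)%E]_(z in (V : set T2)) (f z * z.2 ^- 2)%:E)%E.
Proof.
move=> mV Vu mf.
pose k (z : T2) : R := (z.2 : R) `^ (- 2).
have mid : measurable_fun setT ((fun x : measurableTypeR R => x) : measurableTypeR R -> R).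
  by move=> _ B mB; rewrite setTI; exact: mB.
have mk : measurable_fun setT k.
  exact: (@measurableT_comp _ _ _ _ _ _ _ _ _ (measurable_powR (R:=R) (- 2))
    (measurableT_comp mid (@measurable_snd _ _ (measurableTypeR R) (measurableTypeR R)))).
have k0 z : 0 <= k z by exact: powR_ge0.
have kE (z : T2) : upper (z : R * R) -> k z = (z.2 : R) ^- 2.
  by move=> z0; rewrite /k powRN -[2]/(2%:R) powR_mulrn// ltW.
have nuE (A : set T2) : measurable A -> A `<=` V -> hm A = density_measure (lam \x lam)%E k A.
  move=> mA AV; rewrite /density_measure /hmeasure (_ : A `&` upper = A).
    by apply: eq_integral => z /set_mem /AV /Vu zu; rewrite kE.
  by apply/setIidPl => z /AV /Vu.
have me : measurable_fun (V : set T2) (EFin \o f) by exact/measurable_EFinP.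
have pos (g : T2 -> \bar R) : measurable_fun (V : set T2) g -> (forall z, V z -> 0 <= g z)%E ->
    (\int[hm]_(z in (V : set T2)) g z = \int[(lam \x lam)%E]_(z in (V : set T2)) (g z * (k z)%:E))%E.
  by move=> mg g0; exact: ge0_integral_density.
rewrite integralE [RHS]integralE.
congr (_ - _)%E; rewrite pos//.
- apply: eq_integral => z /set_mem /Vu zu.
  by rewrite !funeposE /= kE// EFinM maxe_pMl ?mul0e ?lee_fin ?invr_ge0 ?sqr_ge0.
- exact: measurable_funepos.
- apply: eq_integral => z /set_mem /Vu zu.
  by rewrite !funenegE /= kE// maxe_pMl ?mul0e ?lee_fin ?invr_ge0 ?sqr_ge0// -EFinM mulNr.
- exact: measurable_funeneg.
Qed.

Variables (Gamma : set 'M[R]_2) (F : set (R * R)).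
Hypothesis hG : is_cofinite_fuchsian Gamma F.
Let fG : is_fuchsian Gamma. Proof. by case: hG. Qed.
Let mF : measurable (F : set T2). Proof. by case: hG => _ []. Qed.
Let Fu : F `<=` upper. Proof. by case: hG => _ []. Qed.

(** The positive and negative parts are both invariant and both vanish off the saturation of V, so
    [unfolding] applies to each and the rest of F adds nothing. *)
Lemma unfolding_signed V f :
  measurable (V : set T2) -> V `<=` upper -> inj_mod Gamma V ->
  measurable_fun (upper : set T2) f -> Defs.invariant Gamma f ->
  (forall z, upper z -> f z != 0 -> saturation Gamma V z) ->
  (\int[hm]_(z in (F : set T2)) (f z)%:E = \int[hm]_(z in (V : set T2)) (f z)%:E)%E.
Proof.
move=> mV Vu iV mf finv supp; have [_ fdF _] := hG.
have me : measurable_fun (upper : set T2) (EFin \o f) by exact/measurable_EFinP.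
rewrite integralE [RHS]integralE.
have pos (g : T2 -> \bar R) : measurable_fun (upper : set T2) g -> (forall z, 0 <= g z)%E ->
    (forall a z, Gamma a -> upper z -> g (mobius a z) = g z) ->
    (forall z, upper z -> f z = 0 -> g z = 0%E) ->
    (\int[hm]_(z in (F : set T2)) g z = \int[hm]_(z in (V : set T2)) g z)%E.
  move=> mg g0 gi gs.
  have [mFV <-] := unfolding fG fdF mV Vu iV mg (fun z _ => g0 z) gi.
  rewrite integral_mkcondr; apply: eq_integral => z /set_mem Fz; rewrite patchE.
  case: ifPn => //; rewrite notin_setE => ns; apply: gs; first exact: Fu.
  by apply/eqP/negPn/negP => fz; apply: ns; apply: supp => //; exact: Fu.
congr (_ - _)%E; apply: pos.
- exact: measurable_funepos.
- by move=> z; exact: funepos_ge0.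
- by move=> a z Ga zu; rewrite !funeposE /= finv.
- by move=> z zu fz; rewrite funeposE /= fz maxxx.
- exact: measurable_funeneg.
- by move=> z; exact: funeneg_ge0.
- by move=> a z Ga zu; rewrite !funenegE /= finv.
- by move=> z zu fz; rewrite funenegE /= fz oppr0 maxxx.
Qed.

Lemma bounded_integrable f (M : R) : measurable_fun (upper : set T2) f ->
  (forall z, upper z -> `|f z| <= M) -> hm.-integrable (F : set T2) (EFin \o f).
Proof.
move=> mf fM; apply: measurable_bounded_integrable => //.
- by case: hG.
- by apply: measurable_funS mf => //; exact: measurable_upper.
- exists M; split; first by rewrite num_real.
  by move=> x Mx z Fz; apply: le_trans (ltW Mx); apply: fM; exact: Fu.
Qed.

Lemma smooth_bounded_measurable f : smooth_bounded Gamma f -> measurable_fun (upper : set T2) f.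
Proof.
move=> [_ sf _]; apply: continuous_upper_measurable => z zu.
exact: (@smooth_on_continuous _ _ _ _ [::] z sf zu).
Qed.

Lemma smooth_bounded_L2 f : smooth_bounded Gamma f -> in_L2 Gamma F f.
Proof.
move=> sf; have mf := smooth_bounded_measurable sf; have [fi _ [M fM]] := sf.
split => //.
have /integrableP[_] : hm.-integrable (F : set T2) (EFin \o (fun z => f z ^+ 2)).
  apply: (@bounded_integrable _ (M ^+ 2)) => [|z zu]; first exact: measurable_funX.
  by rewrite normrX lerXn2r ?nnegrE ?(le_trans (normr_ge0 _) (fM z zu))//; exact: fM.
apply: le_lt_trans; rewrite le_eqVlt; apply/orP; left; apply/eqP.
by apply: eq_integral => z _; rewrite /= ger0_norm// sqr_ge0.
Qed.

Lemma L2_measurable f : in_L2 Gamma F f -> measurable_fun (F : set T2) f.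
Proof. by case=> _ mf _; apply: measurable_funS mf => //; exact: measurable_upper. Qed.

(** From |k f| <= k^2 + f^2, where k^2 is integrable because it is bounded and the volume is
    finite. *)
Lemma L2_bounded_integrable f k (M : R) : in_L2 Gamma F f ->
  measurable_fun (upper : set T2) k -> (forall z, upper z -> `|k z| <= M) ->
  hm.-integrable (F : set T2) (EFin \o (fun z => k z * f z)).
Proof.
move=> fL mk kM; have mf := L2_measurable fL; have [_ _ f2] := fL.
have mkF : measurable_fun (F : set T2) k by apply: measurable_funS mk => //; exact: measurable_upper.
have i1 : hm.-integrable (F : set T2) (EFin \o (fun z => f z ^+ 2)).
  apply/integrableP; split; first by apply/measurable_EFinP; exact: measurable_funX.
  apply: le_lt_trans f2; rewrite le_eqVlt; apply/orP; left; apply/eqP.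
  by apply: eq_integral => z _; rewrite /= ger0_norm// sqr_ge0.
have i2 : hm.-integrable (F : set T2) (EFin \o (fun z => k z ^+ 2)).
  apply: (@bounded_integrable _ (M ^+ 2)) => [|z zu]; first exact: measurable_funX.
  by rewrite normrX lerXn2r ?nnegrE ?(le_trans (normr_ge0 _) (kM z zu))//; exact: kM.
have := integrableD mF i1 i2; apply: le_integrable => //.
  by apply/measurable_EFinP; exact: measurable_funM.
move=> z Fz; rewrite -EFinD lee_fin normrM [leRHS]ger0_norm ?addr_ge0 ?sqr_ge0//.
rewrite -(real_normK (num_real (f z))) -(real_normK (num_real (k z))).
have := sqr_ge0 (`|f z| - `|k z|); have := normr_ge0 (f z); have := normr_ge0 (k z).
set a := `|f z|; set b := `|k z|; nra.
Qed.

End HyperbolicIntegrals.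

(** * Green's identity for a bump function *)

Section BumpGreen.
Variable R : realType.
Local Notation T2 := (measurableTypeR R * measurableTypeR R)%type.
Local Notation lam := (@lebesgue_measure R).
Local Notation hm := (@hmeasure R).
Implicit Types (p z w : R * R) (f k : R * R -> R).

(** Integration by parts is done on rectangles, the bumps live on hyperbolic balls. The square
    between the balls of parameter r and 10 r has the bump vanish on its sides and still lies where
    the other function is smooth. *)
Lemma square_between p (r : R) : upper p -> 0 < r <= 1000^-1 ->
  exists2 s : R, 0 < s & [/\ hball p r `<=` rect (p.1 - s) (p.1 + s) (p.2 - s) (p.2 + s),
    rect (p.1 - s) (p.1 + s) (p.2 - s) (p.2 + s) `<=` hball p (10 * r) &
    forall z, upper z -> `|z.1 - p.1| = s \/ `|z.2 - p.2| = s -> 1 + r <= upt z p].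
Proof.
case: p => a b; rewrite /upper /= => b0 /andP[r0 r1].
pose q := Num.sqrt r; have q0 : 0 < q by rewrite sqrtr_gt0.
have qq : q ^+ 2 = r by rewrite sqr_sqrtr// ltW.
have q1 : q <= 32 / 1000.
  rewrite leNgt; apply/negP => h; have : q ^+ 2 <= 1000^-1 by rewrite qq.
  by rewrite expr2; nra.
(* On the ball the squared Euclidean distance is at most 8 b^2 r, less than (3 b q)^2 = 9 b^2 r. On
   the square u - 1 is at most 9 b r / y, and r <= 1/1000 keeps y >= 0.904 b, so this is below 10
   r. *)
exists (3 * b * q); first by rewrite !mulr_gt0.
have dist z : hball (a, b) r z -> (z.1 - a) ^+ 2 + (z.2 - b) ^+ 2 < (3 * b * q) ^+ 2.
  move=> zB; have := @hball_dist _ (a, b) r z b0 _ zB; rewrite /= => h.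
  apply: le_lt_trans (h _) _; first lra.
  rewrite !exprMn qq; have : 0 < b ^+ 2 * r by rewrite mulr_gt0// exprn_gt0.
  lra.
have s0 : 0 < 3 * b * q by rewrite !mulr_gt0.
split.
- move=> z /dist h; rewrite /rect /= !in_itv /= -!ler_distl; split.
    rewrite -(@ler_pXn2r _ 2)// ?nnegrE ?(ltW s0)// real_normK ?num_real//.
    by have := sqr_ge0 (z.2 - b); lra.
  rewrite -(@ler_pXn2r _ 2)// ?nnegrE ?(ltW s0)// real_normK ?num_real//.
  by have := sqr_ge0 (z.1 - a); lra.
- move=> [x y]; rewrite /rect /= !in_itv /= -!ler_distl => -[hx hy].
  have sb : 3 * b * q <= b * (96 / 1000) by nra.
  have yb : b * (904 / 1000) <= y by move: hy; rewrite ler_distl => /andP[+ _]; lra.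
  have y0 : 0 < y by clear -yb b0; nra.
  split; first by [].
  rewrite uptE /=; rewrite ltrD2l ltr_pdivrMr ?mulr_gt0//.
  have hx2 : (x - a) ^+ 2 <= (3 * b * q) ^+ 2.
    by rewrite -[leLHS]real_normK ?num_real// ler_pXn2r ?nnegrE ?(ltW s0).
  have hy2 : (y - b) ^+ 2 <= (3 * b * q) ^+ 2.
    by rewrite -[leLHS]real_normK ?num_real// ler_pXn2r ?nnegrE ?(ltW s0).
  have e : (3 * b * q) ^+ 2 = 9 * (b ^+ 2 * r) by rewrite !exprMn qq; ring.
  have br : 0 < b * r by rewrite mulr_gt0.
  have : b * r * (b * (904 / 1000)) <= b * r * y by rewrite ler_pM2l.
  have : 0 < b ^+ 2 * r by rewrite mulr_gt0// exprn_gt0.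
  move: hx2 hy2; rewrite e; clear; lra.
- move=> z z0 h; rewrite leNgt; apply/negP => zr.
  have /dist := conj z0 zr : hball (a, b) r z.
  have := sqr_ge0 (z.1 - a); have := sqr_ge0 (z.2 - b).
  by case: h => /= h; rewrite -h real_normK ?num_real//; lra.
Qed.

Lemma smooth_expr_continuous f z : smooth_expr f -> upper z -> {for z, continuous f}.
Proof. by move=> /smooth_expr_grad [fx [fy [_ _ h]]] zu; exact: grad_continuous (h z zu). Qed.

Lemma continuous_addf f k z : {for z, continuous f} -> {for z, continuous k} ->
  {for z, continuous (fun z => f z + k z)}.
Proof. by move=> cf ck; exact: (@continuousD _ R^o). Qed.

Lemma rect_gt0 (a b c d : R) : a < b -> c < d -> (0 < (lam \x lam)%E (rect a b c d))%E.
Proof.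
move=> ab cd; rewrite /rect product_measure1E//.
have l0 (u v : R) : u < v -> (0 < lam `[u, v]%classic)%E.
  by move=> uv; rewrite lebesgue_measure_itv/= lte_fin uv -EFinB lte_fin subr_gt0.
by apply: mule_gt0; exact: l0.
Qed.

Lemma hball_gt0 p (r : R) : upper p -> 0 < r -> (0 < hm (hball p r : set T2))%E.
Proof.
move=> p0 r0.
pose r' := Num.min r 1000^-1 / 10.
have r'0 : 0 < r' by apply: divr_gt0; rewrite ?lt_min ?r0 ?invr_gt0 ltr0n.
have r'r : 10 * r' <= r by rewrite /r' mulrC divfK// ge_min lexx.
have r'1 : 0 < r' <= 1000^-1.
  rewrite r'0 /r' ler_pdivrMr//; apply: (@le_trans _ _ 1000^-1); first by rewrite ge_min lexx orbT.
  have h0 : 0 <= 1000^-1 :> R by rewrite invr_ge0 ler0n.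
  by move: h0; generalize (1000^-1 : R) => t; lra.
have [s s0 [_ sub _]] := square_between p0 r'1.
set W := rect _ _ _ _ in sub.
have mW : measurable (W : set T2) by exact: measurable_rect.
have WB : W `<=` hball p r.
  by move=> z /sub [zu zr]; split => //; apply: lt_le_trans zr _; rewrite lerD2l.
have Wu : W `<=` upper by move=> z /sub [].
have := @le_measure _ _ _ hm (W : set T2) (hball p r : set T2).
rewrite !inE => /(_ mW (open_measurable2 (@open_hball _ p r p0)) WB).
apply: lt_le_trans.
apply: (@lt_le_trans _ _ (\int[hm]_(z in (W : set T2)) (1 : R)%:E)%E); last first.
  by rewrite integral_cst// mul1e.
rewrite (@integral_hmeasure_density _ W (fun=> 1))//.
have c0 : 0 < (p.2 + s) ^- 2 by rewrite invr_gt0 exprn_gt0// addr_gt0.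
apply: (@lt_le_trans _ _ (\int[(lam \x lam)%E]_(z in (W : set T2)) ((p.2 + s) ^- 2)%:E)%E).
  rewrite integral_cst//; apply: mule_gt0; first by rewrite lte_fin.
  by apply: rect_gt0; lra.
apply: ge0_le_integral => //.
- by move=> z _; rewrite lee_fin ltW.
- apply/measurable_EFinP.
  have mf : measurable_fun (W : set T2) (fun z : R * R => 1 * (z.2^-1 * z.2^-1)).
    apply: pointwise_continuous_measurable => // z /Wu zu; apply: smooth_expr_continuous => //.
    by apply: Smooth_mul; [exact: Smooth_cst|apply: Smooth_mul; exact: Smooth_inv].
  by apply: eq_measurable_fun mf => z _; rewrite expr2 invfM.
- move=> [x y] Wxy; have y0 : 0 < (y : R) by exact: Wu Wxy.
  have ys : (y : R) <= p.2 + s by move: Wxy => [_]; rewrite /= in_itv/= => /andP[].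
  have ps : 0 < p.2 + s := lt_le_trans y0 ys.
  rewrite lee_fin mul1r lef_pV2 ?posrE ?exprn_gt0//.
  by apply: lerXn2r; rewrite ?nnegrE ?(ltW y0) ?(ltW ps).
Qed.

Lemma smooth_expr_C2on f : smooth_expr f -> exists fx fy fxx fxy fyx fyy,
  [/\ C2_on upper f fx fy fxx fxy fyx fyy, smooth_expr fxx & smooth_expr fyy].
Proof.
move=> sf; have [fx [fy [sx sy h]]] := smooth_expr_grad sf.
have [fxx [fxy [sxx sxy hx]]] := smooth_expr_grad sx.
have [fyx [fyy [syx syy hy]]] := smooth_expr_grad sy.
exists fx, fy, fxx, fxy, fyx, fyy; split => // z zu.
by split; [exact: h|exact: hx|exact: hy|exact: smooth_expr_continuous|exact: smooth_expr_continuous].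
Qed.

(** The bump and its gradient vanish outside the ball, in particular on the sides of the square of
    [square_between], and the factor y^2 of the Laplacian cancels the density y^-2; so [rect_green]
    applies. *)
Lemma bump_green p (r : R) f : upper p -> 0 < r <= 1000^-1 -> C2 (hball p (10 * r)) f ->
  (\int[hm]_(z in (hball p r : set T2)) (lap_profile (1 + r) (upt z p) * f z)%:E =
   \int[hm]_(z in (hball p r : set T2)) (Th 0 (1 + r - upt z p) * hlaplacian f z)%:E)%E.
Proof.
move=> p0 r01 Cf; have [s s0 [VW WB side]] := square_between p0 r01.
have [u su uE] := smooth_upt p0.
have c1 (a : R) : a - s <= a - s <= a + s by apply/andP; split; lra.
have c2 (a : R) : a - s <= a + s <= a + s by apply/andP; split; lra.
have c3 (a : R) : a - s < a + s by lra.
set V := hball p r in VW *; set W := rect _ _ _ _ in VW WB.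
have Wu : W `<=` upper by move=> z /WB [].
have mV : measurable (V : set T2) by apply: open_measurable2; exact: open_hball.
have mW : measurable (W : set T2) by exact: measurable_rect.
pose phi z := Th 0 ((1 + r) + (-1) * u z).
have phiE z : Th 0 (1 + r - upt z p) = phi z by rewrite /phi uE mulN1r.
have sphi : smooth_expr phi.
  apply: Smooth_Th; apply: Smooth_add; first exact: Smooth_cst.
  by apply: Smooth_mul => //; exact: Smooth_cst.
have [fx [fy [fxx [fxy [fyx [fyy [Cphi sxx syy]]]]]]] := smooth_expr_C2on sphi.
have phi0 z : 1 + r <= upt z p -> phi z = 0 by move=> h; rewrite -phiE bump_profile0.
have grad0 z : upper z -> 1 + r <= upt z p -> fx z = 0 /\ fy z = 0.
  move=> zu h; have [g _ _ _ _] := Cphi z zu.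
  have gt : grad_at phi z 0 0.
    have := grad_comp (is_derive_Th 0 (1 + r - upt z p))
      (grad_add (grad_cst (1 + r) z) (grad_opp (grad_upt p0 zu))).
    rewrite !Th_le0 ?subr_le0// mulr0 subrr !mul0r.
    by congr (grad_at _ _ _ _); apply/funext => w; rewrite -phiE.
  have := grad_derive (1, 0) g; rewrite (grad_derive (1, 0) gt) /= !mul0r mulr1 mulr0 !addr0 => <-.
  by have := grad_derive (0, 1) g; rewrite (grad_derive (0, 1) gt) /= !mul0r mulr1 mulr0 !add0r => <-.
have lapE z : upper z -> lap_profile (1 + r) (upt z p) = z.2 ^+ 2 * (fxx z + fyy z).
  move=> zu; rewrite -hlaplacian_bump//.
  have -> : (fun z => Th 0 (1 + r - upt z p)) = phi by apply/funext => w; exact: phiE.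
  have [_ h1 h2 _ _] := Cphi z zu; apply: hlaplacian_grad h1 h2.
  by apply: filterS (near_upper zu) => w wu; have [] := Cphi w wu.
pose D1 (f : R * R -> R) := 'D_((1, 0) : R * R) (f : R * R -> R^o).
pose D2 (f : R * R -> R) := 'D_((0, 1) : R * R) (f : R * R -> R^o).
have CfW : C2_on W f (D1 f) (D2 f) (D1 (D1 f)) (D2 (D1 f)) (D1 (D2 f)) (D2 (D2 f)).
  by move=> z /WB; exact: Cf.
have CpW : C2_on W phi fx fy fxx fxy fyx fyy by move=> z /Wu; exact: Cphi.
have Wz z : W z -> [/\ {for z, continuous f}, {for z, continuous phi},
    {for z, continuous (fun z => fxx z + fyy z)} & {for z, continuous (fun z => D1 (D1 f) z + D2 (D2 f) z)}].
  move=> zW; have [h1 _ _ h2 h3] := CfW z zW; have [h4 _ _ h5 h6] := CpW z zW.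
  split; [exact: grad_continuous h1|exact: grad_continuous h4| |].
    exact: continuous_addf.
  exact: continuous_addf.
have sq (z1 z2 t : R) : 0 < t -> `|z1 - z2| = t -> z1 = z2 - t \/ z1 = z2 + t.
  move=> t0; have [h|h] := leP 0 (z1 - z2).
    by rewrite ger0_norm// => e; right; lra.
  by rewrite ltr0_norm// => e; left; lra.
have side' z : W z -> `|z.1 - p.1| = s \/ `|z.2 - p.2| = s -> [/\ phi z = 0, fx z = 0 & fy z = 0].
  move=> /Wu zu h; have := side z zu h => h1; have [g1 g2] := grad0 z zu h1.
  by split => //; exact: phi0.
have key := rect_green (a := p.1 - s) (b := p.1 + s) (c := p.2 - s) (d := p.2 + s) _ _ CpW CfW.
have {}key := key (c3 _) (c3 _).
have Win (x y : R) : p.1 - s <= x <= p.1 + s -> p.2 - s <= y <= p.2 + s -> W (x, y).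
  by move=> h1 h2; split; rewrite /= in_itv.
have n1 (a : R) : `|a - s - a| = s by rewrite addrAC subrr add0r normrN gtr0_norm.
have n2 (a : R) : `|a + s - a| = s by rewrite addrAC subrr add0r gtr0_norm.
have {}key : (\int[(lam \x lam)%E]_(z in (W : set T2))
     ((fxx z + fyy z) * f z - phi z * (D1 (D1 f) z + D2 (D2 f) z))%:E)%E = 0%E.
  apply: key.
  - move=> y hy.
    have [e1 e2 _] := side' _ (Win _ _ (c1 _) hy) (or_introl (n1 _)).
    by have [e3 e4 _] := side' _ (Win _ _ (c2 _) hy) (or_introl (n2 _)).
  - move=> x hx.
    have [e1 _ e2] := side' _ (Win _ _ hx (c1 _)) (or_intror (n1 _)).
    by have [e3 _ e4] := side' _ (Win _ _ hx (c2 _)) (or_intror (n2 _)).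
pose k1 z := (fxx z + fyy z) * f z; pose k2 z := phi z * (D1 (D1 f) z + D2 (D2 f) z).
have ck1 z : W z -> {for z, continuous k1} by move=> /Wz [? ? ? ?]; exact: (@continuousM R).
have ck2 z : W z -> {for z, continuous k2} by move=> /Wz [? ? ? ?]; exact: (@continuousM R).
(* Both hyperbolic integrands are y^2 times a function that is continuous on the square and zero off
   the ball, so both integrals become Euclidean ones over the square. *)
have ext (k h : R * R -> R) : (forall z, W z -> {for z, continuous h}) ->
    (forall z, upper z -> k z = z.2 ^+ 2 * h z) -> (forall z, upper z -> ~ V z -> h z = 0) ->
    (\int[hm]_(z in (V : set T2)) (k z)%:E = \int[(lam \x lam)%E]_(z in (W : set T2)) (h z)%:E)%E.
  move=> ch kh h0.
  have Vu : V `<=` upper by move=> z [].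
  rewrite integral_hmeasure_density//; last first.
    apply: (@eq_measurable_fun _ _ _ _ _ (fun z : R * R => z.2 ^+ 2 * h z)).
      by move=> z /set_mem [zu _]; rewrite kh.
    apply: (@measurable_funS _ _ _ _ (W : set T2)) => //; apply: pointwise_continuous_measurable => // z zW.
    apply: (@continuousM R); last exact: ch.
    have sm : smooth_expr (fun z : R * R => z.2 * z.2) by apply: Smooth_mul; exact: Smooth_snd.
    by have := smooth_expr_continuous sm (Wu _ zW); congr {for z, continuous _}; apply/funext => w; rewrite expr2.
  have VWE : V = W `&` V by rewrite setIC; exact/esym/setIidPl.
  rewrite [in LHS]VWE integral_mkcondr.
  apply: eq_integral => z /set_mem zW; have zu := Wu _ zW; rewrite patchE; case: ifPn => [zV|].
    by congr EFin; rewrite kh// mulrAC divff ?mul1r// expf_neq0// gt_eqF.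
  by rewrite notin_setE => zV; rewrite h0.
rewrite (ext _ k1)//; first last.
- move=> z zu zV; rewrite /k1; have h : 1 + r <= upt z p.
    by rewrite leNgt; apply/negP => h; apply: zV.
  have := lapE z zu; rewrite lap_profile0// => /esym/eqP; rewrite mulf_eq0 expf_eq0/= gt_eqF//=.
  by move=> /eqP ->; rewrite mul0r.
- by move=> z zu; rewrite lapE// mulrA.
rewrite (ext _ k2)//; first last.
- move=> z zu zV; rewrite /k2 phi0 ?mul0r// leNgt; apply/negP => h; exact: zV.
- by move=> z zu; rewrite phiE /k2 (C2_hlaplacian W f z) mulrCA.
have i1 := continuous_rect_integrable ck1; have i2 := continuous_rect_integrable ck2.
have : (\int[(lam \x lam)%E]_(z in (W : set T2)) (k1 z)%:E - \int[(lam \x lam)%E]_(z in (W : set T2)) (k2 z)%:E = 0)%E.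
  by rewrite -integralB// -key; apply: eq_integral => z _; rewrite -EFinB.
have f1 := integrable_fin_num mW i1; have f2 := integrable_fin_num mW i2.
by move=> /eqP; rewrite sube_eq// add0e => /eqP.
Qed.

End BumpGreen.

(** * The Green function tested against two bumps *)

Section GreenEquation.
Variable R : realType.
Local Notation T2 := (measurableTypeR R * measurableTypeR R)%type.
Local Notation hm := (@hmeasure R).
Variables (Gamma : set 'M[R]_2) (F : set (R * R)).
Hypothesis hG : is_cofinite_fuchsian Gamma F.
Let fG : is_fuchsian Gamma. Proof. by case: hG. Qed.
Let mF : measurable (F : set T2). Proof. by case: hG => _ []. Qed.
Let Fu : F `<=` upper. Proof. by case: hG => _ []. Qed.

Lemma ncenter_gt0 : 0 < (ncenter Gamma)%:R :> R.
Proof.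
rewrite ltr0n cardfs_gt0; apply/fset0Pn; exists 1%:M; rewrite in_fset_set ?inE; last first.
  by apply: finite_setI; right; apply: finite_set2.
by split; [exact: fuchsian_one|left].
Qed.

(** Gamma is countable and preserves the measure, so the translates of N form a countable union of
    null sets. *)
Lemma null_saturation (N B : set (R * R)) : measurable (N : set T2) -> hm (N : set T2) = 0%E ->
  B `<=` saturation Gamma N -> B `<=` upper -> measurable (B : set T2) -> hm (B : set T2) = 0%E.
Proof.
move=> mN N0 BN Bu mB.
have /(@countable_injP _ Gamma) [i inji] := fuchsian_countable fG.
pose E n : set (R * R) := [set z | exists g, [/\ Gamma g, i g = n & upper z /\ N (mobius g z)]].
have En n : hm.-negligible (E n : set T2).
  have [[g [Gg gn]]|no] := pselect (exists g, Gamma g /\ i g = n); last first.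
    rewrite (_ : E n = set0); first exact: negligible_set0.
    by rewrite -subset0 => z [g [Gg gn _]]; apply: no; exists g.
  have dg := fuchsian_det fG Gg.
  exists (upper `&` mobius g @^-1` N); split.
  - exact: measurable_mobius_preimage.
  - by rewrite hmeasure_mobius.
  - move=> z [h [Gh hn [zu Nz]]]; split => //; rewrite /preimage /=.
    suff <- : h = g by [].
    by apply: inji; rewrite ?inE// hn gn.
have : hm.-negligible (B : set T2).
  apply: negligibleS (negligible_bigcup En) => z Bz; have [g Gg Ng] := BN z Bz.
  by exists (i g) => //; exists g; split => //; split => //; exact: Bu.
by move=> /negligibleP; apply.
Qed.

Lemma sat_disjoint z0 w0 r : (forall z w, hball z0 r z -> hball w0 r w -> offdiag Gamma (z, w)) ->
  forall z, upper z -> saturation Gamma (hball z0 r) z -> saturation Gamma (hball w0 r) z -> False.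
Proof.
move=> off z zu [g Gg gz] [h Gh hz]; have [_ _ /=] := off _ _ gz hz; apply.
exists (g *m invmx h); first by apply: fuchsian_mul => //; exact: fuchsian_inv.
have dg := fuchsian_det fG Gg; have dh := fuchsian_det fG Gh.
by rewrite mobiusM ?det_invmx1 ?mobiusK//; exact: upper_mobius.
Qed.

Lemma Rintegral0_null (D : set (R * R)) (k : R * R -> R) : measurable (D : set T2) ->
  hm.-integrable (D : set T2) (EFin \o k) -> (forall z, D z -> 0 <= k z) ->
  \int[hm]_(z in (D : set T2)) k z = 0 ->
  measurable (D `&` [set z | k z != 0] : set T2) /\ hm (D `&` [set z | k z != 0] : set T2) = 0%E.
Proof.
move=> mD ik k0 I0; have /measurable_EFinP mk := measurable_int _ ik.
have mN : measurable (D `&` [set z | k z != 0] : set T2).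
  have -> : [set z | k z != 0] = k @^-1` (~` [set 0]) by apply/seteqP; split => z /= /eqP.
  by apply: mk => //; exact: measurableC.
split => //; apply: (negligibleP _ _).1 => //.
have e : (\int[hm]_(z in (D : set T2)) `|(EFin \o k) z| = 0)%E.
  transitivity (\int[hm]_(z in (D : set T2)) (k z)%:E)%E.
    by apply: eq_integral => z /set_mem /k0 kz; rewrite /= ger0_norm.
  by rewrite -(fineK (integrable_fin_num mD ik)) -[fine _]/(\int[hm]_(z in (D : set T2)) k z) I0.
have [A [mA A0 sub]] := (ae_eq_integral_abs hm mD (measurable_int _ ik)).1 e.
exists A; split => // z [Dz /eqP kz]; apply: sub => /= /(_ Dz) [].
exact: kz.
Qed.

Lemma Rintegral_gt0 (D : set (R * R)) (k : R * R -> R) : measurable (D : set T2) ->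
  hm.-integrable (D : set T2) (EFin \o k) -> (forall z, D z -> 0 < k z) -> (0 < hm (D : set T2))%E ->
  0 < \int[hm]_(z in (D : set T2)) k z.
Proof.
move=> mD ik k0 D0; have kge z : D z -> 0 <= k z by move=> /k0 /ltW.
rewrite lt_neqAle Rintegral_ge0// andbT; apply/eqP => /esym I0.
have [_] := Rintegral0_null mD ik kge I0.
rewrite (_ : D `&` _ = D) => [h|]; first by rewrite h ltxx in D0.
by apply/setIidPl => z /k0 kz; rewrite /= gt_eqF.
Qed.

Lemma inj_mod_fin (V : set (R * R)) : measurable (V : set T2) -> V `<=` upper -> inj_mod Gamma V ->
  (hm (V : set T2) < +oo)%E.
Proof.
move=> mV Vu iV; have [_ fdF fin] := hG.
have [mFV] := @unfolding _ Gamma F V (fun=> 1%E) fG fdF mV Vu iV (measurable_cst _) (fun _ _ => lee01) (fun _ _ _ _ => erefl).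
rewrite !integral_cst// !mul1e => e.
apply: le_lt_trans fin; apply: (@le_trans _ _ (hm (F `&` saturation Gamma V : set T2))).
  by rewrite le_eqVlt; apply/orP; left; apply/eqP.
by apply: (@le_measure _ _ _ hm) => //; rewrite ?inE//; exact: subIsetl.
Qed.

Variable gr : R * R -> R * R -> R.
Hypothesis hgr : is_green_function Gamma F gr.

Section Localized.
Variables (z0 w0 : R * R) (r : R).
Hypotheses (z0u : upper z0) (w0u : upper w0) (r01 : 0 < r <= 1000^-1).
Hypotheses (sz : separated_at Gamma z0 r) (sw : separated_at Gamma w0 r).
Hypothesis off : forall z w, hball z0 (10 * r) z -> hball w0 (10 * r) w -> offdiag Gamma (z, w).
Hypothesis iw : inj_mod Gamma (hball w0 r).

Let r0 : 0 < r. Proof. by case/andP: r01. Qed.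
Let r10 : 0 < r <= 10^-1.
Proof.
case/andP: r01 => -> /= h; apply: le_trans h _.
by rewrite lef_pV2 ?posrE ?ltr0n// ler_nat.
Qed.
Let Br p : hball p r `<=` hball p (10 * r).
Proof. by move=> z [zu zr]; split => //; apply: lt_le_trans zr _; rewrite lerD2l; have := r0; lra. Qed.
Let off1 z w : hball z0 r z -> hball w0 r w -> offdiag Gamma (z, w).
Proof. by move=> /Br hz /Br hw; exact: off. Qed.

Let Phi := per Gamma w0 r (fun u => Th 0 (1 + r - u)).
Let Psi := per Gamma w0 r (lap_profile (1 + r)).
Let f := per Gamma z0 r (fun u => Th 0 (1 + r - u)).

Let sPhi : smooth_bounded Gamma Phi. Proof. exact: per_bump_smooth. Qed.
Let sPsi : smooth_bounded Gamma Psi. Proof. exact: per_lap_smooth. Qed.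
Let sf : smooth_bounded Gamma f. Proof. exact: per_bump_smooth. Qed.

Let supPsi w : upper w -> Psi w != 0 -> saturation Gamma (hball w0 r) w.
Proof. by apply: per_support => // u; exact: lap_profile0. Qed.
Let supPhi w : upper w -> Phi w != 0 -> saturation Gamma (hball w0 r) w.
Proof. by apply: per_support => // u; exact: bump_profile0. Qed.
Let supf z : upper z -> f z != 0 -> saturation Gamma (hball z0 r) z.
Proof. by apply: per_support => // u; exact: bump_profile0. Qed.
Let PsiE w : hball w0 r w -> Psi w = lap_profile (1 + r) (upt w w0).
Proof. by move=> /Br; apply: per_hball => // u; exact: lap_profile0. Qed.
Let PhiE w : hball w0 r w -> Phi w = Th 0 (1 + r - upt w w0).
Proof. by move=> /Br; apply: per_hball => // u; exact: bump_profile0. Qed.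
Let fE z : hball z0 r z -> f z = Th 0 (1 + r - upt z z0).
Proof. by move=> /Br; apply: per_hball => // u; exact: bump_profile0. Qed.

(** The singularities of gr(z, w) in w lie on the orbit of z, and near that orbit Psi is zero, the
    two balls having disjoint saturations. So the product is continuous everywhere. *)
Lemma green_psi_continuous z w : hball z0 r z -> upper w ->
  {for w, continuous (fun w => gr z w * Psi w)}.
Proof.
move=> zB wu; have zu : upper z by case: zB.
have [so|no] := pselect (same_orbit Gamma z w).
  have [h Gh ze] := so; have dh := fuchsian_det fG Gh.
  have [s s0 sub] := hball_sub zu (open_nbhs_nbhs (conj (@open_hball _ z0 r z0u) zB)).
  suff E : \forall w' \near w, 0 = gr z w' * Psi w'.
    rewrite /prop_for /continuous_at -(nbhs_singleton E).
    by apply: cvg_trans (near_eq_cvg E) _; exact: cvg_cst.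
  apply: filterS (hball_nbhs wu s0) => w' [w'u w's].
  have [->|ps] := eqVneq (Psi w') 0; first by rewrite mulr0.
  have sat := supPsi w'u ps.
  exfalso; apply: (sat_disjoint off1 w'u _ sat).
  exists h => //; apply: sub; split; first exact: upper_mobius.
  by rewrite ze upt_mobius.
apply: (@continuousM R).
  by apply: (@smooth_on_continuous _ _ _ _ [::] w (@green_smooth _ _ _ hG _ hgr z)).
by have [_ sP _] := sPsi; apply: (@smooth_on_continuous _ _ _ _ [::] w sP).
Qed.

Lemma green_psi_invariant z : hball z0 r z -> Defs.invariant Gamma (fun w => gr z w * Psi w).
Proof.
move=> zB g w Gg wu; have [iP _ _] := sPsi; rewrite iP//.
have [->|ps] := eqVneq (Psi w) 0; first by rewrite !mulr0.
congr (_ * _).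
have sat := supPsi wu ps.
have [inv _ _ _ _] := hgr.
have o : offdiag Gamma (z, w).
  split => //; first by case: zB.
  move=> /= so; apply: (sat_disjoint off1 wu _ sat).
  by have [h Gh ze] := so; exists h => //; rewrite -ze.
by have [_ ->] := inv g z w Gg o.
Qed.

(* Unfolding onto the ball about [w0], where integration by parts applies. *)
Lemma green_psi_integral z : upper z -> f z != 0 -> exists2 z', hball z0 r z' &
  (\int[hm]_(w in (F : set T2)) (gr z w * Psi w)%:E =
   \int[hm]_(w in (hball w0 r : set T2)) (Th 0 (1 + r - upt w w0) * hlaplacian (gr z') w)%:E)%E.
Proof.
move=> zu fz.
have [g Gg gz] := supf zu fz.
have dg := fuchsian_det fG Gg.
exists (mobius g z) => //; set z' := mobius g z in gz *.
have mV : measurable (hball w0 r : set T2) by apply: open_measurable2; exact: open_hball.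
transitivity (\int[hm]_(w in (F : set T2)) (gr z' w * Psi w)%:E)%E.
  apply: eq_integral => w /set_mem /Fu wu.
  have [->|ps] := eqVneq (Psi w) 0; first by rewrite !mulr0.
  have sat := supPsi wu ps.
  have [inv _ _ _ _] := hgr.
  have o : offdiag Gamma (z, w).
    split => // /= so; apply: (sat_disjoint off1 wu _ sat).
    have [h Gh ze] := so; exists (g *m h); first exact: fuchsian_mul.
    by rewrite mobiusM ?(fuchsian_det fG)// -ze.
  by have [-> _] := inv g z w Gg o.
rewrite (@unfolding_signed _ _ _ hG (hball w0 r))//; first last.
- move=> w wu; rewrite mulf_eq0 negb_or => /andP[_].
  exact: supPsi.
- exact: green_psi_invariant.
- by apply: continuous_upper_measurable => w wu; exact: green_psi_continuous.
- by move=> w [].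
have C : C2 (hball w0 (10 * r)) (gr z').
  move=> w wB; apply: (smooth_on_C2 (@green_smooth _ _ _ hG _ hgr z')).
  by apply: off => //; exact: Br.
rewrite -(bump_green w0u r01 C); apply: eq_integral => w /set_mem wB.
by rewrite mulrC PsiE.
Qed.

Variables (sg eta : R).
Hypothesis eta0 : 0 < eta.
Hypothesis sign : forall z w, hball z0 r z -> hball w0 r w ->
  eta <= sg * (hlaplacian (gr z) w + (qvol Gamma F)^-1).

(** Symmetry of the Laplacian and of G gives, for bumps f and Phi with disjoint supports, that the
    pairing of f with G(Delta Phi) equals that of f - mean(f) with Phi, which is - vol^-1 times the
    product of their integrals. The kernel, on the other hand, evaluates G(Delta Phi) on the support
    of f as the integral of Phi Delta_w gr. So Delta_w gr + 1/vol averages to 0 against f and Phi,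
    against the assumed sign. *)
Lemma green_equation_contra : False.
Proof.
have [iPhi _ [MPhi bPhi]] := sPhi; have [iPsi _ [MPsi bPsi]] := sPsi.
have [inf _ [Mf bf]] := sf.
have mPhi := smooth_bounded_measurable sPhi; have mPsi := smooth_bounded_measurable sPsi.
have mf := smooth_bounded_measurable sf.
have LPhi := smooth_bounded_L2 hG sPhi; have LPsi := smooth_bounded_L2 hG sPsi.
have Lf := smooth_bounded_L2 hG sf.
have [_ _ _ _ [T [G [isT [isG Geq] grK]]]] := hgr.
have [TL TD TA] := isT; have [GL _ _ _ Gsa] := isG.
set n := (ncenter Gamma)%:R : R; have n0 : 0 < n := ncenter_gt0.
have nI : 0 < n^-1 by rewrite invr_gt0.
have hlE z : upper z -> hlaplacian Phi z = Psi z by move=> zu; exact: hlaplacian_per.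
have Lhl : in_L2 Gamma F (hlaplacian Phi).
  have [i1 i2 i3] := LPsi; split.
  - by move=> g z Gg zu; rewrite !hlE// ?i1//; apply: upper_mobius => //; exact: fuchsian_det Gg.
  - by apply: eq_measurable_fun i2 => z /set_mem zu; rewrite hlE.
  - apply: le_lt_trans i3; rewrite le_eqVlt; apply/orP; left; apply/eqP.
    by apply: eq_integral => z /set_mem /Fu zu; rewrite hlE.
have TPhi : T Phi (hlaplacian Phi) by exact: TD.
have [TGf _] := Geq f sf.
have [LGf Lfm] := TL _ _ TGf.
have e1 := (TA _ _ LGf Lfm).1 TGf _ _ TPhi.
have e2 : ip Gamma F (G f) (hlaplacian Phi) = ip Gamma F (G f) Psi.
  by rewrite /ip /qint; congr (_ * _); apply: eq_Rintegral => z /set_mem /Fu zu; rewrite hlE.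
have e3 := Gsa _ _ Lf LPsi.
pose J := \int[hm]_(z in (F : set T2)) f z.
pose JP := \int[hm]_(z in (F : set T2)) Phi z.
have iPhiF : hm.-integrable (F : set T2) (EFin \o Phi) by exact: (bounded_integrable hG mPhi bPhi).
have ifF : hm.-integrable (F : set T2) (EFin \o f) by exact: (bounded_integrable hG mf bf).
have fPhi z : upper z -> f z * Phi z = 0.
  move=> zu; apply/eqP; rewrite mulf_eq0; apply: contraT; rewrite negb_or => /andP[h1 h2].
  exfalso; apply: (sat_disjoint off1 zu).
    exact: supf.
  exact: supPhi.
(* The integral of Phi over the quotient divided by the volume: the value of - G(Delta Phi) on
   average over f, as [e4] states. *)
pose c0 := (qvol Gamma F)^-1 * (n^-1 * JP).
have e4 : \int[hm]_(z in (F : set T2)) (f z * G Psi z) = - c0 * J.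
  have : n^-1 * \int[hm]_(z in (F : set T2)) (f z * G Psi z) = n^-1 * (- c0 * J).
    rewrite -[LHS]/(ip Gamma F f (G Psi)) -e3 -e2 e1 /ip /qint -/n.
    transitivity (n^-1 * \int[hm]_(z in (F : set T2)) ((- ((qvol Gamma F)^-1 * (n^-1 * J))) * Phi z)).
      congr (_ * _); apply: eq_Rintegral => z /set_mem /Fu zu.
      by rewrite mulrBl fPhi// sub0r mulNr.
    by rewrite RintegralZl// -/JP /c0; ring.
  by apply: mulfI; rewrite gt_eqF.
have kPsi := grK _ sPsi.
(* The uniform lower bound that the assumed defect eta produces for sg (G(Delta Phi) + c0) wherever
   f is nonzero, see [low]. *)
pose kap := n^-1 * (eta * \int[hm]_(w in (hball w0 r : set T2)) Th 0 (1 + r - upt w w0)).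
have mV : measurable (hball w0 r : set T2) by apply: open_measurable2; exact: open_hball.
have Vu : hball w0 r `<=` upper by move=> w [].
have JPE : JP = \int[hm]_(w in (hball w0 r : set T2)) Th 0 (1 + r - upt w w0).
  rewrite /JP /Rintegral; congr fine.
  rewrite (@unfolding_signed _ _ _ hG (hball w0 r))//.
    by apply: eq_integral => w /set_mem wB; rewrite PhiE.
have Vfin := inj_mod_fin mV Vu iw.
have bnd (k : R * R -> R) : (forall w, hball w0 (10 * r) w -> {for w, continuous k}) ->
    hm.-integrable (hball w0 r : set T2) (EFin \o k).
  move=> ck; have [s s0 [VW WB _]] := square_between w0u r01.
  set W := rect _ _ _ _ in VW WB.
  apply: measurable_bounded_integrable => //.
    by apply: pointwise_continuous_measurable => // w /Br; exact: ck.
  have : compact (k @` W).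
    apply: continuous_compact.
      by apply: continuous_in_subspaceT => z; rewrite inE => /WB; exact: ck.
    by apply: compact_setX; exact: segment_compact.
  move=> /compact_bounded [M [Mr hM]]; exists M; split => // x Mx z zV.
  by apply: hM => //; exists z => //; exact: VW.
pose th w := Th 0 (1 + r - upt w w0).
have cth w : upper w -> {for w, continuous th}.
  move=> wu; have gr1 := grad_comp (is_derive_Th 0 (1 + r - upt w w0))
      (grad_add (grad_cst (1 + r) w) (grad_opp (grad_upt w0u wu))).
  exact: grad_continuous gr1.
have ith : hm.-integrable (hball w0 r : set T2) (EFin \o th) by apply: bnd => w [wu _]; exact: cth.
have th0 w : hball w0 r w -> 0 < th w by move=> [wu wr]; rewrite /th Th_gt0// subr_gt0.
have kap0 : 0 < kap.
  apply: mulr_gt0 => //; apply: mulr_gt0 => //; apply: Rintegral_gt0 => //.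
  exact: hball_gt0.
have low z : upper z -> f z != 0 ->
    kap <= sg * (qint Gamma F (fun w => gr z w * Psi w) + c0).
  move=> zu fz; have [z' z'B e] := green_psi_integral zu fz.
  have z'u : upper z' by case: z'B.
  rewrite /qint /Rintegral e -/(Rintegral _ _ _) -/n /c0 JPE.
  have chl w : hball w0 (10 * r) w -> {for w, continuous (hlaplacian (gr z'))}.
    move=> wB; have c := green_hlaplacian_continuous hG hgr (off (Br z'B) wB).
    by move=> A nA; have := near_slice (c _ nA).
  have ihl : hm.-integrable (hball w0 r : set T2) (EFin \o (fun w => th w * hlaplacian (gr z') w)).
    by apply: bnd => w wB; apply: (@continuousM R); [apply: cth; case: wB|exact: chl].
  have ehl : sg * (n^-1 * \int[hm]_(w in (hball w0 r : set T2)) (th w * hlaplacian (gr z') w)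
      + (qvol Gamma F)^-1 * (n^-1 * \int[hm]_(w in (hball w0 r : set T2)) th w)) =
      n^-1 * \int[hm]_(w in (hball w0 r : set T2))
        (sg * (th w * hlaplacian (gr z') w) + sg * (qvol Gamma F)^-1 * th w).
    rewrite RintegralD//; last 2 first.
    - exact: (integrableZl mV _ ihl).
    - exact: (integrableZl mV _ ith).
    by rewrite !RintegralZl//; ring.
  rewrite ehl /kap ler_pM2l// -RintegralZl//; apply: le_Rintegral => //.
  - exact: (integrableZl mV _ ith).
  - exact: (integrableD mV (integrableZl mV _ ihl) (integrableZl mV _ ith)).
  - move=> w wB; have := sign z'B wB; have := th0 w wB => t0 h.
    have : th w * eta <= th w * (sg * (hlaplacian (gr z') w + (qvol Gamma F)^-1)) by rewrite ler_pM2l.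
    by rewrite -/(th w); lra.
have f0 z : upper z -> 0 <= f z.
  move=> zu; have [->//|fz] := eqVneq (f z) 0.
  have [g Gg gz] := supf zu fz.
  by rewrite -(inf g z Gg zu) fE// Th_ge0.
(* Nonnegative almost everywhere by [low] and the kernel identity, while by [e4] its integral is -
   kap J with J >= 0; hence J = 0. *)
pose k z := sg * (f z * G Psi z) + (sg * c0 - kap) * f z.
have ifG : hm.-integrable (F : set T2) (EFin \o (fun z => f z * G Psi z)).
  exact: (L2_bounded_integrable hG (GL _ LPsi) mf bf).
have ik1 := integrableZl mF sg ifG; have ik2 := integrableZl mF (sg * c0 - kap) ifF.
have ik : hm.-integrable (F : set T2) (EFin \o k) by exact: (integrableD mF ik1 ik2).
have kE : \int[hm]_(z in (F : set T2)) k z = - kap * J.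
  by rewrite RintegralD// !RintegralZl// e4 -/J; ring.
have aeK : ae_eq hm (F : set T2) (EFin \o k) (fun z => `|(EFin \o k) z|)%E.
  apply: filterS kPsi => z /= hz Fz; have zu := Fu Fz; congr EFin; rewrite ger0_norm// /k.
  have [->|fz] := eqVneq (f z) 0; first by rewrite mul0r !mulr0 addr0.
  have := low z zu fz; rewrite -hz// => h.
  have : f z * kap <= f z * (sg * (G Psi z + c0)) by rewrite ler_wpM2l// f0.
  by lra.
have kge : 0 <= - kap * J.
  have mk := measurable_int _ ik.
  have mak : measurable_fun (F : set T2) (fun z => `|(EFin \o k) z|)%E by exact: measurableT_comp.
  rewrite -kE /Rintegral (ae_eq_integral _ _ mF mk mak aeK).
  by apply: fine_ge0; apply: integral_ge0 => z _; exact: abse_ge0.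
have J0 : J = 0.
  apply/eqP; rewrite eq_le; apply/andP; split.
    by rewrite -(ler_pM2l kap0) mulr0; lra.
  by apply: Rintegral_ge0 => z /Fu; exact: f0.
(* So f vanishes almost everywhere on F. It is positive on the ball about z0, whose points are
   equivalent to points of F in this null set; but balls have positive measure. *)
have [mN N0] := Rintegral0_null mF ifF (fun z Fz => f0 z (Fu Fz)) J0.
have : hm (hball z0 r : set T2) = 0%E.
  apply: null_saturation mN N0 _ _ _.
  - move=> z zB; have zu : upper z by case: zB.
    have [_ [_ _ rep] _] := hG; have [w [[Fw [g Gg we]] _]] := rep z zu.
    exists g => //; rewrite -we; split => //=; rewrite we inf// fE//.
    by rewrite gt_eqF// Th_gt0// subr_gt0; case: zB.
  - by move=> z [].
  - by apply: open_measurable2; exact: open_hball.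
by have := hball_gt0 z0u r0; move=> /[swap] ->; rewrite ltxx.
Qed.

End Localized.

(** The hypothesis [inj_mod] keeps w0 away from elliptic points, so that integrals over F unfold to
    integrals over a whole ball about w0. A nonzero defect would have a constant sign and absolute
    value above eta near (z0, w0), against [green_equation_contra]. *)
Theorem green_equation z0 w0 (rI : R) : offdiag Gamma (z0, w0) -> 0 < rI ->
  inj_mod Gamma (hball w0 rI) -> hlaplacian (gr z0) w0 = - (qvol Gamma F)^-1.
Proof.
move=> o rI0 iw; apply/eqP; rewrite -addr_eq0; apply/eqP.
have [//|c0] := eqVneq (hlaplacian (gr z0) w0 + (qvol Gamma F)^-1) 0; exfalso.
have [/= z0u w0u _] := o.
set c := hlaplacian _ _ + _ in c0.
pose sg := Num.sg c.
have sc : 0 < sg * c by rewrite -normrEsg normr_gt0.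
pose eta := sg * c / 2.
have eta0 : 0 < eta by rewrite divr_gt0.
have cont : {for (z0, w0), continuous (fun p : (R * R) * (R * R) =>
    sg * (hlaplacian (gr p.1) p.2 + (qvol Gamma F)^-1))}.
  apply: (@continuousM R); first exact: cvg_cst.
  apply: (@continuousD R R^o); last exact: cvg_cst.
  exact: (green_hlaplacian_continuous hG hgr o).
have : nbhs (z0, w0) [set p : (R * R) * (R * R) | eta < sg * (hlaplacian (gr p.1) p.2 + (qvol Gamma F)^-1)].
  apply: (cont [set y | eta < y]); apply: lt_nbhsr; rewrite /= -/c /eta.
  by rewrite ltr_pdivrMr// mulr_natr mulr2n ltrDl.
move=> [[A B] /= [nA nB] AB].
have [ra ra0 subA] := hball_sub z0u nA; have [rb rb0 subB] := hball_sub w0u nB.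
have [rz /andP[rz0 _] sepz] := separated_atP fG z0u.
have [rw /andP[rw0 _] sepw] := separated_atP fG w0u.
have [ro ro0 hro] := offdiag_near hG o.
pose r := Num.min (Num.min (Num.min ra rb) (Num.min rz rw)) (Num.min (Num.min (ro / 10) rI) 1000^-1).
have ro10' : 0 < ro / 10 by rewrite divr_gt0.
have r0 : 0 < r by rewrite !lt_min ra0 rb0 rz0 rw0 rI0 ro10' invr_gt0 ltr0n.
have [r1 r2 r3 r4] : [/\ r <= ra, r <= rb, r <= rz & r <= rw].
  by split; rewrite !ge_min lexx ?orbT.
have [r5 r6 r7] : [/\ r <= ro / 10, r <= rI & r <= 1000^-1].
  by split; rewrite !ge_min lexx ?orbT.
have mono p (a b : R) z : a <= b -> hball p a z -> hball p b z.
  by move=> ab [zu zr]; split => //; apply: lt_le_trans zr _; rewrite lerD2l.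
have ro10 : 10 * r <= ro by lra.
have r01 : 0 < r <= 1000^-1 by rewrite r0 r7.
have sepz' : separated_at Gamma z0 r by apply: sepz; rewrite r0 r3.
have sepw' : separated_at Gamma w0 r by apply: sepw; rewrite r0 r4.
have off z w : hball z0 (10 * r) z -> hball w0 (10 * r) w -> offdiag Gamma (z, w).
  by move=> hz hw; apply: hro; [exact: mono ro10 hz|exact: mono ro10 hw].
have iw' : inj_mod Gamma (hball w0 r).
  by move=> v w hv hw; apply: iw; [exact: mono r6 hv|exact: mono r6 hw].
apply: (green_equation_contra z0u w0u r01 sepz' sepw' off iw' eta0 (sg := sg)) => z w zB wB.
apply/ltW; apply: (AB (z, w)); split => /=.
  by apply: subA; exact: mono zB.
by apply: subB; exact: mono wB.
Qed.

End GreenEquation.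

(** * Harmonic functions *)

Section Laplacians.
Variable R : realType.
Implicit Types (W : set (R * R)) (f g h L : R * R -> R) (z w : R * R).

Lemma grad_near f g z (a b : R) : (\near z, f z = g z) -> grad_at f z a b -> grad_at g z a b.
Proof.
move=> fg gf; have df := grad_differentiable gf.
have dg : differentiable (g : R * R -> R^o) z by exact: near_eq_differentiable df.
apply: DiffDef => //; apply/funext => v; rewrite -deriveE//.
by rewrite -(grad_derive v gf); apply/esym/near_eq_derive.
Qed.

Lemma grad_comp2 f (u v : R * R -> R) z (A B ux uy vx vy : R) :
  grad_at f (u z, v z) A B -> grad_at u z ux uy -> grad_at v z vx vy ->
  grad_at (fun z => f (u z, v z)) z (A * ux + B * vx) (A * uy + B * vy).
Proof.
move=> gf gu gv; have guv := is_diff_pair gu gv.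
apply: (is_diff_eq (is_diff_comp guv gf)); apply/funext => x /=; ring.
Qed.

Lemma continuous_mulf f g z : {for z, continuous f} -> {for z, continuous g} ->
  {for z, continuous (fun z => f z * g z)}.
Proof. by move=> cf cg; exact: (@continuousM R). Qed.

Lemma continuous_scalef (c : R) f z : {for z, continuous f} ->
  {for z, continuous (fun z => c * f z)}.
Proof. by move=> cf; apply: continuous_mulf => //; exact: cvg_cst. Qed.

(** The Euclidean Laplacian, with the derivatives hidden. The mixed derivatives are kept continuous
    because a Moebius substitution mixes them into the pure ones, see [laplacian_on_mobius]. *)
Definition laplacian_on W f L : Prop :=
  exists fx fy fxx fxy fyx fyy, C2_on W f fx fy fxx fxy fyx fyy /\
    forall z, W z -> [/\ {for z, continuous fxy}, {for z, continuous fyx} & fxx z + fyy z = L z].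

Lemma laplacian_on_sub W W' f L : W' `<=` W -> laplacian_on W f L -> laplacian_on W' f L.
Proof.
move=> sub [fx [fy [fxx [fxy [fyx [fyy [C E]]]]]]].
by exists fx, fy, fxx, fxy, fyx, fyy; split => z /sub; [exact: C|exact: E].
Qed.

Lemma laplacian_on_ext W f g L M : open W -> (forall z, W z -> f z = g z) ->
  (forall z, W z -> L z = M z) -> laplacian_on W f L -> laplacian_on W g M.
Proof.
move=> oW fg LM [fx [fy [fxx [fxy [fyx [fyy [C E]]]]]]].
exists fx, fy, fxx, fxy, fyx, fyy; split => z Wz; last by rewrite -LM//; exact: E.
have [h1 h2 h3 h4 h5] := C z Wz; split => //.
apply: grad_near h1; apply: filterS (open_nbhs_nbhs (conj oW Wz)) => w; exact: fg.
Qed.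

Lemma laplacian_on_add W f g L M : laplacian_on W f L -> laplacian_on W g M ->
  laplacian_on W (fun z => f z + g z) (fun z => L z + M z).
Proof.
move=> [fx [fy [fxx [fxy [fyx [fyy [C E]]]]]]] [gx [gy [gxx [gxy [gyx [gyy [C' E']]]]]]].
exists (fun z => fx z + gx z), (fun z => fy z + gy z), (fun z => fxx z + gxx z),
  (fun z => fxy z + gxy z), (fun z => fyx z + gyx z), (fun z => fyy z + gyy z).
split => z Wz.
  have [h1 h2 h3 h4 h5] := C z Wz; have [k1 k2 k3 k4 k5] := C' z Wz.
  by split; do ?[exact: grad_add|exact: continuous_addf].
have [h1 h2 <-] := E z Wz; have [k1 k2 <-] := E' z Wz.
by split; [exact: continuous_addf|exact: continuous_addf|ring].
Qed.

Lemma grad_scale (c : R) f z (a b : R) : grad_at f z a b ->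
  grad_at (fun z => c * f z) z (c * a) (c * b).
Proof.
by move=> gf; apply: grad_ext (grad_mul (grad_cst c z) gf); rewrite mulr0 addr0.
Qed.

Lemma laplacian_on_scale W (c : R) f L : laplacian_on W f L ->
  laplacian_on W (fun z => c * f z) (fun z => c * L z).
Proof.
move=> [fx [fy [fxx [fxy [fyx [fyy [C E]]]]]]].
exists (fun z => c * fx z), (fun z => c * fy z), (fun z => c * fxx z),
  (fun z => c * fxy z), (fun z => c * fyx z), (fun z => c * fyy z).
split => z Wz.
  have [h1 h2 h3 h4 h5] := C z Wz.
  by split; do ?[exact: grad_scale|exact: continuous_scalef].
have [h1 h2 <-] := E z Wz.
by split; [exact: continuous_scalef|exact: continuous_scalef|ring].
Qed.

Lemma laplacian_on_cst W (c : R) : laplacian_on W (fun=> c) (fun=> 0).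
Proof.
exists (fun=> 0), (fun=> 0), (fun=> 0), (fun=> 0), (fun=> 0), (fun=> 0); split => z Wz.
  by split; do ?[exact: grad_cst|exact: cvg_cst].
by rewrite addr0; split => //; exact: cvg_cst.
Qed.

Lemma smooth_on_laplacian W f : W `<=` upper -> smooth_on W f ->
  laplacian_on W f (fun z => hlaplacian f z / z.2 ^+ 2).
Proof.
move=> Wu sf; pose D1 (f : R * R -> R) := 'D_((1, 0) : R * R) (f : R * R -> R^o).
pose D2 (f : R * R -> R) := 'D_((0, 1) : R * R) (f : R * R -> R^o).
exists (D1 f), (D2 f), (D1 (D1 f)), (D2 (D1 f)), (D1 (D2 f)), (D2 (D2 f)); split.
  by move=> z Wz; exact: (smooth_on_C2 sf).
move=> z Wz; have zu := Wu z Wz; split.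
- exact: (@smooth_on_continuous _ _ W f [:: (0, 1) : R * R; (1, 0)] z sf Wz).
- exact: (@smooth_on_continuous _ _ W f [:: (1, 0) : R * R; (0, 1)] z sf Wz).
rewrite (C2_hlaplacian W f z) mulrAC divff ?mul1r//.
by rewrite expf_neq0// gt_eqF.
Qed.

Lemma laplacian_on_continuous W f L z : laplacian_on W f L -> W z -> {for z, continuous f}.
Proof.
move=> [fx [fy [fxx [fxy [fyx [fyy [C E]]]]]]] /C[h _ _ _ _].
exact: grad_continuous h.
Qed.

Lemma laplacian_on_ln : laplacian_on upper (fun z => ln z.2) (fun z => - z.2 ^- 2).
Proof.
exists (fun=> 0), (fun z => z.2^-1), (fun=> 0), (fun=> 0), (fun=> 0), (fun z => -1 * (z.2^-1 * z.2^-1)).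
split => z zu; have zn : z.2 != 0 by rewrite gt_eqF.
  split; do ?[exact: grad_cst|exact: cvg_cst].
  - apply: grad_ext (grad_comp (is_derive1_ln (zu : 0 < z.2)) (grad_snd z)); first by rewrite mulr0.
    by rewrite mulr1.
  - apply: grad_ext (grad_comp (d1_inv zn (d1_id _)) (grad_snd z)); first by rewrite mulr0.
    by case: z zn {zu} => x y /= zn0; field.
  - apply: smooth_expr_continuous => //; apply: Smooth_mul; first exact: Smooth_cst.
    by apply: Smooth_mul; exact: Smooth_inv.
by rewrite add0r mulN1r expr2 invfM; split => //; exact: cvg_cst.
Qed.

Section MobiusComposition.
Variable g : 'M[R]_2.
Hypothesis dg : \det g = 1.
Local Notation c := (g 1 0).
Local Notation d := (g 1 1).
Let N z := (c * z.1 + d) * (c * z.1 + d) + (c * z.2) * (c * z.2).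
(** The complex derivatives of the Moebius map: g'(z) = (cz + d)^-2 = p - i q and g''(z) = -2c (cz +
    d)^-3 = P - i Q. *)
Let p z := ((c * z.1 + d) * (c * z.1 + d) - (c * z.2) * (c * z.2)) * ((N z)^-1 * (N z)^-1).
Let q z := (2 * c * (c * z.1 + d) * z.2) * ((N z)^-1 * (N z)^-1).
Let U z := c * z.1 + d.
Let V z := c * z.2.
Let P z := (- 2 * c) * ((U z * (U z * U z) + - 3 * (U z * (V z * V z))) * ((N z)^-1 * ((N z)^-1 * (N z)^-1))).
Let Q z := (- 2 * c) * ((3 * (U z * (U z * V z)) + -1 * (V z * (V z * V z))) * ((N z)^-1 * ((N z)^-1 * (N z)^-1))).

Let NE z : N z = mden g z. Proof. by rewrite /N /mden !expr2. Qed.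

Let gU z : grad_at (fun z => c * z.1 + d) z c 0.
Proof.
apply: grad_ext (grad_add (grad_scale c (grad_fst z)) (grad_cst d z)); first by rewrite mulr1 addr0.
by rewrite mulr0 addr0.
Qed.

Let gV z : grad_at (fun z => c * z.2) z 0 c.
Proof. by apply: grad_ext (grad_scale c (grad_snd z)); rewrite ?mulr0 ?mulr1. Qed.

Let gN z : grad_at N z (2 * c * (c * z.1 + d)) (2 * c * (c * z.2)).
Proof.
by apply: grad_ext (grad_add (grad_mul (gU z) (gU z)) (grad_mul (gV z) (gV z))); ring.
Qed.

Let gNV z : upper z -> grad_at (fun z => (N z)^-1) z
  (- 2 * c * (c * z.1 + d) / (N z) ^+ 2) (- 2 * c * (c * z.2) / (N z) ^+ 2).
Proof.
move=> zu; have N0 : N z != 0 by rewrite NE gt_eqF// mden_gt0.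
have h := d1_inv (f := fun t : R => t) N0 (d1_id (N z)).
apply: grad_ext (grad_comp h (gN z)); move: N0; rewrite /N; clear h.
  by case: z zu => x y /= _ N0; field.
by case: z zu => x y /= _ N0; field.
Qed.

Lemma mobius_im_grad z : upper z -> grad_at (fun z => z.2 * (N z)^-1) z (- q z) (p z).
Proof.
move=> zu; have N0 : N z != 0 by rewrite NE gt_eqF// mden_gt0.
apply: grad_ext (grad_mul (grad_snd z) (gNV zu)); move: N0; rewrite /p /q /N.
  by case: z zu => x y /= _ N0; field.
by case: z zu => x y /= _ N0; field.
Qed.

Lemma mobius_re_grad z : upper z ->
  grad_at (fun z => ((g 0 0 * z.1 + g 0 1) * (c * z.1 + d) + g 0 0 * c * (z.2 * z.2)) * (N z)^-1) z (p z) (q z).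
Proof.
move=> zu; have N0 : N z != 0 by rewrite NE gt_eqF// mden_gt0.
have ga : grad_at (fun z => g 0 0 * z.1 + g 0 1) z (g 0 0) 0.
  apply: grad_ext (grad_add (grad_scale (g 0 0) (grad_fst z)) (grad_cst (g 0 1) z)).
    by rewrite mulr1 addr0.
  by rewrite mulr0 addr0.
have h := grad_mul (grad_add (grad_mul ga (gU z))
   (grad_scale (g 0 0 * c) (grad_mul (grad_snd z) (grad_snd z)))) (gNV zu).
have := dg; rewrite det2 => d1.
apply: grad_ext h.
  transitivity ((g 0 0 * d - g 0 1 * c) * p z); last by rewrite d1 mul1r.
  by rewrite /p /N; move: N0; rewrite /N; clear zu ga; case: z => x y /= N0; field.
transitivity ((g 0 0 * d - g 0 1 * c) * q z); last by rewrite d1 mul1r.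
by rewrite /q /N; move: N0; rewrite /N; clear zu ga; case: z => x y /= N0; field.
Qed.

Lemma mobius_p_grad z : upper z -> grad_at p z (P z) (Q z).
Proof.
move=> zu; have N0 : N z != 0 by rewrite NE gt_eqF// mden_gt0.
have h := grad_mul (grad_add (grad_mul (gU z) (gU z)) (grad_opp (grad_mul (gV z) (gV z))))
  (grad_mul (gNV zu) (gNV zu)).
apply: grad_ext h; move: N0; rewrite /P /Q /U /V /N; clear zu.
  by case: z => x y /= N0; field.
by case: z => x y /= N0; field.
Qed.

Lemma mobius_q_grad z : upper z -> grad_at q z (Q z) (- P z).
Proof.
move=> zu; have N0 : N z != 0 by rewrite NE gt_eqF// mden_gt0.
have h := grad_mul (grad_mul (grad_scale (2 * c) (gU z)) (grad_snd z)) (grad_mul (gNV zu) (gNV zu)).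
apply: grad_ext h; move: N0; rewrite /P /Q /U /V /N; clear zu.
  by case: z => x y /= N0; field.
by case: z => x y /= N0; field.
Qed.

Let m1 z := ((g 0 0 * z.1 + g 0 1) * (c * z.1 + d) + g 0 0 * c * (z.2 * z.2)) * (N z)^-1.
Let m2 z := z.2 * (N z)^-1.

Let mE z : upper z -> mobius g z = (m1 z, m2 z).
Proof. by move=> zu; rewrite mobiusE// /m1 /m2 NE !expr2. Qed.

Lemma mobius_continuous z : upper z -> {for z, continuous (mobius g)}.
Proof.
move=> zu; rewrite /prop_for /continuous_at mE//.
apply: (@cvg_trans _ ((fun z => (m1 z, m2 z)) @ z)).
  by apply: near_eq_cvg; apply: filterS (near_upper zu) => w wu; rewrite mE.
exact: (cvg_pair (grad_continuous (mobius_re_grad zu)) (grad_continuous (mobius_im_grad zu))).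
Qed.

Lemma open_mobius_preimage W : open W -> open (upper `&` mobius g @^-1` W).
Proof.
move=> oW; rewrite openE => z [zu Wz]; apply: filterI; first exact: near_upper.
by apply: (mobius_continuous zu); exact: open_nbhs_nbhs.
Qed.

Let grad_mobius f z (A B : R) : upper z -> grad_at f (mobius g z) A B ->
  grad_at (fun z => f (mobius g z)) z (A * p z + B * - q z) (A * q z + B * p z).
Proof.
move=> zu; rewrite mE// => gf.
apply: (@grad_near (fun z => f (m1 z, m2 z))).
  by apply: filterS (near_upper zu) => w wu; rewrite mE.
exact: grad_comp2 gf (mobius_re_grad zu) (mobius_im_grad zu).
Qed.

(* The Cauchy-Riemann equations make the mixed derivatives cancel. *)
Lemma laplacian_on_mobius W f L : laplacian_on W f L ->
  laplacian_on (upper `&` mobius g @^-1` W) (fun z => f (mobius g z))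
    (fun z => L (mobius g z) / mden g z ^+ 2).
Proof.
move=> [fx [fy [fxx [fxy [fyx [fyy [C E]]]]]]].
pose X z := fx (mobius g z); pose Y z := fy (mobius g z).
pose Xx z := fxx (mobius g z) * p z + fxy (mobius g z) * - q z.
pose Xy z := fxx (mobius g z) * q z + fxy (mobius g z) * p z.
pose Yx z := fyx (mobius g z) * p z + fyy (mobius g z) * - q z.
pose Yy z := fyx (mobius g z) * q z + fyy (mobius g z) * p z.
exists (fun z => X z * p z + Y z * - q z), (fun z => X z * q z + Y z * p z).
exists (fun z => X z * P z + p z * Xx z + (Y z * - Q z + - q z * Yx z)),
  (fun z => X z * Q z + p z * Xy z + (Y z * - - P z + - q z * Yy z)),
  (fun z => X z * Q z + q z * Xx z + (Y z * P z + p z * Yx z)),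
  (fun z => X z * - P z + q z * Xy z + (Y z * Q z + p z * Yy z)).
have cNV z : upper z -> {for z, continuous (fun z => (N z)^-1)} by move=> zu; exact: grad_continuous (gNV zu).
have cU z : {for z, continuous U} by exact: grad_continuous (gU z).
have cV z : {for z, continuous V} by exact: grad_continuous (gV z).
have cN3 z : upper z -> {for z, continuous (fun z => (N z)^-1 * ((N z)^-1 * (N z)^-1))}.
  by move=> zu; apply: continuous_mulf (cNV _ zu) _; exact: continuous_mulf (cNV _ zu) (cNV _ zu).
have cP z : upper z -> {for z, continuous P}.
  move=> zu; apply: continuous_scalef; apply: continuous_mulf (cN3 _ zu); apply: continuous_addf.
    by apply: continuous_mulf (cU z) _; exact: continuous_mulf (cU z) (cU z).
  by apply: continuous_scalef; apply: continuous_mulf (cU z) _; exact: continuous_mulf (cV z) (cV z).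
have cQ z : upper z -> {for z, continuous Q}.
  move=> zu; apply: continuous_scalef; apply: continuous_mulf (cN3 _ zu); apply: continuous_addf.
    by apply: continuous_scalef; apply: continuous_mulf (cU z) _; exact: continuous_mulf (cU z) (cV z).
  by apply: continuous_scalef; apply: continuous_mulf (cV z) _; exact: continuous_mulf (cV z) (cV z).
have cp z : upper z -> {for z, continuous p} by move=> zu; exact: grad_continuous (mobius_p_grad zu).
have cq z : upper z -> {for z, continuous q} by move=> zu; exact: grad_continuous (mobius_q_grad zu).
have cq' z : upper z -> {for z, continuous (fun z => - q z)}.
  by move=> zu; exact: grad_continuous (grad_opp (mobius_q_grad zu)).
have cop (k : R * R -> R) z : {for z, continuous k} -> {for z, continuous (fun z => - k z)}.
  by move=> ck; exact: (@continuousN _ R^o).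
have cc (k : R * R -> R) z : upper z -> {for mobius g z, continuous k} -> {for z, continuous (fun z => k (mobius g z))}.
  by move=> zu ck; apply: continuous_comp; [exact: mobius_continuous|exact: ck].
have four z (k1 k2 k3 k4 k5 k6 k7 k8 : R * R -> R) :
    {for z, continuous k1} -> {for z, continuous k2} -> {for z, continuous k3} -> {for z, continuous k4} ->
    {for z, continuous k5} -> {for z, continuous k6} -> {for z, continuous k7} -> {for z, continuous k8} ->
    {for z, continuous (fun z => k1 z * k2 z + k3 z * k4 z + (k5 z * k6 z + k7 z * k8 z))}.
  move=> *; apply: continuous_addf; apply: continuous_addf; exact: continuous_mulf.
have two z (k1 k2 k3 k4 : R * R -> R) :
    {for z, continuous k1} -> {for z, continuous k2} -> {for z, continuous k3} -> {for z, continuous k4} ->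
    {for z, continuous (fun z => k1 z * k2 z + k3 z * k4 z)}.
  move=> *; apply: continuous_addf; exact: continuous_mulf.
split => z [zu Wz]; last first.
  have [h1 h2 h3] := E _ Wz; have [h4 h5 h6 h7 h8] := C _ Wz.
  have cX := cc _ _ zu (grad_continuous h5); have cY := cc _ _ zu (grad_continuous h6).
  have c1 := cc _ _ zu h1; have c2 := cc _ _ zu h2; have c3 := cc _ _ zu h7; have c4 := cc _ _ zu h8.
  split.
  - exact: (four _ _ _ _ _ _ _ _ _ cX (cQ _ zu) (cp _ zu) (two _ _ _ _ _ c3 (cq _ zu) c1 (cp _ zu)) cY (cop _ _ (cop _ _ (cP _ zu))) (cq' _ zu) (two _ _ _ _ _ c2 (cq _ zu) c4 (cp _ zu))).
  - exact: (four _ _ _ _ _ _ _ _ _ cX (cQ _ zu) (cq _ zu) (two _ _ _ _ _ c3 (cp _ zu) c1 (cq' _ zu)) cY (cP _ zu) (cp _ zu) (two _ _ _ _ _ c2 (cp _ zu) c4 (cq' _ zu))).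
  have N0 : N z != 0 by rewrite NE gt_eqF// mden_gt0.
  rewrite -h3.
  transitivity ((fxx (mobius g z) + fyy (mobius g z)) * (p z ^+ 2 + q z ^+ 2)).
    by rewrite /Xx /Xy /Yx /Yy; ring.
  congr (_ * _); rewrite -NE; move: N0; rewrite /p /q /N.
  by case: z zu {Wz h1 h2 h3 h4 h5 h6 h7 h8 cX cY c1 c2 c3 c4} => x y /= _ N0; field.
have [h1 h2 h3 h4 h5] := C _ Wz; have [h6 h7 _] := E _ Wz.
have cX := cc _ _ zu (grad_continuous h2); have cY := cc _ _ zu (grad_continuous h3).
have c1 := cc _ _ zu h4; have c2 := cc _ _ zu h5; have c3 := cc _ _ zu h6; have c4 := cc _ _ zu h7.
have gX := grad_mobius zu h2; have gY := grad_mobius zu h3.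
have gp := mobius_p_grad zu; have gq := mobius_q_grad zu.
split.
- exact: grad_mobius h1.
- exact: grad_add (grad_mul gX gp) (grad_mul gY (grad_opp gq)).
- exact: grad_add (grad_mul gX gq) (grad_mul gY gp).
- exact: (four _ _ _ _ _ _ _ _ _ cX (cP _ zu) (cp _ zu) (two _ _ _ _ _ c1 (cp _ zu) c3 (cq' _ zu)) cY (cop _ _ (cQ _ zu)) (cq' _ zu) (two _ _ _ _ _ c4 (cp _ zu) c2 (cq' _ zu))).
- exact: (four _ _ _ _ _ _ _ _ _ cX (cop _ _ (cP _ zu)) (cq _ zu) (two _ _ _ _ _ c1 (cq _ zu) c3 (cp _ zu)) cY (cQ _ zu) (cp _ zu) (two _ _ _ _ _ c4 (cq _ zu) c2 (cp _ zu))).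
Qed.

End MobiusComposition.

(** * The harmonic function log |q(z) - q(w)| *)

Section CuspCoordinate.
Variables (a u v : R).
Let A z : R := expR (- a * z.2).
Let B : R := expR (- a * v).
Let C z : R := cos (a * (z.1 + - u)).
Let S z : R := sin (a * (z.1 + - u)).

(* For [a = 2 * pi] this is |q(z) - q(u + iv)|^2, where q(z) = exp(2 i pi z). *)
Definition qdist z : R := A z * A z + B * B + (- 2 * B) * (A z * C z).

Let gA z : grad_at A z 0 (- a * A z).
Proof.
apply: grad_ext (grad_comp (is_derive_expR _) (grad_scale (- a) (grad_snd z))); rewrite -/(A z); ring.
Qed.

Let gl z : grad_at (fun z => a * (z.1 + - u)) z a 0.
Proof.
by apply: grad_ext (grad_scale a (grad_add (grad_fst z) (grad_cst (- u) z))); rewrite addr0 ?mulr1 ?mulr0.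
Qed.

Let gC z : grad_at C z (- a * S z) 0.
Proof. by apply: grad_ext (grad_comp (is_derive_cos _) (gl z)); rewrite -/(S z); ring. Qed.

Let gS z : grad_at S z (a * C z) 0.
Proof. by apply: grad_ext (grad_comp (is_derive_sin _) (gl z)); rewrite -/(C z); ring. Qed.

Let gqd z : grad_at qdist z (2 * a * B * (A z * S z)) (- 2 * a * (A z * A z) + 2 * a * B * (A z * C z)).
Proof.
apply: grad_ext (grad_add (grad_add (grad_mul (gA z) (gA z)) (grad_cst (B * B) z))
  (grad_scale (- 2 * B) (grad_mul (gA z) (gC z)))); ring.
Qed.

Lemma qdist_continuous z : {for z, continuous qdist}.
Proof. exact: grad_continuous (gqd z). Qed.

Lemma laplacian_on_ln_qdist : laplacian_on [set z | 0 < qdist z] (fun z => ln (qdist z)) (fun=> 0).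
Proof.
pose px z := 2 * a * B * (A z * S z).
pose py z := - 2 * a * (A z * A z) + 2 * a * B * (A z * C z).
pose pxx z := 2 * a ^+ 2 * B * (A z * C z).
pose pxy z := - 2 * a ^+ 2 * B * (A z * S z).
pose pyy z := 4 * a ^+ 2 * (A z * A z) + - 2 * a ^+ 2 * B * (A z * C z).
have gpx z : grad_at px z (pxx z) (pxy z).
  by apply: grad_ext (grad_scale (2 * a * B) (grad_mul (gA z) (gS z))); rewrite /pxx /pxy; ring.
have gpy z : grad_at py z (pxy z) (pyy z).
  by apply: grad_ext (grad_add (grad_scale (- 2 * a) (grad_mul (gA z) (gA z)))
    (grad_scale (2 * a * B) (grad_mul (gA z) (gC z)))); rewrite /pyy /pxy; ring.
have gV z : 0 < qdist z -> grad_at (fun z => (qdist z)^-1) z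
    (- px z * ((qdist z)^-1 * (qdist z)^-1)) (- py z * ((qdist z)^-1 * (qdist z)^-1)).
  move=> q0; have qn : qdist z != 0 by rewrite gt_eqF.
  have h := d1_inv (f := fun t : R => t) qn (d1_id (qdist z)).
  apply: grad_ext (grad_comp h (gqd z)); rewrite mulr1 expr2 invfM /px /py; ring.
have cA z := grad_continuous (gA z); have cC z := grad_continuous (gC z); have cS z := grad_continuous (gS z).
have cV z q0 := grad_continuous (gV z q0).
have cpx z := grad_continuous (gpx z); have cpy z := grad_continuous (gpy z).
have cAC z : {for z, continuous (fun z => A z * C z)} by exact: continuous_mulf.
have cAA z : {for z, continuous (fun z => A z * A z)} by exact: continuous_mulf.
have cAS z : {for z, continuous (fun z => A z * S z)} by exact: continuous_mulf.
have cpxx z : {for z, continuous pxx} by exact: continuous_scalef.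
have cpxy z : {for z, continuous pxy} by exact: continuous_scalef.
have cpyy z : {for z, continuous pyy} by apply: continuous_addf; exact: continuous_scalef.
have cVV z : 0 < qdist z -> {for z, continuous (fun z => (qdist z)^-1 * (qdist z)^-1)}.
  by move=> q0; apply: continuous_mulf; exact: cV.
have cop (k : R * R -> R) z : {for z, continuous k} -> {for z, continuous (fun z => - k z)}.
  by move=> ck; exact: (@continuousN _ R^o).
pose V z := (qdist z)^-1.
have second z (k l m : R * R -> R) : 0 < qdist z -> {for z, continuous k} -> {for z, continuous l} ->
    {for z, continuous m} -> {for z, continuous (fun z => k z * (- l z * (V z * V z)) + V z * m z)}.
  move=> q0 ck cl cm; apply: continuous_addf.
    by apply: continuous_mulf => //; apply: continuous_mulf; [exact: cop|exact: cVV].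
  by apply: continuous_mulf => //; exact: cV.
exists (fun z => px z * V z), (fun z => py z * V z),
  (fun z => px z * (- px z * (V z * V z)) + V z * pxx z),
  (fun z => px z * (- py z * (V z * V z)) + V z * pxy z),
  (fun z => py z * (- px z * (V z * V z)) + V z * pxy z),
  (fun z => py z * (- py z * (V z * V z)) + V z * pyy z).
split => z /= q0.
  split; do ?[exact: grad_mul (gpx z) (gV z q0)|exact: grad_mul (gpy z) (gV z q0)|exact: second].
  apply: grad_ext (grad_comp (is_derive1_ln q0) (gqd z)); rewrite -/(px z) -/(py z) /V; exact: mulrC.
split; do ?exact: second.
have qn : qdist z != 0 by rewrite gt_eqF.
have cs : C z ^+ 2 + S z ^+ 2 = 1 by exact: cos2Dsin2.
(* The numerator of the Laplacian of ln qdist. It vanishes because qdist is the squared modulus of a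
   holomorphic function. *)
have key : qdist z * (pxx z + pyy z) - px z ^+ 2 - py z ^+ 2 = 0.
  have -> : py z ^+ 2 = 4 * a ^+ 2 * (A z) ^+ 2 * (A z ^+ 2 + B ^+ 2 * (C z ^+ 2) - 2 * B * (A z * C z)).
    by rewrite /py; ring.
  have -> : C z ^+ 2 = 1 - S z ^+ 2 by rewrite -cs; ring.
  by rewrite /qdist /pxx /pyy /px; ring.
transitivity ((qdist z * (pxx z + pyy z) - px z ^+ 2 - py z ^+ 2) * (V z * V z)).
  by rewrite /V; field.
by rewrite key mul0r.
Qed.

End CuspCoordinate.
End Laplacians.

(** * Periodic harmonic functions on a strip *)

Section ConvexCutoff.
Variable R : realType.
Implicit Types t : R.

(* t^3 / (1 + t)^2 on the positive half-line: a C^2 convex cutoff whose growth is only linear. *)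
Definition cutoff t : R := if 0 < t then t * (t * t) * ((1 + t)^-1 * (1 + t)^-1) else 0.
Definition cutoff1 t : R :=
  if 0 < t then t * t * (t + 3) * ((1 + t)^-1 * ((1 + t)^-1 * (1 + t)^-1)) else 0.
Definition cutoff2 t : R :=
  if 0 < t then 6 * t * ((1 + t)^-1 * ((1 + t)^-1 * ((1 + t)^-1 * (1 + t)^-1))) else 0.

Let inv1 t : 0 < t -> 0 < (1 + t)^-1 <= 1.
Proof.
move=> t0; rewrite invr_gt0 addr_gt0//= -[leRHS]invr1 lef_pV2 ?posrE ?addr_gt0//.
by rewrite lerDl ltW.
Qed.

Let d1inv t : 0 < t -> is_derive t (1 : R) (fun t => (1 + t)^-1) (- ((1 + t)^-1 * (1 + t)^-1)).
Proof.
move=> t0; have n0 : 1 + t != 0 by rewrite gt_eqF// addr_gt0.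
apply: d1_eq (d1_inv (f := fun t => 1 + t) n0 (d1_add (d1_cst 1 t) (d1_id t))) _.
by rewrite add0r mulr1 expr2 invfM.
Qed.

Lemma cutoff_ge0 t : 0 <= cutoff t.
Proof.
rewrite /cutoff; case: ifPn => // t0; have /andP[i0 _] := inv1 t0.
by rewrite !mulr_ge0// ltW.
Qed.

Lemma cutoff_gt0 t : 0 < t -> 0 < cutoff t.
Proof. by move=> t0; have /andP[i0 _] := inv1 t0; rewrite /cutoff t0 !mulr_gt0. Qed.

Lemma cutoff_le0 t : t <= 0 -> cutoff t = 0.
Proof. by rewrite /cutoff leNgt => /negbTE ->. Qed.

Lemma cutoff_le t : cutoff t <= `|t|.
Proof.
rewrite /cutoff; case: ifPn => // t0; rewrite gtr0_norm//.
have n0 : 0 < 1 + t by rewrite addr_gt0.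
rewrite -invfM ler_pdivrMr ?mulr_gt0//.
have : 0 < t * t by rewrite mulr_gt0.
nra.
Qed.

Lemma cutoff2_ge0 t : 0 <= cutoff2 t.
Proof.
rewrite /cutoff2; case: ifPn => // t0; have /andP[i0 _] := inv1 t0.
by rewrite !mulr_ge0// ltW.
Qed.

Lemma is_derive_cutoff t : is_derive t (1 : R) cutoff (cutoff1 t).
Proof.
have [t0|t0|->] := ltgtP t 0.
- rewrite /cutoff1 ltNge ltW//=.
  apply: (@near_eq_is_derive _ _ _ (cst (0 : R))).
  near=> s; rewrite /= cutoff_le0// ltW//.
  by near: s; exact: lt_nbhsl.
- apply: (@near_eq_is_derive _ _ _ (fun t => t * (t * t) * ((1 + t)^-1 * (1 + t)^-1))).
    near=> s; rewrite /cutoff ifT//; near: s; exact: lt_nbhsr.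
  have h := d1_mul (d1_mul (d1_id t) (d1_mul (d1_id t) (d1_id t))) (d1_mul (d1inv t0) (d1inv t0)).
  apply: d1_eq h _; rewrite /cutoff1 t0; field.
  by rewrite gt_eqF// addr_gt0.
- rewrite /cutoff1 ltxx; apply: (@is_derive0_sqr _ _ 1) => {}t; rewrite mul1r ger0_norm ?cutoff_ge0//.
  rewrite /cutoff; case: ifPn => t0; last exact: sqr_ge0.
  have n0 : 0 < 1 + t by rewrite addr_gt0.
  rewrite -invfM ler_pdivrMr ?mulr_gt0// expr2; have : 0 < t * t by rewrite mulr_gt0.
  nra.
Unshelve. all: by end_near. Qed.

Lemma is_derive_cutoff1 t : is_derive t (1 : R) cutoff1 (cutoff2 t).
Proof.
have [t0|t0|->] := ltgtP t 0.
- rewrite /cutoff2 ltNge ltW//=.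
  apply: (@near_eq_is_derive _ _ _ (cst (0 : R))).
  near=> s; rewrite /cutoff1 ifF// ltNge; apply/negbTE/negPn/ltW.
  by near: s; exact: lt_nbhsl.
- apply: (@near_eq_is_derive _ _ _ (fun t => t * t * (t + 3) * ((1 + t)^-1 * ((1 + t)^-1 * (1 + t)^-1)))).
    near=> s; rewrite /cutoff1 ifT//; near: s; exact: lt_nbhsr.
  have h := d1_mul (d1_mul (d1_mul (d1_id t) (d1_id t)) (d1_add (d1_id t) (d1_cst 3 t)))
    (d1_mul (d1inv t0) (d1_mul (d1inv t0) (d1inv t0))).
  apply: d1_eq h _; rewrite /cutoff2 t0; field.
  by rewrite gt_eqF// addr_gt0.
- rewrite /cutoff2 ltxx; apply: (@is_derive0_sqr _ _ 3) => {}t; rewrite /cutoff1.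
  case: ifPn => t0; last by rewrite normr0 mulr_ge0// sqr_ge0.
  have n0 : 0 < 1 + t by rewrite addr_gt0.
  have tt : 0 < t * t by rewrite mulr_gt0.
  have t3 : 0 < t + 3 by lra.
  have nn := inv1 t0; have /andP[i0 _] := nn.
  rewrite ger0_norm ?mulr_ge0 ?(ltW i0) ?(ltW tt) ?(ltW t3) ?(ltW t0)//.
  rewrite -!invfM ler_pdivrMr ?mulr_gt0// expr2.
  rewrite -subr_ge0.
  have -> : 3 * (t * t) * ((1 + t) * ((1 + t) * (1 + t))) - t * t * (t + 3) =
    (t * t) * (3 * t ^+ 3 + 9 * t ^+ 2 + 8 * t) by ring.
  have t0' := ltW t0; apply: mulr_ge0; first exact: ltW.
  by apply: addr_ge0; [apply: addr_ge0|]; apply: mulr_ge0 => //; rewrite exprn_ge0.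
Unshelve. all: by end_near. Qed.

Lemma continuous_cutoff2 t : {for t, continuous cutoff2}.
Proof.
have [t0|t0|->] := ltgtP t 0.
- apply: (@d1_continuous _ _ _ 0).
  apply: (@near_eq_is_derive _ _ _ (cst (0 : R))).
  near=> s; rewrite /cutoff2 ifF// ltNge; apply/negbTE/negPn/ltW.
  by near: s; exact: lt_nbhsl.
- pose k t : R := 6 * t * ((1 + t)^-1 * ((1 + t)^-1 * ((1 + t)^-1 * (1 + t)^-1))).
  have h := d1_mul (d1_mul (d1_cst 6 t) (d1_id t))
    (d1_mul (d1inv t0) (d1_mul (d1inv t0) (d1_mul (d1inv t0) (d1inv t0)))).
  apply: (@d1_continuous _ _ _ _).
  apply: (@near_eq_is_derive _ _ _ k) h.
  near=> s; rewrite /cutoff2 ifT//; near: s; exact: lt_nbhsr.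
- rewrite /prop_for /continuous_at {2}/cutoff2 ltxx.
  apply/cvgr0Pnorm_le => e e0; near=> s.
  rewrite ger0_norm ?cutoff2_ge0//; apply: (@le_trans _ _ (6 * `|s|)).
    rewrite /cutoff2; case: ifPn => s0; last by rewrite mulr_ge0.
    rewrite gtr0_norm// ler_piMr ?mulr_ge0 ?(ltW s0)//.
    have /andP[i0 i1] := inv1 s0.
    by rewrite !mulr_ile1// ?mulr_ge0// ltW.
  have : `|s| <= e / 6.
    near: s; apply/nbhs_ballP; exists (e / 6); first by rewrite /= divr_gt0.
    by move=> y; rewrite /ball /= sub0r normrN => /ltW.
  lra.
Unshelve. all: by end_near. Qed.

End ConvexCutoff.

(** * Harmonic functions of period 1, integrable at infinity *)

Section PeriodicHarmonic.
Variable R : realType.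
Local Notation T2 := (measurableTypeR R * measurableTypeR R)%type.
Local Notation lam := (@lebesgue_measure R).
Implicit Types (f h k : R * R -> R).

Lemma rect_fubini (a b c d : R) k : (forall z, rect a b c d z -> {for z, continuous k}) ->
  (\int[(lam \x lam)%E]_(z in (rect a b c d : set T2)) (k z)%:E =
   \int[lam]_(x in `[a, b]) \int[lam]_(y in `[c, d]) (k (x, y))%:E)%E.
Proof.
move=> ck; rewrite integral_mkcond -integral12_prod_meas1; last first.
  by apply/(integrable_mkcond _ (@measurable_rect _ a b c d)); exact: continuous_rect_integrable.
rewrite [RHS]integral_mkcond; apply: eq_integral => x _; rewrite /fubini_F patchE.
case: ifPn => [|nx]; [rewrite inE /= in_itv/= => xab|].
  rewrite [RHS]integral_mkcond; apply: eq_integral => y _.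
  rewrite !patchE; case: ifPn; case: ifPn => //; rewrite ?inE /rect /= !in_itv/= ?notin_setE /=.
    by move=> h1 [_ h2]; case: h1; rewrite in_itv.
  by move=> h1 h2; case: h2; split => //; rewrite in_itv.
apply: integral0_eq => y _; rewrite patchE; case: ifPn => //.
by rewrite inE => -[/= h _]; exfalso; move/negP: nx; apply; rewrite inE.
Qed.

Lemma open_above (y0 : R) : open [set z : R * R | y0 < z.2].
Proof.
rewrite (_ : [set z | _] = snd @^-1` [set y | y0 < y]) //.
apply: open_comp; last exact: open_gt.
by move=> z _; exact: cvg_snd.
Qed.

Lemma continuous_itv_integrable (a b : R) (k : R -> R) :
  (forall x, a <= x <= b -> {for x, continuous k}) -> lam.-integrable `[a, b] (EFin \o k).
Proof.
move=> ck; apply: continuous_compact_integrable; first exact: segment_compact.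
by apply: continuous_in_subspaceT => x; rewrite inE /= in_itv/=; exact: ck.
Qed.

(** Green's identity against a function of y alone: the two vertical sides cancel by periodicity and
    only means over horizontal segments remain. *)
Lemma periodic_green (c d : R) f fx fy fxx fxy fyx fyy (psi psi1 psi2 : R -> R) :
  c < d -> C2_on (rect 0 1 c d) f fx fy fxx fxy fyx fyy ->
  (forall y, c <= y <= d -> fx (0, y) = fx (1, y)) ->
  (forall y, c <= y <= d -> is_derive y (1 : R) psi (psi1 y)) ->
  (forall y, c <= y <= d -> is_derive y (1 : R) psi1 (psi2 y)) ->
  (forall y, c <= y <= d -> {for y, continuous psi2}) ->
  (\int[(lam \x lam)%E]_(z in (rect 0 1 c d : set T2))
     (psi z.2 * (fxx z + fyy z) - psi2 z.2 * f z)%:E =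
   (psi d * \int[lam]_(x in `[0, 1]) fy (x, d) - psi1 d * \int[lam]_(x in `[0, 1]) f (x, d)
    - (psi c * \int[lam]_(x in `[0, 1]) fy (x, c) - psi1 c * \int[lam]_(x in `[0, 1]) f (x, c)))%:E)%E.
Proof.
move=> cd Cf per dpsi dpsi1 cpsi2.
have in_rect (x y : R) : 0 <= x <= 1 -> c <= y <= d -> rect 0 1 c d (x, y).
  by move=> h1 h2; split; rewrite /= in_itv.
have rectP z : rect 0 1 c d z -> c <= z.2 <= d by move=> [_]; rewrite /= in_itv.
have csnd (p : R -> R) z : {for z.2, continuous p} -> {for z, continuous (fun z : R * R => p z.2)}.
  by move=> cp; apply: (@continuous_comp _ _ _ (fun z : R * R => z.2) p); [exact: cvg_snd|exact: cp].
pose k1 z := psi z.2 * fxx z.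
pose k2 z := psi z.2 * fyy z - psi2 z.2 * f z.
have ck1 z : rect 0 1 c d z -> {for z, continuous k1}.
  move=> zW; have [h1 h2 h3 h4 h5] := Cf z zW; have zy := rectP z zW.
  by apply: continuous_mulf => //; apply: csnd; exact: d1_continuous (dpsi _ zy).
have ck2 z : rect 0 1 c d z -> {for z, continuous k2}.
  move=> zW; have [h1 h2 h3 h4 h5] := Cf z zW; have zy := rectP z zW.
  apply: (@continuousMD _ setT) => //.
  - by apply: csnd; exact: d1_continuous (dpsi _ zy).
  - by apply: csnd; exact: cpsi2.
  - exact: grad_continuous h1.
transitivity (\int[(lam \x lam)%E]_(z in (rect 0 1 c d : set T2)) ((k1 z)%:E + (k2 z)%:E))%E.
  by apply: eq_integral => z _; rewrite -EFinD; congr EFin; rewrite /k1 /k2; ring.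
rewrite integralD//=; first last.
- exact: continuous_rect_integrable.
- exact: continuous_rect_integrable.
- exact: measurable_rect.
rewrite rect_integral_x0//; last first.
  move=> y ycd.
  have dk (x : R) : 0 <= x <= 1 -> is_derive x (1 : R) (fun x => psi y * fx (x, y)) (k1 (x, y)).
    move=> xab; have [h1 h2 _ _ _] := Cf _ (in_rect _ _ xab ycd).
    by apply: d1_eq (d1_mul (d1_cst (psi y) x) (grad_sect1 h2)) _; rewrite mulr0 addr0.
  rewrite (integral_derive ltr01 dk) => [|x xab].
    by rewrite per// -EFinB subrr.
  by apply: sect1_continuous; apply: ck1; exact: in_rect.
rewrite add0e rect_fubini//.
pose G y x := psi y * fy (x, y) - psi1 y * f (x, y).
transitivity (\int[lam]_(x in `[0%R, 1%R]) (G d x - G c x)%:E)%E.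
  apply: eq_integral => x; rewrite inE /= in_itv/= => x01.
  have dk y : c <= y <= d -> is_derive y (1 : R) (fun y => G y x) (k2 (x, y)).
    move=> ycd; have [h1 h2 h3 _ _] := Cf _ (in_rect _ _ x01 ycd).
    apply: d1_eq (d1_add (d1_mul (dpsi y ycd) (grad_sect2 h3)) (d1_opp (d1_mul (dpsi1 y ycd) (grad_sect2 h1)))) _.
    by rewrite /k2 /=; ring.
  rewrite (integral_derive cd dk) ?EFinB// => y ycd.
  by apply: sect2_continuous; apply: ck2; exact: in_rect.
have int1 y : c <= y <= d -> lam.-integrable `[0, 1] (EFin \o (fun x => fy (x, y))).
  move=> ycd; apply: continuous_itv_integrable => x x01; apply: sect1_continuous.
  by have [_ _ h _ _] := Cf _ (in_rect _ _ x01 ycd); exact: grad_continuous h.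
have int0 y : c <= y <= d -> lam.-integrable `[0, 1] (EFin \o (fun x => f (x, y))).
  move=> ycd; apply: continuous_itv_integrable => x x01; apply: sect1_continuous.
  by have [h _ _ _ _] := Cf _ (in_rect _ _ x01 ycd); exact: grad_continuous h.
have mI : measurable (`[0 : R, 1 : R]%classic : set (measurableTypeR R)) by exact: measurable_itv.
have intG y : c <= y <= d -> lam.-integrable `[0, 1] (EFin \o G y).
  move=> ycd; exact: (integrableB mI (integrableZl mI _ (int1 y ycd)) (integrableZl mI _ (int0 y ycd))).
have ed : c <= d <= d by rewrite lexx ltW.
have ec : c <= c <= d by rewrite lexx ltW.
have valG y : c <= y <= d -> \int[lam]_(x in `[0, 1]) G y x =
    psi y * \int[lam]_(x in `[0, 1]) fy (x, y) - psi1 y * \int[lam]_(x in `[0, 1]) f (x, y).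
  move=> ycd; rewrite RintegralB//; last 2 first.
  - exact: (integrableZl mI _ (int1 y ycd)).
  - exact: (integrableZl mI _ (int0 y ycd)).
  by rewrite !RintegralZl//; [exact: int0|exact: int1].
rewrite -!valG// -RintegralB//; [|exact: intG|exact: intG].
rewrite /Rintegral fineK//; apply: integrable_fin_num => //.
exact: (integrableB mI (intG d ed) (intG c ec)).
Qed.

Lemma itv_integral_gt0 (k : R -> R) (x0 : R) : 0 <= x0 <= 1 ->
  (forall x : R, 0 <= x <= 1 -> {for x, continuous k}) -> (forall x : R, 0 <= x <= 1 -> 0 <= k x) ->
  0 < k x0 -> 0 < \int[lam]_(x in `[0, 1]) k x.
Proof.
move=> /andP[x00 x01] ck k0 kx0.
have : nbhs x0 (k @^-1` [set y | k x0 / 2 < y]).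
  by apply: (ck x0); [rewrite x00 x01|apply: lt_nbhsr; rewrite /= ltr_pdivrMr// mulr_natr mulr2n ltrDl].
move=> /nbhs_ballP[e /= e0 eU].
pose a := Num.max 0 (x0 - e / 2); pose b := Num.min 1 (x0 + e / 2).
have ab : a < b.
  by rewrite /a /b gt_max !lt_min ltr01/=; apply/andP; split; [|apply/andP; split]; lra.
have ab01 (x : R) : a <= x <= b -> 0 <= x <= 1 /\ x0 - e / 2 <= x <= x0 + e / 2.
  by rewrite /a /b ge_max le_min => /andP[/andP[-> ->] /andP[-> ->]].
have mI : measurable (`[0 : R, 1 : R]%classic : set (measurableTypeR R)) by exact: measurable_itv.
have mJ : measurable (`[a, b]%classic : set (measurableTypeR R)) by exact: measurable_itv.
have ik := continuous_itv_integrable ck.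
have mk : measurable_fun (`[0 : R, 1 : R]%classic : set (measurableTypeR R)) k.
  by have /measurable_EFinP := measurable_int _ ik.
rewrite /Rintegral fine_gt0//; apply/andP; split; last first.
  by rewrite ltey_eq integrable_fin_num.
apply: (@lt_le_trans _ _ (\int[lam]_(x in `[a, b]) (k x0 / 2)%:E)%E).
  rewrite integral_cst//= lebesgue_measure_itv/= lte_fin ab -EFinB -EFinM lte_fin.
  by rewrite mulr_gt0 ?divr_gt0// subr_gt0.
have sub : `[a, b]%classic `<=` `[0%R, 1%R]%classic.
  by move=> x; rewrite /= !in_itv/= => /ab01[].
apply: (@le_trans _ _ (\int[lam]_(x in `[a, b]) (k x)%:E)%E).
  apply: ge0_le_integral => //.
  - by move=> x _; rewrite lee_fin ltW// divr_gt0.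
  - by apply/measurable_EFinP; exact: measurable_funS mk.
  - move=> x; rewrite /= in_itv/= => /ab01[_ /andP[h1 h2]]; rewrite lee_fin ltW//.
    apply: eU; rewrite /ball /= ltr_norml; apply/andP; split; lra.
by apply: ge0_subset_integral => //; exact/measurable_EFinP.
Qed.

(** Let m(y) be the mean over x of cutoff(h - B). A convex function of a harmonic function is
    subharmonic, so m is convex, and it vanishes at y1. Were it positive at some y2, it would grow
    at least linearly, and the integral of m / y^2 up to D would grow like log D, against the bound
    by I. *)
Lemma periodic_harmonic_le h (y0 y1 B I : R) :
  laplacian_on [set z | y0 < z.2] h (fun=> 0) ->
  (forall (b : int) z, y0 < z.2 -> h (z.1 + b%:~R, z.2) = h z) ->
  0 < y0 -> y0 < y1 -> (forall x, h (x, y1) <= B) ->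
  (forall D, y1 < D -> (\int[(lam \x lam)%E]_(z in (rect 0 1 y1 D : set T2))
     ((`|h z| + 1) * (z.2^-1 * z.2^-1))%:E <= I%:E)%E) ->
  forall z, y1 <= z.2 -> h z <= B.
Proof.
move=> [hx [hy [hxx [hxy [hyx [hyy [Ch Eh]]]]]]] per y00 y01 hB hI.
suff main x y2 : 0 <= x <= 1 -> y1 < y2 -> h (x, y2) <= B.
  move=> [x y] /=; rewrite le_eqVlt => /orP[/eqP <-//|yy].
  rewrite -(per (- Num.floor x) (x, y)) /=; last exact: lt_trans yy.
  apply: main => //; rewrite intrN subr_ge0 floor_le /= lerBlDl addrC.
  by have := floorD1_gt x; rewrite intrD; lra.
move=> x01 y12; rewrite leNgt; apply/negP => hgt.
have y20 : 0 < y2 by lra.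
pose k z := h z - B.
pose f z := cutoff (k z).
pose fx z := cutoff1 (k z) * hx z; pose fy z := cutoff1 (k z) * hy z.
pose fxx z := cutoff1 (k z) * hxx z + hx z * (cutoff2 (k z) * hx z).
pose fxy z := cutoff1 (k z) * hxy z + hx z * (cutoff2 (k z) * hy z).
pose fyx z := cutoff1 (k z) * hyx z + hy z * (cutoff2 (k z) * hx z).
pose fyy z := cutoff1 (k z) * hyy z + hy z * (cutoff2 (k z) * hy z).
have gk z : y0 < z.2 -> grad_at k z (hx z) (hy z).
  move=> zy; have [h1 _ _ _ _] := Ch z zy.
  by apply: grad_ext (grad_add h1 (grad_cst (- B) z)); rewrite addr0.
have Cf : C2_on [set z | y0 < z.2] f fx fy fxx fxy fyx fyy.
  move=> z zy; have [h1 h2 h3 h4 h5] := Ch z zy; have g := gk z zy.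
  have g1 := grad_comp (is_derive_cutoff1 (k z)) g.
  have ck : {for z, continuous k} := grad_continuous g.
  have c1 : {for z, continuous (fun z => cutoff1 (k z))} := grad_continuous g1.
  have c2 : {for z, continuous (fun z => cutoff2 (k z))}.
    by apply: (@continuous_comp _ _ _ k (@cutoff2 R)); [exact: ck|exact: continuous_cutoff2].
  have cx : {for z, continuous hx} := grad_continuous h2.
  have cy : {for z, continuous hy} := grad_continuous h3.
  split.
  - exact: grad_comp (is_derive_cutoff _) g.
  - exact: grad_mul g1 h2.
  - exact: grad_mul g1 h3.
  - by apply: continuous_addf; apply: continuous_mulf => //; exact: continuous_mulf.
  - by apply: continuous_addf; apply: continuous_mulf => //; exact: continuous_mulf.
have sub z : y0 < z.2 -> 0 <= fxx z + fyy z.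
  move=> zy; have [_ _ e] := Eh z zy.
  have -> : fxx z + fyy z = cutoff1 (k z) * (hxx z + hyy z) + cutoff2 (k z) * (hx z ^+ 2 + hy z ^+ 2).
    by rewrite /fxx /fyy; ring.
  by rewrite e mulr0 add0r mulr_ge0 ?cutoff2_ge0// addr_ge0 ?sqr_ge0.
have hxper y : y0 < y -> hx (0, y) = hx (1, y).
  move=> yy; have [h0 _ _ _ _] := Ch (0, y) yy; have [h1 _ _ _ _] := Ch (1, y) yy.
  have g : grad_at (fun z => h (z.1 + 1, z.2)) (0, y) (hx (1, y)) (hy (1, y)).
    have gu : grad_at (fun z : R * R => z.1 + 1) (0, y) 1 0.
      by apply: grad_ext (grad_add (grad_fst _) (grad_cst 1 _)); rewrite addr0.
    have h1' : grad_at h (((0, y) : R * R).1 + 1, ((0, y) : R * R).2) (hx (1, y)) (hy (1, y)) by rewrite /= add0r.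
    by apply: grad_ext (grad_comp2 h1' gu (grad_snd _)); ring.
  have g' : grad_at h (0, y) (hx (1, y)) (hy (1, y)).
    apply: grad_near g; have ny : \forall z \near ((0, y) : R * R), y0 < z.2.
      by apply: open_nbhs_nbhs; split => //; exact: open_above.
    by apply: filterS ny => z zy; rewrite -(per 1 z zy).
  have := grad_derive (1, 0) h0; rewrite (grad_derive (1, 0) g') /= !mulr0 !mulr1 !addr0 => ->.
  by [].
have fxper y : y0 < y -> fx (0, y) = fx (1, y).
  move=> yy; rewrite /fx /k hxper// -(per 1 (0, y))//= add0r.
  by [].
pose m y := \int[lam]_(x in `[0, 1]) f (x, y); pose P y := \int[lam]_(x in `[0, 1]) fy (x, y).
have rectP c d z : y0 < c -> rect 0 1 c d z -> y0 < z.2.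
  by move=> yc [_]; rewrite /= in_itv/= => /andP[+ _]; exact: lt_le_trans.
have CfW c d : y0 < c -> C2_on (rect 0 1 c d) f fx fy fxx fxy fyx fyy.
  by move=> yc z /(rectP _ _ _ yc); exact: Cf.
have m1 : m y1 = 0.
  rewrite /m (_ : (fun x => f (x, y1)) = fun=> 0) ?Rintegral_cst ?mul0r//.
  by apply/funext => t; rewrite /f cutoff_le0// subr_le0.
have f0 z : 0 <= f z by exact: cutoff_ge0.
have m2 : 0 < m y2.
  apply: (@itv_integral_gt0 (fun x => f (x, y2)) x) => //.
    move=> t _; apply: sect1_continuous; have [h1 _ _ _ _] := Cf (t, y2) (lt_trans y01 y12).
    exact: grad_continuous h1.
  by rewrite /f cutoff_gt0// subr_gt0.
(* Green's identity with the weight y - y1 gives (y2 - y1) P y2 >= m y2, because m y1 = 0: the slope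
   of m at y2 is positive. *)
have P2 : 0 < P y2.
  have := @periodic_green y1 y2 f fx fy fxx fxy fyx fyy (fun s => s - y1) (fun=> 1) (fun=> 0)
    y12 (CfW _ _ y01).
  have d1 y : is_derive y (1 : R) (fun s => s - y1) (1 : R).
    by apply: d1_eq (d1_add (d1_id y) (d1_cst (- y1) y)) _; rewrite addr0.
  have nb y : y1 <= y <= y2 -> y0 < y by move=> /andP[+ _]; exact: lt_le_trans.
  move=> /(_ (fun y i => fxper y (nb y i)) (fun y _ => d1 y) (fun y _ => d1_cst 1 y)
    (fun y _ => cvg_cst _)) e.
  have : (0 <= \int[(lam \x lam)%E]_(z in (rect 0 1 y1 y2 : set T2))
     ((z.2 - y1) * (fxx z + fyy z) - 0 * f z)%:E)%E.
    apply: integral_ge0 => z zW; rewrite lee_fin mul0r subr0 mulr_ge0 ?sub ?(rectP _ _ _ y01 zW)//.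
    by rewrite subr_ge0; case: zW => _; rewrite /= in_itv/= => /andP[].
  rewrite e lee_fin -/(m y2) -/(m y1) -/(P y2) -/(P y1) m1 subrr mul0r mulr0 subr0 mul1r subr0 => ge.
  have : 0 < (y2 - y1) * P y2 by lra.
  by rewrite pmulr_rgt0// subr_gt0.
pose K := (1 + `|B|) * `|I| + 1.
have K0 : 0 < K by rewrite /K ltr_wpDl// mulr_ge0// addr_ge0.
(* This height makes - psi y2 at least K / P y2, so the boundary term at y2 is at least K, more than
   the integral of f / y^2 can be. *)
pose D := expR (ln y2 + 1 + K / P y2).
have lnD : ln D = ln y2 + 1 + K / P y2 by rewrite expRK.
have D0 : 0 < D by exact: expR_gt0.
have y2D : y2 < D.
  by rewrite -ltr_ln ?posrE// lnD -addrA ltrDl addr_gt0// divr_gt0.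
have y02 : y0 < y2 by exact: lt_trans y12.
have nb y : y2 <= y <= D -> y0 < y by move=> /andP[+ _]; exact: lt_le_trans.
have nb0 y : y2 <= y <= D -> 0 < y by move=> /nb; exact: lt_trans.
(* Its second derivative -1/s^2 matches the hyperbolic density, psi and psi1 vanish at D so that
   nothing remains there, and psi <= 0 by the concavity of the logarithm. *)
pose psi s := ln s + (- ln D + 1) + - D^-1 * s.
pose psi1 (s : R) := s^-1 + - D^-1.
pose psi2 (s : R) := - (s^-1 * s^-1).
have dV y : y2 <= y <= D -> is_derive y (1 : R) (fun s => s^-1) (psi2 y).
  move=> h1; have yn : y != 0 by rewrite gt_eqF// nb0.
  by apply: d1_eq (d1_inv (f := fun t => t) yn (d1_id y)) _; rewrite mulr1 expr2 invfM.
have dpsi y : y2 <= y <= D -> is_derive y (1 : R) psi (psi1 y).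
  move=> h1; apply: d1_eq (d1_add (d1_add (is_derive1_ln (nb0 _ h1)) (d1_cst _ y)) (d1_mul (d1_cst (- D^-1) y) (d1_id y))) _.
  by rewrite /psi1; ring.
have dpsi1 y : y2 <= y <= D -> is_derive y (1 : R) psi1 (psi2 y).
  by move=> h1; apply: d1_eq (d1_add (dV y h1) (d1_cst _ y)) _; rewrite addr0.
have cpsi2 y : y2 <= y <= D -> {for y, continuous psi2}.
  move=> h1; have c := d1_continuous (dV y h1).
  by apply: (@continuousN R R^o); exact: (@continuousM R).
have psi_le s : 0 < s -> psi s <= 0.
  move=> s0; have : ln (1 + (s / D - 1)) <= s / D - 1.
    by apply: le_ln1Dx; rewrite ltrBDl addrN divr_gt0.
  by rewrite addrC subrK ln_div ?posrE// /psi [- D^-1 * s]mulrC mulrN; lra.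
have e := periodic_green y2D (CfW _ _ y02) (fun y i => fxper y (nb y i)) dpsi dpsi1 cpsi2.
have psiD : psi D = 0 by rewrite /psi mulNr mulVf ?gt_eqF//; ring.
have psi1D : psi1 D = 0 by rewrite /psi1 subrr.
have csnd (p : R -> R) (z : R * R) : {for z.2, continuous p} -> {for z, continuous (fun z : R * R => p z.2)}.
  by move=> cp; apply: (@continuous_comp _ _ _ (fun z : R * R => z.2) p); [exact: cvg_snd|exact: cp].
have rP z : rect 0 1 y2 D z -> y2 <= z.2 <= D by move=> [_]; rewrite /= in_itv.
pose g z := (1 + `|B|) * ((`|h z| + 1) * (z.2^-1 * z.2^-1)).
have cabs z : rect 0 1 y2 D z -> {for z, continuous (fun z => (`|h z| + 1) * (z.2^-1 * z.2^-1))}.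
  move=> zW; have [h1 _ _ _ _] := Ch z (nb _ (rP z zW)).
  have cV : {for z, continuous (fun z : R * R => z.2^-1)} by apply: csnd; exact: d1_continuous (dV _ (rP z zW)).
  apply: continuous_mulf; last exact: continuous_mulf.
  apply: continuous_addf; last exact: cvg_cst.
  by apply: (@continuous_comp _ _ _ h (fun t : R => `|t|)); [exact: grad_continuous h1|exact: norm_continuous].
have ig : (lam \x lam)%E.-integrable (rect 0 1 y2 D : set T2) (EFin \o g).
  by apply: continuous_rect_integrable => z zW; apply: continuous_scalef; exact: cabs.
have ia : (lam \x lam)%E.-integrable (rect 0 1 y2 D : set T2) (EFin \o (fun z => (`|h z| + 1) * (z.2^-1 * z.2^-1))).
  exact: continuous_rect_integrable.
have il : (lam \x lam)%E.-integrable (rect 0 1 y2 D : set T2)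
    (EFin \o (fun z => psi z.2 * (fxx z + fyy z) - psi2 z.2 * f z)).
  apply: continuous_rect_integrable => z zW; have zy := rP z zW.
  have [h1 h2 h3 h4 h5] := Cf z (nb _ zy).
  apply: (@continuousMD _ setT).
  - by apply: csnd; exact: d1_continuous (dpsi _ zy).
  - exact: continuous_addf.
  - by apply: csnd; exact: cpsi2.
  - exact: grad_continuous h1.
have mW : measurable (rect 0 1 y2 D : set T2) by exact: measurable_rect.
have le1 : (\int[(lam \x lam)%E]_(z in (rect 0 1 y2 D : set T2))
     (psi z.2 * (fxx z + fyy z) - psi2 z.2 * f z)%:E <=
   \int[(lam \x lam)%E]_(z in (rect 0 1 y2 D : set T2)) (g z)%:E)%E.
  apply: le_integral => // z /set_mem zW; rewrite lee_fin.
  have zy := rP z zW; have z0 := nb0 _ zy; have v0 : 0 <= z.2^-1 * z.2^-1 by rewrite -expr2 sqr_ge0.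
  have l1 : psi z.2 * (fxx z + fyy z) <= 0 by rewrite mulr_le0_ge0 ?psi_le// sub// nb.
  have l2 : f z <= (1 + `|B|) * (`|h z| + 1).
    apply: le_trans (cutoff_le _) _; apply: le_trans (ler_normB _ _) _.
    by have := normr_ge0 (h z); have := normr_ge0 B; clear; nra.
  have : (z.2^-1 * z.2^-1) * f z <= (z.2^-1 * z.2^-1) * ((1 + `|B|) * (`|h z| + 1)) by rewrite ler_wpM2l.
  by rewrite /g /psi2; clear -l1; lra.
have le2 : (\int[(lam \x lam)%E]_(z in (rect 0 1 y2 D : set T2)) (g z)%:E <= ((1 + `|B|) * I)%:E)%E.
  under eq_integral do rewrite /g EFinM.
  rewrite integralZl// EFinM lee_wpmul2l// ?lee_fin ?addr_ge0//.
  apply: le_trans (hI D (lt_trans y12 y2D)); apply: ge0_subset_integral => //.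
  - exact: measurable_rect.
  - apply/measurable_EFinP; apply: pointwise_continuous_measurable; first exact: measurable_rect.
    move=> z [_]; rewrite /= in_itv/= => /andP[zy _]; have zy0 : y0 < z.2 by exact: lt_le_trans zy.
    have zn : z.2 != 0 by rewrite gt_eqF// (lt_trans y00).
    have [h1 _ _ _ _] := Ch z zy0.
    have cV : {for z, continuous (fun z : R * R => z.2^-1)}.
      by apply: csnd; exact: d1_continuous (d1_inv (f := fun t => t) zn (d1_id _)).
    apply: continuous_mulf; last exact: continuous_mulf.
    apply: continuous_addf; last exact: cvg_cst.
    by apply: (@continuous_comp _ _ _ h (fun t : R => `|t|)); [exact: grad_continuous h1|exact: norm_continuous].
  - by move=> z _; rewrite lee_fin mulr_ge0 ?addr_ge0// -expr2 sqr_ge0.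
  - move=> z [h1 /=]; rewrite in_itv/= => /andP[h2 h3]; split => //=; rewrite in_itv/= h3 andbT.
    by rewrite ltW// (lt_le_trans y12).
have := le_trans le1 le2; rewrite e psiD psi1D !mul0r subrr sub0r lee_fin -/(P y2) -/(m y2).
have s1 : 0 <= psi1 y2 * m y2.
  by rewrite mulr_ge0 ?(ltW m2)// subr_ge0 lef_pV2 ?posrE// ltW.
have s2 : K <= - psi y2 * P y2.
  have : K / P y2 <= - psi y2.
    rewrite /psi lnD; have : 0 < D^-1 * y2 by rewrite mulr_gt0 ?invr_gt0.
    by rewrite mulNr; clear; lra.
  by rewrite ler_pdivrMr.
have : (1 + `|B|) * I <= (1 + `|B|) * `|I| by rewrite ler_wpM2l ?addr_ge0// ler_norm.
rewrite /K in s2 *; clear -s1 s2; lra.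
Qed.

End PeriodicHarmonic.

(** * The Green function near a cusp *)

Lemma int_small (R : realType) (b : int) : `|b%:~R : R| < 1 -> b = 0.
Proof. by rewrite -intr_norm -[1](mulr1z 1) ltr_int; lia. Qed.

Section CuspGeometry.
Variable R : realType.
Variables (Gamma : set 'M[R]_2) (F : set (R * R)).
Hypothesis hG : is_cofinite_fuchsian Gamma F.
Let fG : is_fuchsian Gamma. Proof. by case: hG. Qed.
Variables (s : 'M[R]_2) (m : R).
Hypothesis ds : \det s = 1.
Hypothesis hstab : pm (conjugate (invmx s) (cusp_stab Gamma s)) =
  pm [set mat2 1 b%:~R 0 1 | b in [set: int]].
Hypothesis m0 : 0 < m.
Hypothesis hmin : forall g, Gamma g -> ~ cusp_stab Gamma s g -> m <= Ccusp s g.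
Implicit Types (z w x : R * R).

Let dsi : \det (invmx s) = 1. Proof. exact: det_invmx1. Qed.
Let su : s \in unitmx. Proof. exact: unitmx_det1. Qed.

Definition hshift (b : int) z : R * R := (z.1 + b%:~R, z.2).

Lemma upper_shift b z : upper z -> upper (hshift b z). Proof. by []. Qed.

Lemma det_translation (b : int) : \det (mat2 1 b%:~R 0 1 : 'M[R]_2) = 1.
Proof. by rewrite det2 !mxE /= mulr1 mulr0 subr0. Qed.

Lemma mobius_translation (b : int) z : upper z -> mobius (mat2 1 b%:~R 0 1) z = hshift b z.
Proof.
move=> zu; rewrite mobiusE ?det_translation// /mden !mxE /= !mul0r !add0r expr1n expr0n addr0 !divr1.
by rewrite mul1r mulr1 mulr0 mul0r addr0.
Qed.

Lemma mobius_conj g x : \det g = 1 -> upper x ->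
  mobius g (mobius s x) = mobius s (mobius (invmx s *m g *m s) x).
Proof.
move=> dg xu; have dsg : \det (invmx s *m g) = 1 by rewrite det_mulmx dsi dg mulr1.
rewrite mobiusM// mobiusM//; last exact: upper_mobius.
by rewrite mobiusKV//; apply: upper_mobius => //; exact: upper_mobius.
Qed.

Lemma cusp_stab_translation g : cusp_stab Gamma s g ->
  exists b : int, invmx s *m g *m s = mat2 1 b%:~R 0 1 \/ invmx s *m g *m s = - mat2 1 b%:~R 0 1.
Proof.
move=> sg; have : pm (conjugate (invmx s) (cusp_stab Gamma s)) (invmx s *m g *m s).
  by left; exists g => //; rewrite invmxK.
rewrite hstab => -[[b _ e]|[b _ e]]; exists b; first by left.
by right; rewrite -[LHS]opprK -e.
Qed.

Lemma translation_cusp_stab (b : int) : exists g, cusp_stab Gamma s g /\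
  (invmx s *m g *m s = mat2 1 b%:~R 0 1 \/ invmx s *m g *m s = - mat2 1 b%:~R 0 1).
Proof.
have : pm [set mat2 1 b%:~R 0 1 | b in [set: int]] (mat2 1 b%:~R 0 1 : 'M[R]_2) by left; exists b.
rewrite -hstab => -[[g sg e]|[g sg e]]; exists g; split=> //.
  by left; rewrite -e invmxK.
by right; rewrite -[mat2 _ _ _ _]opprK -e invmxK opprK.
Qed.

Lemma mobius_of_translation g (b : int) x : Gamma g -> upper x ->
  invmx s *m g *m s = mat2 1 b%:~R 0 1 \/ invmx s *m g *m s = - mat2 1 b%:~R 0 1 ->
  mobius g (mobius s x) = mobius s (hshift b x).
Proof.
move=> Gg xu e; rewrite mobius_conj ?(fuchsian_det fG)//; congr mobius.
by case: e => ->; rewrite ?mobiusN mobius_translation.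
Qed.

Lemma same_orbit_shift (b : int) x : upper x -> same_orbit Gamma (mobius s (hshift b x)) (mobius s x).
Proof.
move=> xu; have [g [[Gg sg] e]] := translation_cusp_stab b.
by exists g => //; rewrite (mobius_of_translation Gg xu e).
Qed.

(** The product of the heights of x and gx is y^2 / |cx + d|^2 <= 1 / c^2, and |c| >= m off the
    stabilizer. *)
Lemma im_nonstab g x : Gamma g -> ~ cusp_stab Gamma s g -> upper x ->
  (mobius (invmx s *m g *m s) x).2 * x.2 <= (m ^+ 2)^-1.
Proof.
move=> Gg ng xu; have dg := fuchsian_det fG Gg.
set q := invmx s *m g *m s.
have dq : \det q = 1 by rewrite !det_mulmx dsi dg ds !mulr1.
have qm : m <= `|q 1 0| := hmin Gg ng.
rewrite mobiusE//= -[leRHS]mul1r ler_pdivlMr ?exprn_gt0//.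
have N0 := mden_gt0 dq xu.
have x0 : 0 < x.2 by [].
have -> : x.2 / mden q x * x.2 * m ^+ 2 = (x.2 ^+ 2 * m ^+ 2) / mden q x by ring.
rewrite ler_pdivrMr// mul1r /mden.
have : m ^+ 2 <= q 1 0 ^+ 2.
  by rewrite -[leRHS]real_normK ?num_real// lerXn2r ?nnegrE ?(ltW m0)// (le_trans (ltW m0)).
rewrite exprMn => h; have := sqr_ge0 (q 1 0 * x.1 + q 1 1).
have : x.2 ^+ 2 * m ^+ 2 <= x.2 ^+ 2 * q 1 0 ^+ 2 by rewrite ler_wpM2l ?sqr_ge0.
by lra.
Qed.

Lemma same_orbit_cusp x x' : upper x -> upper x' -> (m ^+ 2)^-1 < x'.2 * x.2 ->
  same_orbit Gamma (mobius s x') (mobius s x) -> exists b, x' = hshift b x.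
Proof.
move=> xu x'u big [g Gg]; have dg := fuchsian_det fG Gg.
have [sg|ng] := pselect (cusp_stab Gamma s g).
  have [b e] := cusp_stab_translation sg; rewrite (mobius_of_translation Gg xu e) => e'.
  exists b; rewrite -[LHS](mobiusK ds x'u) e' mobiusK//; exact: upper_shift.
rewrite mobius_conj// => e; have dq : \det (invmx s *m g *m s) = 1 by rewrite !det_mulmx dsi dg ds !mulr1.
have e' : x' = mobius (invmx s *m g *m s) x.
  by rewrite -[LHS](mobiusK ds x'u) e mobiusK//; exact: upper_mobius.
by have := im_nonstab Gg ng xu; rewrite -e' leNgt big.
Qed.

Lemma upt_ratio_ge (k : R) x x' : upper x -> upper x' -> 1 <= k -> k * x.2 <= x'.2 ->
  (k + k^-1) / 2 <= upt x' x.
Proof.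
move=> xu x'u k1 kx; have k0 : 0 < k by lra.
apply: le_trans (upt_im x'u xu); rewrite ler_pM2r ?invr_gt0//.
have x0 : 0 < x.2 by []. have x'0 : 0 < x'.2 by [].
have t : k <= x'.2 / x.2 by rewrite ler_pdivlMr.
have -> : x.2 / x'.2 = (x'.2 / x.2)^-1 by rewrite invf_div.
set r := x'.2 / x.2 in t *; have r0 : 0 < r by rewrite divr_gt0.
rewrite -subr_ge0 (_ : _ - _ = (r - k) * (k * r - 1) / (k * r)); last first.
  by field; rewrite !gt_eqF.
apply: divr_ge0; last by rewrite mulr_ge0// ltW.
by apply: mulr_ge0; rewrite subr_ge0//; nra.
Qed.

(** An element outside the stabilizer brings x down to height at most 1 / (m^2 y), so x' is at least
    k times higher than the image. For k + 1/k = 2 delta this means u >= delta. *)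
Lemma upt_nonstab g x x' (k : R) : Gamma g -> ~ cusp_stab Gamma s g -> upper x -> upper x' ->
  1 <= k -> k / m ^+ 2 <= x'.2 * x.2 ->
  (k + k^-1) / 2 <= upt (mobius s x') (mobius g (mobius s x)).
Proof.
move=> Gg ng xu x'u k1 big; have dg := fuchsian_det fG Gg.
have dq : \det (invmx s *m g *m s) = 1 by rewrite !det_mulmx dsi dg ds !mulr1.
rewrite mobius_conj// upt_mobius//; last exact: upper_mobius.
apply: upt_ratio_ge => //; first exact: upper_mobius.
have x0 : 0 < x.2 by [].
rewrite -(ler_pM2r x0); apply: le_trans big; rewrite -mulrA ler_wpM2l//; first lra.
exact: im_nonstab.
Qed.

(** Above height 1/m only integer translations identify points, and a window of width less than 1
    excludes the nontrivial ones. This supplies the injectivity that [green_equation] asks for. *)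
Lemma inj_mod_cusp x : upper x -> m^-1 < x.2 ->
  exists2 r : R, 0 < r & inj_mod Gamma (hball (mobius s x) r).
Proof.
move=> xu xm.
have nU : nbhs x [set z : R * R | m^-1 < z.2 /\ `|z.1 - x.1| < 2^-1].
  have n1 : \forall z \near x, m^-1 < z.2 by apply: open_nbhs_nbhs; split => //; exact: open_above.
  have n2 : \forall z \near x, `|z.1 - x.1| < 2^-1.
    have c : {for x, continuous (fun z : R * R => `|z.1 - x.1|)}.
      apply: (@continuous_comp _ _ _ (fun z : R * R => z.1 - x.1) (fun t : R => `|t|)); last exact: norm_continuous.
      exact: grad_continuous (grad_add (grad_fst x) (grad_cst (- x.1) x)).
    by apply: (c [set t | t < 2^-1]); apply: lt_nbhsl; rewrite /= subrr normr0.
  by apply: filterS2 n1 n2.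
have [r r0 sub] := hball_sub xu nU; exists r => // v w [vu vr] [wu wr] so.
have pre z : upper z -> upt z (mobius s x) < 1 + r ->
    exists2 x', upper x' /\ (m^-1 < x'.2 /\ `|x'.1 - x.1| < 2^-1) & z = mobius s x'.
  move=> zu zr; exists (mobius (invmx s) z); last by rewrite mobiusKV.
  split; first exact: upper_mobius.
  apply: sub; split; first exact: upper_mobius.
  by rewrite upt_mobiusl// invmxK.
have [v' [v'u [v'm v'x]] ve] := pre v vu vr; have [w' [w'u [w'm w'x]] we] := pre w wu wr.
have big : (m ^+ 2)^-1 < v'.2 * w'.2.
  by rewrite expr2 invfM; apply: ltr_pM => //; rewrite invr_ge0 ltW.
have [|b e] := same_orbit_cusp w'u v'u big; first by rewrite -ve -we.
have b0 : b = 0.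
  move: v'x w'x; rewrite e /= !ltr_norml => /andP[h1 h2] /andP[h3 h4].
  by apply: (@int_small R); rewrite ltr_norml; apply/andP; split; lra.
by rewrite ve we e b0 /hshift addr0; congr mobius; case: w' {we w'u w'm w'x big e}.
Qed.

Variable gr : R * R -> R * R -> R.
Hypothesis hgr : is_green_function Gamma F gr.
Local Notation T2 := (measurableTypeR R * measurableTypeR R)%type.
Local Notation lam := (@lebesgue_measure R).
Local Notation hm := (@hmeasure R).
Let vI := (qvol Gamma F)^-1.

Definition cusp_green z x : R := gr z (mobius s x) - vI * ln x.2.

Definition cusp_regular z : set (R * R) :=
  [set x | m^-1 < x.2 /\ offdiag Gamma (z, mobius s x)].

Lemma offdiag_slice_open z : open [set w | offdiag Gamma (z, w)].
Proof. by rewrite openE => w; exact: (offdiag_nbhs2 hG). Qed.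

Lemma cusp_regular_upper z : cusp_regular z `<=` upper.
Proof. by move=> x [xm _]; apply: lt_trans xm; rewrite invr_gt0. Qed.

Lemma cusp_regularE z : cusp_regular z =
  [set x | m^-1 < x.2] `&` (upper `&` mobius s @^-1` [set w | offdiag Gamma (z, w)]).
Proof.
apply/seteqP; split => [x h|x [h1 [h2 h3]]//]; split; first by case: h.
by split; [exact: cusp_regular_upper h|case: h].
Qed.

Lemma cusp_regular_open z : open (cusp_regular z).
Proof.
rewrite cusp_regularE; apply: openI; first exact: open_above.
by apply: open_mobius_preimage => //; exact: offdiag_slice_open.
Qed.

Lemma cusp_green_harmonic z : laplacian_on (cusp_regular z) (cusp_green z) (fun=> 0).
Proof.
have U0 : [set w | offdiag Gamma (z, w)] `<=` upper by move=> w [].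
have L1 := smooth_on_laplacian U0 (@green_smooth _ _ _ hG _ hgr z).
have L2 := laplacian_on_mobius ds L1.
have sub : cusp_regular z `<=` upper `&` mobius s @^-1` [set w | offdiag Gamma (z, w)].
  by rewrite cusp_regularE => x [].
have L3 := laplacian_on_add (laplacian_on_sub sub L2)
  (laplacian_on_scale (- vI) (laplacian_on_sub (@cusp_regular_upper z) (@laplacian_on_ln R))).
apply: (@laplacian_on_ext _ _ _ (cusp_green z) _ (fun=> 0) (@cusp_regular_open z) _ _ L3) => x.
  by rewrite /cusp_green mulNr.
move=> xr; have xu := cusp_regular_upper xr; have [xm xo] := xr.
have [r r0 ir] := inj_mod_cusp xu xm.
rewrite (green_equation hG hgr xo r0 ir) im_mobius// -/vI.
have N0 := mden_gt0 ds xu; have xn : x.2 != 0 by rewrite gt_eqF.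
by case: x xn N0 {xr xu xm xo r0 ir} => a b /= xn N0; field; rewrite xn gt_eqF.
Qed.

(* A fundamental domain sees each point of an injective piece of the cusp strip once. *)
Lemma cusp_strip_integral z : upper z -> exists I : R, forall W : set (R * R),
  measurable (W : set T2) -> (forall x, W x -> cusp_regular z x) ->
  (forall x x', W x -> W x' -> `|x.1 - x'.1| < 1) ->
  (\int[(lam \x lam)%E]_(x in (W : set T2))
     ((`|gr z (mobius s x)| + 1) * x.2 ^- 2)%:E <= I%:E)%E.
Proof.
move=> zu; have [_ fdF finF] := hG; have [mF Fu _] := fdF.
have [inv _ _ /(_ z zu) intg _] := hgr.
pose O : set (R * R) := [set w | offdiag Gamma (z, w)].
have oO : open O by exact: offdiag_slice_open.
have mO : measurable (O : set T2) by exact: open_measurable2.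
(* The values of gr on the orbit of z are arbitrary; replacing them by 0 makes f invariant and
   measurable. *)
pose f : R * R -> R := (fun w => `|gr z w| + 1) \_ O.
have cg w : O w -> {for w, continuous (fun w => `|gr z w| + 1)}.
  move=> Ow; apply: continuous_addf; last exact: cvg_cst.
  apply: (@continuous_comp _ _ _ (gr z) (fun t : R => `|t|)); last exact: norm_continuous.
  exact: (@smooth_on_continuous _ _ _ _ [::] w (@green_smooth _ _ _ hG _ hgr z) Ow).
have mf0 : measurable_fun (setT : set T2) f.
  apply/(measurable_restrictT _ mO); exact: pointwise_continuous_measurable.
have mf : measurable_fun (upper : set T2) f by exact: measurable_funTS.
have f0 w : 0 <= f w by rewrite /f patchE; case: ifPn => // _; rewrite addr_ge0.
have fle w : f w <= `|gr z w| + 1 by rewrite /f patchE; case: ifPn => // _; rewrite addr_ge0.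
have finv g w : Gamma g -> upper w -> f (mobius g w) = f w.
  move=> Gg wu; have dg := fuchsian_det fG Gg; rewrite /f !patchE.
  have [Ow|nO] := pselect (O w).
    have e := (inv g z w Gg Ow).2.
    rewrite !mem_set//= ?e// /O /=; split => //=; first exact: upper_mobius.
    move=> [h Gh ze]; have [_ _] := Ow; apply => /=; exists (h *m g); first exact: fuchsian_mul.
    by rewrite mobiusM// (fuchsian_det fG).
  rewrite !memNset//= => -[/= _ _ no]; apply: nO; split => //= -[h Gh ze]; apply: no.
  exists (h *m invmx g); first by apply: fuchsian_mul => //; exact: fuchsian_inv.
  by rewrite (mobiusM (fuchsian_det fG Gh) (det_invmx1 dg) (upper_mobius dg wu)) mobiusK.
have I0 : (\int[hm]_(w in (F : set T2)) (`|gr z w| + 1)%:E < +oo)%E.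
  have i1 : hm.-integrable (F : set T2) (EFin \o (fun w => `|gr z w|)).
    by have := integrable_abse intg; apply: eq_integrable => // w _.
  have i2 : hm.-integrable (F : set T2) (EFin \o (fun=> 1 : R)).
    apply: measurable_bounded_integrable => //; exists 1; split; first by rewrite num_real.
    by move=> t t1 w _ /=; rewrite normr1 ltW.
  rewrite ltey_eq (integrable_fin_num _ (integrableD mF i1 i2))//.
pose I := fine (\int[hm]_(w in (F : set T2)) (`|gr z w| + 1)%:E).
have IE : (\int[hm]_(w in (F : set T2)) (`|gr z w| + 1)%:E)%E = I%:E.
  rewrite /I fineK// ge0_fin_numE//; apply: integral_ge0 => w _; by rewrite lee_fin addr_ge0.
exists I => W mW Wr Wx.
have Wu : W `<=` upper by move=> x /Wr; exact: cusp_regular_upper.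
pose V : set (R * R) := upper `&` mobius (invmx s) @^-1` W.
have mV : measurable (V : set T2) by exact: measurable_mobius_preimage.
have Vu : V `<=` upper by move=> w [].
have iV : inj_mod Gamma V.
  move=> v w [vu Wv] [wu Ww] so; rewrite -(mobiusKV ds vu) -(mobiusKV ds wu).
  have [vm _] := Wr _ Wv; have [wm _] := Wr _ Ww.
  have big : (m ^+ 2)^-1 < (mobius (invmx s) v).2 * (mobius (invmx s) w).2.
    by rewrite expr2 invfM; apply: ltr_pM => //; rewrite invr_ge0 ltW.
  have so' : same_orbit Gamma (mobius s (mobius (invmx s) v)) (mobius s (mobius (invmx s) w)).
    by rewrite !mobiusKV.
  have [b e] := same_orbit_cusp (Wu _ Ww) (Wu _ Wv) big so'.
  have b0 : b = 0.
    have := Wx _ _ Wv Ww; rewrite e /= addrAC subrr add0r; exact: int_small.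
  rewrite e b0 /hshift addr0; congr mobius; exact/esym/surjective_pairing.
have [mFV e1] := @unfolding _ Gamma F V (EFin \o f) fG fdF mV Vu iV
  ((measurable_EFinP _ _).2 mf) (fun w _ => f0 w) (fun g w Gg wu => congr1 EFin (finv g w Gg wu)).
have mfs : measurable_fun (W : set T2) (fun x => f (mobius s x)).
  apply: (@eq_measurable_fun _ _ _ _ _ (fun x => `|gr z (mobius s x)| + 1)).
    by move=> x /set_mem /Wr[_ xo]; rewrite /f patchE mem_set.
  apply: pointwise_continuous_measurable => // x Wxx; have [_ xo] := Wr x Wxx.
  by apply: (@continuous_comp _ _ _ (mobius s) (fun w => `|gr z w| + 1));
    [apply: mobius_continuous => //; exact: Wu|exact: cg].
have e2 : (\int[hm]_(w in (V : set T2)) (f w)%:E = \int[hm]_(x in (W : set T2)) (f (mobius s x))%:E)%E.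
  rewrite -(@ge0_integral_mobius _ (invmx s) W (fun x => (f (mobius s x))%:E))//.
  - by apply: eq_integral => w /set_mem [wu _]; rewrite mobiusKV.
  - exact/measurable_EFinP.
  - by move=> x _; rewrite lee_fin.
have e3 := integral_hmeasure_density mW Wu mfs.
rewrite (_ : (\int[_]_(x in _) _)%E = (\int[hm]_(w in (F `&` saturation Gamma V : set T2)) (f w)%:E)%E); last first.
  rewrite e1 e2 e3; apply: eq_integral => x /set_mem /Wr[_ xo].
  by rewrite /f patchE mem_set.
apply: (@le_trans _ _ (\int[hm]_(w in (F : set T2)) (f w)%:E)%E).
  have mfF : measurable_fun (F : set T2) (fun w => (f w)%:E).
    by apply/measurable_EFinP; exact: measurable_funTS.
  by apply: ge0_subset_integral => // w _; rewrite lee_fin.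
rewrite -IE; apply: ge0_le_integral => //.
- by move=> w _; rewrite lee_fin.
- by apply/measurable_EFinP; apply: measurable_funTS.
- apply/measurable_EFinP; apply: measurable_funD => //; apply: measurableT_comp => //.
  by have /measurable_EFinP := measurable_int _ intg.
- by move=> w _; rewrite lee_fin.
Qed.

Lemma cusp_green_shift z (b : int) x : cusp_regular z x -> cusp_green z (hshift b x) = cusp_green z x.
Proof.
move=> [xm xo]; have xu : upper x by apply: lt_trans xm; rewrite invr_gt0.
have [inv _ _ _ _] := hgr; have [g [[Gg sg] e]] := translation_cusp_stab b.
by rewrite /cusp_green -(mobius_of_translation Gg xu e) (inv g z _ Gg xo).2.
Qed.

Lemma ln_strip_integral (y1 : R) : 0 < y1 -> exists I : R, forall D, y1 < D ->
  (\int[(lam \x lam)%E]_(x in (rect 0 1 y1 D : set T2)) (`|ln x.2| * (x.2^-1 * x.2^-1))%:E <= I%:E)%E.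
Proof.
move=> y10; pose A := `|ln y1|; exists (y1^-1 * (1 + A)) => D yD.
have D0 : 0 < D by exact: lt_trans yD.
(* For s >= y1 one has |ln s| <= ln s - ln y1 + A, and this majorant divided by s^2 has the
   elementary antiderivative G, which is nonpositive at D. *)
pose k (s : R) := (ln s + (- ln y1 + A)) * (s^-1 * s^-1).
pose G (s : R) := - (s^-1 * (ln s + (- ln y1 + 1 + A))).
have pos y : y1 <= y <= D -> 0 < y by move=> /andP[+ _]; exact: lt_le_trans.
have dV y : y1 <= y <= D -> is_derive y (1 : R) (fun s => s^-1) (- (y^-1 * y^-1)).
  move=> h; have yn : y != 0 by rewrite gt_eqF// pos.
  by apply: d1_eq (d1_inv (f := fun t => t) yn (d1_id y)) _; rewrite mulr1 expr2 invfM.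
have dG y : y1 <= y <= D -> is_derive y (1 : R) G (k y).
  move=> h; have yn : y != 0 by rewrite gt_eqF// pos.
  apply: d1_eq (d1_opp (d1_mul (dV y h) (d1_add (is_derive1_ln (pos y h)) (d1_cst _ y)))) _.
  by rewrite /k; ring.
have ck y : y1 <= y <= D -> {for y, continuous k}.
  move=> h; apply: (@continuousM R).
    exact: d1_continuous (d1_add (is_derive1_ln (pos y h)) (d1_cst _ y)).
  by apply: (@continuousM R); exact: d1_continuous (dV y h).
have rP x : rect 0 1 y1 D x -> y1 <= x.2 <= D by move=> [_]; rewrite /= in_itv.
have csnd (p : R -> R) (x : R * R) : {for x.2, continuous p} -> {for x, continuous (fun x : R * R => p x.2)}.
  by move=> cp; apply: (@continuous_comp _ _ _ (fun x : R * R => x.2) p); [exact: cvg_snd|exact: cp].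
have ckr x : rect 0 1 y1 D x -> {for x, continuous (fun x : R * R => k x.2)}.
  by move=> /rP h; apply: csnd; exact: ck.
have mW : measurable (rect 0 1 y1 D : set T2) by exact: measurable_rect.
apply: (@le_trans _ _ (\int[(lam \x lam)%E]_(x in (rect 0 1 y1 D : set T2)) (k x.2)%:E)%E).
  apply: ge0_le_integral => //.
  - by move=> x _; rewrite lee_fin mulr_ge0// -expr2 sqr_ge0.
  - apply/measurable_EFinP; apply: pointwise_continuous_measurable => // x /rP h.
    have cV : {for x, continuous (fun x : R * R => x.2^-1)} by apply: csnd; exact: d1_continuous (dV _ h).
    apply: continuous_mulf; last exact: continuous_mulf.
    apply: (@continuous_comp _ _ _ (fun x : R * R => ln x.2) (fun t : R => `|t|)); last exact: norm_continuous.
    by apply: (laplacian_on_continuous (@laplacian_on_ln R)); exact: pos h.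
  - by apply/measurable_EFinP; exact: pointwise_continuous_measurable.
  - move=> x /rP h; rewrite lee_fin ler_wpM2r ?invr_ge0//; first by rewrite -expr2 sqr_ge0.
    have l : ln y1 <= ln x.2 by rewrite ler_ln ?posrE ?(pos _ h)//; case/andP: h.
    by rewrite /A; have [a0|a0] := ger0P (ln x.2); have [b0|b0] := ger0P (ln y1); lra.
rewrite rect_fubini//; under eq_integral => t _ do rewrite (integral_derive yD dG ck).
rewrite -EFinB integral_cst//= lebesgue_measure_itv/= lte_fin ltr01 oppr0 adde0 mule1 lee_fin.
have lD : ln y1 <= ln D by rewrite ler_ln ?posrE// ltW.
have h1 : 0 <= D^-1 * (ln D + (- ln y1 + 1 + A)).
  by rewrite mulr_ge0 ?invr_ge0 ?(ltW D0)//; have := normr_ge0 (ln y1); rewrite -/A; lra.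
rewrite /G; have -> : ln y1 + (- ln y1 + 1 + A) = 1 + A by ring.
by lra.
Qed.

(** Used with sg = 1 and sg = -1 for upper and lower bounds. The integral bound that
    [periodic_harmonic_le] asks for combines the integrability of gr over F with that of log y /
    y^2. *)
Lemma cusp_bounded z (y0 y1 B sg : R) : upper z -> m^-1 <= y0 -> y0 < y1 ->
  (forall x, y0 < x.2 -> offdiag Gamma (z, mobius s x)) -> `|sg| = 1 ->
  (forall a, sg * cusp_green z (a, y1) <= B) ->
  forall x, y1 <= x.2 -> sg * cusp_green z x <= B.
Proof.
move=> zu my0 y01 off sg1 hB.
have y00 : 0 < y0 by apply: lt_le_trans my0; rewrite invr_gt0.
have reg x : y0 < x.2 -> cusp_regular z x by move=> h; split; [exact: le_lt_trans h|exact: off].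
have y10 : 0 < y1 by exact: lt_trans y01.
have [I1 hI1] := ln_strip_integral y10; have [I2 hI2] := cusp_strip_integral zu.
apply: (@periodic_harmonic_le _ (fun x => sg * cusp_green z x) y0 y1 B (I2 + I2 + `|vI| * I1)) => //.
- have L := laplacian_on_scale sg (laplacian_on_sub (W' := [set x | y0 < x.2]) reg (cusp_green_harmonic z)).
  apply: laplacian_on_ext (@open_above _ y0) _ _ L => // x _; by rewrite mulr0.
- by move=> b x xy /=; rewrite -/(hshift b x) cusp_green_shift//; exact: reg.
move=> D yD; set W := rect 0 1 y1 D.
have WP x : W x -> [/\ 0 <= x.1, x.1 <= 1, y1 <= x.2 & x.2 <= D].
  by move=> [] /=; rewrite !in_itv/= => /andP[? ?] /andP[? ?].
have Wreg x : W x -> cusp_regular z x by move=> /WP[_ _ h _]; apply: reg; exact: lt_le_trans h.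
have mW : measurable (W : set T2) by exact: measurable_rect.
pose H x := (`|gr z (mobius s x)| + 1) * x.2 ^- 2.
pose L x := `|ln x.2| * (x.2^-1 * x.2^-1).
have xn x : W x -> 0 < x.2 by move=> /WP[_ _ h _]; exact: lt_le_trans h.
have cV x : W x -> {for x, continuous (fun x : R * R => x.2^-1 * x.2^-1)}.
  move=> /xn x0; apply: smooth_expr_continuous => //.
  by apply: Smooth_mul; exact: Smooth_inv.
have mH : measurable_fun (W : set T2) H.
  apply: (@eq_measurable_fun _ _ _ _ _ (fun x => (`|gr z (mobius s x)| + 1) * (x.2^-1 * x.2^-1))).
    by move=> x _; rewrite /H expr2 invfM.
  apply: pointwise_continuous_measurable => // x xW; have [_ xo] := Wreg x xW.
  apply: continuous_mulf; last exact: cV.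
  apply: continuous_addf; last exact: cvg_cst.
  apply: (@continuous_comp _ _ _ (fun x => gr z (mobius s x)) (fun t : R => `|t|)); last exact: norm_continuous.
  apply: (@continuous_comp _ _ _ (mobius s) (gr z)); first by apply: mobius_continuous => //; exact: xn.
  exact: (@smooth_on_continuous _ _ _ _ [::] _ (@green_smooth _ _ _ hG _ hgr z) xo).
have mL : measurable_fun (W : set T2) L.
  apply: pointwise_continuous_measurable => // x xW; apply: continuous_mulf; last exact: cV.
  apply: (@continuous_comp _ _ _ (fun x : R * R => ln x.2) (fun t : R => `|t|)); last exact: norm_continuous.
  by apply: (laplacian_on_continuous (@laplacian_on_ln R)); exact: xn.
have H0 x : 0 <= H x by rewrite /H mulr_ge0 ?addr_ge0 ?invr_ge0 ?sqr_ge0.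
have L0 x : 0 <= L x by rewrite /L mulr_ge0 // -expr2 sqr_ge0.
have iH : (\int[(lam \x lam)%E]_(x in (W : set T2)) (H x)%:E <= (I2 + I2)%:E)%E.
  (* Over a full period the two vertical sides are identified by a translation; on each half the
     width is less than 1, as [cusp_strip_integral] demands. *)
  pose W1 := rect 0 2^-1 y1 D; pose W2 := W `\` W1.
  have mW1 : measurable (W1 : set T2) by exact: measurable_rect.
  have mW2 : measurable (W2 : set T2) by exact: measurableD.
  have W1P x : W1 x -> [/\ 0 <= x.1, x.1 <= 2^-1, y1 <= x.2 & x.2 <= D].
    by move=> [] /=; rewrite !in_itv/= => /andP[? ?] /andP[? ?].
  have W2P x : W2 x -> [/\ 2^-1 < x.1 & x.1 <= 1].
    move=> [/WP[h1 h2 h3 h4] n]; split => //; rewrite ltNge; apply/negP => h; apply: n.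
    by split; rewrite /= in_itv/= ?h1 ?h3.
  have WW : W = W1 `|` W2.
    apply/esym/setDUK => x /W1P[h1 h2 h3 h4]; split; rewrite /= in_itv/= ?h1 ?h3//=; lra.
  have W1W : W1 `<=` W by rewrite WW; exact: subsetUl.
  rewrite WW ge0_integral_setU//; last 3 first.
  - by apply/measurable_EFinP; rewrite -WW.
  - by move=> x _; rewrite lee_fin.
  - by apply/disj_setPS => x [h [_]].
  rewrite EFinD; apply: leeD.
    apply: hI2 => //; first by move=> x /W1W; exact: Wreg.
    by move=> x x' /W1P[a1 a2 _ _] /W1P[b1 b2 _ _]; rewrite ltr_norml; apply/andP; split; lra.
  apply: hI2 => //; first by move=> x [xW _]; exact: Wreg.
  by move=> x x' /W2P[a1 a2] /W2P[b1 b2]; rewrite ltr_norml; apply/andP; split; lra.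
apply: (@le_trans _ _ (\int[(lam \x lam)%E]_(x in (W : set T2)) ((H x)%:E + (`|vI|)%:E * (L x)%:E))%E).
  apply: ge0_le_integral => //.
  - by move=> x _; rewrite lee_fin mulr_ge0 ?addr_ge0// -expr2 sqr_ge0.
  - apply/measurable_EFinP; apply: pointwise_continuous_measurable => // x xW.
    apply: continuous_mulf; last exact: cV.
    apply: continuous_addf; last exact: cvg_cst.
    apply: (@continuous_comp _ _ _ (fun x => sg * cusp_green z x) (fun t : R => `|t|)); last exact: norm_continuous.
    by apply: continuous_scalef; exact: laplacian_on_continuous (cusp_green_harmonic z) (Wreg x xW).
  - apply: emeasurable_funD; first exact/measurable_EFinP.
    by apply: measurable_funeM; exact/measurable_EFinP.
  - move=> x xW; rewrite -EFinM -EFinD lee_fin normrM sg1 mul1r /H /L expr2 invfM.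
    have v0 : 0 <= x.2^-1 * x.2^-1 by rewrite -expr2 sqr_ge0.
    have -> : (`|gr z (mobius s x)| + 1) * (x.2^-1 / x.2) + `|vI| * (`|ln x.2| * (x.2^-1 / x.2)) =
      (`|gr z (mobius s x)| + 1 + `|vI| * `|ln x.2|) * (x.2^-1 / x.2) by ring.
    apply: ler_wpM2r => //.
    have := ler_normB (gr z (mobius s x)) (vI * ln x.2); rewrite normrM -/(cusp_green z x); lra.
rewrite ge0_integralD//; last 4 first.
- by move=> x _; rewrite lee_fin.
- exact/measurable_EFinP.
- by move=> x _; rewrite mule_ge0 ?lee_fin.
- by apply: measurable_funeM; exact/measurable_EFinP.
rewrite EFinD; apply: leeD => //; rewrite ge0_integralZl//; last 2 first.
- exact/measurable_EFinP.
- by move=> x _; rewrite lee_fin.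
by rewrite EFinM; apply: lee_wpmul2l; [rewrite lee_fin|exact: hI1].
Qed.

End CuspGeometry.

(** * A maximum principle *)

Section MaximumPrinciple.
Variable R : realType.
Implicit Types (h p v : R * R -> R) (x z w : R * R).

(** If c were positive, f1 would increase strictly through a, by Caratheodory's form of the
    derivative. Then f exceeds f(a) on the right if f1(a) >= 0 and on the left otherwise, by the
    mean value theorem. *)
Lemma local_max_second (f f1 : R -> R) (a c : R) :
  (\forall t \near a, is_derive t (1 : R) f (f1 t)) -> is_derive a (1 : R) f1 c ->
  (\forall t \near a, f t <= f a) -> c <= 0.
Proof.
move=> df df1 mx; rewrite leNgt; apply/negP => c0.
have [g [gE cg gc]] := (is_derive1_caratheodory f1 a c).1 df1.
have ng : \forall t \near a, 0 < g t.
  by apply: (cg [set y | 0 < y]); apply: lt_nbhsr; rewrite /= gc.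
have [e /= e0 He] : exists2 e : R, 0 < e & forall t, `|t - a| < e ->
    [/\ is_derive t (1 : R) f (f1 t), f t <= f a & 0 < g t].
  have /nbhs_ballP[e /= e0 H] : \forall t \near a, [/\ is_derive t (1 : R) f (f1 t), f t <= f a & 0 < g t].
    by apply: filterS3 df mx ng => t.
  by exists e => // t te; apply: H; rewrite /ball /= distrC.
have cf t : `|t - a| < e -> {for t, continuous f} by move=> /He[h _ _]; exact: d1_continuous h.
have e20 : 0 < e / 2 by rewrite divr_gt0.
have [f10|f10] := leP 0 (f1 a).
  have ab : a < a + e / 2 by rewrite ltrDl.
  have near t : a <= t <= a + e / 2 -> `|t - a| < e.
    by move=> /andP[h1 h2]; rewrite ger0_norm ?subr_ge0//; lra.
  have d t : t \in `]a, a + e / 2[ -> is_derive t (1 : R) f (f1 t).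
    rewrite in_itv/= => /andP[h1 h2]; have h3 := near t ltac:(by rewrite !ltW).
    by have [dt _ _] := He t h3.
  have [|t tI ft] := MVT ab d.
    by apply: continuous_in_subspaceT => t; rewrite inE /= in_itv/= => h; apply: cf; exact: near.
  move: tI; rewrite in_itv/= => /andP[t1 t2].
  have [_ _ g0] := He t (near t ltac:(by rewrite !ltW)).
  have nb : `|a + e / 2 - a| < e by apply: near; apply/andP; split; lra.
  have [_ fe _] := He (a + e / 2) nb.
  have pos : 0 < f1 t.
    by rewrite -[f1 t](subrK (f1 a)) gE ltr_wpDr// mulr_gt0// subr_gt0.
  have : 0 < f1 t * (a + e / 2 - a) by rewrite mulr_gt0// addrAC subrr add0r.
  by rewrite -ft; lra.
have ab : a - e / 2 < a by rewrite ltrBlDr ltrDl.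
have near t : a - e / 2 <= t <= a -> `|t - a| < e.
  by move=> /andP[h1 h2]; rewrite ler0_norm ?subr_le0//; lra.
have d t : t \in `]a - e / 2, a[ -> is_derive t (1 : R) f (f1 t).
  rewrite in_itv/= => /andP[h1 h2]; have h3 := near t ltac:(by rewrite !ltW).
    by have [dt _ _] := He t h3.
have [|t tI ft] := MVT ab d.
  by apply: continuous_in_subspaceT => t; rewrite inE /= in_itv/= => h; apply: cf; exact: near.
move: tI; rewrite in_itv/= => /andP[t1 t2].
have [_ _ g0] := He t (near t ltac:(by rewrite !ltW)).
have nb : `|a - e / 2 - a| < e by apply: near; apply/andP; split; lra.
have [_ fe _] := He (a - e / 2) nb.
have neg : f1 t < 0.
  have : g t * (t - a) < 0 by rewrite pmulr_rlt0// subr_lt0.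
  by rewrite -gE; lra.
have : f1 t * (a - (a - e / 2)) < 0.
  by rewrite nmulr_rlt0// opprB addrC subrK.
by rewrite -ft; lra.
Qed.

Lemma local_max_laplacian W v L z : open W -> laplacian_on W v L -> W z ->
  (\forall w \near z, v w <= v z) -> L z <= 0.
Proof.
case: z => a b oW [vx [vy [vxx [vxy [vyx [vyy [C E]]]]]]] Wz mx.
have [_ _ <-] := E _ Wz; have [h1 h2 h3 _ _] := C _ Wz.
have nW : \forall w \near ((a, b) : R * R), W w by exact: open_nbhs_nbhs.
have sl1 (P : R * R -> Prop) : (\forall w \near ((a, b) : R * R), P w) -> \forall t \near a, P (t, b).
  move=> nP; exact: (cvg_pair (@cvg_id _ (nbhs a)) (cvg_cst b) nP).
have sl2 (P : R * R -> Prop) : (\forall w \near ((a, b) : R * R), P w) -> \forall t \near b, P (a, t).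
  move=> nP; exact: (cvg_pair (cvg_cst a) (@cvg_id _ (nbhs b)) nP).
have l1 : vxx (a, b) <= 0.
  apply: (@local_max_second (fun t => v (t, b)) (fun t => vx (t, b)) a).
  - apply: filterS (sl1 _ nW) => t Wt; have [g _ _ _ _] := C _ Wt; exact: grad_sect1 g.
  - exact: grad_sect1 h2.
  - exact: sl1 mx.
have l2 : vyy (a, b) <= 0.
  apply: (@local_max_second (fun t => v (a, t)) (fun t => vy (a, t)) b).
  - apply: filterS (sl2 _ nW) => t Wt; have [g _ _ _ _] := C _ Wt; exact: grad_sect2 g.
  - exact: grad_sect2 h3.
  - exact: sl2 mx.
lra.
Qed.

(* The singularities of [h] lie in the zero set of [p]; a small multiple of
   [ln p - ln y] turns [h] into a strictly subharmonic function with a maximum. *)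
Lemma strip_max_principle h p (y1 B L M : R) : 0 < y1 ->
  (forall z, {for z, continuous p}) ->
  (forall z, y1 <= z.2 -> 0 < p z -> ln (p z) <= L) ->
  (forall (b : int) z, p (hshift b z) = p z) ->
  laplacian_on [set z | 0 < p z] (fun z => ln (p z)) (fun=> 0) ->
  laplacian_on ([set z | y1 < z.2] `&` [set z | 0 < p z]) h (fun=> 0) ->
  (forall z, z.2 = y1 -> 0 < p z -> {for z, continuous h}) ->
  (forall (b : int) z, y1 <= z.2 -> 0 < p z -> h (hshift b z) = h z) ->
  (forall z, y1 <= z.2 -> 0 < p z -> h z <= M) ->
  (forall z, z.2 = y1 -> 0 < p z -> h z <= B) ->
  forall z, y1 <= z.2 -> 0 < p z -> h z <= B.
Proof.
move=> y10 cp pL pper lp lh ch hper hM hB z1 z1y p1; rewrite leNgt; apply/negP => gt.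
pose c0 := (L - ln (p z1)) + (ln z1.2 - ln y1).
have z10 : 0 < z1.2 by exact: lt_le_trans z1y.
have c00 : 0 <= c0.
  by rewrite addr_ge0// subr_ge0 ?pL// ler_ln ?posrE.
(* Small enough that the perturbation, which is - eta c0 at z1, leaves v z1 above B. *)
pose eta := (h z1 - B) / (2 * (c0 + 1)).
have eta0 : 0 < eta by rewrite divr_gt0 ?subr_gt0// mulr_gt0// ltr_wpDl.
pose v z := h z + eta * (ln (p z) + - L) + (- eta) * (ln z.2 + - ln y1).
have vz1 : B < v z1.
  have : eta * c0 < h z1 - B.
    rewrite /eta mulrAC ltr_pdivrMr ?mulr_gt0// ?ltr_wpDl// ltr_pM2l ?subr_gt0//; lra.
  by rewrite /v /c0; lra.
(* Where v >= v z1, the bound h <= M forces p >= c and y <= Y. Hence, up to a translation, v takes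
   its maximum on the compact set K, away from the singularities. *)
pose c := expR (L + (v z1 - M) / eta); pose Y := expR (ln y1 + (M - v z1) / eta).
have c_gt0 : 0 < c by exact: expR_gt0.
pose K : set (R * R) := rect 0 1 y1 Y `&` p @^-1` [set t | c <= t].
have vK z : y1 <= z.2 -> 0 < p z -> v z1 <= v z -> c <= p z /\ z.2 <= Y.
  move=> zy pz vz; have z0 : 0 < z.2 by exact: lt_le_trans zy.
  have lz : ln y1 <= ln z.2 by rewrite ler_ln ?posrE.
  have h1 := hM z zy pz; have h2 := pL z zy pz.
  split.
    rewrite -[leRHS]lnK ?posrE// ler_expR.
    have e1 : 0 <= eta * (ln z.2 + - ln y1) by rewrite mulr_ge0 ?(ltW eta0)// subr_ge0.
    have : v z1 - M <= eta * (ln (p z) + - L) by move: vz; rewrite {2}/v; lra.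
    by rewrite mulrC -ler_pdivrMr// addrC; lra.
  rewrite -[leLHS]lnK ?posrE// ler_expR.
  have e1 : 0 <= eta * (L - ln (p z)) by rewrite mulr_ge0 ?(ltW eta0)// subr_ge0.
  have : eta * (ln z.2 - ln y1) <= M - v z1 by move: vz; rewrite {2}/v; lra.
  by rewrite mulrC -ler_pdivlMr//; lra.
have vper (b : int) z : y1 <= z.2 -> 0 < p z -> v (hshift b z) = v z.
  by move=> zy pz; rewrite /v hper// pper.
have frac z : exists b : int, 0 <= (hshift b z).1 <= 1.
  exists (- Num.floor z.1); rewrite /= intrN subr_ge0 floor_le /=.
  by have := floorD1_gt z.1; rewrite intrD; lra.
have inK z : y1 <= z.2 -> 0 < p z -> v z1 <= v z -> exists2 z', K z' & v z' = v z.
  move=> zy pz vz; have [b hb] := frac z; exists (hshift b z); last exact: vper.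
  have [h1 h2] := vK z zy pz vz.
  by split; [split; rewrite /= in_itv//= zy h2|rewrite /preimage /= pper].
have cK : compact K.
  apply: compact_closedI; first by apply: compact_setX; exact: segment_compact.
  by apply: closed_comp; [move=> z _; exact: cp|exact: closed_ge].
have KP z : K z -> y1 <= z.2 /\ 0 < p z.
  move=> [[_] /=]; rewrite in_itv/= => /andP[h1 _] h2; split => //.
  exact: lt_le_trans c_gt0 h2.
have cln z : 0 < p z -> {for z, continuous (fun z => ln (p z))}.
  by move=> pz; exact: (laplacian_on_continuous lp).
have ch' z : y1 <= z.2 -> 0 < p z -> {for z, continuous h}.
  rewrite le_eqVlt => /orP[/eqP e|zy] pz; first exact: ch.
  exact: (laplacian_on_continuous lh).
have cv z : K z -> {for z, continuous v}.
  move=> /KP[zy pz]; have z0 : 0 < z.2 by exact: lt_le_trans zy.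
  apply: continuous_addf; [apply: continuous_addf; [exact: ch'|]|]; apply: continuous_scalef.
    by apply: continuous_addf; [exact: cln|exact: cvg_cst].
  apply: continuous_addf; last exact: cvg_cst.
  exact: (laplacian_on_continuous (@laplacian_on_ln R)).
have K0 : K !=set0 by have [z' Kz' _] := inK z1 z1y p1 (lexx _); exists z'.
have [|zs] := @compact_EVT_max _ R v K K0 cK.
  by apply: continuous_in_subspaceT => z; rewrite inE; exact: cv.
rewrite inE => Ks mx; have [sy ps] := KP zs Ks.
have vs : v z1 <= v zs.
  by have [z' Kz' <-] := inK z1 z1y p1 (lexx _); apply: mx; rewrite inE.
have glob z : y1 <= z.2 -> 0 < p z -> v z <= v zs.
  move=> zy pz; have [h1|h1] := leP (v z1) (v z); last by rewrite (le_trans (ltW h1)).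
  by have [z' Kz' <-] := inK z zy pz h1; apply: mx; rewrite inE.
move: sy; rewrite le_eqVlt => /orP[/eqP e|sy].
  have h1 := hB zs (esym e) ps; have h2 := pL zs ltac:(by rewrite e) ps.
  have : 0 <= eta * (L - ln (p zs)) by rewrite mulr_ge0 ?(ltW eta0)// subr_ge0.
  have : v zs = h zs + eta * (ln (p zs) + - L) by rewrite /v -e subrr mulr0 addr0.
  by lra.
pose W := [set z : R * R | y1 < z.2] `&` [set z | 0 < p z].
have oW : open W.
  apply: openI; first exact: open_above.
  rewrite (_ : [set z | 0 < p z] = p @^-1` [set t | 0 < t])//.
  by apply: open_comp; [move=> z _; exact: cp|exact: open_gt].
have Wu : W `<=` upper by move=> z [zy _]; exact: lt_trans zy.
have Wp : W `<=` [set z | 0 < p z] by move=> z [].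
have lv := laplacian_on_add (laplacian_on_add lh
  (laplacian_on_scale eta (laplacian_on_add (laplacian_on_sub Wp lp) (laplacian_on_cst W (- L)))))
  (laplacian_on_scale (- eta) (laplacian_on_add (laplacian_on_sub Wu (@laplacian_on_ln R)) (laplacian_on_cst W (- ln y1)))).
have := local_max_laplacian oW lv (conj sy ps).
have nW : \forall w \near zs, v w <= v zs.
  apply: filterS (open_nbhs_nbhs (conj oW (conj sy ps))) => w [wy pw].
  by apply: glob => //; exact: ltW.
(* The Laplacian of v is eta / y^2, the contribution of - eta ln y alone, and a positive Laplacian
   is impossible at an interior maximum. *)
move=> /(_ nW); have : 0 < eta * zs.2 ^- 2.
  by rewrite mulr_gt0// invr_gt0 exprn_gt0// (lt_trans y10).
lra.
Qed.

End MaximumPrinciple.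

(** * Sums of convex functions *)

Section MonotoneCalculus.
Variable R : realType.
Implicit Types (f k : R -> R) (u v x y t c : R).

Lemma derive_ge0_le (k k1 : R -> R) u v : u <= v ->
  (forall t : R, u <= t <= v -> is_derive t (1 : R) k (k1 t)) ->
  (forall t : R, u <= t <= v -> 0 <= k1 t) -> k u <= k v.
Proof.
rewrite le_eqVlt => /orP[/eqP -> //|uv] dk k0.
have d t : t \in `]u, v[ -> is_derive t (1 : R) k (k1 t).
  by rewrite in_itv/= => /andP[h1 h2]; apply: dk; rewrite !ltW.
have [|t tI e] := MVT uv d.
  by apply: continuous_in_subspaceT => t; rewrite inE /= in_itv/= => h; exact: d1_continuous (dk t h).
rewrite -subr_ge0 e mulr_ge0 ?subr_ge0 ?(ltW uv)//; apply: k0.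
by move: tI; rewrite in_itv/= => /andP[h1 h2]; rewrite !ltW.
Qed.

Section Convex.
Variables (f f1 Fi : R -> R) (u v : R).
Hypothesis df : forall t : R, u <= t <= v -> is_derive t (1 : R) f (f1 t).
Hypothesis dF : forall t : R, u <= t <= v -> is_derive t (1 : R) Fi (f t).
Hypothesis incr : forall t t' : R, u <= t -> t <= t' -> t' <= v -> f1 t <= f1 t'.

Lemma convex_tangent x y : u <= x <= v -> u <= y <= v -> f x + f1 x * (y - x) <= f y.
Proof.
move=> /andP[ux xv] /andP[uy yv]; have [xy|yx] := leP x y.
  have := @derive_ge0_le (fun t => f t + - f1 x * (t + - x)) (fun t => f1 t + - f1 x) x y xy.
  have d t : x <= t <= y -> is_derive t (1 : R) (fun t => f t + - f1 x * (t + - x)) (f1 t + - f1 x).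
    move=> /andP[h1 h2]; apply: d1_eq (d1_add (df _) (d1_mul (d1_cst _ t) (d1_add (d1_id t) (d1_cst _ t)))) _.
      by rewrite (le_trans ux)// (le_trans h2).
    by rewrite mulr0 addr0 addr0 mulr1.
  move=> /(_ d) h; have : f x + - f1 x * (x + - x) <= f y + - f1 x * (y + - x).
    by apply: h => t /andP[h1 h2]; rewrite subr_ge0 incr// (le_trans h2).
  by rewrite subrr mulr0 addr0; lra.
have yx' := ltW yx.
have := @derive_ge0_le (fun t => - f t + f1 x * (t + - x)) (fun t => - f1 t + f1 x) y x yx'.
have d t : y <= t <= x -> is_derive t (1 : R) (fun t => - f t + f1 x * (t + - x)) (- f1 t + f1 x).
  move=> /andP[h1 h2]; apply: d1_eq (d1_add (d1_opp (df _)) (d1_mul (d1_cst _ t) (d1_add (d1_id t) (d1_cst _ t)))) _.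
    by rewrite (le_trans uy)// (le_trans h2).
  by rewrite mulr0 addr0 addr0 mulr1.
move=> /(_ d) h; have : - f y + f1 x * (y + - x) <= - f x + f1 x * (x + - x).
  by apply: h => t /andP[h1 h2]; rewrite addrC subr_ge0 incr// (le_trans uy).
by rewrite subrr mulr0 addr0; lra.
Qed.

Lemma convex_int_left x y : u <= x -> x <= y -> y <= v ->
  f x * (y - x) + f1 x * (y - x) ^+ 2 / 2 <= Fi y - Fi x.
Proof.
move=> ux xy yv.
pose k t := Fi t + - f x * (t + - x) + - (f1 x / 2) * ((t + - x) * (t + - x)).
have dl t : is_derive t (1 : R) (fun t => t + - x) (1 : R).
  by apply: d1_eq (d1_add (d1_id t) (d1_cst _ t)) _; rewrite addr0.
have := @derive_ge0_le k (fun t => f t - (f x + f1 x * (t - x))) x y xy.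
have d t : x <= t <= y -> is_derive t (1 : R) k (f t - (f x + f1 x * (t - x))).
  move=> /andP[h1 h2]; apply: d1_eq (d1_add (d1_add (dF _) (d1_mul (d1_cst _ t) (dl t)))
    (d1_mul (d1_cst _ t) (d1_mul (dl t) (dl t)))) _.
    by rewrite (le_trans ux)// (le_trans h2).
  by field.
move=> /(_ d) h; have : k x <= k y.
  apply: h => t /andP[h1 h2]; rewrite subr_ge0; apply: convex_tangent.
    by rewrite ux (le_trans xy).
  by rewrite (le_trans ux)// (le_trans h2).
by rewrite /k subrr !mulr0 !addr0 expr2; lra.
Qed.

Lemma convex_int_right x y : u <= x -> x <= y -> y <= v ->
  f y * (y - x) - f1 y * (y - x) ^+ 2 / 2 <= Fi y - Fi x.
Proof.
move=> ux xy yv.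
pose k t := Fi t + - f y * (t + - y) + - (f1 y / 2) * ((t + - y) * (t + - y)).
have dl t : is_derive t (1 : R) (fun t => t + - y) (1 : R).
  by apply: d1_eq (d1_add (d1_id t) (d1_cst _ t)) _; rewrite addr0.
have := @derive_ge0_le k (fun t => f t - (f y + f1 y * (t - y))) x y xy.
have d t : x <= t <= y -> is_derive t (1 : R) k (f t - (f y + f1 y * (t - y))).
  move=> /andP[h1 h2]; apply: d1_eq (d1_add (d1_add (dF _) (d1_mul (d1_cst _ t) (dl t)))
    (d1_mul (d1_cst _ t) (d1_mul (dl t) (dl t)))) _.
    by rewrite (le_trans ux)// (le_trans h2).
  by field.
move=> /(_ d) h; have : k x <= k y.
  apply: h => t /andP[h1 h2]; rewrite subr_ge0; apply: convex_tangent.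
    by rewrite yv (le_trans ux).
  by rewrite (le_trans ux)// (le_trans h2).
by rewrite /k subrr !mulr0 !addr0 expr2; lra.
Qed.

Lemma convex_trapezoid x y : u <= x -> x <= y -> y <= v ->
  Fi y - Fi x <= (y - x) * (f x + f y) / 2.
Proof.
move=> ux xy yv.
pose k t := (t + - x) * ((f x + f t) * 2^-1) + - Fi t.
have dl t : is_derive t (1 : R) (fun t => t + - x) (1 : R).
  by apply: d1_eq (d1_add (d1_id t) (d1_cst _ t)) _; rewrite addr0.
have := @derive_ge0_le k (fun t => (f x - (f t + f1 t * (x - t))) / 2) x y xy.
have d t : x <= t <= y -> is_derive t (1 : R) k ((f x - (f t + f1 t * (x - t))) / 2).
  move=> /andP[h1 h2]; have tI : u <= t <= v by rewrite (le_trans ux)// (le_trans h2).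
  apply: d1_eq (d1_add (d1_mul (dl t) (d1_mul (d1_add (d1_cst _ t) (df tI)) (d1_cst _ t))) (d1_opp (dF tI))) _.
  by field.
move=> /(_ d) h; have : k x <= k y.
  apply: h => t /andP[h1 h2]; rewrite divr_ge0// subr_ge0; apply: convex_tangent.
    by rewrite (le_trans ux)// (le_trans h2).
  by rewrite ux (le_trans xy).
by rewrite /k subrr mul0r add0r; lra.
Qed.

Lemma convex_progression_trapezoid t (n : nat) : u <= t -> t + n%:R <= v ->
  Fi (t + n%:R) - Fi t <= \sum_(i < n.+1) f (t + i%:R) - (f t + f (t + n%:R)) / 2.
Proof.
move=> ut; elim: n => [|n IH] tv.
  by rewrite big_ord1 addr0 subrr; lra.
have nv : t + n%:R <= v by apply: le_trans tv; rewrite lerD2l ler_nat.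
have := IH nv; rewrite [X in _ -> _ <= X - _]big_ord_recr/=.
have := @convex_trapezoid (t + n%:R) (t + n.+1%:R).
have -> : t + n.+1%:R = t + n%:R + 1 by rewrite -addrA natr1.
have tn : u <= t + n%:R by rewrite ler_wpDr.
by move=> /(_ tn) h; have := h ltac:(lra) ltac:(by rewrite -addrA natr1); lra.
Qed.

(** On a unit interval the tangents at both ends, each integrated over half of it, give (f(x) +
    f(y)) / 2 - (f1(y) - f1(x)) / 8 as a lower bound of the integral; the slopes telescope. *)
Lemma convex_progression_midpoint t (n : nat) : u <= t -> t + n%:R <= v ->
  \sum_(i < n.+1) f (t + i%:R) - (f t + f (t + n%:R)) / 2 <=
  Fi (t + n%:R) - Fi t + (f1 (t + n%:R) - f1 t) / 8.
Proof.
move=> ut; elim: n => [|n IH] tv.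
  by rewrite big_ord1 addr0 !subrr; lra.
have nv : t + n%:R <= v by apply: le_trans tv; rewrite lerD2l ler_nat.
have := IH nv; rewrite [X in _ -> X - _ <= _]big_ord_recr/=.
have := @convex_int_left (t + n%:R) (t + n%:R + 2^-1).
have := @convex_int_right (t + n%:R + 2^-1) (t + n%:R + 1).
have e : t + n.+1%:R = t + n%:R + 1 by rewrite -addrA natr1.
rewrite e in tv *.
have tn : u <= t + n%:R by rewrite ler_wpDr.
have e1 : t + n%:R + 1 - (t + n%:R + 2^-1) = 2^-1 by lra.
have e2 : t + n%:R + 2^-1 - (t + n%:R) = 2^-1 by lra.
rewrite e1 e2 expr2 => h1 h2.
have := h1 ltac:(lra) ltac:(lra) tv; have := h2 tn ltac:(lra) ltac:(lra).
by lra.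
Qed.

(** The incomplete last step. If it is longer than 1/2, the tangent at t serves for half a unit and
    a parabola through the value at v for the rest; if it is shorter, the overshoot is corrected by
    the tangent inequality between t and v. *)
Lemma convex_right_end t c : u <= t -> t <= v -> v - t <= 1 ->
  (forall t', t <= t' <= v -> f1 t' <= c) ->
  f t / 2 + f1 t / 8 + (v - t - 2^-1) * f v - c * (v - t - 2^-1) ^+ 2 / 2 <= Fi v - Fi t.
Proof.
move=> ut tv r1 hc.
have vI : u <= v <= v by rewrite lexx (le_trans ut).
have tI : u <= t <= v by rewrite ut.
have ct : f1 t <= c by apply: hc; rewrite lexx.
have [r2|r2] := leP (v - t) 2^-1.
  have h1 := convex_int_left ut tv (lexx v); have h2 := convex_tangent tI vI.
  set r := v - t in h1 h2 r1 r2 *; rewrite !expr2 in h1 *.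
  have e0 : 0 <= 2^-1 - r by lra.
  have := ler_wpM2l e0 h2.
  have := mulr_ge0 (mulr_ge0 e0 e0) (ltac:(by rewrite subr_ge0) : 0 <= c - f1 t).
  by lra.
have h1 := @convex_int_left t (t + 2^-1) ut ltac:(lra) ltac:(lra).
have h2 : f v * (v - (t + 2^-1)) - c * (v - (t + 2^-1)) ^+ 2 / 2 <= Fi v - Fi (t + 2^-1).
  have := @convex_int_right (t + 2^-1) v ltac:(lra) ltac:(lra) (lexx v).
  have cv : f1 v <= c by apply: hc; rewrite tv lexx.
  have : f1 v * (v - (t + 2^-1)) ^+ 2 <= c * (v - (t + 2^-1)) ^+ 2 by rewrite ler_wpM2r ?sqr_ge0.
  by lra.
have e : t + 2^-1 - t = 2^-1 by lra.
have e' : v - (t + 2^-1) = v - t - 2^-1 by lra.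
rewrite e expr2 in h1; rewrite e' in h2.
by lra.
Qed.

Lemma convex_left_end t c : u <= t -> t <= v -> t - u <= 1 ->
  (forall t', u <= t' <= t -> - c <= f1 t') ->
  f t / 2 - f1 t / 8 + (t - u - 2^-1) * f u - c * (t - u - 2^-1) ^+ 2 / 2 <= Fi t - Fi u.
Proof.
move=> ut tv r1 hc.
have vI : u <= u <= v by rewrite lexx (le_trans ut).
have tI : u <= t <= v by rewrite ut.
have ct : - c <= f1 t by apply: hc; rewrite lexx ut.
have [r2|r2] := leP (t - u) 2^-1.
  have h1 := convex_int_right (lexx u) ut tv; have h2 := convex_tangent tI vI.
  have e : u - t = - (t - u) by lra.
  rewrite e in h2; set r := t - u in h1 h2 r1 r2 *; rewrite !expr2 in h1 *.
  have e0 : 0 <= 2^-1 - r by lra.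
  have := ler_wpM2l e0 h2.
  have := mulr_ge0 (mulr_ge0 e0 e0) (ltac:(lra) : 0 <= c + f1 t).
  by lra.
have h1 := @convex_int_right (t - 2^-1) t ltac:(lra) ltac:(lra) tv.
have h2 : f u * (t - 2^-1 - u) - c * (t - 2^-1 - u) ^+ 2 / 2 <= Fi (t - 2^-1) - Fi u.
  have := @convex_int_left u (t - 2^-1) (lexx u) ltac:(lra) ltac:(lra).
  have cv : - c <= f1 u by apply: hc; rewrite lexx ut.
  have : - c * (t - 2^-1 - u) ^+ 2 <= f1 u * (t - 2^-1 - u) ^+ 2 by rewrite ler_wpM2r ?sqr_ge0.
  by lra.
have e : t - (t - 2^-1) = 2^-1 by lra.
have e' : t - 2^-1 - u = t - u - 2^-1 by lra.
rewrite e expr2 in h1; rewrite e' in h2.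
by lra.
Qed.

(* Euler-Maclaurin with one-sided error terms for a convex function. *)
Lemma convex_sum_le t (n : nat) c c' : u <= t -> t + n%:R <= v ->
  t - u <= 1 -> v - (t + n%:R) <= 1 ->
  (forall t', t + n%:R <= t' <= v -> f1 t' <= c) -> (forall t', u <= t' <= t -> - c' <= f1 t') ->
  \sum_(i < n.+1) f (t + i%:R) - (Fi v - Fi u) <=
  - (v - (t + n%:R) - 2^-1) * f v - (t - u - 2^-1) * f u +
  c * (v - (t + n%:R) - 2^-1) ^+ 2 / 2 + c' * (t - u - 2^-1) ^+ 2 / 2.
Proof.
move=> ut tv r' r hc hc'.
have tn : t <= t + n%:R by rewrite lerDl.
have := convex_progression_midpoint ut tv.
have := convex_right_end (le_trans ut tn) tv r hc.
have := convex_left_end ut (le_trans tn tv) r' hc'.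
lra.
Qed.

(** Chords lie above a convex graph: trapezoids are used on the progression and on the two
    incomplete end intervals. *)
Lemma convex_sum_ge t (n : nat) : u <= t -> t + n%:R <= v ->
  ((1 - (v - (t + n%:R))) * f (t + n%:R) - (v - (t + n%:R)) * f v) / 2 +
  ((1 - (t - u)) * f t - (t - u) * f u) / 2 <=
  \sum_(i < n.+1) f (t + i%:R) - (Fi v - Fi u).
Proof.
move=> ut tv; have tn : t <= t + n%:R by rewrite lerDl.
have := convex_progression_trapezoid ut tv.
have := convex_trapezoid (le_trans ut tn) tv (lexx v).
have := convex_trapezoid (lexx u) ut (le_trans tn tv).
lra.
Qed.

End Convex.
End MonotoneCalculus.

(** * The logarithm of the Gamma function *)

Section StirlingSeries.
Variable R : realType.
Implicit Types (p q x h v X s : R) (n M : nat).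

Lemma d1_ln (f : R -> R) (x d : R) : 0 < f x -> is_derive x (1 : R) f d ->
  is_derive x (1 : R) (fun t => ln (f t)) (d / f x).
Proof. by move=> f0 df; apply: d1_eq (d1_comp (is_derive1_ln f0) df) _; rewrite mulrC. Qed.

Lemma le0_archimedean (c K : R) : (forall n, c <= K / n.+1%:R) -> c <= 0.
Proof.
move=> h; rewrite leNgt; apply/negP => c0.
have K0 : 0 < K by have := h 0%N; rewrite divr1; apply: lt_le_trans.
have := h (Num.truncn (K / c)); apply/negP; rewrite -ltNge ltr_pdivrMr ?ltr0n//.
by rewrite -ltr_pdivrMl// mulrC; have /andP[_] := truncn_itv (ltW (divr_gt0 K0 c0)).
Qed.

Lemma ln_sub_le (a b : R) : 0 < a -> 0 < b -> ln a - ln b <= a / b - 1.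
Proof.
move=> a0 b0; rewrite -ln_div ?posrE//.
have -> : a / b = 1 + (a / b - 1) by ring.
by rewrite (le_trans (le_ln1Dx _))//; have := divr_gt0 a0 b0; lra.
Qed.

(** Two terms of the series 2 artanh v = 2 v + 2 v^3 / 3 + ..., by comparing derivatives. *)
Lemma log_ratio_ge v : 0 <= v < 1 -> 2 * v + 2 / 3 * v ^+ 3 <= ln (1 + v) - ln (1 - v).
Proof.
move=> /andP[v0 v1].
have := @derive_ge0_le R (fun t => ln (1 + t) + - ln (1 + - t) + - (2 * t + 2 / 3 * (t * (t * t))))
  (fun t => 2 * t ^+ 4 / (1 - t ^+ 2)) 0 v v0.
rewrite !oppr0 !addr0 ln1 !mulr0 !addr0 !oppr0 !addr0 => h.
have {}h : 0 <= ln (1 + v) + - ln (1 + - v) + - (2 * v + 2 / 3 * (v * (v * v))).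
  apply: h => t /andP[t0 tv].
    apply: d1_eq (d1_add (d1_add (d1_ln _ (d1_add (d1_cst 1 t) (d1_id t)))
      (d1_opp (d1_ln _ (d1_add (d1_cst 1 t) (d1_opp (d1_id t))))))
      (d1_opp (d1_add (d1_mul (d1_cst 2 t) (d1_id t)) (d1_mul (d1_cst (2 / 3) t)
        (d1_mul (d1_id t) (d1_mul (d1_id t) (d1_id t))))))) _; [lra|lra|].
    have t1 : 1 - t != 0 by rewrite gt_eqF; lra.
    have t2 : 1 + t != 0 by rewrite gt_eqF; lra.
    have t3 : 1 - t ^+ 2 != 0 by rewrite (_ : 1 - t ^+ 2 = (1 - t) * (1 + t)) ?mulf_neq0//; ring.
    by field; rewrite t1 t2 t3.
  rewrite divr_ge0 ?mulr_ge0 ?exprn_ge0 ?ler0n// subr_ge0.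
  by rewrite expr2; nra.
by rewrite !exprS expr0 mulr1; lra.
Qed.

(** The terms of the series of 2 artanh v after the first are dominated by a geometric series of
    ratio v^2. *)
Lemma log_ratio_le v : 0 <= v < 1 ->
  ln (1 + v) - ln (1 - v) <= 2 * v + 2 / 3 * v ^+ 3 / (1 - v ^+ 2).
Proof.
move=> /andP[v0 v1].
have := @derive_ge0_le R (fun t => 2 * t + 2 / 3 * (t * (t * t)) * (1 + - (t * t))^-1
  + - (ln (1 + t) + - ln (1 + - t)))
  (fun t => 4 / 3 * (t ^+ 2 / (1 - t ^+ 2)) ^+ 2) 0 v v0.
rewrite !oppr0 !mulr0 !mul0r !addr0 ln1 !oppr0 !addr0 !oppr0 ?addr0 => h.
have {}h : 0 <= 2 * v + 2 / 3 * (v * (v * v)) * (1 + - (v * v))^-1 + - (ln (1 + v) + - ln (1 + - v)).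
  apply: h => t /andP[t0 tv]; last by rewrite mulr_ge0 ?sqr_ge0.
  have t1 : 1 - t != 0 by rewrite gt_eqF; lra.
  have t2 : 1 + t != 0 by rewrite gt_eqF; lra.
  have t3 : 1 - t ^+ 2 != 0 by rewrite (_ : 1 - t ^+ 2 = (1 - t) * (1 + t)) ?mulf_neq0//; ring.
  have t3' : 1 + - (t * t) != 0 by rewrite -expr2.
  have di := @d1_inv _ (fun t => 1 + - (t * t)) t _ t3' (d1_add (d1_cst 1 t) (d1_opp (d1_mul (d1_id t) (d1_id t)))).
  apply: d1_eq (d1_add (d1_add (d1_mul (d1_cst 2 t) (d1_id t)) (d1_mul (d1_mul (d1_cst (2 / 3) t)
        (d1_mul (d1_id t) (d1_mul (d1_id t) (d1_id t)))) di))
      (d1_opp (d1_add (d1_ln _ (d1_add (d1_cst 1 t) (d1_id t)))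
      (d1_opp (d1_ln _ (d1_add (d1_cst 1 t) (d1_opp (d1_id t)))))))) _; [lra|lra|].
  by field; rewrite t1 t2 t3.
by rewrite !exprS expr0 !mulr1; lra.
Qed.

Definition stirling_main p := (p - 2^-1) * ln p - p.
Definition stirling_step p := (p + 2^-1) * (ln (p + 1) - ln p) - 1.

Lemma stirling_main_succ p : stirling_main (p + 1) = stirling_main p + ln p + stirling_step p.
Proof. by rewrite /stirling_main /stirling_step; field. Qed.

(** With v = 1 / (2p + 1) the step is artanh(v) / v - 1. Both bounds are differences of reciprocals,
    so that they telescope in [binet_sum_bounds]. *)
Lemma stirling_step_bounds p : 0 < p ->
  (3 * (2 * p + 1) * (2 * p + 3))^-1 <= stirling_step p <= (12 * p * (p + 1))^-1.
Proof.
move=> p0; have p1 : 0 < 2 * p + 1 by lra.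
set v := (2 * p + 1)^-1.
have v0 : 0 < v by rewrite invr_gt0.
have v1 : v < 1 by rewrite invf_lt1//; lra.
have e : ln (p + 1) - ln p = ln (1 + v) - ln (1 - v).
  rewrite -!ln_div ?posrE; [congr ln|lra|lra|lra|lra].
  rewrite /v; field.
  by rewrite !gt_eqF//; lra.
have pv : p + 2^-1 = (2 * v)^-1 by rewrite /v; field; rewrite gt_eqF.
have vI : 0 <= v < 1 by rewrite ltW.
have h1 := log_ratio_ge vI; have h2 := log_ratio_le vI.
rewrite /stirling_step e pv; apply/andP; split.
  have := ler_wpM2l (ltac:(by rewrite invr_ge0 mulr_ge0// ltW) : 0 <= (2 * v)^-1) h1.
  have -> : (2 * v)^-1 * (2 * v + 2 / 3 * v ^+ 3) = 1 + v ^+ 2 / 3.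
    by field; rewrite gt_eqF.
  have : (3 * (2 * p + 1) * (2 * p + 3))^-1 <= v ^+ 2 / 3.
    have -> : v ^+ 2 / 3 = (3 * (2 * p + 1) * (2 * p + 1))^-1.
      by rewrite /v; field; rewrite gt_eqF.
    rewrite lef_pV2 ?posrE ?mulr_gt0//; [|lra].
    by rewrite ler_wpM2l//; [rewrite mulr_ge0// ltW|lra].
  lra.
have := ler_wpM2l (ltac:(by rewrite invr_ge0 mulr_ge0// ltW) : 0 <= (2 * v)^-1) h2.
have -> : (2 * v)^-1 * (2 * v + 2 / 3 * v ^+ 3 / (1 - v ^+ 2)) = 1 + (12 * p * (p + 1))^-1.
  have d : 1 - v ^+ 2 = 4 * p * (p + 1) * v ^+ 2 by rewrite /v; field; rewrite gt_eqF.
  rewrite d; field.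
  by rewrite !gt_eqF//; lra.
lra.
Qed.

(** Its limit [binet] is Binet's function: log Gamma(p) = (p - 1/2) log p - p + (1/2) log(2 pi) +
    binet p. *)
Definition binet_sum p n := \sum_(j < n) stirling_step (p + j%:R).
Definition binet p := limn (binet_sum p).

Lemma binet_sum_bounds p n : 0 < p ->
  6^-1 * ((2 * p + 1)^-1 - (2 * p + 1 + 2 * n%:R)^-1) <= binet_sum p n <=
  12^-1 * (p^-1 - (p + n%:R)^-1).
Proof.
move=> p0; rewrite /binet_sum; elim: n => [|n /andP[h1 h2]].
  by rewrite big_ord0 !mulr0 !addr0 !subrr !mulr0 lexx.
have n0 : 0 <= n%:R :> R by rewrite ler0n.
have pn : 0 < p + n%:R by lra.
have /andP[h3 h4] := stirling_step_bounds pn.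
have e : n.+1%:R = n%:R + 1 :> R by rewrite natr1.
rewrite big_ord_recr/= e; move: n0 pn h1 h2 h3 h4; set N := n%:R => n0 pn h1 h2 h3 h4.
apply/andP; split.
  have : 6^-1 * ((2 * p + 1 + 2 * N)^-1 - (2 * p + 1 + 2 * (N + 1))^-1) =
    (3 * (2 * (p + N) + 1) * (2 * (p + N) + 3))^-1.
    by field; rewrite !gt_eqF//; lra.
  lra.
have : 12^-1 * ((p + N)^-1 - (p + (N + 1))^-1) = (12 * (p + N) * (p + N + 1))^-1.
  by field; rewrite !gt_eqF//; lra.
lra.
Qed.

Lemma binet_sum_cvg p : 0 < p -> cvgn (binet_sum p).
Proof.
move=> p0; apply: nondecreasing_is_cvgn.
  apply/nondecreasing_seqP => n; rewrite /binet_sum big_ord_recr/= lerDl.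
  have pn : 0 < p + n%:R by rewrite ltr_wpDr.
  have /andP[h _] := stirling_step_bounds pn.
  by apply: le_trans h; rewrite invr_ge0 !mulr_ge0//; lra.
exists (12^-1 * p^-1) => _ [n _ <-]; have /andP[_ h] := binet_sum_bounds n p0.
have pn : 0 < p + n%:R by rewrite ltr_wpDr.
by apply: (le_trans h); rewrite ler_wpM2l// gerBl invr_ge0 ltW.
Qed.

Lemma binetE p : 0 < p -> binet p = stirling_step p + binet (p + 1).
Proof.
move=> p0; have p1 : 0 < p + 1 by lra.
apply/cvg_lim => //; rewrite -(cvg_shiftS (binet_sum p)).
have -> : (fun n => binet_sum p n.+1) = (fun n => stirling_step p + binet_sum (p + 1) n).
  apply/funext => n; rewrite /binet_sum big_ord_recl/= addr0; congr (_ + _).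
  by apply: eq_bigr => i _; rewrite /bump /= natrD addrA.
by apply: cvgD; [exact: cvg_cst|exact: binet_sum_cvg].
Qed.

Lemma binet_le p : 0 < p -> binet p <= (12 * p)^-1.
Proof.
move=> p0; apply: limr_le; first exact: binet_sum_cvg.
near=> n; have /andP[_ h] := binet_sum_bounds n p0.
have pn : 0 < p + n%:R by rewrite ltr_wpDr.
by apply: (le_trans h); rewrite invfM ler_wpM2l// gerBl invr_ge0 ltW.
Unshelve. all: by end_near. Qed.

Lemma binet_ge p : 0 < p -> (12 * p + 6)^-1 <= binet p.
Proof.
move=> p0; rewrite -subr_le0; apply: (@le0_archimedean _ 1) => n.
have : binet_sum p n.+1 <= binet p.
  apply: nondecreasing_cvgn_le; last exact: binet_sum_cvg.
  apply/nondecreasing_seqP => k; rewrite /binet_sum big_ord_recr/= lerDl.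
  have pn : 0 < p + k%:R by rewrite ltr_wpDr.
  have /andP[h _] := stirling_step_bounds pn.
  by apply: le_trans h; rewrite invr_ge0 !mulr_ge0//; lra.
have /andP[h _] := binet_sum_bounds n.+1 p0.
have -> : (12 * p + 6)^-1 = 6^-1 * (2 * p + 1)^-1 by rewrite -invfM; congr (_^-1); ring.
have : (2 * p + 1 + 2 * n.+1%:R)^-1 <= 1 / n.+1%:R.
  rewrite div1r lef_pV2 ?posrE ?ltr0n//; have : 0 < n.+1%:R :> R by rewrite ltr0n.
    by lra.
  by lra.
have : 0 < (2 * p + 1 + 2 * n.+1%:R)^-1 by rewrite invr_gt0; have : 0 < n.+1%:R :> R by []; lra.
set T := (2 * p + 1 + _)^-1 in h *; set I := (1 / _).
set P := (2 * p + 1)^-1 in h *; lra.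
Qed.

(* Up to an additive constant this is the negative of the logarithm of the Gamma function. *)
Definition nlgamma p := - stirling_main p - binet p.

Lemma nlgammaE p : 0 < p -> nlgamma p = ln p + nlgamma (p + 1).
Proof. by move=> p0; rewrite /nlgamma stirling_main_succ (binetE p0); ring. Qed.

Lemma nlgamma_sum p n : 0 < p -> nlgamma p = \sum_(j < n) ln (p + j%:R) + nlgamma (p + n%:R).
Proof.
move=> p0; elim: n => [|n ->]; first by rewrite big_ord0 add0r addr0.
have pn : 0 < p + n%:R by rewrite ltr_wpDr.
have e : n.+1%:R = n%:R + 1 :> R by rewrite natr1.
by rewrite big_ord_recr/= (nlgammaE pn) e !addrA.
Qed.

Definition diff2 (f : R -> R) x h := f (x + h) + f (x - h) - 2 * f x.

Lemma diff2_ln q h : 0 <= h -> h < q ->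
  - (h ^+ 2 / (q ^+ 2 - h ^+ 2)) <= diff2 (@ln R) q h <= 0.
Proof.
move=> h0 hq; have q0 : 0 < q by lra.
have e : (q + h) * (q - h) = q ^+ 2 - h ^+ 2 by ring.
have d0 : 0 < q ^+ 2 - h ^+ 2 by rewrite -e mulr_gt0//; lra.
have -> : diff2 (@ln R) q h = ln (q ^+ 2 - h ^+ 2) - ln (q ^+ 2).
  rewrite /diff2 -e lnM ?posrE; [|lra|lra].
  by rewrite lnXn// mulr_natl.
have q2 : 0 < q ^+ 2 by rewrite exprn_gt0.
apply/andP; split; last by rewrite subr_le0 ler_ln ?posrE// gerBl sqr_ge0.
have := ln_sub_le q2 d0.
have -> : q ^+ 2 / (q ^+ 2 - h ^+ 2) - 1 = h ^+ 2 / (q ^+ 2 - h ^+ 2).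
  by field; rewrite gt_eqF.
lra.
Qed.

Lemma diff2_stirling_main q h : 1 <= q -> 0 <= h <= 2^-1 ->
  `|diff2 stirling_main q h| <= 4 * h ^+ 2.
Proof.
move=> q1 /andP[h0 h2].
have -> : diff2 stirling_main q h =
  (q - 2^-1) * diff2 (@ln R) q h + h * (ln (q + h) - ln (q - h)).
  by rewrite /diff2 /stirling_main; field.
have hq : h < q by lra.
have /andP[h3 h4] := diff2_ln h0 hq.
have d0 : 0 < q ^+ 2 - h ^+ 2.
  by rewrite (_ : q ^+ 2 - h ^+ 2 = (q + h) * (q - h)) ?mulr_gt0//; [lra|lra|ring].
have a0 : 0 < q + h by lra.
have b0 : 0 < q - h by lra.
have h5 := ln_sub_le a0 b0; have h6 := ln_sub_le b0 a0.
have e5 : (q + h) / (q - h) - 1 = 2 * h / (q - h) by field; rewrite gt_eqF.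
have h7 : 2 * h / (q - h) <= 4 * h.
  by rewrite ler_pdivrMr//; nra.
have h8 : ln (q + h) - ln (q - h) >= 0 by rewrite subr_ge0 ler_ln ?posrE//; lra.
have h9 : (q - 2^-1) * (h ^+ 2 / (q ^+ 2 - h ^+ 2)) <= 2 * h ^+ 2.
  rewrite mulrA ler_pdivrMr//.
  have := mulr_ge0 (sqr_ge0 h) (ltac:(rewrite !expr2; nra) : 0 <= 2 * (q ^+ 2 - h ^+ 2) - (q - 2^-1)).
  by lra.
have k1 : 0 <= q - 2^-1 by lra.
have k2 := ler_wpM2l k1 h3; have k3 := mulr_ge0_le0 k1 h4.
have k4 := mulr_ge0 h0 h8.
have k5 : h * (ln (q + h) - ln (q - h)) <= h * (4 * h) by rewrite ler_wpM2l//; lra.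
have k6 := sqr_ge0 h.
rewrite ler_norml; apply/andP; split; rewrite !expr2 in k2 h9 k6 *; lra.
Qed.

Lemma binet_ge0 p : 0 < p -> 0 <= binet p.
Proof.
by move=> p0; apply: le_trans (binet_ge p0); rewrite invr_ge0; lra.
Qed.

(** The functional equation moves the second difference to p + n + 1 at the cost of second
    differences of logarithms, whose sum telescopes to at most 2 h^2. At the far end Stirling's main
    term contributes at most 4 h^2, and [binet] is of order 1/n. *)
Lemma diff2_nlgamma p h : 1 <= p -> 0 <= h <= 2^-1 -> `|diff2 nlgamma p h| <= 6 * h ^+ 2.
Proof.
move=> p1 hI; have /andP[h0 h2] := hI.
rewrite -subr_le0; apply: (@le0_archimedean _ 1) => n.
set q := p + n.+1%:R.
have n0 : 0 < n.+1%:R :> R by rewrite ltr0n.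
have q1 : 1 <= q by rewrite /q; lra.
have p0 : 0 < p by lra. have ph : 0 < p + h by lra. have pmh : 0 < p - h by lra.
have -> : diff2 nlgamma p h = \sum_(j < n.+1) diff2 (@ln R) (p + j%:R) h + diff2 nlgamma q h.
  rewrite /diff2 (nlgamma_sum n.+1 p0) (nlgamma_sum n.+1 ph) (nlgamma_sum n.+1 pmh).
  have -> : p + h + n.+1%:R = q + h by rewrite /q; ring.
  have -> : p - h + n.+1%:R = q - h by rewrite /q; ring.
  rewrite -/q !big_split/= sumrN -mulr_sumr.
  have -> : \sum_(j < n.+1) ln (p + h + j%:R) = \sum_(j < n.+1) ln (p + j%:R + h) :> R.
    by apply: eq_bigr => j _; congr ln; ring.
  have -> : \sum_(j < n.+1) ln (p - h + j%:R) = \sum_(j < n.+1) ln (p + j%:R - h) :> R.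
    by apply: eq_bigr => j _; congr ln; ring.
  by ring.
have s1 : - (2 * h ^+ 2) <= \sum_(j < n.+1) diff2 (@ln R) (p + j%:R) h <= 0.
  apply/andP; split; last first.
    rewrite sumr_le0// => j _; have j0 : 0 <= j%:R :> R by rewrite ler0n.
    have hj : h < p + j%:R by lra.
    by have /andP[] := diff2_ln h0 hj.
  have : - (h ^+ 2 * ((p - 2^-1)^-1 - (p - 2^-1 + n.+1%:R)^-1)) <=
      \sum_(j < n.+1) diff2 (@ln R) (p + j%:R) h.
    elim: n.+1 => [|k IH]; first by rewrite big_ord0 addr0 subrr mulr0 oppr0.
    have e : k.+1%:R = k%:R + 1 :> R by rewrite natr1.
    have k0 : 0 <= k%:R :> R by rewrite ler0n.
    rewrite big_ord_recr/= e; move: k0 IH; set K := k%:R => k0 IH.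
    have hK : h < p + K by lra.
    have /andP[d _] := diff2_ln h0 hK.
    have : h ^+ 2 / ((p + K) ^+ 2 - h ^+ 2) <=
        h ^+ 2 * ((p - 2^-1 + K)^-1 - (p - 2^-1 + (K + 1))^-1).
      rewrite ler_wpM2l ?sqr_ge0//.
      have -> : (p - 2^-1 + K)^-1 - (p - 2^-1 + (K + 1))^-1 =
          ((p - 2^-1 + K) * (p + 2^-1 + K))^-1.
        by field; rewrite !gt_eqF//; lra.
      rewrite lef_pV2 ?posrE ?mulr_gt0//; [rewrite !expr2; nra|rewrite !expr2; nra|lra|lra].
    by lra.
  apply: le_trans; rewrite lerN2.
  have : (p - 2^-1)^-1 <= 2 by rewrite -[leRHS]invrK lef_pV2 ?posrE//; lra.
  have : 0 <= (p - 2^-1 + n.+1%:R)^-1 by rewrite invr_ge0; lra.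
  move=> i0 i2; rewrite [leRHS]mulrC ler_wpM2l ?sqr_ge0//; lra.
have s2 : `|diff2 nlgamma q h| <= 4 * h ^+ 2 + 1 / n.+1%:R.
  have -> : diff2 nlgamma q h = - diff2 stirling_main q h - diff2 binet q h.
    by rewrite /diff2 /nlgamma; ring.
  apply: (le_trans (ler_normB _ _)); rewrite normrN lerD//.
    exact: diff2_stirling_main.
  have b t : n.+1%:R + 2^-1 <= t -> 0 <= binet t <= 12^-1 * (1 / n.+1%:R).
    move=> ht; have t0 : 0 < t by lra.
    rewrite binet_ge0//= (le_trans (binet_le t0))// div1r -invfM lef_pV2 ?posrE ?mulr_gt0//.
    by rewrite ler_wpM2l//; lra.
  have qn : q = p + n.+1%:R by [].
  have := b (q + h) ltac:(lra); have := b (q - h) ltac:(lra); have := b q ltac:(lra).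
  rewrite /diff2; move=> /andP[b1 b2] /andP[b3 b4] /andP[b5 b6].
  move: b1 b2 b3 b4 b5 b6; move: (binet q) (binet _) (binet _) (1 / _) => u1 u2 u3 u4 *.
  by rewrite ler_norml; apply/andP; split; lra.
have /andP[s3 s4] := s1.
move: s2; rewrite ler_norml => /andP[s5 s6].
have k6 := sqr_ge0 h.
move: s3 s4 s5 s6 k6.
move: (\sum_(j < n.+1) _) (diff2 nlgamma q h) (1 / n.+1%:R) (h ^+ 2) => u1 u2 u3 u4 *.
by rewrite lerBlDr ler_norml; apply/andP; split; lra.
Qed.

End StirlingSeries.

(** * The reflection formula and the error in Stirling's formula *)

Section Reflection.
Variable R : realType.
Implicit Types (p q x h v y s : R) (n : nat).

(** The defect Fd of Legendre's formula has period 2 by the functional equation and is at most 2/y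
    at y by Stirling's formula, hence it is zero. The exponent 1/2 - x reflects the omission of
    (1/2) log(2 pi) from [nlgamma]. *)
Lemma nlgamma_duplication x : 0 < x ->
  nlgamma x = nlgamma (x / 2) + nlgamma ((x + 1) / 2) + (2^-1 - x) * ln 2.
Proof.
pose Fd x : R := nlgamma (x / 2) + nlgamma ((x + 1) / 2) + (2^-1 - x) * ln 2 - nlgamma x.
have per x0 : 0 < x0 -> Fd (x0 + 2) = Fd x0.
  move=> x00; rewrite /Fd.
  have -> : (x0 + 2) / 2 = x0 / 2 + 1 by field.
  have -> : (x0 + 2 + 1) / 2 = (x0 + 1) / 2 + 1 by field.
  have x1 : 0 < x0 + 1 by lra.
  rewrite (nlgammaE (p := x0 / 2)) ?divr_gt0// (nlgammaE (p := (x0 + 1) / 2)) ?divr_gt0//.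
  rewrite (nlgammaE x00) (nlgammaE x1) !ln_div ?posrE//.
  have -> : x0 + 1 + 1 = x0 + 2 by ring.
  by ring.
have pern n x0 : 0 < x0 -> Fd (x0 + 2 * n%:R) = Fd x0.
  move=> x00; elim: n => [|n IH]; first by rewrite mulr0 addr0.
  have n0 : 0 <= n%:R :> R by rewrite ler0n.
  have e : n.+1%:R = n%:R + 1 :> R by rewrite natr1.
  by rewrite -IH -[RHS]per ?e; [congr Fd; ring|lra].
have small y : 1 <= y -> `|Fd y| <= 2 / y.
  move=> y1; have y0 : 0 < y by lra.
  have -> : Fd y = 2^-1 - y / 2 * (ln (y + 1) - ln y) - binet (y / 2) - binet ((y + 1) / 2) + binet y.
    rewrite /Fd /nlgamma /stirling_main !ln_div ?posrE//; last by lra.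
    by field.
  have y10 : 0 < y + 1 by clear -y0; lra.
  have h1 := @ln_sub_le _ (y + 1) y y10 y0.
  have h2 := @ln_sub_le _ y (y + 1) y0 y10.
  have e1 : (y + 1) / y - 1 = y^-1 by field; rewrite gt_eqF.
  have e2 : y / (y + 1) - 1 = - (y + 1)^-1 by field; rewrite !gt_eqF.
  rewrite e1 in h1; rewrite e2 in h2.
  have yh : 0 < y / 2 by rewrite divr_gt0.
  have yh1 : 0 < (y + 1) / 2 by rewrite divr_gt0.
  have b1 := binet_ge0 yh; have b2 := binet_le yh.
  have b3 := binet_ge0 yh1; have b4 := binet_le yh1.
  have b5 := binet_ge0 y0; have b6 := binet_le y0.
  have c2 : (12 * (y / 2))^-1 = 6^-1 * y^-1 by field; rewrite gt_eqF.
  have c4 : (12 * ((y + 1) / 2))^-1 <= 6^-1 * y^-1.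
    by rewrite -c2; clear -y0; rewrite lef_pV2 ?posrE; lra.
  have c6 : (12 * y)^-1 = 12^-1 * y^-1 by rewrite invfM.
  have i0 : 0 < y^-1 by rewrite invr_gt0.
  have k1 : y / 2 * (ln (y + 1) - ln y) <= 2^-1.
    have := ler_wpM2l (ltW yh) h1.
    by have -> : y / 2 * y^-1 = 2^-1 by field; rewrite gt_eqF.
  have k2 : 2^-1 - y^-1 <= y / 2 * (ln (y + 1) - ln y).
    have h3 : (y + 1)^-1 <= ln (y + 1) - ln y by clear -h2; lra.
    have := ler_wpM2l (ltW yh) h3.
    have -> : y / 2 / (y + 1) = 2^-1 - 2^-1 * (y + 1)^-1 by field; rewrite gt_eqF.
    have : (y + 1)^-1 <= y^-1 by rewrite lef_pV2 ?posrE// lerDl.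
    have : 0 < (y + 1)^-1 by rewrite invr_gt0.
    move: (y / 2 * _) => u; clear; lra.
  rewrite c2 in b2; rewrite c6 in b6; have b4' := le_trans b4 c4.
  move: k1 k2 b1 b2 b3 b4' b5 b6 i0.
  move: (y^-1) (binet y) (binet (y / 2)) (binet ((y + 1) / 2)) (y / 2 * _) => u1 u2 u3 u4 u5; clear=> *.
  by rewrite ler_norml; apply/andP; split; lra.
move=> x0; suff : Fd x = 0 by rewrite /Fd; lra.
apply/eqP; rewrite -normr_le0; apply: (@le0_archimedean _ _ 1) => n.
have n0 : 0 < n.+1%:R :> R by rewrite ltr0n.
rewrite -(pern n.+1)//; apply: (le_trans (small _ _)).
  by have : 1 <= n.+1%:R :> R by [rewrite ler1n]; lra.
by rewrite ler_pdivlMr// mulrAC ler_pdivrMr; lra.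
Qed.

Lemma sin_le_id y : 0 <= y -> sin y <= y.
Proof.
move=> y0; rewrite -subr_ge0.
have := @derive_ge0_le R (fun t => t + - sin t) (fun t => 1 + - cos t) 0 y y0.
rewrite sin0 subrr; apply => t _.
by rewrite subr_ge0 cos_le1.
Qed.

Lemma cos_ge_parabola y : 0 <= y -> 1 - y ^+ 2 / 2 <= cos y.
Proof.
move=> y0; have := @derive_ge0_le R (fun t => cos t + 2^-1 * (t * t)) (fun t => - sin t + t) 0 y y0.
have d t : is_derive t (1 : R) (fun t : R => cos t + 2^-1 * (t * t)) (- sin t + t).
  apply: d1_eq (d1_add (is_derive_cos t) (d1_mul (d1_cst 2^-1 t) (d1_mul (d1_id t) (d1_id t)))) _.
  by field.
move=> /(_ (fun t _ => d t)) h; have : cos 0 + 2^-1 * (0 * 0) <= cos y + 2^-1 * (y * y).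
  by apply: h => t /andP[t0 _]; rewrite addrC subr_ge0 sin_le_id.
by rewrite cos0 expr2; lra.
Qed.

Lemma sin_ge_cubic y : 0 <= y -> y - y ^+ 3 / 6 <= sin y.
Proof.
move=> y0; have := @derive_ge0_le R (fun t => sin t + (6^-1 * (t * (t * t)) + - t))
  (fun t => cos t + t ^+ 2 / 2 - 1) 0 y y0.
have d t : is_derive t (1 : R) (fun t : R => sin t + (6^-1 * (t * (t * t)) + - t)) (cos t + t ^+ 2 / 2 - 1).
  apply: d1_eq (d1_add (is_derive_sin t) (d1_add (d1_mul (d1_cst 6^-1 t) (d1_mul (d1_id t) (d1_mul (d1_id t) (d1_id t)))) (d1_opp (d1_id t)))) _.
  by field.
move=> /(_ (fun t _ => d t)) h; have : sin 0 + (6^-1 * (0 * (0 * 0)) + - 0) <= sin y + (6^-1 * (y * (y * y)) + - y).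
  by apply: h => t /andP[t0 _]; have := cos_ge_parabola t0; lra.
by rewrite sin0 !exprS expr0 mulr1; lra.
Qed.

Lemma sin_ratio_bounds x h : 0 < x <= 2^-1 -> 0 <= h <= x ->
  h ^+ 2 / x ^+ 2 - 6 * h ^+ 2 <= sin (pi * h) ^+ 2 / sin (pi * x) ^+ 2 <= h ^+ 2 / x ^+ 2 + 48 * h ^+ 2.
Proof.
move=> /andP[x0 x1] /andP[h0 hx].
have pi2 : 2 <= pi :> R := pi_ge2 R.
have pi0 : 0 < pi :> R := pi_gt0 R.
have pi4 : pi <= 4 :> R by have := pihalf_lt2 R; lra.
have a0 : 0 <= pi * h by rewrite mulr_ge0// (le_trans _ pi2).
have b0 : 0 < pi * x by rewrite mulr_gt0// (lt_le_trans _ pi2).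
have b2 : pi * x <= 2 by clear -x0 x1 pi4; nra.
have sh := sin_le_id a0; have sx := sin_le_id (ltW b0).
have sh' := sin_ge_cubic a0; have sx' := sin_ge_cubic (ltW b0).
set t := (pi * x) ^+ 2 / 6; set r := (pi * h) ^+ 2 / 6.
have px : 0 <= (pi * x) <= 2 by rewrite b2 ltW.
have tI : 0 <= t <= 2 / 3.
  by rewrite /t; apply/andP; split; rewrite expr2; clear -px; nra.
have sx0 : pi * x * (1 - t) <= sin (pi * x).
  by apply: le_trans sx'; rewrite /t !exprS expr0 !mulr1; clear; lra.
have sh0 : pi * h * (1 - r) <= sin (pi * h).
  by apply: le_trans sh'; rewrite /r !exprS expr0 !mulr1; clear; lra.
have /andP[t0 t1] := tI.
have t1' : 0 < 1 - t by clear -t1; lra.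
have spos : 0 < sin (pi * x) by apply: lt_le_trans sx0; rewrite mulr_gt0.
have shpos : 0 <= sin (pi * h).
  by rewrite sin_ge0_pi// a0/= -[leRHS]mulr1 ler_wpM2l//; clear -pi2 hx x1; lra.
have p16 : pi ^+ 2 <= 16 :> R by rewrite expr2; clear -pi2 pi4; nra.
have tx : t <= 8 / 3 * x ^+ 2.
  by rewrite /t exprMn; have := ler_wpM2r (sqr_ge0 x) p16; clear; lra.
have rx : r <= 8 / 3 * h ^+ 2.
  by rewrite /r exprMn; have := ler_wpM2r (sqr_ge0 h) p16; clear; lra.
have r0 : 0 <= r by rewrite /r divr_ge0 ?sqr_ge0.
have s20 : 0 < sin (pi * x) ^+ 2 by rewrite exprn_gt0.
have x20 : 0 < x ^+ 2 by rewrite exprn_gt0.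
have h20 : 0 <= h ^+ 2 by rewrite sqr_ge0.
have hxr : h ^+ 2 / x ^+ 2 <= 1 by rewrite ler_pdivrMr// mul1r ler_sqr ?nnegrE// ltW.
have hxr0 : 0 <= h ^+ 2 / x ^+ 2 by rewrite divr_ge0// ltW.
have p20 : 0 < pi ^+ 2 :> R by rewrite exprn_gt0// (lt_le_trans _ pi2).
apply/andP; split.
  have h1 : sin (pi * h) ^+ 2 / (pi * x) ^+ 2 <= sin (pi * h) ^+ 2 / sin (pi * x) ^+ 2.
    rewrite ler_wpM2l ?sqr_ge0// lef_pV2 ?posrE ?exprn_gt0//.
    by rewrite ler_sqr ?nnegrE//; exact: ltW.
  apply: le_trans h1.
  have [r1|r1] := leP r 1; last first.
    apply: (@le_trans _ _ 0); last by rewrite divr_ge0 ?sqr_ge0.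
    by clear -r1 rx hxr hxr0 h20; nra.
  have h2 : (pi * h * (1 - r)) ^+ 2 / (pi * x) ^+ 2 <= sin (pi * h) ^+ 2 / (pi * x) ^+ 2.
    rewrite ler_pM2r ?invr_gt0 ?exprn_gt0//.
    by rewrite ler_sqr ?nnegrE// mulr_ge0// subr_ge0.
  apply: le_trans h2.
  have -> : (pi * h * (1 - r)) ^+ 2 / (pi * x) ^+ 2 = h ^+ 2 / x ^+ 2 * (1 - r) ^+ 2.
    by move: (pi : R) pi0 => P ?; field; rewrite !gt_eqF.
  move: hxr hxr0 rx r0 r1 h20; move: (h ^+ 2 / x ^+ 2) (h ^+ 2) => u w.
  by clear; rewrite expr2 => *; nra.
have h1 : sin (pi * h) ^+ 2 / sin (pi * x) ^+ 2 <= (pi * h) ^+ 2 / (pi * x * (1 - t)) ^+ 2.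
  apply: ler_pM; rewrite ?sqr_ge0 ?invr_ge0 ?sqr_ge0//.
    by rewrite ler_sqr ?nnegrE.
  rewrite lef_pV2 ?posrE ?exprn_gt0 ?(mulr_gt0 b0)//.
  by rewrite ler_sqr// nnegrE ?(ltW spos)// mulr_ge0// ltW.
apply: (le_trans h1).
have -> : (pi * h) ^+ 2 / (pi * x * (1 - t)) ^+ 2 = h ^+ 2 / x ^+ 2 + h ^+ 2 / x ^+ 2 * (t * (2 - t) / (1 - t) ^+ 2).
  by move: (pi : R) pi0 => P ?; field; rewrite !gt_eqF.
rewrite lerD2l.
have h2 : t * (2 - t) / (1 - t) ^+ 2 <= 18 * t.
  rewrite ler_pdivrMr ?exprn_gt0//.
  have : (3^-1) ^+ 2 <= (1 - t) ^+ 2 by clear -t1; rewrite ler_sqr ?nnegrE//; lra.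
  by clear -t0 t1; rewrite !expr2; nra.
have h3 : t * (2 - t) / (1 - t) ^+ 2 <= 48 * x ^+ 2 by clear -h2 tx; lra.
have := ler_wpM2l hxr0 h3.
by have -> : h ^+ 2 / x ^+ 2 * (48 * x ^+ 2) = 48 * h ^+ 2 by field; rewrite gt_eqF.
Qed.

(** The defect of the reflection formula. It is symmetric under x -> 1 - x, satisfies D(x) = D(x/2)
    + D((x+1)/2), and has second differences of size h^2; these three properties force it to
    vanish. *)
Let D x : R := nlgamma x + nlgamma (1 - x) - ln (2 * sin (pi * x)).

Let sin_gt0 x : 0 < x < 1 -> 0 < sin (pi * x).
Proof.
move=> /andP[x0 x1]; rewrite sin_gt0_pi// mulr_gt0 ?pi_gt0//=.
by rewrite -[ltRHS]mulr1 ltr_pM2l ?pi_gt0.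
Qed.

Let DC x : D (1 - x) = D x.
Proof.
rewrite /D (_ : 1 - (1 - x) = x); last by ring.
rewrite (_ : pi * (1 - x) = - (pi * x) + pi); last by ring.
by rewrite sinDpi sinN opprK [nlgamma (1 - x) + _]addrC.
Qed.

Let DE x : 0 < x < 1 -> D x = D (x / 2) + D ((x + 1) / 2).
Proof.
move=> xI; have /andP[x0 x1] := xI; rewrite /D.
have y0 : 0 < 1 - x by lra.
rewrite (nlgamma_duplication x0) (nlgamma_duplication y0).
have -> : (1 - x) / 2 = 1 - (x + 1) / 2 by field.
have -> : (1 - x + 1) / 2 = 1 - x / 2 by field.
have -> : 2 * sin (pi * x) = (2 * sin (pi * (x / 2))) * (2 * sin (pi * ((x + 1) / 2))).
  have -> : pi * x = (pi * (x / 2)) *+ 2 by rewrite -mulr_natl; field.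
  have -> : pi * ((x + 1) / 2) = pi * (x / 2) + pi / 2 by field.
  by rewrite sin_mulr2n sinDpihalf -mulr_natl; ring.
have s1 : 0 < sin (pi * (x / 2)) by apply: sin_gt0; lra.
have s2 : 0 < sin (pi * ((x + 1) / 2)) by apply: sin_gt0; lra.
rewrite lnM ?posrE ?mulr_gt0//.
by field.
Qed.

(** One use of the functional equation moves [nlgamma] to arguments at least 1, where
    [diff2_nlgamma] applies. The logarithm split off at 0 cancels the singularity of log sin up to a
    multiple of h^2, and the one at 1 - x is regular for x <= 1/2. *)
Let diff2_D_near0 x h : 0 < x <= 2^-1 -> 0 <= h <= x / 2 -> h <= 20^-1 ->
  `|diff2 D x h| <= 1000 * h ^+ 2.
Proof.
move=> xI /andP[h0 hx] h20; have /andP[x0 x1] := xI.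
have hI : 0 <= h <= 2^-1 by rewrite h0; lra.
have hxI : 0 <= h <= x by rewrite h0; lra.
have := diff2_nlgamma (ltac:(lra) : 1 <= x + 1) hI.
have := diff2_nlgamma (ltac:(lra) : 1 <= 2 - x) hI.
have /andP[A1 A2] := sin_ratio_bounds xI hxI.
set A := _ / sin (pi * x) ^+ 2 in A1 A2.
set v := h ^+ 2 / x ^+ 2 in A1 A2.
set w := h ^+ 2 / (1 - x) ^+ 2.
have x20 : 0 < x ^+ 2 by rewrite exprn_gt0.
have y20 : 0 < (1 - x) ^+ 2 by rewrite exprn_gt0//; lra.
have h2 : 0 <= h ^+ 2 by rewrite sqr_ge0.
have h2' : h ^+ 2 <= 400^-1.
  by rewrite (_ : 400^-1 = 20^-1 ^+ 2) ?ler_sqr ?nnegrE//; field.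
have v0 : 0 <= v by rewrite divr_ge0// ltW.
have v4 : v <= 4^-1.
  by rewrite ler_pdivrMr// (_ : 4^-1 * x ^+ 2 = (x / 2) ^+ 2) ?ler_sqr ?nnegrE//; [lra|field].
have w0 : 0 <= w by rewrite divr_ge0// ltW.
have w4 : w <= 4 * h ^+ 2.
  rewrite ler_pdivrMr//; clear -x1 h2; have : 2^-1 ^+ 2 <= (1 - x) ^+ 2 by rewrite ler_sqr ?nnegrE//; lra.
  by rewrite !expr2 in h2 *; nra.
have e : diff2 D x h = diff2 (@nlgamma R) (x + 1) h + diff2 (@nlgamma R) (2 - x) h
    + (ln (1 - v) - ln (1 - A)) + ln (1 - w).
  clear A1 A2 v4 w4 v0 w0 h2 h2' x20 y20 hxI hI xI h20.
  have s0 : 0 < sin (pi * x) by apply: sin_gt0; lra.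
  have sp : 0 < sin (pi * (x + h)) by apply: sin_gt0; lra.
  have sm : 0 < sin (pi * (x - h)) by apply: sin_gt0; lra.
  have eA : ln (1 - A) = ln (sin (pi * (x + h))) + ln (sin (pi * (x - h))) - 2 * ln (sin (pi * x)).
    rewrite mulr_natl -lnXn// -lnM ?posrE// -ln_div ?posrE ?mulr_gt0 ?exprn_gt0//.
    congr ln; rewrite /A mulrDr mulrBr sinD sinB.
    have : cos (pi * x) ^+ 2 = 1 - sin (pi * x) ^+ 2 by rewrite cos2sin2.
    have : cos (pi * h) ^+ 2 = 1 - sin (pi * h) ^+ 2 by rewrite cos2sin2.
    move: (cos (pi * x)) (cos (pi * h)) s0; set S := sin (pi * x); set T := sin (pi * h).
    move=> c d s0 e1 e2.
    have -> : (S * d + c * T) * (S * d - c * T) = S ^+ 2 * d ^+ 2 - c ^+ 2 * T ^+ 2 by ring.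
    by rewrite e1 e2; field; rewrite gt_eqF.
  have ev : ln (1 - v) = ln (x + h) + ln (x - h) - 2 * ln x.
    have a1 : 0 < x + h by lra.
    have a2 : 0 < x - h by lra.
    rewrite mulr_natl -lnXn// -lnM ?posrE// -ln_div ?posrE ?mulr_gt0 ?exprn_gt0//.
    by congr ln; rewrite /v; field; rewrite gt_eqF.
  have ew : ln (1 - w) = ln (1 - x - h) + ln (1 - x + h) - 2 * ln (1 - x).
    rewrite mulr_natl -lnXn; last lra.
    have a0 : 0 < 1 - x by lra.
    have a1 : 0 < 1 - x - h by lra.
    have a2 : 0 < 1 - x + h by lra.
    rewrite -lnM ?posrE// -ln_div ?posrE ?mulr_gt0//.
    by congr ln; rewrite /w; field; rewrite gt_eqF//; lra.
  rewrite eA ev ew /diff2 /D.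
  rewrite !lnM ?posrE//.
  rewrite (nlgammaE x0) (@nlgammaE _ (x + h)); last lra.
  rewrite (@nlgammaE _ (x - h)); last lra.
  rewrite (@nlgammaE _ (1 - (x + h))); last lra.
  rewrite (@nlgammaE _ (1 - (x - h))); last lra.
  rewrite (@nlgammaE _ (1 - x)); last lra.
  have -> : x + h + 1 = x + 1 + h by ring.
  have -> : x - h + 1 = x + 1 - h by ring.
  have -> : 1 - (x + h) + 1 = 2 - x - h by ring.
  have -> : 1 - (x - h) + 1 = 2 - x + h by ring.
  have -> : 1 - x + 1 = 2 - x by ring.
  have -> : 1 - (x + h) = 1 - x - h by ring.
  have -> : 1 - (x - h) = 1 - x + h by ring.
  by ring.
have A3 : A <= 2^-1 by clear -A2 v4 h2'; lra.
have q1 : 0 < 1 - v by clear -v4; lra.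
have q2 : 0 < 1 - A by clear -A3; lra.
have w2 : w <= 2^-1 by clear -w4 h2'; lra.
have q3 : 0 < 1 - w by clear -w2; lra.
have i1 := ln_sub_le q1 q2; have i2 := ln_sub_le q2 q1.
have j1 : (1 - v) / (1 - A) - 1 <= 96 * h ^+ 2.
  by rewrite lerBlDr ler_pdivrMr//; clear -A2 A3 h2; nra.
have j2 : (1 - A) / (1 - v) - 1 <= 96 * h ^+ 2.
  by rewrite lerBlDr ler_pdivrMr//; clear -A1 v4 h2; nra.
have k1 : ln (1 - w) <= 0 by rewrite ln_le0//; clear -w0; lra.
have := ln_sub_le (@ltr01 R) q3; rewrite ln1 => k2.
have j3 : 1 / (1 - w) - 1 <= 8 * h ^+ 2.
  by rewrite lerBlDr ler_pdivrMr//; clear -w2 w4 h2; nra.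
rewrite e; move: i1 i2 j1 j2 k1 k2 j3 h2.
move: (ln (1 - v)) (ln (1 - A)) (ln (1 - w)) (_ / _) (_ / _) (_ / _) (h ^+ 2) => u1 u2 u3 u4 u5 u6 u7.
move: (diff2 _ _ _) (diff2 _ _ _) => u8 u9.
clear; move=> ? ? ? ? ? ? ? ?; rewrite !ler_norml => /andP[? ?] /andP[? ?]; apply/andP; split; lra.
Qed.

Let diff2_D x h : 0 < x < 1 -> 0 <= h -> h <= x / 2 -> h <= (1 - x) / 2 -> h <= 20^-1 ->
  `|diff2 D x h| <= 1000 * h ^+ 2.
Proof.
move=> /andP[x0 x1] h0 h1 h2 h3; have [x2|x2] := leP x 2^-1.
  by apply: diff2_D_near0; rewrite ?x0 ?h0.
have -> : diff2 D x h = diff2 D (1 - x) h.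
  rewrite /diff2 DC -[D (1 - x + h)]DC -[D (1 - x - h)]DC.
  have -> : 1 - (1 - x + h) = x - h by ring.
  have -> : 1 - (1 - x - h) = x + h by ring.
  by ring.
by apply: diff2_D_near0; rewrite ?h0 ?h2//; lra.
Qed.

(** Herglotz's trick: the duplication relation writes a second difference of step h as two of step
    h/2, so a bound K h^2 improves to K h^2 / 2, and so on indefinitely. *)
Let diff2_D0 x h : 0 < x < 1 -> 0 <= h -> h <= x / 2 -> h <= (1 - x) / 2 -> h <= 20^-1 ->
  diff2 D x h = 0.
Proof.
have H n : forall x h, 0 < x < 1 -> 0 <= h -> h <= x / 2 -> h <= (1 - x) / 2 -> h <= 20^-1 ->
    `|diff2 D x h| <= 1000 / 2 ^+ n * h ^+ 2.
  elim: n => [|n IH] {}x {}h xI h0 h1 h2 h3; first by rewrite expr0 divr1 diff2_D.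
  have /andP[x0 x1] := xI.
  have -> : diff2 D x h = diff2 D (x / 2) (h / 2) + diff2 D ((x + 1) / 2) (h / 2).
    rewrite /diff2 (DE xI) (@DE (x + h)) ?(@DE (x - h)); [|lra|lra].
    have -> : (x + h + 1) / 2 = (x + 1) / 2 + h / 2 by field.
    have -> : (x - h + 1) / 2 = (x + 1) / 2 - h / 2 by field.
    by rewrite mulrDl mulrBl; ring.
  apply: (le_trans (ler_normD _ _)).
  have -> : 1000 / 2 ^+ n.+1 * h ^+ 2 = 1000 / 2 ^+ n * (h / 2) ^+ 2 + 1000 / 2 ^+ n * (h / 2) ^+ 2.
    by rewrite exprS; field; rewrite expf_neq0.
  by apply: lerD; apply: IH; lra.
move=> xI h0 h1 h2 h3; apply/eqP; rewrite -normr_le0.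
apply: (@le0_archimedean _ _ (1000 * h ^+ 2)) => n; apply: (le_trans (H n _ _ xI h0 h1 h2 h3)).
rewrite [leLHS]mulrAC; apply: ler_wpM2l; first by apply: mulr_ge0; [exact: ler0n|exact: sqr_ge0].
rewrite lef_pV2 ?posrE ?exprn_gt0 ?ltr0n//.
by rewrite -natrX ler_nat ltn_expl.
Qed.

Lemma nlgamma_reflection x : 0 < x < 1 -> nlgamma x + nlgamma (1 - x) = ln (2 * sin (pi * x)).
Proof.
(* A second difference of step h combines those of step h/2 at x and x +- h/2, so its vanishing
   spreads by doubling to all steps that stay m0 away from the ends. *)
have lift n : forall m0 x h, 0 < m0 -> m0 <= x - h -> x + h <= 1 - m0 -> 0 <= h ->
    h <= 2 ^+ n * (m0 / 2) -> h <= 2 ^+ n * 20^-1 -> diff2 D x h = 0.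
  elim: n => [|n IH] m0 {}x h m00 h1 h2 h0 h3 h4.
    by rewrite !expr0 !mul1r in h3 h4; apply: diff2_D0; lra.
  have -> : diff2 D x h = diff2 D (x + h / 2) (h / 2) + 2 * diff2 D x (h / 2) + diff2 D (x - h / 2) (h / 2).
    rewrite /diff2.
    have -> : x + h / 2 + h / 2 = x + h by field.
    have -> : x + h / 2 - h / 2 = x by field.
    have -> : x - h / 2 + h / 2 = x by field.
    have -> : x - h / 2 - h / 2 = x - h by field.
    by ring.
  rewrite !exprS -!mulrA in h3 h4.
  by rewrite !(IH m0) ?mulr0 ?addr0//; clear -h0 h1 h2 h3 h4 m00; lra.
(* A second difference centred at 1/2 reads D(z) + D(1 - z) = 2 D(1/2), and D(1 - z) = D(z). Once D
   is constant, the duplication relation says that the constant is twice itself. *)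
have const y : 0 < y < 1 -> D y = D 2^-1.
  have main z : 2^-1 <= z < 1 -> D z = D 2^-1.
    move=> /andP[z1 z2]; have z0 : 0 < 1 - z by lra.
    have := @lift (Num.truncn (z / ((1 - z) / 2)) + 20)%N (1 - z) 2^-1 (z - 2^-1) z0.
    set n := (_ + 20)%N.
    have n1 : n%:R <= 2 ^+ n :> R by rewrite -natrX ler_nat ltnW// ltn_expl.
    have n2 : z / ((1 - z) / 2) <= n%:R.
      have zz : 0 <= z / ((1 - z) / 2) by rewrite divr_ge0//; lra.
      have /andP[_ /ltW h] := truncn_itv zz.
      by apply: (le_trans h); rewrite ler_nat /n -addn1 leq_add2l.
    have n3 : 20 <= n%:R :> R by rewrite ler_nat leq_addl.
    rewrite /diff2 => h; have : D (2^-1 + (z - 2^-1)) + D (2^-1 - (z - 2^-1)) - 2 * D 2^-1 = 0.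
      apply: h; [lra|lra|lra| |].
        have n4 := le_trans n2 n1; rewrite ler_pdivrMr in n4; last by lra.
        by lra.
      by have := le_trans n3 n1; lra.
    have -> : 2^-1 + (z - 2^-1) = z by ring.
    have -> : 2^-1 - (z - 2^-1) = 1 - z by field.
    by rewrite DC; lra.
  move=> /andP[y0 y1]; have [h|h] := leP 2^-1 y; first by apply: main; rewrite h.
  by rewrite -DC; apply: main; lra.
move=> xI; have := DE xI; have /andP[x0 x1] := xI.
rewrite (const x)// (const (x / 2)) ?(const ((x + 1) / 2)); [|lra|lra].
move=> c0; have : D x = 0 by rewrite (const x)//; lra.
by rewrite /D; lra.
Qed.

(** The error made when log Gamma(X + s), up to the constant (1/2) log(2 pi), is replaced by (X + s
    - 1/2) log X - X, with the logarithm taken at the cutoff X. *)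
Definition stirling_excess X s : R :=
  (X + s - 2^-1) * (ln (X + s) - ln X) - s + binet (X + s).

(** With [binet] replaced by its upper bound the error u is convex in s, so it lies below the chords
    through s = 0, 1/2, 1. There it is at most 1 / (12 X), 0 and 1 / (12 X), and the parabola on the
    right dominates these chords. *)
Lemma stirling_excess_le (X s : R) : 0 < X -> 0 <= s <= 1 ->
  stirling_excess X s <= (1 - s * (1 - s)) / (12 * X).
Proof.
move=> X0 /andP[s0 s1]; have Xs : 0 < X + s by lra.
pose u s := (X + s - 2^-1) * (ln (X + s) - ln X) - s + (12 * (X + s))^-1.
pose u1 s := (ln (X + s) - ln X) + (X + s - 2^-1) / (X + s) - 1 - (12 * (X + s) ^+ 2)^-1.
have du (t : R) : 0 <= t <= 1 -> is_derive t (1 : R) u (u1 t).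
  move=> /andP[t0 t1]; have Xt : 0 < X + t by lra.
  have dl : is_derive t (1 : R) (fun t => X + t) 1.
    by apply: d1_eq (d1_add (d1_cst X t) (d1_id t)) _; rewrite add0r.
  have di := @d1_inv _ (fun t => 12 * (X + t)) t _ ltac:(by rewrite mulf_neq0// gt_eqF) (d1_mul (d1_cst 12 t) dl).
  apply: d1_eq (d1_add (d1_add (d1_mul (d1_add dl (d1_cst _ t)) (d1_add (d1_ln Xt dl) (d1_cst _ t))) (d1_opp (d1_id t))) di) _.
  by rewrite /u1; field; rewrite gt_eqF.
have mono (t t' : R) : 0 <= t -> t <= t' -> t' <= 1 -> u1 t <= u1 t'.
  move=> t0 tt' t1'.
  have Xt : 0 < X + t by lra.
  have Xt' : 0 < X + t' by lra.
  have l1 : ln (X + t) <= ln (X + t') by rewrite ler_ln ?posrE//; lra.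
  have l2 : (X + t')^-1 <= (X + t)^-1 by rewrite lef_pV2 ?posrE//; lra.
  have l3 : (12 * (X + t') ^+ 2)^-1 <= (12 * (X + t) ^+ 2)^-1.
    rewrite lef_pV2 ?posrE ?mulr_gt0 ?exprn_gt0// ler_wpM2l// ler_sqr ?nnegrE; lra.
  have e y : 0 < X + y -> (X + y - 2^-1) / (X + y) = 1 - (X + y)^-1 / 2.
    by move=> ?; field; rewrite gt_eqF.
  rewrite /u1 (e t)// (e t')//; lra.
have cv (a b : R) : 0 <= a -> a <= s -> s <= b -> b <= 1 -> (b - a) * u s <= (b - s) * u a + (s - a) * u b.
  move=> a0 as_ sb b1.
  have sI : 0 <= s <= 1 by lra.
  have h1 := convex_tangent du mono sI (ltac:(lra) : 0 <= a <= 1).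
  have h2 := convex_tangent du mono sI (ltac:(lra) : 0 <= b <= 1).
  have := ler_wpM2l (ltac:(lra) : 0 <= b - s) h1.
  have := ler_wpM2l (ltac:(lra) : 0 <= s - a) h2.
  by lra.
have us : stirling_excess X s <= u s by rewrite /stirling_excess lerD2l binet_le.
have u0 : u 0 = (12 * X)^-1 by rewrite /u addr0 subrr; ring.
have uh : u 2^-1 <= 0.
  pose v := (2 * X)^-1.
  have v0 : 0 < v by rewrite invr_gt0 mulr_gt0.
  have := @derive_ge0_le R (fun t => t + - (3^-1 * (t * t) * (1 + t)^-1) + - ln (1 + t))
    (fun t => (t + 2 * t ^+ 2) / (3 * (1 + t) ^+ 2)) 0 v (ltW v0).
  rewrite !mulr0 mul0r addr0 ln1 oppr0 !addr0 => h.
  have {}h : 0 <= v + - (3^-1 * (v * v) * (1 + v)^-1) + - ln (1 + v).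
    apply: h => t /andP[t0 tv]; last first.
      by rewrite divr_ge0 ?mulr_ge0 ?addr_ge0 ?mulr_ge0 ?sqr_ge0.
    have t10 : 0 < 1 + t by lra.
    have dl : is_derive t (1 : R) (fun t => 1 + t) 1.
      by apply: d1_eq (d1_add (d1_cst 1 t) (d1_id t)) _; rewrite add0r.
    have di := @d1_inv _ (fun t => 1 + t) t _ ltac:(by rewrite gt_eqF) dl.
    apply: d1_eq (d1_add (d1_add (d1_id t) (d1_opp (d1_mul (d1_mul (d1_cst 3^-1 t) (d1_mul (d1_id t) (d1_id t))) di))) (d1_opp (d1_ln t10 dl))) _.
    by field; rewrite gt_eqF.
  have eX : ln (X + 2^-1) - ln X = ln (1 + v).
    rewrite -ln_div ?posrE//; last lra.
    by congr ln; rewrite /v; field; rewrite gt_eqF.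
  rewrite /u eX.
  have h' : ln (1 + v) <= v - 3^-1 * (v * v) * (1 + v)^-1 by lra.
  have := ler_wpM2l (ltW X0) h'.
  have -> : X * (v - 3^-1 * (v * v) * (1 + v)^-1) = 2^-1 - (12 * (X + 2^-1))^-1.
    by rewrite /v; field; rewrite !gt_eqF//; lra.
  by rewrite addrK; lra.
have u1' : u 1 <= (12 * X)^-1.
  have := stirling_step_bounds X0; rewrite /stirling_step => /andP[_ h].
  have e1 : (12 * X)^-1 = (12 * X * (X + 1))^-1 + (12 * (X + 1))^-1.
    by field; rewrite !gt_eqF//; lra.
  by rewrite /u e1 (_ : X + 1 - 2^-1 = X + 2^-1); [lra|field].
have i0 : 0 < (12 * X)^-1 by rewrite invr_gt0 mulr_gt0.
apply: (le_trans us); have [h|h] := leP s 2^-1.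
  have := cv 0 2^-1 (lexx _) s0 h ltac:(lra).
  rewrite u0; have := mulr_ge0_le0 (ltac:(lra) : 0 <= s - 0) uh; move: i0.
  move: (u s) (u 2^-1) ((12 * X)^-1) => y1 y2 y3 *.
  have : 0 <= y3 * (s * (1 + s)) by clear cv; rewrite !mulr_ge0//; lra.
  by lra.
have := cv 2^-1 1 ltac:(lra) (ltW h) s1 (lexx _).
have k1 := mulr_ge0_le0 (ltac:(lra) : 0 <= 1 - s) uh.
have k2 := ler_wpM2l (ltac:(lra) : 0 <= s - 2^-1) u1'.
move: k1 k2 i0; move: (u s) (u 2^-1) (u 1) ((12 * X)^-1) => y1 y2 y4 y3 *.
have : 0 <= y3 * ((1 - s) * (2 - s)) by rewrite !mulr_ge0//; lra.
by lra.
Qed.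

(** The constant 16 comes from the range X + s < 1/2, where a linear bound of the logarithm leaves
    exactly - 1 / (16 X) + (s - 1/4)^2 / X. For larger X + s the first term of the artanh series and
    the lower bound of [binet] suffice. *)
Lemma stirling_excess_ge (X s : R) : 0 < X -> 0 <= s <= 1 -> - (16 * X)^-1 <= stirling_excess X s.
Proof.
move=> X0 /andP[s0 s1]; have Xs : 0 < X + s by lra.
have [h|h] := leP 2^-1 (X + s).
  have b := binet_ge Xs.
  have v0 : 0 <= s / (2 * X + s) < 1 by rewrite divr_ge0//= ?ltr_pdivrMr; lra.
  have := log_ratio_ge v0; set v := s / _ in v0 *.
  have /andP[v1 v2] := v0.
  have e : ln (X + s) - ln X = ln (1 + v) - ln (1 - v).
    rewrite -!ln_div ?posrE//; [|lra|lra].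
    by congr ln; rewrite /v; field; rewrite !gt_eqF//; lra.
  rewrite -e => l; have : 2 * v <= ln (X + s) - ln X.
    by have := exprn_ge0 3 v1; lra.
  move=> {}l; have := ler_wpM2l (ltac:(lra) : 0 <= X + s - 2^-1) l.
  rewrite /stirling_excess => l'.
  suff : s - (X + s - 2^-1) * (2 * v) <= (16 * X)^-1 + (12 * (X + s) + 6)^-1 by lra.
  have -> : s - (X + s - 2^-1) * (2 * v) = s * (1 - s) / (2 * X + s).
    by rewrite /v; field; rewrite gt_eqF//; lra.
  have -> : (16 * X)^-1 + (12 * (X + s) + 6)^-1 =
      (28 * X + 12 * s + 6) / (16 * X * (12 * (X + s) + 6)).
    by field; rewrite !gt_eqF//; lra.
  rewrite ler_pdivrMr; last by lra.
  rewrite mulrAC ler_pdivlMr; last by rewrite !mulr_gt0//; lra.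
  (* Nonnegative products p1, ..., p5 of which the remaining polynomial inequality is a positive
     linear consequence. *)
  have p1 : 0 <= X ^+ 2 * (s - 2^-1) ^+ 2 by rewrite mulr_ge0// sqr_ge0.
  have p2 : 0 <= (X - 29 / 20 * s) ^+ 2 by rewrite sqr_ge0.
  have p3 : 0 <= s * (1 - s) by rewrite mulr_ge0//; lra.
  have p4 : 0 <= X * ((s - 42 / 100) ^+ 2 * (s + 34 / 100)).
    by apply: mulr_ge0; [exact: ltW|apply: mulr_ge0; [exact: sqr_ge0|apply: addr_ge0; rewrite // divr_ge0// ler0n]].
  have p5 : 0 <= X * s by rewrite mulr_ge0// ltW.
  by rewrite !expr2 in p1 p2 p4; lra.
have l := @ln_sub_le _ (X + s) X Xs X0.
have e : (X + s) / X - 1 = s / X by field; rewrite gt_eqF.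
rewrite e in l; have := ler_wpM2l (ltac:(lra) : 0 <= 2^-1 - (X + s)) l.
have b := binet_ge0 Xs; rewrite /stirling_excess => l'.
suff : (2^-1 - (X + s)) * (s / X) + s <= (16 * X)^-1 by lra.
have -> : (2^-1 - (X + s)) * (s / X) + s = (16 * X)^-1 - (s - 4^-1) ^+ 2 / X.
  by field; rewrite gt_eqF.
by rewrite gerBl divr_ge0 ?sqr_ge0// ltW.
Qed.

End Reflection.

(** * The periodized logarithm *)

Section LogSum.
Variable R : realType.
Implicit Types (a t x X s : R) (N : nat).

Lemma sum_two_sided (phi : R -> R) x (N N' : nat) : (forall t : R, phi (- t) = phi t) ->
  \sum_(i < N' + N) phi (x - N'%:R + i%:R) =
  \sum_(j < N) phi (x + j%:R) + \sum_(j < N') phi (1 - x + j%:R).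
Proof.
move=> ev; rewrite big_split_ord/= addrC; congr (_ + _).
  by apply: eq_bigr => j _; rewrite natrD; congr phi; ring.
rewrite (reindex_inj rev_ord_inj)/=; apply: eq_bigr => j _.
by rewrite natrB// -addn1 natrD -[RHS]ev; congr phi; ring.
Qed.

(** At height y, with a = 2y and horizontal distance t, (u + 1) / (u - 1) = (a^2 + t^2) / t^2. This
    is the logarithm of the numerator, normalized to vanish at t = X. *)
Definition log_bump a X t : R := ln (a ^+ 2 + t ^+ 2) - ln (a ^+ 2 + X ^+ 2).
Definition log_bump1 a t : R := 2 * t / (a ^+ 2 + t ^+ 2).
Definition log_bump_int a X t : R := t * log_bump a X t - 2 * t + 2 * a * atan (t / a).

Lemma log_bumpN a X t : log_bump a X (- t) = log_bump a X t.
Proof. by rewrite /log_bump sqrrN. Qed.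

Lemma log_bump_intN a X t : log_bump_int a X (- t) = - log_bump_int a X t.
Proof. by rewrite /log_bump_int log_bumpN (mulNr t a^-1) atanN; ring. Qed.

Let den_gt0 a t : 0 < a -> 0 < a ^+ 2 + t ^+ 2.
Proof. by move=> a0; rewrite ltr_wpDr ?sqr_ge0// exprn_gt0. Qed.

Lemma is_derive_log_bump a X t : 0 < a -> is_derive t (1 : R) (log_bump a X) (log_bump1 a t).
Proof.
move=> a0; have d0 : 0 < a ^+ 2 + t * t by rewrite -expr2 den_gt0.
have := d1_add (@d1_ln _ (fun t => a ^+ 2 + t * t) t _ d0 (d1_add (d1_cst (a ^+ 2) t) (d1_mul (d1_id t) (d1_id t))))
  (d1_cst (- ln (a ^+ 2 + X ^+ 2)) t).
move=> /d1_eq; apply.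
by rewrite /log_bump1; field; rewrite gt_eqF.
Qed.

Lemma is_derive_log_bump_int a X t : 0 < a ->
  is_derive t (1 : R) (log_bump_int a X) (log_bump a X t).
Proof.
move=> a0; have d0 := den_gt0 t a0.
have da : is_derive t (1 : R) (fun t => atan (t / a)) ((1 + (t / a) ^+ 2)^-1 * a^-1).
  apply: d1_comp; apply: d1_eq (d1_mul (d1_id t) (d1_cst a^-1 t)) _.
  by rewrite mulr0 mulr1 add0r.
apply: d1_eq (d1_add (d1_add (d1_mul (d1_id t) (is_derive_log_bump X t a0))
  (d1_opp (d1_mul (d1_cst 2 t) (d1_id t)))) (d1_mul (d1_cst (2 * a) t) da)) _.
have -> : 1 + (t / a) ^+ 2 = (a ^+ 2 + t ^+ 2) / a ^+ 2 by field; rewrite gt_eqF.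
by rewrite /log_bump1; field; rewrite !gt_eqF.
Qed.

Let log_bump1_diff a t t' : 0 < a ->
  log_bump1 a t' - log_bump1 a t =
  2 * (t' - t) * (a ^+ 2 - t * t') / ((a ^+ 2 + t ^+ 2) * (a ^+ 2 + t' ^+ 2)).
Proof.
move=> a0; have d0 := den_gt0 t a0; have d0' := den_gt0 t' a0.
by rewrite /log_bump1; field; rewrite !gt_eqF.
Qed.

Lemma log_bump1_incr a t t' : 0 < a -> - a <= t -> t <= t' -> t' <= a ->
  log_bump1 a t <= log_bump1 a t'.
Proof.
move=> a0 at_ tt ta; rewrite -subr_ge0 (log_bump1_diff _ _ a0) divr_ge0 ?mulr_ge0//.
- by rewrite subr_ge0.
- by rewrite expr2; nra.
- by rewrite ltW// den_gt0.
- by rewrite ltW// den_gt0.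
Qed.

Lemma log_bump1_decr a t t' : 0 < a -> a <= t -> t <= t' -> log_bump1 a t' <= log_bump1 a t.
Proof.
move=> a0 at_ tt; rewrite -subr_ge0 -opprB (log_bump1_diff _ _ a0) -mulNr divr_ge0 ?mulr_ge0//.
- rewrite -mulrN mulr_ge0//; first by rewrite mulr_ge0// subr_ge0.
  by rewrite opprB expr2; nra.
- by rewrite ltW// den_gt0.
- by rewrite ltW// den_gt0.
Qed.

(** The inflection points of [log_bump] are at a and -a, so for X <= a it is convex on the whole of
    [-X, X] and both Euler-Maclaurin bounds apply, with zero end values. *)
Lemma log_sum_inner a X x s s' (N N' : nat) : 0 < X -> X <= a ->
  x + N%:R = X + s -> 1 - x + N'%:R = X + s' -> 0 <= s <= 1 -> 0 <= s' <= 1 ->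
  - (log_bump1 a X * (s * (1 - s) + s' * (1 - s'))) / 2 <=
  \sum_(j < N) log_bump a X (x + j%:R) + \sum_(j < N') log_bump a X (1 - x + j%:R)
    - 2 * log_bump_int a X X
  <= log_bump1 a X * ((s - 2^-1) ^+ 2 + (s' - 2^-1) ^+ 2) / 2.
Proof.
move=> X0 Xa xN xN' /andP[s0 s1] /andP[s0' s1'].
have a0 : 0 < a by lra.
rewrite -sum_two_sided; last exact: log_bumpN.
have df t (_ : - X <= t <= X) := is_derive_log_bump X t a0.
have dF t (_ : - X <= t <= X) := is_derive_log_bump_int X t a0.
have incr t t' : - X <= t -> t <= t' -> t' <= X -> log_bump1 a t <= log_bump1 a t'.
  by move=> h1 h2 h3; apply: log_bump1_incr => //; lra.
have fv : log_bump a X X = 0 by rewrite /log_bump subrr.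
have fu : log_bump a X (- X) = 0 by rewrite log_bumpN.
have c0 : 0 <= log_bump1 a X.
  by rewrite /log_bump1 divr_ge0 ?mulr_ge0 ?(ltW X0)// ltW// den_gt0.
have f1u : log_bump1 a (- X) = - log_bump1 a X by rewrite /log_bump1 sqrrN mulrN mulNr.
have uI : - X <= - X <= X by lra.
have vI : - X <= X <= X by lra.
have Fu := log_bump_intN a X X.
have NN : x - N'%:R = - X + (1 - s') by lra.
case e : (N' + N)%N => [|n].
  move/eqP: e; rewrite addn_eq0 => /andP[/eqP n1 /eqP n2].
  rewrite n2 addr0 in xN; rewrite n1 addr0 in xN'.
  have := convex_int_left df dF incr (lexx _) (ltac:(lra) : - X <= 0) (ltW X0).
  have := convex_int_right df dF incr (ltac:(lra) : - X <= 0) (ltW X0) (lexx _).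
  have F0 : log_bump_int a X 0 = 0 by rewrite /log_bump_int !mul0r atan0; ring.
  rewrite big_ord0 fv fu f1u Fu F0 !mul0r !sub0r !add0r opprK subr0.
  have Fneg : log_bump_int a X X <= 0.
    have := convex_trapezoid df dF incr (lexx _) (ltac:(lra) : - X <= X) (lexx _).
    by rewrite fv fu Fu addr0 mulr0 mul0r; lra.
  have := mulr_ge0 c0 (ltac:(lra) : 0 <= 1 - s).
  have q : (s - 2^-1) ^+ 2 + (s' - 2^-1) ^+ 2 = 2 * X ^+ 2 + 2 * (x - 2^-1) ^+ 2.
    by rewrite (_ : s = x - X) 1?(_ : s' = 1 - x - X); [field|lra|lra].
  rewrite q; move=> k1 k2 k3; apply/andP; split.
    have : 0 <= log_bump1 a X * (s * (1 - s) + s' * (1 - s')).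
      by rewrite mulr_ge0// addr_ge0// mulr_ge0//; lra.
    by lra.
  have := mulr_ge0 c0 (sqr_ge0 (x - 2^-1)); lra.
have tn : x - N'%:R + n%:R = X - (1 - s).
  have -> : n%:R = N'%:R + N%:R - 1 :> R by rewrite -natrD e -addn1 natrD addrK.
  by lra.
have h1 : - X <= x - N'%:R by lra.
have h2 : x - N'%:R + n%:R <= X by lra.
have ht : x - N'%:R <= x - N'%:R + n%:R by rewrite lerDl.
apply/andP; split.
  have := convex_sum_ge df dF incr h1 h2.
  have tI : - X <= x - N'%:R + n%:R <= X by rewrite h2 (le_trans h1).
  have t0I : - X <= x - N'%:R <= X by rewrite h1 (le_trans ht).
  have := convex_tangent df incr vI tI; have := convex_tangent df incr uI t0I.
  rewrite fv fu Fu f1u tn NN.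
  have -> : - X + (1 - s') - - X = 1 - s' by ring.
  have -> : X - (1 - s) - X = s - 1 by ring.
  have -> : X - (X - (1 - s)) = 1 - s by ring.
  rewrite !mulr0 !subr0 !add0r !subKr => k1 k2.
  have := ler_wpM2l s0 k2; have := ler_wpM2l s0' k1; move: k1 k2.
  move: (\sum_(i < _) _) => S; clear; lra.
have := convex_sum_le df dF incr (c := log_bump1 a X) (c' := log_bump1 a X) h1 h2.
rewrite fv fu Fu tn NN !mulr0.
have -> : - X + (1 - s') - - X = 1 - s' by ring.
have -> : X - (X - (1 - s)) = 1 - s by ring.
move=> /(_ ltac:(clear -s0'; lra) ltac:(clear -s0; lra)) h.
have := h _ _; rewrite (_ : (1 - s - 2^-1) ^+ 2 = (s - 2^-1) ^+ 2); last by field.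
rewrite (_ : (1 - s' - 2^-1) ^+ 2 = (s' - 2^-1) ^+ 2); last by field.
move=> {}h; have {}h := h _ _.
have := h ltac:(move=> t /andP[q1 q2]; apply: incr; clear -q1 q2 h1 h2 ht X0 tn NN; lra)
  ltac:(move=> t /andP[q1 q2]; rewrite -f1u; apply: incr; clear -q1 q2 h1 h2 ht X0 tn NN; lra).
move: (\sum_(i < _) _) => S; clear; lra.
Qed.

(** Beyond its inflection point a the function is concave, so the convex bounds are applied to its
    negative on [a, X]. Here sigma is the position of the first sample after a. *)
Lemma log_sum_outer a X y sigma s (k : nat) : 0 < a -> a <= X ->
  y = a + sigma -> y + k%:R = X + s -> 0 <= sigma <= 1 -> 0 <= s <= 1 ->
  - (sigma * (1 - sigma)) / (2 * a) <=
  log_bump_int a X X - log_bump_int a X a - \sum_(j < k) log_bump a X (y + j%:R)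
    - (sigma - 2^-1) * log_bump a X a
  <= (sigma - 2^-1) ^+ 2 / (2 * a).
Proof.
move=> a0 aX ya yk /andP[g0 g1] /andP[s0 s1].
have df t : a <= t <= X -> is_derive t (1 : R) (fun t => - log_bump a X t) (- log_bump1 a t).
  by move=> _; exact: d1_opp (is_derive_log_bump X t a0).
have dF t : a <= t <= X -> is_derive t (1 : R) (fun t => - log_bump_int a X t) (- log_bump a X t).
  by move=> _; exact: d1_opp (is_derive_log_bump_int X t a0).
have incr t t' : a <= t -> t <= t' -> t' <= X -> - log_bump1 a t <= - log_bump1 a t'.
  by move=> h1 h2 _; rewrite lerN2; exact: log_bump1_decr.
have fv : - log_bump a X X = 0 by rewrite /log_bump subrr oppr0.
have f1a : log_bump1 a a = a^-1 by rewrite /log_bump1 (_ : a ^+ 2 + a ^+ 2 = 2 * a * a); [field; rewrite gt_eqF|ring].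
have f10 t : a <= t -> 0 <= log_bump1 a t.
  by move=> ht; rewrite /log_bump1 divr_ge0 ?mulr_ge0 ?ltW ?den_gt0//; lra.
have uI : a <= a <= X by rewrite lexx.
have vI : a <= X <= X by rewrite lexx aX.
have i0 : 0 < a^-1 by rewrite invr_gt0.
have ia2 : (2 * a)^-1 = a^-1 / 2 by rewrite invfM mulrC.
have fpos t : a <= t <= X -> 0 <= - log_bump a X t.
  move=> tI; have /andP[h1 h2] := tI.
  rewrite -fv lerN2 /log_bump lerD2r ler_ln ?posrE ?den_gt0// lerD2l ler_sqr ?nnegrE//; lra.
set A := - log_bump a X a; have -> : log_bump a X a = - A by rewrite /A opprK.
have A0 : 0 <= A := fpos _ uI.
case: k yk => [|k] yk.
  (* No sample precedes X and the integral stands alone. It is bounded below by the triangle under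
     the tangent at a, which meets the axis at a + a A, and above by the trapezoid. *)
  rewrite big_ord0 addr0 in yk *; pose d := X - a.
  have d0 : 0 <= d by rewrite subr_ge0.
  have dg : d <= sigma by rewrite /d; lra.
  have Ad : a * A <= d.
    have := convex_tangent df incr uI vI; rewrite -/A fv f1a -/d => h.
    have : A <= a^-1 * d by lra.
    by rewrite ler_pdivlMl.
  have up := convex_trapezoid df dF incr (lexx _) aX (lexx _).
  have aA : 0 <= a * A by rewrite mulr_ge0// ltW.
  have lo : a * A ^+ 2 / 2 <= - log_bump_int a X X - - log_bump_int a X a.
    have x1 : a <= a + a * A by clear -aA; lra.
    have x2 : a + a * A <= X by rewrite /d in Ad; lra.
    have := convex_int_left df dF incr (lexx _) x1 x2; rewrite -/A f1a.
    have -> : A * (a + a * A - a) + - a^-1 * (a + a * A - a) ^+ 2 / 2 = a * A ^+ 2 / 2.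
      by field; rewrite gt_eqF.
    move=> h; have := @derive_ge0_le R (fun t => - log_bump_int a X t) (fun t => - log_bump a X t) _ _ x2.
    have dF' t : a + a * A <= t <= X -> is_derive t (1 : R) (fun t => - log_bump_int a X t) (- log_bump a X t).
      by move=> /andP[q1 q2]; apply: dF; clear -q1 q2 x1; lra.
    move=> /(_ dF') h'; have : - log_bump_int a X (a + a * A) <= - log_bump_int a X X.
      by apply: h' => t /andP[q1 q2]; apply: fpos; clear -q1 q2 x1; lra.
    by lra.
  rewrite -/A fv in up; rewrite ia2 subr0; apply/andP; split.
    have k1 : A <= d * a^-1 by rewrite ler_pdivlMr// mulrC.
    have k2 : d * A <= sigma * A by rewrite ler_wpM2r.
    have k3 : (1 - sigma) * A <= (1 - sigma) * (sigma * a^-1).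
      by rewrite ler_wpM2l//; [lra|rewrite (le_trans k1)// ler_wpM2r// ltW].
    by rewrite -/d in up; clear -up k2 k3; lra.
  have : 0 <= a^-1 * (a * A - (sigma - 2^-1)) ^+ 2 by rewrite mulr_ge0 ?sqr_ge0// ltW.
  have -> : a^-1 * (a * A - (sigma - 2^-1)) ^+ 2 = a * A ^+ 2 - 2 * ((sigma - 2^-1) * A) + (sigma - 2^-1) ^+ 2 * a^-1.
    by field; rewrite gt_eqF.
  by lra.
have e : k.+1%:R = k%:R + 1 :> R by rewrite natr1.
have tn : y + k%:R = X - (1 - s) by lra.
have k0 : 0 <= k%:R :> R by rewrite ler0n.
have h1 : a <= y by rewrite ya lerDl.
have h2 : y + k%:R <= X by clear -tn s1; lra.
have yI : a <= y <= X by clear -h1 h2 k0; lra.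
have tI : a <= y + k%:R <= X by clear -h1 h2 k0; lra.
have e1 : y - a = sigma by rewrite ya addrC addKr.
have e2 : X - (y + k%:R) = 1 - s by rewrite tn subKr.
rewrite ia2; apply/andP; split.
  have := convex_sum_ge df dF incr h1 h2.
  have := convex_tangent df incr uI yI; have := fpos _ tI.
  rewrite e1 e2 fv f1a -/A sumrN => p1 p2.
  have := mulr_ge0 s0 p1; have := ler_wpM2l (ltac:(clear -g1; lra) : 0 <= 1 - sigma) p2.
  move: (\sum_(i < _) _) => S; clear; lra.
have := convex_sum_le df dF incr (c := 0) (c' := a^-1) h1 h2.
rewrite e1 e2 fv -/A sumrN => /(_ g1 ltac:(clear -s0; lra)) h.
have := h ltac:(move=> t /andP[q1 q2]; rewrite oppr_le0 f10//; clear -q1 h1 k0 tn; lra)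
  ltac:(move=> t /andP[q1 q2]; rewrite -f1a; apply: incr; clear -q1 q2 h1 h2 k0 tn e1; lra).
rewrite !mulr0 !mul0r.
move: (\sum_(i < _) _) => S; clear; lra.
Qed.

Lemma atan_ge_ratio t : 0 <= t -> t / (1 + t ^+ 2) <= atan t.
Proof.
move=> t0; have d0 u : 1 + u * u != 0 :> R by rewrite gt_eqF// -expr2 ltr_wpDr ?sqr_ge0.
have := @derive_ge0_le R (fun u => atan u + - (u * (1 + u * u)^-1))
  (fun u => 2 * u ^+ 2 / (1 + u ^+ 2) ^+ 2) 0 t t0.
rewrite atan0 mul0r oppr0 addr0 => h; have {}h : 0 <= atan t + - (t * (1 + t * t)^-1).
  apply: h => u _; last by rewrite divr_ge0 ?sqr_ge0// mulr_ge0 ?sqr_ge0.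
  have di := @d1_inv _ (fun u => 1 + u * u) u _ (d0 u) (d1_add (d1_cst 1 u) (d1_mul (d1_id u) (d1_id u))).
  apply: d1_eq (d1_add (is_derive1_atan u) (d1_opp (d1_mul (d1_id u) di))) _.
  by field; rewrite ?expr2 d0.
by rewrite expr2; lra.
Qed.

(** As atan 1 = pi/4, it is enough that pi >= 3. The triple angle formula at pi/6 gives sin(pi/6) =
    1/2, and sin y <= y. *)
Lemma atan_ge_3_4 t : 1 <= t -> 3 / 4 <= atan t.
Proof.
move=> t1; have : atan 1 <= atan t.
  apply: (@derive_ge0_le R atan (fun u => (1 + u ^+ 2)^-1) 1 t t1) => u _.
    by rewrite invr_ge0 addr_ge0 ?sqr_ge0.
suff : 3 <= pi :> R by rewrite atan1; lra.
set y : R := pi / 6; have p0 := pi_gt0 R.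
have y0 : 0 <= y by rewrite /y; lra.
have s0 : 0 <= sin y by rewrite sin_ge0_pi// y0 /y; lra.
have sE : sin (y + y + y) = 3 * sin y - 4 * sin y ^+ 3.
  rewrite !sinD !cosD; have := cos2sin2 y.
  move: (sin y) (cos y) => u v e; rewrite !exprS expr0 mulr1 in e *.
  have -> : (u * v + v * u) * v + (v * v - u * u) * u = 3 * u * (v * v) - u * (u * u) by ring.
  by rewrite e; ring.
have : sin (y + y + y) = 1 by rewrite (_ : y + y + y = pi / 2) ?sin_pihalf// /y; field.
rewrite sE => e; have : (sin y + 1) * (2 * sin y - 1) ^+ 2 = 0.
  have -> : (sin y + 1) * (2 * sin y - 1) ^+ 2 = 1 - (3 * sin y - 4 * sin y ^+ 3) by ring.
  by rewrite e subrr.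
move=> /eqP; rewrite mulf_eq0 expf_eq0/= => /orP[/eqP h|/eqP h]; first by lra.
by have := sin_le_id y0; rewrite /y; lra.
Qed.

(** N counts the points y, y + 1, ... not exceeding X; the first point beyond X is X + s. *)
Lemma cutoff_nat y X : 0 < X -> y <= 1 -> exists N s, y + N%:R = X + s /\ 0 < s <= 1.
Proof.
move=> X0 y1; have [h|h] := leP y X; last first.
  by exists 0%N, (y - X); rewrite addr0; split; lra.
have := truncn_itv (ltac:(lra) : 0 <= X - y); set N := Num.truncn _ => /andP[h1 h2].
exists N.+1, (y + N.+1%:R - X); split; first by ring.
by move: h2; rewrite -addn1 natrD; lra.
Qed.

Let sum_affine (f h : nat -> R) (c : R) N :
  \sum_(j < N) (f j - 2 * (h j - c)) = \sum_(j < N) f j - 2 * \sum_(j < N) h j + 2 * N%:R * c.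
Proof.
elim: N => [|N IH]; first by rewrite !big_ord0; ring.
by rewrite !big_ord_recr/= IH -addn1 natrD; ring.
Qed.

(** The logarithms of the distances are summed by Stirling's formula and reflection, which produces
    2 log(2 sin(pi x)); the sum of [log_bump] is compared with its integral, which produces 4 a
    atan(X/a). The parameters s, s' place the cutoff X relative to the samples. *)
Lemma periodized_log_sum a X x s s' (N N' : nat) : 0 < a -> 0 < X -> 0 < x < 1 ->
  x + N%:R = X + s -> 1 - x + N'%:R = X + s' -> 0 <= s <= 1 -> 0 <= s' <= 1 ->
  `| \sum_(j < N) (log_bump a X (x + j%:R) - 2 * (ln (x + j%:R) - ln X))
   + \sum_(j < N') (log_bump a X (1 - x + j%:R) - 2 * (ln (1 - x + j%:R) - ln X))
   + 2 * ln (2 * sin (pi * x)) - 4 * a * atan (X / a) |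
  <= 3^-1 * (X^-1 + atan (X / a) / a).
Proof.
move=> a0 X0 /andP[x0 x1] xN xN' sI sI'.
have /andP[s0 s1] := sI; have /andP[s0' s1'] := sI'.
have y0 : 0 < 1 - x by lra.
have xI : 0 < x < 1 by rewrite x0.
set S := \sum_(j < N) log_bump a X (x + j%:R) + \sum_(j < N') log_bump a X (1 - x + j%:R).
set E := (X in `|X|).
(* The sums of logarithms are differences of [nlgamma]. Its values at x and 1 - x cancel against the
   sine, its values at X + s and X + s' leave the Stirling errors. *)
have EE : E = (S - 2 * log_bump_int a X X) - 2 * (stirling_excess X s + stirling_excess X s').
  rewrite /E /S (sum_affine (fun j => log_bump a X (x + j%:R)) (fun j => ln (x + j%:R)))
    (sum_affine (fun j => log_bump a X (1 - x + j%:R)) (fun j => ln (1 - x + j%:R))).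
  have -> : \sum_(j < N) ln (x + j%:R) = nlgamma x - nlgamma (X + s) by rewrite -xN (nlgamma_sum N x0) addrK.
  have -> : \sum_(j < N') ln (1 - x + j%:R) = nlgamma (1 - x) - nlgamma (X + s') by rewrite -xN' (nlgamma_sum N' y0) addrK.
  have fX : log_bump a X X = 0 by rewrite /log_bump subrr.
  have nX u : nlgamma (X + u) = - stirling_main (X + u) - binet (X + u) by [].
  rewrite -(nlgamma_reflection xI) /log_bump_int fX mulr0 !nX.
  have -> : N%:R = X + s - x by rewrite -xN; ring.
  have -> : N'%:R = X + s' - (1 - x) by rewrite -xN'; ring.
  rewrite /stirling_excess /stirling_main.
  by field.
have up := stirling_excess_le X0 sI; have up' := stirling_excess_le X0 sI'.
have lo := stirling_excess_ge X0 sI; have lo' := stirling_excess_ge X0 sI'.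
have cX : (12 * X)^-1 = 12^-1 * X^-1 by rewrite invfM.
have cX' : (16 * X)^-1 = 16^-1 * X^-1 by rewrite invfM.
rewrite cX in up up'; rewrite cX' in lo lo'.
have iX : 0 < X^-1 by rewrite invr_gt0.
have ia : 0 < a^-1 by rewrite invr_gt0.
(* Both the Stirling error and the Euler-Maclaurin error are bounded through this same quantity;
   retaining it lets the two errors compensate in part. *)
pose kap := s * (1 - s) + s' * (1 - s'); have k0 : 0 <= kap.
  by clear -s0 s1 s0' s1'; rewrite addr_ge0// mulr_ge0//; lra.
have kE : (s - 2^-1) ^+ 2 + (s' - 2^-1) ^+ 2 = 2^-1 - kap by rewrite /kap; field.
have k1 : kap <= 2^-1 by have := sqr_ge0 (s - 2^-1); have := sqr_ge0 (s' - 2^-1); clear -kE; lra.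
have hX1 : stirling_excess X s + stirling_excess X s' <= (2 - kap) * (12^-1 * X^-1).
  by rewrite /kap; clear -up up'; lra.
set Q := stirling_excess X s + stirling_excess X s' in EE hX1 *.
have hX2 : - (8^-1 * X^-1) <= Q by rewrite /Q; clear -lo lo'; lra.
rewrite EE; move: lo lo' up up' => _ _ _ _.
have [Xa|aX] := leP X a.
  have := log_sum_inner X0 Xa xN xN' sI sI'; rewrite -/S -/kap kE.
  set c := log_bump1 a X; set I := log_bump_int a X X => /andP[i1 i2].
  (* With T = X / a <= 1 the slope c is 2 T / (a (1 + T^2)); it is bounded by the two quantities
     that occur in the final estimate. *)
  have ca : c <= 3^-1 * X^-1 + 4 / 3 * (atan (X / a) / a).
    pose T := X / a; have T0 : 0 < T by rewrite divr_gt0.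
    have T1 : T <= 1 by rewrite /T ler_pdivrMr// mul1r.
    have h := atan_ge_ratio (ltW T0); rewrite -/T.
    have d1 : 0 < 1 + T ^+ 2 by rewrite ltr_wpDr ?sqr_ge0.
    have -> : c = 2 * (T / (1 + T ^+ 2)) * a^-1.
      rewrite /c /log_bump1 /T.
      have -> : 1 + (X / a) ^+ 2 = (a ^+ 2 + X ^+ 2) / a ^+ 2 by field; rewrite gt_eqF.
      by field; rewrite !gt_eqF// ltr_wpDr ?sqr_ge0// exprn_gt0.
    have -> : X^-1 = T^-1 * a^-1 by rewrite /T; field; rewrite !gt_eqF.
    have -> : 3^-1 * (T^-1 / a) + 4 / 3 * (atan T / a) = (3^-1 * T^-1 + 4 / 3 * atan T) / a by ring.
    rewrite ler_pM2r//.
    have : 2 / 3 * (T / (1 + T ^+ 2)) <= 3^-1 * T^-1.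
      have iT : 1 <= T^-1 by rewrite invf_ge1.
      have : T / (1 + T ^+ 2) <= 2^-1 * T^-1.
        rewrite ler_pdivrMr// (_ : 2^-1 / T * (1 + T ^+ 2) = 2^-1 * (T^-1 + T)); last by field; rewrite gt_eqF.
        by clear -iT T1; lra.
      by clear; lra.
    by clear -h; lra.
  have c0 : 0 <= c.
    by rewrite /c /log_bump1 divr_ge0 ?mulr_ge0 ?(ltW X0)// addr_ge0 ?sqr_ge0.
  have m1 : kap * c <= kap * (3^-1 * X^-1 + 4 / 3 * (atan (X / a) / a)) by rewrite ler_wpM2l.
  have at0 : 0 <= atan (X / a) / a.
    rewrite mulr_ge0 ?(ltW ia)//; apply: le_trans (atan_ge_ratio _); last by rewrite divr_ge0// ltW.
    by rewrite divr_ge0 ?divr_ge0 ?addr_ge0 ?sqr_ge0 ?ltW.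
  have m2 : kap * (atan (X / a) / a) <= 2^-1 * (atan (X / a) / a) by rewrite ler_wpM2r.
  have m3 : kap * X^-1 <= 2^-1 * X^-1 by rewrite ler_wpM2r// ltW.
  have m4 : 0 <= kap * X^-1 by rewrite mulr_ge0// ltW.
  have m5 : 0 <= kap * (atan (X / a) / a) by rewrite mulr_ge0.
  have m6 : 0 <= kap * c by rewrite mulr_ge0.
  move: m1 m2 m3 m4 m5 m6 at0 ca c0 i1 i2 hX1 hX2 iX k0 k1.
  move: (atan (X / a) / a) (X^-1) => V W; clear; move=> *.
  rewrite ler_norml; apply/andP; split; lra.
have XX := ltW aX.
have [M [sg [xM sgP]]] := @cutoff_nat x a a0 (ltW x1).
have sgI : 0 <= sg <= 1 by clear -sgP; lra.
have [M' [sg' [xM' sgP']]] := @cutoff_nat (1 - x) a a0 (ltac:(clear -x0; lra)).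
have sgI' : 0 <= sg' <= 1 by clear -sgP'; lra.
(* The sum is cut at the inflection point into an inner convex part and two concave tails, with
   total error 1 / (4 a). This fits, since atan(X/a) >= 3/4 makes atan(X/a) / (3 a) at least 1 / (4
   a). *)
suff hS : `|S - 2 * log_bump_int a X X| <= 4^-1 * a^-1.
  have T1 : 1 <= X / a by rewrite ler_pdivlMr// mul1r.
  have := ler_wpM2r (ltW ia) (atan_ge_3_4 T1).
  have m3 : kap * X^-1 <= 2^-1 * X^-1 by rewrite ler_wpM2r// ltW.
  have m4 : 0 <= kap * X^-1 by rewrite mulr_ge0// ltW.
  move: hS; rewrite ler_norml => /andP[h1 h2] h3; rewrite ler_norml.
  move: hX1 hX2 m3 m4 h3; move: (S - _) h1 h2 => U h1 h2; clear -h1 h2 => *; apply/andP; split; lra.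
have NM y (m n : nat) (u v : R) : y + m%:R = a + u -> y + n%:R = X + v -> 0 <= u <= 1 -> 0 <= v ->
    (m <= n)%N.
  move=> h1 h2 /andP[q1 q2] q3; rewrite leqNgt; apply/negP => nm.
  have : (n.+1)%:R <= m%:R :> R by rewrite ler_nat.
  by rewrite -addn1 natrD; clear -h1 h2 aX q2 q3; lra.
have outer y (m n : nat) (u v : R) : y + m%:R = a + u -> y + n%:R = X + v -> 0 <= u <= 1 -> 0 <= v <= 1 ->
    exists2 Z, \sum_(j < n) log_bump a X (y + j%:R) = \sum_(j < m) log_bump a a (y + j%:R) +
      (a + u - y) * log_bump a X a + (log_bump_int a X X - log_bump_int a X a) - (u - 2^-1) * log_bump a X a - Z
    & - (u * (1 - u)) / (2 * a) <= Z <= (u - 2^-1) ^+ 2 / (2 * a).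
  move=> h1 h2 uI vI; have /andP[v0 _] := vI; have mn := NM _ _ _ _ _ h1 h2 uI v0.
  have [k nk] : exists k, n = (m + k)%N by exists (n - m)%N; rewrite subnKC.
  subst n; rewrite natrD addrA in h2.
  have h := @log_sum_outer a X (y + m%:R) u v k a0 XX h1 h2 uI vI.
  eexists; last exact: h.
  rewrite big_split_ord/=.
  have -> : \sum_(j < m) log_bump a a (y + j%:R) =
      \sum_(j < m) log_bump a X (y + j%:R) - m%:R * log_bump a X a.
    elim: (m) => [|q IH]; first by rewrite !big_ord0; ring.
    by rewrite !big_ord_recr/= IH -addn1 natrD /log_bump; ring.
  have -> : \sum_(i < k) log_bump a X (y + (m + i)%:R) = \sum_(i < k) log_bump a X (y + m%:R + i%:R).
    by apply: eq_bigr => i _; rewrite natrD addrA.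
  have -> : a + u - y = m%:R by rewrite -h1; ring.
  by ring.
have [Z ZE /andP[Z1 Z2]] := outer _ _ _ _ _ xM xN sgI sI.
have [Z' ZE' /andP[Z1' Z2']] := outer _ _ _ _ _ xM' xN' sgI' sI'.
have := log_sum_inner a0 (lexx a) xM xM' sgI sgI'.
have -> : log_bump1 a a = a^-1.
  by rewrite /log_bump1 (_ : a ^+ 2 + a ^+ 2 = 2 * a * a); [field; rewrite gt_eqF|ring].
have -> : log_bump_int a a a = log_bump_int a X a - a * log_bump a X a.
  by rewrite /log_bump_int {1}/log_bump subrr; ring.
rewrite /S ZE ZE'; rewrite (_ : (2 * a)^-1 = a^-1 / 2) in Z1 Z2 Z1' Z2'; last by rewrite invfM mulrC.
move: Z1 Z2 Z1' Z2'; move: (\sum_(j < M) _) (\sum_(j < M') _) => U U'.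
move: (log_bump a X a) (log_bump_int a X X) (log_bump_int a X a) (a^-1) => W1 W2 W3 W4.
clear; move=> z1 z2 z3 z4 /andP[z5 z6]; rewrite ler_norml; apply/andP; split; lra.
Qed.

End LogSum.

(** * Pairs of points near a cusp *)

Section QDistance.
Variable R : realType.
Implicit Types (x v z w : R * R) (s : 'M[R]_2).

Lemma cos_2pi_int (t : R) (b : int) : cos (2 * pi * (t + b%:~R)) = cos (2 * pi * t).
Proof.
have nat_ (u : R) (n : nat) : cos (2 * pi * (u + n%:R)) = cos (2 * pi * u).
  elim: n => [|n IH]; first by rewrite addr0.
  have e : n.+1%:R = n%:R + 1 :> R by rewrite natr1.
  rewrite -IH e.
  rewrite (_ : 2 * pi * (u + (n%:R + 1)) = 2 * pi * (u + n%:R) + pi *+ 2) ?cosD2pi//.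
  by rewrite -mulr_natl; ring.
case: b => n; first exact: nat_.
by rewrite NegzE mulrNz -{1}(nat_ _ n.+1) subrK.
Qed.

Definition qd x v : R := qdist (2 * pi) v.1 v.2 x.

Let E (y : R) : R := expR (- (2 * pi) * y).

Lemma qdE x v : qd x v = (E x.2 - E v.2) ^+ 2 + 2 * (E x.2 * E v.2) * (1 - cos (2 * pi * (x.1 - v.1))).
Proof. by rewrite /qd /qdist -/(E _) -/(E _); ring. Qed.

Let E0 y : 0 < E y. Proof. exact: expR_gt0. Qed.

Let tail_ge0 (y y' t : R) : 0 <= 2 * (E y * E y') * (1 - cos t).
Proof.
apply: mulr_ge0; last by rewrite subr_ge0 cos_le1.
by rewrite mulr_ge0// mulr_ge0// ltW.
Qed.

Lemma qd_ge0 x v : 0 <= qd x v.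
Proof. by rewrite qdE addr_ge0 ?sqr_ge0// tail_ge0. Qed.

Lemma qd_sym x v : qd x v = qd v x.
Proof.
rewrite !qdE; congr (_ + _); first by rewrite -sqrrN opprB.
by rewrite [E v.2 * _]mulrC -[cos (_ * (v.1 - _))]cosN -mulrN opprB.
Qed.

Lemma qd_shift (b : int) x v : qd (hshift b x) v = qd x v.
Proof. by rewrite !qdE /hshift/= addrAC cos_2pi_int. Qed.

Lemma qd_diag x : qd x x = 0.
Proof. by rewrite qdE !subrr mulr0 cos0 subrr mulr0 expr0n/= addr0. Qed.

Lemma cos_2pi_half (t : R) : 1 - cos (2 * pi * t) = 2 * sin (pi * t) ^+ 2.
Proof.
have -> : 2 * pi * t = pi * t + pi * t by ring.
have := cos2sin2 (pi * t); rewrite cosD -!expr2 => ->; ring.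
Qed.

Lemma sin_pi_gt0 (t : R) : 0 < t < 1 -> 0 < sin (pi * t).
Proof.
move=> /andP[x0 x1]; rewrite sin_gt0_pi// mulr_gt0 ?pi_gt0//=.
by rewrite -[ltRHS]mulr1 ltr_pM2l ?pi_gt0.
Qed.

Lemma floor_split (t : R) : exists (k : int) (f : R), t = f + k%:~R /\ 0 <= f < 1.
Proof.
exists (Num.floor t), (t - (Num.floor t)%:~R); rewrite subrK; split=> //.
by have := floor_itv t; rewrite intrD; lra.
Qed.

Lemma qd_eq0 x v : qd x v = 0 -> exists b, x = hshift b v.
Proof.
rewrite qdE => /eqP; rewrite paddr_eq0 ?sqr_ge0// ?tail_ge0//.
rewrite expf_eq0/= subr_eq0 => /andP[/eqP e1 /eqP e2].
have h2 : x.2 = v.2.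
  move/expR_inj: e1 => /(mulfI _); apply.
  by rewrite oppr_eq0 mulf_neq0 ?pnatr_eq0 ?gt_eqF ?pi_gt0.
have [k [f [e /andP[f0 f1]]]] := floor_split (x.1 - v.1).
have c : 1 - cos (2 * pi * (x.1 - v.1)) = 0.
  by move/eqP: e2; rewrite mulf_eq0 gt_eqF ?mulr_gt0 ?E0//= => /eqP.
exists k; rewrite /hshift -h2 [LHS]surjective_pairing; congr (_, _).
move: c; rewrite e cos_2pi_int cos_2pi_half => /eqP; rewrite mulf_eq0 pnatr_eq0/= expf_eq0/=.
have [f0'|f0'] := eqVneq f 0; first by move=> _; lra.
by rewrite gt_eqF// sin_pi_gt0// f1 lt_def f0' f0.
Qed.

Lemma ln_qd_le x v : 0 <= x.2 -> 0 <= v.2 -> 0 < qd x v -> ln (qd x v) <= ln 4.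
Proof.
have E1 y : 0 <= y -> E y <= 1.
  by move=> y0; rewrite -expR0 ler_expR mulNr oppr_le0 !mulr_ge0 ?pi_ge0.
move=> /E1 x0 /E1 v0 q0; rewrite ler_ln ?posrE// qdE.
have := cos_geN1 (2 * pi * (x.1 - v.1)); have := E0 x.2; have := E0 v.2.
move: (cos _) x0 v0; move: (E x.2) (E v.2) => p q c p1 q1 q0' p0' c1.
have : 0 <= p * q * (c + 1) by apply: mulr_ge0; [rewrite mulr_ge0// ltW|lra].
have : p + q <= 2 by lra.
have : 0 <= p + q by lra.
rewrite !expr2; nra.
Qed.

(** One unit above v the modulus of q has dropped by the factor e^(-2 pi), so log qd is bounded
    below from there on. *)
Lemma qd_lower x v : v.2 + 1 <= x.2 -> (E v.2 * (1 - E 1)) ^+ 2 <= qd x v.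
Proof.
move=> h; rewrite qdE.
have e1 : E x.2 <= E v.2 * E 1.
  by rewrite /E -expRD ler_expR -mulrDr !mulNr lerN2 ler_pM2l// mulr_gt0// pi_gt0.
have e2 : 0 <= E v.2 * (1 - E 1) <= E v.2 - E x.2.
  apply/andP; split; last by lra.
  apply: mulr_ge0; first exact: ltW.
  rewrite subr_ge0 ltW//.
  by rewrite expR_lt1 mulr1 oppr_lt0 mulr_gt0 ?pi_gt0.
have : (E v.2 * (1 - E 1)) ^+ 2 <= (E x.2 - E v.2) ^+ 2.
  rewrite -[leRHS]sqrrN opprB ler_sqr ?nnegrE; lra.
have : 0 <= 2 * (E x.2 * E v.2) * (1 - cos (2 * pi * (x.1 - v.1))) by exact: tail_ge0.
lra.
Qed.

Lemma qd_lower_gt0 v : 0 < (E v.2 * (1 - E 1)) ^+ 2.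
Proof.
rewrite exprn_gt0// mulr_gt0 ?E0// subr_gt0 expR_lt1 mulr1 oppr_lt0.
by rewrite mulr_gt0 ?pi_gt0.
Qed.

Lemma normc_qcusp s z w : ComplexField.Normc.normc (qcusp s z - qcusp s w) ^+ 2 =
  qd (mobius (invmx s) z) (mobius (invmx s) w).
Proof.
rewrite /qcusp /toC; move: (mobius _ z) (mobius _ w) => [a b] [c d] /=.
rewrite sqr_sqrtr; last by rewrite addr_ge0 ?sqr_ge0.
rewrite !mul0r !add0r qdE /= -!(mulNr (2 * pi)).
have EbE : expR (- (2 * pi) * b) = E b by [].
have EdE : expR (- (2 * pi) * d) = E d by [].
rewrite EbE EdE (mulrBr (2 * pi)) cosB.
have := cos2Dsin2 (2 * pi * a); have := cos2Dsin2 (2 * pi * c).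
move: (cos (2 * pi * a)) (sin (2 * pi * a)) (cos (2 * pi * c)) (sin (2 * pi * c)) => A B C D e1 e2.
have -> : (E b * A - E d * C) ^+ 2 + (E b * B - E d * D) ^+ 2 =
  E b ^+ 2 * (A ^+ 2 + B ^+ 2) + E d ^+ 2 * (C ^+ 2 + D ^+ 2) - 2 * (E b * E d) * (A * C + B * D) by ring.
by rewrite e1 e2; ring.
Qed.

Lemma qd_horizontal x v : x.2 = v.2 -> 0 < qd x v ->
  ln (qd x v) = 2 * ln (2 * `|sin (pi * (x.1 - v.1))|) - 4 * pi * v.2.
Proof.
move=> e; rewrite qdE e subrr expr0n/= add0r cos_2pi_half => q0.
have EE : E v.2 * E v.2 = expR (- (4 * pi * v.2)) by rewrite -expRD; congr expR; ring.
have s0 : sin (pi * (x.1 - v.1)) != 0.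
  by apply: contraTneq q0 => ->; rewrite expr0n/= !mulr0 ltxx.
rewrite EE -(real_normK (num_real (sin _))).
have -> : 2 * expR (- (4 * pi * v.2)) * (2 * `|sin (pi * (x.1 - v.1))| ^+ 2) =
  (2 * `|sin (pi * (x.1 - v.1))|) ^+ 2 * expR (- (4 * pi * v.2)) by ring.
have s1 : 0 < 2 * `|sin (pi * (x.1 - v.1))| by rewrite mulr_gt0 ?normr_gt0.
by rewrite lnM ?posrE ?exprn_gt0 ?expR_gt0// expRK lnXn// -[_ *+ 2]mulr_natl.
Qed.

Definition sqdist x v : R := (x.1 - v.1) ^+ 2 + (x.2 - v.2) ^+ 2.

Lemma uptE_sqdist x v : upper x -> upper v -> upt x v = 1 + sqdist x v / (2 * x.2 * v.2).
Proof. by move=> xu vu; rewrite uptE. Qed.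

Let expR_sinh (u : R) : 0 <= u -> 2 * u <= expR u - expR (- u) <= 2 * u * expR u.
Proof.
move=> u0.
have e1 (t : R) : is_derive t (1 : R) (fun t : R => expR (- t)) (- expR (- t)).
  by apply: d1_eq (d1_comp (is_derive_expR _) (d1_opp (d1_id t))) _; rewrite mulrN1.
apply/andP; split.
  have := @derive_ge0_le R (fun t => expR t + - expR (- t) + - (2 * t)) (fun t => expR t + expR (- t) - 2) 0 u u0.
  rewrite oppr0 expR0 subrr mulr0 oppr0 addr0 => h.
  suff : 0 <= expR u + - expR (- u) + - (2 * u) by lra.
  apply: h => t _.
    by apply: d1_eq (d1_add (d1_add (is_derive_expR t) (d1_opp (e1 t))) (d1_opp (d1_mul (d1_cst 2 t) (d1_id t)))) _; ring.
  have p := expR_gt0 t; rewrite expRN.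
  have -> : expR t + (expR t)^-1 - 2 = (expR t - 1) ^+ 2 / expR t by field; rewrite gt_eqF.
  by rewrite divr_ge0 ?sqr_ge0// ltW.
have := @expR_ge1Dx R (- (2 * u)) => h.
have p := expR_gt0 u.
have -> : expR (- u) = expR u * expR (- (2 * u)) by rewrite -expRD; congr expR; ring.
have := ler_wpM2l (ltW p) h; lra.
Qed.

(** The identity behind it is qd = 4 |q(x) q(v)| (sinh^2(pi (y - y')) + sin^2(pi (x - x')));
    elementary bounds of sinh and sin give two estimates that tend to 1 at the diagonal. *)
Lemma qd_ratio_bounds x v : sqdist x v != 0 -> `|x.1 - v.1| <= 2^-1 ->
  1 - 6 * (x.1 - v.1) ^+ 2 <= qd x v / (4 * pi ^+ 2 * (E x.2 * E v.2) * sqdist x v)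
  <= expR (2 * pi * `|x.2 - v.2|).
Proof.
move=> d0 t2.
have dp : 0 < sqdist x v by rewrite lt_def d0 addr_ge0 ?sqr_ge0.
have p0 := pi_gt0 R; have p20 : 0 < pi ^+ 2 :> R by rewrite exprn_gt0.
set c := E x.2 * E v.2; have c0 : 0 < c by rewrite mulr_gt0 ?E0.
set S := (expR (pi * (x.2 - v.2)) - expR (- (pi * (x.2 - v.2)))) ^+ 2.
set T := sin (pi * (x.1 - v.1)) ^+ 2.
have -> : qd x v = c * (S + 4 * T).
  rewrite qdE cos_2pi_half -/T -/c mulrDr; congr (_ + _); last by ring.
  have -> : E x.2 - E v.2 = - expR (- (pi * (x.2 + v.2))) * (expR (pi * (x.2 - v.2)) - expR (- (pi * (x.2 - v.2)))).
    rewrite mulNr mulrBr opprB -!expRD /E; congr (expR _ - expR _); ring.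
  by rewrite exprMn -/S sqrrN; congr (_ * _); rewrite expr2 /c -!expRD; congr expR; ring.
set u := pi * `|x.2 - v.2|; have u0 : 0 <= u by rewrite mulr_ge0// ltW.
have SE : S = (expR u - expR (- u)) ^+ 2.
  rewrite /S /u; have [h|h] := leP 0 (x.2 - v.2); first by rewrite ger0_norm.
  by rewrite ltr0_norm// (mulrN pi) opprK -[RHS]sqrrN opprB.
have /andP[s1 s2] := expR_sinh u0.
have u2 : u ^+ 2 = pi ^+ 2 * (x.2 - v.2) ^+ 2 by rewrite exprMn real_normK ?num_real.
have S1 : 4 * u ^+ 2 <= S.
  have -> : 4 * u ^+ 2 = (2 * u) ^+ 2 by ring.
  by rewrite SE ler_sqr ?nnegrE//; [rewrite mulr_ge0|apply: le_trans s1; rewrite mulr_ge0].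
have S2 : S <= 4 * u ^+ 2 * expR (2 * u).
  have -> : 4 * u ^+ 2 * expR (2 * u) = (2 * u * expR u) ^+ 2.
    rewrite (_ : expR (2 * u) = expR u * expR u); first by ring.
    by rewrite -expRD; congr expR; ring.
  rewrite SE ler_sqr ?nnegrE//; first by apply: le_trans s1; rewrite mulr_ge0.
  by rewrite !mulr_ge0// ltW// expR_gt0.
set t := `|x.1 - v.1|; have t0 : 0 <= t := normr_ge0 _.
have t2' : t <= 2^-1 := t2.
have TE : T = sin (pi * t) ^+ 2.
  rewrite /T /t; have [h|h] := leP 0 (x.1 - v.1); first by rewrite ger0_norm.
  by rewrite ltr0_norm// (mulrN pi) sinN sqrrN.
have tt : t ^+ 2 = (x.1 - v.1) ^+ 2 by rewrite real_normK ?num_real.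
have pt0 : 0 <= pi * t by rewrite mulr_ge0// ltW.
have T2 : T <= pi ^+ 2 * t ^+ 2.
  rewrite TE -exprMn ler_sqr ?nnegrE//; first exact: sin_le_id.
  apply: sin_ge0_pi; rewrite pt0/= -[leRHS]mulr1 ler_pM2l//; lra.
have p4 : pi <= 4 :> R by have := pihalf_lt2 R; lra.
have T1 : pi ^+ 2 * t ^+ 2 * (1 - 6 * t ^+ 2) <= T.
  have c1 := sin_ge_cubic pt0.
  have c2 : 0 <= 1 - (pi * t) ^+ 2 / 6.
    have : pi * t <= 2 by nra.
    by rewrite expr2; nra.
  have c3 : (pi * t * (1 - (pi * t) ^+ 2 / 6)) ^+ 2 <= T.
    have e : pi * t - (pi * t) ^+ 3 / 6 = pi * t * (1 - (pi * t) ^+ 2 / 6) by ring.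
    rewrite e in c1; have c0' : 0 <= pi * t * (1 - (pi * t) ^+ 2 / 6) by rewrite mulr_ge0.
    by rewrite TE ler_sqr ?nnegrE//; exact: le_trans c1.
  apply: le_trans c3; rewrite exprMn exprMn -mulrA -mulrA; apply: ler_wpM2l; first exact: ltW.
  apply: ler_wpM2l; first exact: sqr_ge0.
  have p16 : pi ^+ 2 <= 16 :> R by rewrite expr2; nra.
  have : pi ^+ 2 * t ^+ 2 <= 16 * t ^+ 2 by rewrite ler_wpM2r ?sqr_ge0.
  have := sqr_ge0 t.
  move: (pi ^+ 2 * t ^+ 2) => Z; move: (t ^+ 2) => Q *.
  by have := sqr_ge0 (Z / 6); rewrite !expr2; lra.
rewrite -tt; have den : 0 < 4 * pi ^+ 2 * c * sqdist x v by rewrite !mulr_gt0.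
have dE : pi ^+ 2 * sqdist x v = u ^+ 2 + pi ^+ 2 * t ^+ 2 by rewrite u2 tt /sqdist; ring.
have e1 : 1 <= expR (2 * u) by rewrite -expR0 ler_expR mulr_ge0.
have uE : 2 * pi * `|x.2 - v.2| = 2 * u by rewrite /u mulrA.
rewrite uE; apply/andP; split.
  rewrite ler_pdivlMr//.
  have -> : (1 - 6 * t ^+ 2) * (4 * pi ^+ 2 * c * sqdist x v) = c * (4 * ((1 - 6 * t ^+ 2) * (pi ^+ 2 * sqdist x v))) by ring.
  rewrite dE ler_pM2l//; have : 0 <= 6 * t ^+ 2 * u ^+ 2.
    by apply: mulr_ge0; [apply: mulr_ge0; [exact: ler0n|exact: sqr_ge0]|exact: sqr_ge0].
  lra.
rewrite ler_pdivrMr//.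
have -> : expR (2 * u) * (4 * pi ^+ 2 * c * sqdist x v) = c * (4 * (expR (2 * u) * (pi ^+ 2 * sqdist x v))) by ring.
rewrite dE ler_pM2l//.
have : pi ^+ 2 * t ^+ 2 <= expR (2 * u) * (pi ^+ 2 * t ^+ 2) 
  by rewrite ler_peMl//; apply: mulr_ge0; [exact: ltW|exact: sqr_ge0].
lra.
Qed.

(** By [qd_ratio_bounds] the quotient of qd by 4 pi^2 |q(x) q(v)| |x - v|^2 tends to 1. The limit is
    taken along pairs of distinct points, where both logarithms are meaningful. *)
Lemma ln_qd_diag x0 : exists l : R,
  ln (qd p.1 p.2) - ln (sqdist p.1 p.2) @[p --> within [set p | sqdist p.1 p.2 != 0] (nbhs (x0, x0))] --> l.
Proof.
set W := within _ _; have FW : Filter W by exact: within_filter.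
have WN : W --> nbhs (x0, x0) by exact: cvg_within.
have c1 : p.1 @[p --> W] --> x0 by apply: cvg_trans (@cvg_fst _ _ (nbhs x0) (nbhs x0) _); exact: cvg_app.
have c2 : p.2 @[p --> W] --> x0 by apply: cvg_trans (@cvg_snd _ _ (nbhs x0) (nbhs x0) _); exact: cvg_app.
have f1 : {for x0, continuous (fun z : R * R => z.1)} .
  by apply: (@cvg_fst _ _ (nbhs x0.1) (nbhs x0.2)).
have f2 : {for x0, continuous (fun z : R * R => z.2)} .
  by apply: (@cvg_snd _ _ (nbhs x0.1) (nbhs x0.2)).
have c11 : p.1.1 @[p --> W] --> x0.1 by exact: (cvg_comp _ _ c1 f1).
have c12 : p.1.2 @[p --> W] --> x0.2 by exact: (cvg_comp _ _ c1 f2).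
have c21 : p.2.1 @[p --> W] --> x0.1 by exact: (cvg_comp _ _ c2 f1).
have c22 : p.2.2 @[p --> W] --> x0.2 by exact: (cvg_comp _ _ c2 f2).
have cd1 : p.1.1 - p.2.1 @[p --> W] --> (0 : R) by rewrite -(subrr x0.1); exact: cvgB.
have cd2 : p.1.2 - p.2.2 @[p --> W] --> (0 : R) by rewrite -(subrr x0.2); exact: cvgB.
pose rho (p : (R * R) * (R * R)) : R :=
  qd p.1 p.2 / (4 * pi ^+ 2 * (E p.1.2 * E p.2.2) * sqdist p.1 p.2).
have nW : \forall p \near W, sqdist p.1 p.2 != 0 /\ `|p.1.1 - p.2.1| < 4^-1.
  near=> p; split; first by near: p; exact: withinT.
  near: p; have /cvgr0Pnorm_lt := cd1; apply; lra.
have crho : rho p @[p --> W] --> (1 : R).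
  apply: (@squeeze_cvgr _ _ _ _ (fun p => 1 - 6 * (p.1.1 - p.2.1) ^+ 2) (fun p => expR (2 * pi * `|p.1.2 - p.2.2|))).
  - near=> p; have [d0 t] : sqdist p.1 p.2 != 0 /\ `|p.1.1 - p.2.1| < 4^-1 by near: p.
    by apply: qd_ratio_bounds => //; lra.
  - have : 1 - 6 * ((p.1.1 - p.2.1) * (p.1.1 - p.2.1)) @[p --> W] --> 1 - 6 * (0 * 0 : R).
      by apply: cvgB; [exact: cvg_cst|apply: cvgM; [exact: cvg_cst|exact: cvgM]].
    by rewrite !mulr0 subr0.
  - have c : 2 * pi * `|p.1.2 - p.2.2| @[p --> W] --> (0 : R).
      rewrite -(mulr0 (2 * pi)) -(normr0 R); apply: cvgM; first exact: cvg_cst.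
      exact: (cvg_norm cd2).
    by have := cvg_comp _ _ c (@continuous_expR R 0); rewrite expR0.
have clr : ln (rho p) @[p --> W] --> (0 : R).
  by have := cvg_comp _ _ crho (continuous_ln ltr01); rewrite ln1.
exists (0 + (ln (4 * pi ^+ 2) + - (2 * pi) * (x0.2 + x0.2))).
have cl : ln (rho p) + (ln (4 * pi ^+ 2) + - (2 * pi) * (p.1.2 + p.2.2)) @[p --> W]
    --> 0 + (ln (4 * pi ^+ 2) + - (2 * pi) * (x0.2 + x0.2)).
  by apply: cvgD => //; apply: cvgD; [exact: cvg_cst|apply: cvgM; [exact: cvg_cst|exact: cvgD]].
apply: cvg_trans cl; apply: near_eq_cvg; near=> p.
have [d0 t] : sqdist p.1 p.2 != 0 /\ `|p.1.1 - p.2.1| < 4^-1 by near: p.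
have /andP[r1 _] := qd_ratio_bounds d0 (ltac:(lra)).
have r0 : 0 < rho p.
  apply: lt_le_trans r1; rewrite -(real_normK (num_real _)).
  have := normr_ge0 (p.1.1 - p.2.1); move: t; move: (`|_ - _|) => t t1 t0; rewrite expr2; nra.
have dp : 0 < sqdist p.1 p.2 by rewrite lt_def d0 addr_ge0 ?sqr_ge0.
have p20 : 0 < 4 * pi ^+ 2 :> R by rewrite mulr_gt0// exprn_gt0// pi_gt0.
have e : qd p.1 p.2 = rho p * (4 * pi ^+ 2) * expR (- (2 * pi) * (p.1.2 + p.2.2)) * sqdist p.1 p.2.
  rewrite (mulrDr (- (2 * pi))) expRD -/(E p.1.2) -/(E p.2.2) /rho.
  have := mulr_gt0 (E0 p.1.2) (E0 p.2.2); move: p20 d0.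
  move: (4 * pi ^+ 2) (E _ * E _) (sqdist _ _) => a b d a0 d0 b0.
  by field; rewrite d0 !gt_eqF.
have ln4 (a b c d : R) : 0 < a -> 0 < b -> 0 < d -> ln (a * b * expR c * d) = ln a + ln b + c + ln d.
  move=> a0 b0 d0'; have ab := mulr_gt0 a0 b0; have abc := mulr_gt0 ab (expR_gt0 c).
  by rewrite (lnM abc d0') (lnM ab (expR_gt0 c)) (lnM a0 b0) expRK.
by rewrite e ln4//; ring.
Unshelve. all: by end_near. Qed.

End QDistance.

Lemma Lfn_1D (R : realType) (k : R) : 0 < k -> Lfn (1 + k) = (4 * pi)^-1 * (ln (2 + k) - ln k).
Proof.
move=> k0; rewrite /Lfn -ln_div ?posrE//; last by rewrite addr_gt0.
by congr (_ * ln (_ / _)); ring.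
Qed.

(** * The Green function of two points in one cusp disc *)

Section CuspPair.
Variables (R : realType) (Gamma : set 'M[R]_2) (F : set (R * R)).
Hypothesis hG : is_cofinite_fuchsian Gamma F.
Let fG : is_fuchsian Gamma. Proof. by case: hG. Qed.
Variables (s : 'M[R]_2) (m : R).
Hypothesis ds : \det s = 1.
Hypothesis hstab : pm (conjugate (invmx s) (cusp_stab Gamma s)) =
  pm [set mat2 1 b%:~R 0 1 | b in [set: int]].
Hypothesis m0 : 0 < m.
Hypothesis hmin : forall g, Gamma g -> ~ cusp_stab Gamma s g -> m <= Ccusp s g.
Variable gr : R * R -> R * R -> R.
Hypothesis hgr : is_green_function Gamma F gr.
Implicit Types (z w x v : R * R).
Let vI := (qvol Gamma F)^-1.
Let n : R := (ncenter Gamma)%:R.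

Let n0 : 0 < n. Proof. exact: (ncenter_gt0 hG). Qed.

(** The expression of (c) in the coordinate of the cusp, without the factors eps'. The coefficient
    is n / (4 pi) because [qd] is a squared modulus. *)
Definition cusp_pair v x : R :=
  cusp_green Gamma F s gr (mobius s v) x - n / (4 * pi) * ln (qd x v) - vI * ln v.2.

Let above_upper x : m^-1 < x.2 -> upper x.
Proof. by apply: lt_trans; rewrite invr_gt0. Qed.

Let m2 x v : m^-1 < x.2 -> m^-1 < v.2 -> (m ^+ 2)^-1 < x.2 * v.2.
Proof.
move=> hx hv; rewrite -exprVn expr2.
by apply: ltr_pM => //; rewrite invr_ge0 ltW.
Qed.

(** Above height 1/m equivalent points differ by an integer translation, and these are the pairs on
    which q agrees. *)
Lemma offdiag_qd x v : m^-1 < x.2 -> m^-1 < v.2 ->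
  offdiag Gamma (mobius s v, mobius s x) <-> 0 < qd x v.
Proof.
move=> hx hv; have xu := above_upper hx; have vu := above_upper hv; split.
  move=> [/= _ _ no]; rewrite lt_def qd_ge0 andbT; apply/eqP => /qd_eq0[b e].
  apply: no; rewrite e; apply: (same_orbit_sym fG).
    exact: upper_mobius.
  exact: (same_orbit_shift hG ds hstab).
move=> q0; split; [exact: upper_mobius|exact: upper_mobius|].
move=> /(same_orbit_sym fG (upper_mobius ds xu)) so.
have [b e] := same_orbit_cusp hG ds hstab m0 hmin vu xu (m2 hx hv) so.
by move: q0; rewrite e qd_shift qd_diag ltxx.
Qed.

Lemma cusp_pair_sym x v : m^-1 < x.2 -> m^-1 < v.2 -> 0 < qd x v -> cusp_pair v x = cusp_pair x v.
Proof.
move=> hx hv q0; have o := (offdiag_qd hx hv).2 q0.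
have [_ sym _ _ _] := hgr.
by rewrite /cusp_pair /cusp_green (sym _ _ o) (qd_sym x v) -/vI; ring.
Qed.

Lemma cusp_pair_shift (b : int) v x : m^-1 < x.2 -> m^-1 < v.2 -> 0 < qd x v ->
  cusp_pair v (hshift b x) = cusp_pair v x.
Proof.
move=> hx hv q0; have o := (offdiag_qd hx hv).2 q0.
by rewrite /cusp_pair qd_shift (cusp_green_shift hG ds hstab m0 hgr)//; split.
Qed.

Lemma cusp_pair_harmonic v : m^-1 < v.2 ->
  laplacian_on ([set x | m^-1 < x.2] `&` [set x | 0 < qd x v]) (cusp_pair v) (fun=> 0).
Proof.
move=> hv; set W := _ `&` _.
have sub1 : W `<=` cusp_regular Gamma s m (mobius s v).
  by move=> x [h1 h2]; split => //; exact: (offdiag_qd h1 hv).2.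
have sub2 : W `<=` [set x | 0 < qd x v] by move=> x [].
have oW : open W.
  apply: openI; first exact: open_above.
  have := @open_comp _ _ (fun x => qd x v) [set t : R | 0 < t].
  by apply; [move=> x _; exact: qdist_continuous|exact: open_gt].
have L := laplacian_on_add (laplacian_on_add
  (laplacian_on_sub sub1 (cusp_green_harmonic hG ds hstab m0 hmin hgr (mobius s v)))
  (laplacian_on_scale (- (n / (4 * pi))) (laplacian_on_sub sub2 (@laplacian_on_ln_qdist R (2 * pi) v.1 v.2))))
  (laplacian_on_cst W (- (vI * ln v.2))).
apply: (laplacian_on_ext oW _ _ L) => x _.
  by rewrite /cusp_pair /qd; ring.
by rewrite mulr0 !addr0.
Qed.

(** Above height 1/m an element fixing a point is, up to sign, a translation with a fixed point,
    hence trivial. So the singular sum of gr has n equal terms there. *)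
Lemma center_stab v : m^-1 < v.2 ->
  [set g | Gamma g /\ mobius g (mobius s v) = mobius s v] = Gamma `&` [set 1%:M; - 1%:M].
Proof.
move=> hv; have vu := above_upper hv; apply/seteqP; split => g [Gg]; last first.
  by move=> [|] e; rewrite e in Gg *; split=> //; rewrite ?mobiusN mobius1.
move=> e; split=> //.
have dg := fuchsian_det fG Gg.
have sg : cusp_stab Gamma s g.
  apply: contrapT => ng; have := im_nonstab hG ds m0 hmin Gg ng vu.
  have : mobius (invmx s *m g *m s) v = v.
    have dq : \det (invmx s *m g *m s) = 1 by rewrite !det_mulmx det_invmx1// dg ds !mulr1.
    have := mobius_conj ds dg vu; rewrite e => /(congr1 (mobius (invmx s))).
    by rewrite (mobiusK ds vu) (mobiusK ds (upper_mobius dq vu)) => <-.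
  by move=> ->; apply/negP; rewrite -ltNge m2.
have [b eb] := cusp_stab_translation hstab sg.
have := mobius_of_translation hG ds Gg vu eb; rewrite e => /(congr1 (mobius (invmx s))).
rewrite !mobiusK// => /(congr1 fst) /= /eqP; rewrite -subr_eq0 opprD addrA subrr sub0r oppr_eq0 intr_eq0 => /eqP b0.
rewrite b0 in eb; have t1 : mat2 1 0%:~R 0 1 = 1%:M :> 'M[R]_2.
  by apply/matrixP => i j; rewrite !mxE; case: i => [[|[|]]] //= ?; case: j => [[|[|]]].
have gE h : invmx s *m g *m s = h -> g = s *m h *m invmx s.
  have su := unitmx_det1 ds.
  by move=> <-; rewrite !mulmxA mulmxV// mul1mx mulmxK.
have ss : s *m invmx s = 1%:M by rewrite mulmxV// unitmx_det1.
rewrite t1 in eb; case: eb => /gE ->; [left|right]; rewrite ?mulmxN mulmx1 ?mulNmx ss//.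
Qed.

Lemma center_sum (f : 'M[R]_2 -> R) (c : R) : (forall g, g = 1%:M \/ g = - 1%:M -> f g = c) ->
  \sum_(g \in Gamma `&` [set 1%:M; - 1%:M]) f g = n * c.
Proof.
move=> fc; have fin : finite_set (Gamma `&` [set 1%:M; - 1%:M]) by exact: finite_setIr.
rewrite fsbig_finite// (eq_big_seq (fun=> c)).
  by rewrite big_const_seq count_predT iter_addr addr0 -mulr_natl.
by move=> g /=; rewrite in_fset_set// inE => -[_ h]; exact: fc.
Qed.

(** Near the diagonal gr is smooth up to - n L(u), and L(u) = (1/4 pi) (log(u + 1) - log(u - 1))
    with u - 1 = |x - v|^2 / (2 y y'). What must converge is therefore log qd - log |x - v|^2, which
    is [ln_qd_diag]. *)
Lemma cusp_pair_diag v : m^-1 < v.2 -> exists l : R,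
  cusp_pair p.1 p.2 @[p --> within [set p | 0 < qd p.2 p.1] (nbhs (v, v))] --> l.
Proof.
move=> hv; have vu := above_upper hv; have svu : upper (mobius s v) := upper_mobius ds vu.
have [_ _ lg _ _] := hgr; have [U [r [oU Us sr h]]] := lg _ _ svu svu.
rewrite (center_stab hv) in h.
set W := within _ _; have FW : Filter W by exact: within_filter.
have WN : W --> nbhs (v, v) by exact: cvg_within.
have [l1 hl1] := ln_qd_diag v.
have c1 : p.1 @[p --> W] --> v by apply: cvg_trans (@cvg_fst _ _ (nbhs v) (nbhs v) _); exact: cvg_app.
have c2 : p.2 @[p --> W] --> v by apply: cvg_trans (@cvg_snd _ _ (nbhs v) (nbhs v) _); exact: cvg_app.
have f2 : {for v, continuous (fun z : R * R => z.2)}.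
  by apply: (@cvg_snd _ _ (nbhs v.1) (nbhs v.2)).
have c12 : p.1.2 @[p --> W] --> v.2 by exact: (cvg_comp _ _ c1 f2).
have c22 : p.2.2 @[p --> W] --> v.2 by exact: (cvg_comp _ _ c2 f2).
have cm1 : mobius s p.1 @[p --> W] --> mobius s v by exact: (cvg_comp _ _ c1 (mobius_continuous ds vu)).
have cm2 : mobius s p.2 @[p --> W] --> mobius s v by exact: (cvg_comp _ _ c2 (mobius_continuous ds vu)).
have cp : (mobius s p.1, mobius s p.2) @[p --> W] --> (mobius s v, mobius s v) by exact: (cvg_pair cm1 cm2).
have cr : {for (mobius s v, mobius s v), continuous r} by exact: (@smooth_on_continuous _ _ U r [::] _ sr Us).
have crp : r (mobius s p.1, mobius s p.2) @[p --> W] --> r (mobius s v, mobius s v).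
  exact: (cvg_comp _ _ cp cr).
have f1 : {for v, continuous (fun z : R * R => z.1)}.
  by apply: (@cvg_fst _ _ (nbhs v.1) (nbhs v.2)).
have c11 : p.1.1 @[p --> W] --> v.1 by exact: (cvg_comp _ _ c1 f1).
have c21 : p.2.1 @[p --> W] --> v.1 by exact: (cvg_comp _ _ c2 f1).
have cd1 : p.1.1 - p.2.1 @[p --> W] --> (0 : R) by rewrite -(subrr v.1); exact: cvgB.
have cd2 : p.1.2 - p.2.2 @[p --> W] --> (0 : R) by rewrite -(subrr v.2); exact: cvgB.
have cs : sqdist p.1 p.2 @[p --> W] --> (0 : R).
  have := cvgD (cvgM cd1 cd1) (cvgM cd2 cd2); by rewrite !mulr0 addr0 => h'; exact: h'.
have v0 : 0 < v.2 := vu.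
have cy : 2 * p.1.2 * p.2.2 @[p --> W] --> 2 * v.2 * v.2.
  by apply: cvgM => //; apply: cvgM => //; exact: cvg_cst.
have y0 : 0 < 2 * v.2 * v.2 by rewrite !mulr_gt0.
have cq : ln (2 + sqdist p.1 p.2 / (2 * p.1.2 * p.2.2)) @[p --> W] --> ln (2 + 0 / (2 * v.2 * v.2)).
  have c : 2 + sqdist p.1 p.2 / (2 * p.1.2 * p.2.2) @[p --> W] --> 2 + 0 / (2 * v.2 * v.2).
    apply: cvgD; first exact: cvg_cst.
    by apply: cvgM => //; apply: cvgV => //; rewrite gt_eqF.
  by apply: (cvg_comp _ _ c); apply: continuous_ln; rewrite mul0r addr0.
have cly : ln (2 * p.1.2 * p.2.2) @[p --> W] --> ln (2 * v.2 * v.2).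
  exact: (cvg_comp _ _ cy (continuous_ln y0)).
have cl1 : ln p.1.2 @[p --> W] --> ln v.2 by exact: (cvg_comp _ _ c12 (continuous_ln v0)).
have cl2 : ln p.2.2 @[p --> W] --> ln v.2 by exact: (cvg_comp _ _ c22 (continuous_ln v0)).
have {}hl1 : ln (qd p.1 p.2) - ln (sqdist p.1 p.2) @[p --> W] --> l1.
  apply: cvg_trans hl1; apply: cvg_app => A hA; rewrite /W /within.
  apply: (@filterS _ (nbhs (v, v)) _ _ _ _ hA) => p hp /= q0; apply: hp.
  have z0 (x y : R * R) : sqdist x y = 0 -> x = y.
    move=> /eqP; rewrite paddr_eq0 ?sqr_ge0// !expf_eq0/= !subr_eq0 => /andP[/eqP e1 /eqP e2].
    by rewrite [x]surjective_pairing [y]surjective_pairing e1 e2.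
  by apply: contraTneq q0 => /z0 ->; rewrite qd_diag ltxx.
exists (r (mobius s v, mobius s v) + - (n / (4 * pi)) * (ln (2 + 0 / (2 * v.2 * v.2)) + ln (2 * v.2 * v.2) + l1)
  + - vI * (ln v.2 + ln v.2)).
have cl : r (mobius s p.1, mobius s p.2) + - (n / (4 * pi)) * (ln (2 + sqdist p.1 p.2 / (2 * p.1.2 * p.2.2))
   + ln (2 * p.1.2 * p.2.2) + (ln (qd p.1 p.2) - ln (sqdist p.1 p.2))) + - vI * (ln p.1.2 + ln p.2.2)
   @[p --> W] --> (r (mobius s v, mobius s v) + - (n / (4 * pi)) * (ln (2 + 0 / (2 * v.2 * v.2)) + ln (2 * v.2 * v.2) + l1)
  + - vI * (ln v.2 + ln v.2)).
  apply: cvgD; last by apply: cvgM; [exact: cvg_cst|exact: cvgD].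
  apply: cvgD => //; apply: cvgM; first exact: cvg_cst.
  by apply: cvgD => //; exact: cvgD.
apply: cvg_trans cl; apply: near_eq_cvg; near=> p.
have q0 : 0 < qd p.2 p.1 by near: p; exact: withinT.
have p1 : m^-1 < p.1.2 by near: p; apply: cvgr_gt c12 _ hv.
have p2 : m^-1 < p.2.2 by near: p; apply: cvgr_gt c22 _ hv.
have Up : U (mobius s p.1, mobius s p.2) by near: p; apply: (cp U); exact: open_nbhs_nbhs.
have o := (offdiag_qd p2 p1).2 q0.
have u1 := above_upper p1; have u2 := above_upper p2.
have y1 : 0 < p.1.2 := u1. have y2 : 0 < p.2.2 := u2.
rewrite /cusp_pair /cusp_green (h _ _ Up o).
rewrite (@center_sum _ (Lfn (upt p.1 p.2))); last first.
  by move=> g [|] ->; rewrite ?mobiusN mobius1 upt_mobius.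
have sq0 : 0 < sqdist p.1 p.2.
  rewrite lt_def addr_ge0 ?sqr_ge0// andbT; apply: contraTneq q0 => /eqP.
  rewrite paddr_eq0 ?sqr_ge0// !expf_eq0/= !subr_eq0 => /andP[/eqP e1 /eqP e2].
  by rewrite (_ : p.1 = p.2) ?qd_diag ?ltxx// [p.1]surjective_pairing [p.2]surjective_pairing e1 e2.
have yy : 0 < 2 * p.1.2 * p.2.2 by rewrite !mulr_gt0.
have k0 : 0 < sqdist p.1 p.2 / (2 * p.1.2 * p.2.2) by rewrite divr_gt0.
have k2 : 0 < 2 + sqdist p.1 p.2 / (2 * p.1.2 * p.2.2) by rewrite addr_gt0.
have -> : Lfn (upt p.1 p.2) = (4 * pi)^-1 * (ln (2 + sqdist p.1 p.2 / (2 * p.1.2 * p.2.2)) + ln (2 * p.1.2 * p.2.2) - ln (sqdist p.1 p.2)).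
  by rewrite uptE_sqdist// Lfn_1D// (ln_div (x := sqdist _ _)) ?posrE//; ring.
by rewrite (qd_sym p.2 p.1) /vI; ring.
Unshelve. all: by end_near. Qed.

Lemma compact_locally_bounded (K : set (R * R)) (P : set (R * R)) (h : R * R -> R) : compact K ->
  (forall x, K x -> exists M : R, \forall x' \near x, P x' -> h x' <= M) ->
  exists M : R, forall x, K x -> P x -> h x <= M.
Proof.
move=> /compact_near_coveringP cK hK.
have [|M [_ hM]] := cK R (+oo : set_system R) (fun M x => P x -> h x <= M) _.
  move=> x Kx; have [M0 hM0] := hK x Kx.
  exists ([set x' | P x' -> h x' <= M0], [set M | M0 <= M]) => /=.
    by split => //; exact: nbhs_pinfty_ge (num_real _).
  by move=> [x' M] [/= h1 h2] Px; apply: le_trans h2; exact: h1.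
exists (M + 1) => x Kx Px; apply: (hM (M + 1)) => //; lra.
Qed.

Let EP v := [set x | 0 < qd x v].

(** Where qd vanishes, x is a translate of v; periodicity moves it to v, where [cusp_pair_diag]
    gives a limit. *)
Let cusp_pair_locally_bounded sg v x : `|sg| = 1 -> m^-1 < v.2 -> m^-1 < x.2 ->
  exists M : R, \forall x' \near x, 0 < qd x' v -> sg * cusp_pair v x' <= M.
Proof.
move=> sg1 hv hx; have above : \forall x' \near x, m^-1 < x'.2.
  by apply: open_nbhs_nbhs; split => //; exact: open_above.
have := qd_ge0 x v; rewrite le_eqVlt => /orP[/eqP/esym q0|q0]; last first.
  have c : {for x, continuous (cusp_pair v)} := laplacian_on_continuous (cusp_pair_harmonic hv) (conj hx q0).
  exists (`|cusp_pair v x| + 1).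
  have : \forall x' \near x, `|cusp_pair v x - cusp_pair v x'| < 1 by apply: cvgr_dist_lt c _ ltr01.
  apply: filterS => x' h _; apply: (le_trans (ler_norm _)); rewrite normrM sg1 mul1r.
  have -> : cusp_pair v x' = cusp_pair v x - (cusp_pair v x - cusp_pair v x') by ring.
  by apply: (le_trans (ler_normB _ _)); rewrite lerD2l ltW.
have [b e] := qd_eq0 q0; have [l hl] := cusp_pair_diag hv.
exists (`|l| + 1).
have h1 : nbhs (v, v) [set p | 0 < qd p.2 p.1 -> `|l - cusp_pair p.1 p.2| < 1].
  by have h0 := hl _ (nbhsx_ballx l 1 ltr01); exact: h0.
have h2 : nbhs v [set y | 0 < qd y v -> `|l - cusp_pair v y| < 1].
  have [[A B] /= [hA hB] AB] := h1.
  by apply: filterS hB => y By; apply: (AB (v, y)); split => //=; exact: nbhs_singleton.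
have h3 : \forall x' \near x, 0 < qd (hshift (- b) x') v -> `|l - cusp_pair v (hshift (- b) x')| < 1.
  have c : {for x, continuous (hshift (- b))}.
    have k2 : (fun z : R * R => z.2) @ nbhs x --> x.2 by apply: (@cvg_snd _ _ (nbhs x.1) (nbhs x.2)).
    have k1 : (fun z : R * R => z.1 + (- b)%:~R) @ nbhs x --> x.1 + (- b)%:~R.
      by apply: cvgD; [apply: (@cvg_fst _ _ (nbhs x.1) (nbhs x.2))|exact: cvg_cst].
    exact: (cvg_pair k1 k2).
  have ev : hshift (- b) x = v.
    by rewrite e /hshift /= rmorphN /= addrK -surjective_pairing.
  have h2' : nbhs (hshift (- b) x) [set y | 0 < qd y v -> `|l - cusp_pair v y| < 1] by rewrite ev.
  exact: (c _ h2').
near=> x'; have hx' : m^-1 < x'.2 by near: x'.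
have h4 : 0 < qd (hshift (- b) x') v -> `|l - cusp_pair v (hshift (- b) x')| < 1 by near: x'.
rewrite qd_shift in h4 => q'; have {}h4 := h4 q'.
rewrite cusp_pair_shift// in h4.
apply: (le_trans (ler_norm _)); rewrite normrM sg1 mul1r.
have -> : cusp_pair v x' = l - (l - cusp_pair v x') by ring.
by apply: (le_trans (ler_normB _ _)); rewrite lerD2l ltW.
Unshelve. all: by end_near. Qed.

Lemma reduce_shift x : exists b, 0 <= (hshift b x).1 <= 1.
Proof.
have [k [f [e /andP[f0 f1]]]] := floor_split x.1.
exists (- k); rewrite /hshift /= rmorphN /= e addrK f0 ltW//.
Qed.

Let cusp_pair_rect_bounded sg v (y1 y2 : R) : `|sg| = 1 -> m^-1 < v.2 -> m^-1 < y1 ->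
  exists M : R, forall x, y1 <= x.2 -> x.2 <= y2 -> 0 < qd x v -> sg * cusp_pair v x <= M.
Proof.
move=> sg1 hv hy1.
have cK : compact (rect 0 1 y1 y2 : set (R * R)).
  by apply: compact_setX; exact: segment_compact.
have [|M hM] := @compact_locally_bounded _ (EP v) (fun x => sg * cusp_pair v x) cK.
  move=> x [_ hx]; apply: cusp_pair_locally_bounded => //.
  by move: hx; rewrite /= in_itv/= => /andP[h _]; exact: lt_le_trans h.
exists M => x h1 h2 q0; have [b hb] := reduce_shift x.
have hx : m^-1 < x.2 by exact: lt_le_trans h1.
rewrite -(@cusp_pair_shift b)//; apply: hM; last by rewrite /EP /= qd_shift.
by split; rewrite /= in_itv/=; [exact: hb|rewrite h1].
Qed.

(** Up to height v.2 + 1 periodicity and compactness suffice. Higher up qd stays away from 0, so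
    [cusp_pair] differs by a bounded amount from [cusp_green], to which [cusp_bounded] applies. This
    is the crude bound M that the maximum principle starts from. *)
Lemma cusp_pair_bounded sg v (y1 : R) : `|sg| = 1 -> m^-1 < v.2 -> m^-1 < y1 ->
  exists M : R, forall x, y1 <= x.2 -> 0 < qd x v -> sg * cusp_pair v x <= M.
Proof.
move=> sg1 hv hy1; have vu := above_upper hv; have v0 : 0 < v.2 := vu.
have [M1 hM1] := cusp_pair_rect_bounded (v.2 + 1) sg1 hv hy1.
have [M2 hM2] := cusp_pair_rect_bounded (v.2 + 1) sg1 hv hv.
have c0 : 0 < n / (4 * pi) by rewrite divr_gt0// mulr_gt0// pi_gt0.
have [L hL] : exists L : R, forall x, v.2 + 1 <= x.2 -> 0 < qd x v /\ `|ln (qd x v)| <= L.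
  have l0 := qd_lower_gt0 v; set q := (_ ^+ 2) in l0.
  exists (`|ln 4| + `|ln q|) => x hx; have := qd_lower hx; rewrite -/q => h.
  have q0 : 0 < qd x v by exact: lt_le_trans h.
  have x0 : 0 <= x.2 by lra.
  split=> //; have h1 := ln_qd_le x0 (ltW v0) q0.
  have h2 : ln q <= ln (qd x v) by rewrite ler_ln ?posrE.
  have := ler_norm (ln 4 : R); have := ler_norm (- ln q); rewrite normrN.
  have := normr_ge0 (ln 4 : R); have := normr_ge0 (ln q).
  by rewrite ler_norml => *; apply/andP; split; lra.
pose K := n / (4 * pi) * L + `|vI * ln v.2|.
have diff x : v.2 + 1 <= x.2 ->
    `|sg * cusp_pair v x - sg * cusp_green Gamma F s gr (mobius s v) x| <= K.
  move=> hx; have [_ hl] := hL _ hx.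
  rewrite -mulrBr normrM sg1 mul1r /cusp_pair.
  rewrite (_ : _ - _ = - (n / (4 * pi) * ln (qd x v) + vI * ln v.2)); last by ring.
  rewrite normrN; apply: (le_trans (ler_normD _ _)); rewrite lerD2r normrM gtr0_norm//.
  by rewrite ler_pM2l.
exists (Num.max M1 (M2 + K + K)) => x hx q0; rewrite le_max.
have [h|h] := leP x.2 (v.2 + 1); first by rewrite hM1.
apply/orP; right; have h' := ltW h.
have := diff x h'; rewrite ler_norml => /andP[_ d1].
have : sg * cusp_green Gamma F s gr (mobius s v) x <= M2 + K; last by lra.
apply: (@cusp_bounded _ _ _ hG s m ds hstab m0 hmin gr hgr (mobius s v) (v.2 + 2^-1) (v.2 + 1)) => //.
- exact: upper_mobius.
- by rewrite ltW// (lt_trans hv)//; lra.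
- by lra.
- move=> y hy; have hy' : m^-1 < y.2 by apply: (lt_trans hv); lra.
  apply/(offdiag_qd hy' hv); rewrite lt_def qd_ge0 andbT; apply/eqP => /qd_eq0[b e].
  by move: hy; rewrite e /=; lra.
- move=> a; have hy : v.2 + 1 <= (a, v.2 + 1 : R).2 by [].
  have [q1 _] := hL _ hy; have := diff _ hy; rewrite ler_norml => /andP[d2 _].
  have := hM2 (a, v.2 + 1) _ _ q1; rewrite /= => /(_ ltac:(lra) (lexx _)); lra.
Qed.

(** The maximum principle on a strip with p = qd; ln 4 bounds log qd because |q| <= 1. *)
Lemma cusp_pair_extend v (y1 A B : R) : m^-1 < v.2 -> m^-1 < y1 ->
  (forall x, x.2 = y1 -> 0 < qd x v -> A <= cusp_pair v x <= B) ->
  forall x, y1 <= x.2 -> 0 < qd x v -> A <= cusp_pair v x <= B.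
Proof.
move=> hv hy1 hAB.
have y10 : 0 < y1 by apply: lt_trans hy1; rewrite invr_gt0.
have v0 : 0 < v.2 := above_upper hv.
have gen sg C : `|sg| = 1 -> (forall x, x.2 = y1 -> 0 < qd x v -> sg * cusp_pair v x <= C) ->
    forall x, y1 <= x.2 -> 0 < qd x v -> sg * cusp_pair v x <= C.
  move=> sg1 hC; have [M hM] := cusp_pair_bounded sg1 hv hy1.
  have H := laplacian_on_scale sg (cusp_pair_harmonic hv).
  apply: (@strip_max_principle _ (fun x => sg * cusp_pair v x) (fun x => qd x v) y1 C (ln 4) M) => //.
  - by move=> z; exact: qdist_continuous.
  - by move=> z zy; apply: ln_qd_le; lra.
  - by move=> b z; exact: qd_shift.
  - exact: laplacian_on_ln_qdist.
  - have sub : [set z | y1 < z.2] `&` [set z | 0 < qd z v] `<=` [set x | m^-1 < x.2] `&` [set x | 0 < qd x v].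
      by move=> z [/= h1 h2]; split=> //=; exact: lt_trans h1.
    have := laplacian_on_sub sub H; rewrite (_ : (fun z => sg * 0) = (fun=> 0))//.
    by apply/funext => z; rewrite mulr0.
  - by move=> z zy q0; apply: (laplacian_on_continuous H); split=> //=; rewrite zy.
  - by move=> b z zy q0; rewrite cusp_pair_shift//; exact: lt_le_trans zy.
move=> x hx q0; apply/andP; split; last first.
  rewrite -[cusp_pair v x]mul1r; apply: (gen 1 B (normr1 R)) => // z zy qz.
  by rewrite mul1r; have /andP[] := hAB z zy qz.
rewrite -lerN2 -mulN1r; apply: gen => //; first by rewrite normrN normr1.
by move=> z zy qz; rewrite mulN1r lerN2; have /andP[] := hAB z zy qz.
Qed.

Lemma cusp_pair_extend2 (y1 A B : R) : m^-1 < y1 ->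
  (forall x v, x.2 = y1 -> v.2 = y1 -> 0 < qd x v -> A <= cusp_pair v x <= B) ->
  forall x v, y1 <= x.2 -> y1 <= v.2 -> 0 < qd x v -> A <= cusp_pair v x <= B.
Proof.
move=> hy1 hAB x v hx hv.
have hv' : m^-1 < v.2 by exact: lt_le_trans hv.
apply: (cusp_pair_extend hv' hy1) => // z zy q0.
have hz : m^-1 < z.2 by rewrite zy.
rewrite cusp_pair_sym//; apply: (cusp_pair_extend hz hy1) => //; last by rewrite qd_sym.
by move=> w wy q1; exact: hAB.
Qed.

Lemma cusp_green_extend w (y0 y1 A B : R) : upper w -> m^-1 <= y0 -> y0 < y1 ->
  (forall x, y0 < x.2 -> offdiag Gamma (w, mobius s x)) ->
  (forall a, A <= cusp_green Gamma F s gr w (a, y1) <= B) ->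
  forall x, y1 <= x.2 -> A <= cusp_green Gamma F s gr w x <= B.
Proof.
move=> wu my y01 off hAB x hx.
have gen sg C : `|sg| = 1 -> (forall a, sg * cusp_green Gamma F s gr w (a, y1) <= C) ->
    sg * cusp_green Gamma F s gr w x <= C.
  by move=> sg1 hC; exact: (@cusp_bounded _ _ _ hG s m ds hstab m0 hmin gr hgr w y0 y1 C sg).
apply/andP; split; last first.
  rewrite -[leLHS]mul1r; apply: gen; first exact: normr1.
  by move=> a; rewrite mul1r; have /andP[] := hAB a.
rewrite -lerN2 -mulN1r; apply: gen; first by rewrite normrN normr1.
by move=> a; rewrite mulN1r lerN2; have /andP[] := hAB a.
Qed.

End CuspPair.

(** * The sum over the orbit for two points on a horocycle *)

Section BoundarySum.
Variables (R : realType) (Gamma : set 'M[R]_2) (F : set (R * R)).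
Hypothesis hG : is_cofinite_fuchsian Gamma F.
Let fG : is_fuchsian Gamma. Proof. by case: hG. Qed.
Variables (s : 'M[R]_2) (m : R).
Hypothesis ds : \det s = 1.
Hypothesis hstab : pm (conjugate (invmx s) (cusp_stab Gamma s)) =
  pm [set mat2 1 b%:~R 0 1 | b in [set: int]].
Hypothesis m0 : 0 < m.
Hypothesis hmin : forall g, Gamma g -> ~ cusp_stab Gamma s g -> m <= Ccusp s g.
Implicit Types (z w x v : R * R).
Let n : R := (ncenter Gamma)%:R.
Variables (delta k y1 : R).
Hypothesis delta1 : 1 < delta.
Hypothesis k1 : 1 <= k.
Hypothesis kE : (k + k^-1) / 2 = delta.
Hypothesis y10 : 0 < y1.
Hypothesis my1 : k / m ^+ 2 <= y1 * y1.

Let T := Num.sqrt ((delta - 1) / 2).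
Let a := 2 * y1.
(** The horizontal distance at height y1 for which u = delta, see [deltaE]. *)
Let X := a * T.

Let T0 : 0 < T. Proof. by rewrite sqrtr_gt0 divr_gt0// subr_gt0. Qed.
Let a0 : 0 < a. Proof. by rewrite mulr_gt0. Qed.
Let X0 : 0 < X. Proof. exact: mulr_gt0. Qed.

Lemma Lfn_horizontal (t : R) : t != 0 ->
  Lfn (1 + t ^+ 2 / (2 * y1 * y1)) = (4 * pi)^-1 * (ln (a ^+ 2 + t ^+ 2) - 2 * ln `|t|).
Proof.
move=> t0; have t2 : 0 < t ^+ 2 by rewrite exprn_even_gt0.
have yy : 0 < 2 * y1 * y1 by rewrite !mulr_gt0.
have at0 : 0 < a ^+ 2 + t ^+ 2 by rewrite addr_gt0// exprn_gt0.
rewrite Lfn_1D ?divr_gt0//.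
have -> : 2 + t ^+ 2 / (2 * y1 * y1) = (a ^+ 2 + t ^+ 2) / (2 * y1 * y1).
  by rewrite /a; field; rewrite gt_eqF.
rewrite !ln_div ?posrE//; congr (_ * _).
have -> : ln (t ^+ 2) = 2 * ln `|t|.
  by rewrite -(real_normK (num_real t)) lnXn ?normr_gt0// mulr_natl.
ring.
Qed.

Let deltaE : delta = 1 + X ^+ 2 / (2 * y1 * y1).
Proof.
have T2 : T ^+ 2 = (delta - 1) / 2 by rewrite sqr_sqrtr// divr_ge0// subr_ge0 ltW.
by rewrite /X /a !exprMn T2; field; rewrite gt_eqF.
Qed.

Let phi (t : R) : R := log_bump a X t - 2 * (ln `|t| - ln X).

Let Lfn_phi (t : R) : t != 0 -> Lfn (1 + t ^+ 2 / (2 * y1 * y1)) - Lfn delta = (4 * pi)^-1 * phi t.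
Proof.
move=> t0; rewrite Lfn_horizontal// deltaE Lfn_horizontal ?gt_eqF// (gtr0_norm X0).
by rewrite /phi /log_bump; ring.
Qed.

(** Only translations contribute, each through n elements of Gamma, and the shifts of horizontal
    distance at most X are exactly those with u <= delta. The rest is [periodized_log_sum]. *)
Lemma orbit_term_sum x v : x.2 = y1 -> v.2 = y1 -> 0 < qd x v ->
  exists2 E : R, `|E| <= 3^-1 * (X^-1 + atan (X / a) / a) &
  \sum_(g \in [set g | Gamma g /\ upt (mobius s v) (mobius g (mobius s x)) <= delta])
     (Lfn (upt (mobius s v) (mobius g (mobius s x))) - Lfn delta) =
  n / (4 * pi) * (E - 2 * ln (2 * `|sin (pi * (x.1 - v.1))|) + 4 * a * atan (X / a)).
Proof.
move=> xy vy q0.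
have xu : upper x by rewrite /upper /= xy.
have vu : upper v by rewrite /upper /= vy.
have [kk [x0 [thE /andP[x00 x01]]]] := floor_split (v.1 - x.1).
have s2E : `|sin (pi * (x.1 - v.1))| = `|sin (pi * x0)|.
  rewrite -(opprB v.1 x.1) mulrN sinN normrN.
  apply/eqP; rewrite -(@eqrXn2 _ 2)// !real_normK ?num_real//; apply/eqP.
  have := cos_2pi_half (v.1 - x.1); rewrite thE cos_2pi_int cos_2pi_half.
  by move=> /(mulfI _) ->; rewrite ?pnatr_eq0.
have {}x00 : 0 < x0.
  rewrite lt_def x00 andbT; apply/eqP => x0'.
  move: q0; rewrite qdE xy vy subrr expr0n/= add0r cos_2pi_half -(opprB v.1 x.1) mulrN sinN sqrrN.
  have := cos_2pi_half (v.1 - x.1); rewrite thE x0' cos_2pi_int !mulr0 cos0 subrr => <-.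
  by rewrite mulr0 ltxx.
have [N [r [xN rP]]] := @cutoff_nat _ x0 X X0 (ltW x01).
have [N' [r' [xN' rP']]] := @cutoff_nat _ (1 - x0) X X0 (ltac:(lra)).
have rI : 0 <= r <= 1 by lra.
have rI' : 0 <= r' <= 1 by lra.
have xI : 0 < x0 < 1 by rewrite x00.
have s0 : 0 < sin (pi * x0) := sin_pi_gt0 xI.
have := periodized_log_sum a0 X0 xI xN xN' rI rI'; set E := (X in `|X|) => hE.
exists E => //; rewrite s2E gtr0_norm//.
have [gam hgam] := choice (translation_cusp_stab hstab).
have gG b : Gamma (gam b) by have [[]] := hgam b.
have gact b : mobius (gam b) (mobius s x) = mobius s (hshift b x).
  by have [_ e] := hgam b; exact: (mobius_of_translation hG ds (gG b) xu e).
have uptb b : upt (mobius s v) (mobius s (hshift b x)) = 1 + (v.1 - x.1 - b%:~R) ^+ 2 / (2 * y1 * y1).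
  rewrite upt_mobius// uptE_sqdist// /sqdist /= xy vy subrr expr0n/= addr0.
  by congr (1 + _ / _); rewrite opprD addrA.
pose C : set 'M[R]_2 := Gamma `&` [set 1%:M; - 1%:M].
(* Numbered so that the i-th translation leaves the horizontal difference x0 - N' + i; for i < N' +
   N these are the differences of absolute value at most X. *)
pose beta (i : nat) : int := kk + N'%:Z - i%:Z.
have betaE i : v.1 - x.1 - (beta i)%:~R = x0 - N'%:R + i%:R.
  by rewrite thE /beta intrB intrD; ring.
pose S0 : set 'M[R]_2 := [set g | Gamma g /\ exists b : int,
  (invmx s *m g *m s = mat2 1 b%:~R 0 1 \/ invmx s *m g *m s = - mat2 1 b%:~R 0 1) /\
  upt (mobius s v) (mobius g (mobius s x)) <= delta].
have su := unitmx_det1 ds.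
have conjK (g h : 'M[R]_2) : invmx s *m g *m s = invmx s *m h *m s -> g = h.
  move=> /(congr1 (mulmx s)) /(congr1 (fun M => M *m invmx s)).
  by rewrite !mulmxA !mulmxV// !mul1mx -!mulmxA !mulmxV// !mulmx1.
(* Elements outside the stabilizer have u >= delta by [upt_nonstab]; those that still occur have u =
   delta and contribute 0. *)
rewrite -(@fsbig_widen _ _ _ _ S0); first last.
- move=> g [[Gg ug] nS]; apply/eqP; rewrite subr_eq0; apply/eqP; congr Lfn.
  apply/le_anti; rewrite ug/= -kE; apply: (upt_nonstab hG ds m0 hmin) => //; last by rewrite xy vy.
  by move=> sg; apply: nS; split => //; have [b e] := cusp_stab_translation hstab sg; exists b.
- by move=> g [Gg [b [_ ub]]].
pose f (p : 'M[R]_2 * nat) := p.1 *m gam (beta p.2).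
have Cmob e z : C e -> mobius e z = z by move=> [_ [|]] ->; rewrite ?mobiusN mobius1.
have Cdet e : C e -> \det e = 1 by move=> [Ge _]; exact: (fuchsian_det fG).
have fact p : C p.1 -> mobius (f p) (mobius s x) = mobius s (hshift (beta p.2) x).
  by move=> Cp; rewrite /f (mobiusM (Cdet _ Cp) (fuchsian_det fG (gG _)) (upper_mobius ds xu)) gact Cmob.
have inrange (i : nat) : (i < N' + N)%N -> `|x0 - N'%:R + i%:R| <= X.
  move=> iN; have : i.+1%:R <= (N' + N)%:R :> R by rewrite ler_nat.
  rewrite -addn1 !natrD => h; have i0 : 0 <= i%:R :> R by [].
  by rewrite ler_norml; apply/andP; split; lra.
(* The elements acting by a given translation are the products of one of them, [gam b], with the
   central elements. *)
have bij : set_bij (C `*` `I_(N' + N)) S0 f.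
  split.
  - move=> [e i] [/= Ce iN]; have [Ge e1] := Ce; split; first exact: fuchsian_mul.
    exists (beta i); split.
      have [_ h] := hgam (beta i); rewrite /f /=.
      by case: e1 => ->; rewrite ?mulNmx mul1mx ?mulmxN ?mulNmx; case: h => ->; rewrite ?opprK; [left|right|right|left].
    rewrite (fact (e, i))//= uptb betaE deltaE lerD2l ler_pM2r ?invr_gt0 ?mulr_gt0//.
    by rewrite -(real_normK (num_real (_ + _))) ler_sqr ?nnegrE ?(ltW X0)// inrange.
  - move=> [e i] [e' i'] /set_mem[/= Ce iN] /set_mem[/= Ce' iN'] ff.
    have := fact (e, i) Ce; rewrite ff (fact (e', i') Ce') /= => /(congr1 (mobius (invmx s))).
    rewrite !mobiusK// => /(congr1 fst) /= /addrI /intr_inj; rewrite /beta => /addrI /oppr_inj [ii].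
    subst i'; congr pair; move: ff; rewrite /f /= => /(congr1 (fun M => M *m invmx (gam (beta i)))).
    by rewrite -!mulmxA !mulmxV ?mulmx1// unitmx_det1// (fuchsian_det fG (gG _)).
  - move=> g [Gg [b [eb ub]]].
    have gb := mobius_of_translation hG ds Gg xu eb.
    move: ub; rewrite gb uptb deltaE lerD2l ler_pM2r ?invr_gt0 ?mulr_gt0// => ub.
    have {}ub : `|v.1 - x.1 - b%:~R| <= X.
      by rewrite -(ler_sqr (normr_nneg _))// ?nnegrE ?(ltW X0)// real_normK ?num_real.
    have [i [iN ei]] : exists i : nat, (i < N' + N)%N /\ beta i = b.
      move: ub; rewrite thE ler_norml => /andP[b1 b2].
      have jR : (kk + N'%:Z - b)%:~R = kk%:~R + N'%:R - b%:~R :> R by rewrite intrB intrD.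
      move: jR; set j := kk + _ - b => jR.
      have j0 : 0 <= j.
        rewrite leNgt; apply/negP => jn; have : (j + 1)%:~R <= 0%:~R :> R by rewrite ler_int lezD1.
        by rewrite intrD jR; lra.
      exists `|j|%N; split; last by rewrite /beta gez0_abs// /j; ring.
      rewrite -ltz_nat gez0_abs// -(ltr_int R) jR -[((N' + N)%N : int)%:~R]/((N' + N)%:R : R) natrD; lra.
    exists (g *m invmx (gam b), i); last first.
      by rewrite /f /= ei -mulmxA mulVmx ?mulmx1// unitmx_det1// (fuchsian_det fG (gG _)).
    split=> //=; split; first by apply: fuchsian_mul => //; exact: fuchsian_inv.
    have gg : g = gam b \/ g = - gam b.
      have [_ h] := hgam b.
      have h' : invmx s *m g *m s = invmx s *m gam b *m s \/ invmx s *m g *m s = invmx s *m (- gam b) *m s.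
        by rewrite mulmxN mulNmx; case: eb => ->; case: h => ->; rewrite ?opprK; [left|right|right|left].
      by case: h' => /conjK; [left|right].
    have gu : gam b \in unitmx by rewrite unitmx_det1// (fuchsian_det fG (gG _)).
    by case: gg => ->; rewrite ?mulNmx mulmxV//; [left|right].
rewrite (reindex_fsbig f _ _ _ bij).
rewrite -(@eq_fsbigr _ _ _ _ (fun p : 'M[R]_2 * nat => (4 * pi)^-1 * phi (x0 - N'%:R + p.2%:R))); last first.
  move=> p /set_mem[Cp iN]; rewrite fact// uptb betaE Lfn_phi//.
  apply/eqP => e; have [h|h] := leqP N' p.2.
    have : N'%:R <= p.2%:R :> R by rewrite ler_nat.
    by lra.
  have : p.2.+1%:R <= N'%:R :> R by rewrite ler_nat.
  by rewrite -addn1 natrD; lra.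
rewrite -(@pair_fsbig _ _ _ _ _ C `I_(N' + N) (fun e i => (4 * pi)^-1 * phi (x0 - N'%:R + i%:R))); last 2 first.
- exact: finite_setIr.
- exact: finite_II.
rewrite (@center_sum R Gamma _ ((4 * pi)^-1 * \sum_(i < N' + N) phi (x0 - N'%:R + i%:R))); last first.
  by move=> e _; rewrite -fsbig_ord mulr_sumr.
rewrite sum_two_sided; last by move=> t; rewrite /phi log_bumpN normrN.
rewrite mulrA; congr (_ * _); rewrite /E.
have -> : \sum_(j < N) phi (x0 + j%:R) = \sum_(j < N) (log_bump a X (x0 + j%:R) - 2 * (ln (x0 + j%:R) - ln X)).
  by apply: eq_bigr => j _; rewrite /phi gtr0_norm// ltr_wpDr.
have -> : \sum_(j < N') phi (1 - x0 + j%:R) = \sum_(j < N') (log_bump a X (1 - x0 + j%:R) - 2 * (ln (1 - x0 + j%:R) - ln X)).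
  by apply: eq_bigr => j _; rewrite /phi gtr0_norm// ltr_wpDr// subr_gt0.
by ring.
Qed.

Variable gr : R * R -> R * R -> R.

(** The terms log(2 |sin|) of the sum and of log qd cancel. There remain n y1 from |q(x)| on the
    horocycle, - n y1 (2/pi) atan T from the sum, and the error E. *)
Lemma cusp_pair_boundary x v (A B : R) : x.2 = y1 -> v.2 = y1 -> 0 < qd x v ->
  A <= gr (mobius s v) (mobius s x) +
    \sum_(g \in [set g | Gamma g /\ upt (mobius s v) (mobius g (mobius s x)) <= delta])
       (Lfn (upt (mobius s v) (mobius g (mobius s x))) - Lfn delta) <= B ->
  Atilde Gamma A delta y1^-1 - 2 * ((qvol Gamma F)^-1 * ln y1) <= cusp_pair Gamma F s gr v x
    <= Btilde Gamma B delta y1^-1 - 2 * ((qvol Gamma F)^-1 * ln y1).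
Proof.
move=> xy vy q0; have [E hE ->] := orbit_term_sum xy vy q0.
rewrite /cusp_pair /cusp_green (qd_horizontal (etrans xy (esym vy)) q0) xy vy -/n.
rewrite /Atilde /Btilde /rdelta -/n invrK -/T.
have -> : Num.sqrt (2 / (delta - 1)) = T^-1.
  by rewrite -sqrtrV ?divr_ge0 ?subr_ge0 ?(ltW delta1)// invf_div.
have XT : X / a = T by rewrite /X mulrC mulKf// gt_eqF.
rewrite XT in hE *; have aE : a = 2 * y1 by [].
have XE : X^-1 = y1^-1 / 2 * T^-1 by rewrite /X /a; field; rewrite !gt_eqF.
have aI : a^-1 = y1^-1 / 2 by rewrite /a invfM mulrC.
have pi0 : 0 < pi :> R := pi_gt0 R.
have n0 : 0 <= n by exact: ler0n.
pose c := n / (4 * pi); have c0 : 0 <= c by rewrite divr_ge0// mulr_ge0// ltW.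
have := ler_wpM2l c0 hE.
(* The factor 24 pi arises here as 4 pi times 3 times 2, the last one from a = 2 y1. *)
have -> : c * (3^-1 * (X^-1 + atan T / a)) = n * (y1^-1 * ((24 * pi)^-1 * (T^-1 + atan T))).
  rewrite XE aI /c; move: (atan T) (T^-1) (y1^-1) => u1 u2 u3.
  by rewrite !invfM; move: (pi^-1) => u4; lra.
have cE : `|c * E| = c * `|E| by rewrite normrM ger0_norm.
rewrite -cE ler_norml => /andP[e1 e2].
rewrite aE (_ : n / (4 * pi) * (E - 2 * ln (2 * `|sin (pi * (x.1 - v.1))|) + 4 * (2 * y1) * atan T) =
  c * E - c * (2 * ln (2 * `|sin (pi * (x.1 - v.1))|)) + n * (y1 * (2 / pi * atan T))); last first.
  rewrite /c invfM; move: (pi^-1) (ln _) (atan T) => u4 u5 u6; lra.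
have cpi : c * (4 * pi) = n by rewrite /c divfK// gt_eqF// mulr_gt0.
rewrite (_ : n / (4 * pi) * (2 * ln (2 * `|sin (pi * (x.1 - v.1))|) - 4 * pi * y1) =
  c * (2 * ln (2 * `|sin (pi * (x.1 - v.1))|)) - n * y1); last first.
  by rewrite -/c -cpi; ring.
move: e1 e2; move: (c * (2 * _)) (c * E) => u1 u2 e1 e2 /andP[h1 h2]; apply/andP; split; lra.
Qed.

End BoundarySum.

(** * The estimates *)

Lemma nbhs_raise (R : realType) (x : R * R) (P : set (R * R)) : nbhs x P ->
  exists2 e : R, 0 < e & P (x.1, x.2 + e).
Proof.
move=> /nbhs_ballP[r /= r0 hr]; exists (r / 2); first by rewrite divr_gt0.
apply: hr; split; rewrite /ball /= /ball_ /=; first by rewrite subrr normr0.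
by rewrite opprD addrA subrr sub0r normrN gtr0_norm ?divr_gt0// ltr_pdivrMr// ltr_pMr// ltr1n.
Qed.

Section CuspDiscs.
Variables (R : realType) (Gamma : set 'M[R]_2) (F : set (R * R)).
Hypothesis hG : is_cofinite_fuchsian Gamma F.
Let fG : is_fuchsian Gamma. Proof. by case: hG. Qed.
Variable gr : R * R -> R * R -> R.
Hypothesis hgr : is_green_function Gamma F gr.
Variables (C : Type) (sigma : C -> 'M[R]_2).
Hypothesis ds : forall c, \det (sigma c) = 1.
Hypothesis hstab : forall c,
  pm (conjugate (invmx (sigma c)) (cusp_stab Gamma (sigma c))) =
  pm [set mat2 1 b%:~R 0 1 | b in [set: int]].
Variables (delta : R) (eps eps' : C -> R).
Hypothesis hdelta : 1 < delta.
Hypothesis heps : forall c, 0 < eps c < eps' c.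
(** This is exp(arcosh delta), so that (kap + 1/kap) / 2 = delta and a ratio kap of heights forces u
    >= delta. *)
Let kap := delta + Num.sqrt (delta ^+ 2 - 1).
Hypothesis hmin : forall c g, Gamma g -> ~ cusp_stab Gamma (sigma c) g ->
  eps' c * Num.sqrt kap <= Ccusp (sigma c) g.
Hypothesis heps_eps' : forall c, kap * eps c <= eps' c.
Hypothesis hdisj : trivIset setT (fun c => cusp_disc Gamma (sigma c) (eps' c)).
Variables A B : R.
Hypothesis hAB : forall z w,
  cusp_complement Gamma sigma eps z -> cusp_complement Gamma sigma eps w ->
  A <= cont_ext Gamma (fun z w => gr z w +
         \sum_(g \in [set g | Gamma g /\ upt z (mobius g w) <= delta])
            (Lfn (upt z (mobius g w)) - Lfn delta)) z w <= B.
Implicit Types (c d : C) (x v z w : R * R).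

(** Chosen so that kap / m^2 = (1/eps')^2: two points of height 1/eps' then meet the condition of
    [upt_nonstab] with k = kap. It exceeds eps', which leaves room below the horocycle 1/eps'. *)
Let m c := eps' c * Num.sqrt kap.
Let vI := (qvol Gamma F)^-1.

Let kap1 : 1 < kap.
Proof. by apply: lt_le_trans hdelta _; rewrite lerDl sqrtr_ge0. Qed.

Let kapE : (kap + kap^-1) / 2 = delta.
Proof.
have s2 : Num.sqrt (delta ^+ 2 - 1) ^+ 2 = delta ^+ 2 - 1.
  by rewrite sqr_sqrtr// subr_ge0 expr_ge1// ltW// (lt_trans ltr01).
have k0 : kap != 0 by rewrite gt_eqF// (lt_trans ltr01).
have -> : kap^-1 = delta - Num.sqrt (delta ^+ 2 - 1).
  apply: (mulfI k0); rewrite mulfV// /kap.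
  have -> : (delta + Num.sqrt (delta ^+ 2 - 1)) * (delta - Num.sqrt (delta ^+ 2 - 1)) =
    delta ^+ 2 - Num.sqrt (delta ^+ 2 - 1) ^+ 2 by ring.
  by rewrite s2; ring.
by rewrite /kap; field.
Qed.

Let e0 c : 0 < eps c. Proof. by have /andP[] := heps c. Qed.
Let e'0 c : 0 < eps' c. Proof. by have /andP[h] := heps c; exact: lt_trans. Qed.
Let sk1 : 1 < Num.sqrt kap.
Proof. by rewrite -(sqrtr1 R) ltr_sqrt// (lt_trans ltr01). Qed.
Let m0 c : 0 < m c. Proof. by rewrite mulr_gt0// (lt_trans ltr01). Qed.
Let mlt c : (m c)^-1 < (eps' c)^-1.
Proof. by rewrite ltf_pV2 ?posrE// -[ltLHS]mulr1 ltr_pM2l. Qed.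
Let elt c : (eps' c)^-1 < (eps c)^-1.
Proof. by rewrite ltf_pV2 ?posrE//; have /andP[] := heps c. Qed.
Let kape c : kap * (eps' c)^-1 <= (eps c)^-1.
Proof. by rewrite ler_pdivrMr// ler_pdivlMl// mulrC. Qed.
Let m2E c : kap / m c ^+ 2 = (eps' c)^-1 * (eps' c)^-1.
Proof.
have k0 : 0 < kap by rewrite (lt_trans ltr01).
by rewrite /m exprMn sqr_sqrtr ?ltW//; field; rewrite !gt_eqF.
Qed.

Let dsi c : \det (invmx (sigma c)) = 1. Proof. exact: det_invmx1. Qed.

Lemma cusp_disc_orbit s (e : R) z w : same_orbit Gamma w z -> cusp_disc Gamma s e z -> cusp_disc Gamma s e w.
Proof.
move=> [h Gh ->] [zu [g Gg gz]]; have dh := fuchsian_det fG Gh.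
split; first exact: upper_mobius.
exists (g *m invmx h); first by apply: (fuchsian_mul fG) => //; exact: (fuchsian_inv fG).
rewrite mobiusM ?(fuchsian_det fG Gg) ?det_invmx1//; last exact: upper_mobius.
by rewrite mobiusK.
Qed.

Let upper_of_height c x : (eps' c)^-1 <= x.2 -> upper x.
Proof. by apply: lt_le_trans; rewrite invr_gt0. Qed.

Lemma cusp_disc_coord c (e : R) x : upper x -> e^-1 < x.2 ->
  cusp_disc Gamma (sigma c) e (mobius (sigma c) x).
Proof.
move=> xu h; split; first exact: upper_mobius.
exists 1%:M; first exact: fuchsian_one.
by rewrite mobius1 /ycusp mobiusK.
Qed.

Lemma cusp_disc_le s (e e' : R) : 0 < e -> e <= e' -> cusp_disc Gamma s e `<=` cusp_disc Gamma s e'.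
Proof.
move=> e00 ee z [zu [g Gg h]]; split=> //; exists g => //; apply: le_lt_trans h.
by rewrite lef_pV2 ?posrE// (lt_le_trans e00).
Qed.

Let disj c d z : c <> d -> cusp_disc Gamma (sigma c) (eps' c) z ->
  ~ cusp_disc Gamma (sigma d) (eps' d) z.
Proof. by move=> cd h1 h2; apply: cd; apply: hdisj => //; exists z. Qed.

(** An image of x in a smaller disc of its own cusp would be an integer translate, because
    (1/eps')^2 > 1/m^2, and translates keep their height. Other cusps are excluded by the
    disjointness of the larger discs. *)
Lemma band_in_complement c x : (eps' c)^-1 <= x.2 -> x.2 <= (eps c)^-1 ->
  cusp_complement Gamma sigma eps (mobius (sigma c) x).
Proof.
move=> h1 h2; have xu := upper_of_height h1; split; first exact: upper_mobius.
move=> [d _ [_ [g Gg hg]]]; have dg := fuchsian_det fG Gg.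
have [cd|cd] := pselect (d = c).
  rewrite cd in hg; set x' := mobius (invmx (sigma c)) (mobius g (mobius (sigma c) x)).
  have x'u : upper x' by apply: upper_mobius => //; apply: upper_mobius => //; exact: upper_mobius.
  have so : same_orbit Gamma (mobius (sigma c) x') (mobius (sigma c) x).
    by exists g => //; rewrite mobiusKV//; apply: upper_mobius => //; exact: upper_mobius.
  have big : (m c ^+ 2)^-1 < x'.2 * x.2.
    have i0 : 0 < (eps' c)^-1 by rewrite invr_gt0.
    have : (eps' c)^-1 * (eps' c)^-1 < x'.2 * x.2.
      apply: (@lt_le_trans _ _ (x'.2 * (eps' c)^-1)); last by rewrite ler_wpM2l// ltW.
      by rewrite ltr_pM2r//; exact: lt_trans (elt c) hg.
    apply: lt_trans; rewrite -m2E -[ltLHS]mul1r ltr_pM2r// invr_gt0 exprn_gt0//.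
  have [b e] := same_orbit_cusp hG (ds c) (@hstab c) (m0 c) (@hmin c) xu x'u big so.
  by move: hg; rewrite /ycusp -/x' e /= ltNge h2.
have cont : {for x, continuous (fun y => ycusp (sigma d) (mobius g (mobius (sigma c) y)))}.
  apply: (@continuous_comp _ _ _ (mobius (sigma c)) (fun y => ycusp (sigma d) (mobius g y))).
    exact: mobius_continuous.
  have su : upper (mobius (sigma c) x) := upper_mobius (ds c) xu.
  apply: (@continuous_comp _ _ _ (mobius g) (fun y => ycusp (sigma d) y)); first exact: mobius_continuous.
  have gu := upper_mobius dg su.
  apply: (@continuous_comp _ _ _ (mobius (invmx (sigma d))) (fun y => y.2)); first exact: mobius_continuous.
  by set y := mobius _ _; apply: (@cvg_snd _ _ (nbhs y.1) (nbhs y.2)).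
have nx : \forall y \near x, (eps d)^-1 < ycusp (sigma d) (mobius g (mobius (sigma c) y)).
  exact: cvgr_gt cont _ hg.
(* At height exactly 1/eps' the point is not in the open disc about c. Raised slightly it is, while
   it remains in the disc about d. *)
have [r r0 hr] := nbhs_raise nx; pose y := (x.1, x.2 + r).
have hy : (eps' c)^-1 < y.2 by apply: (le_lt_trans h1); rewrite ltrDl.
have yu : upper y := upper_of_height (ltW hy).
apply: (@disj c d (mobius (sigma c) y)).
- by move=> e; apply: cd.
- exact: cusp_disc_coord.
- split; first exact: upper_mobius.
  exists g => //; exact: lt_trans (elt d) hr.
Qed.

(** On the horocycle 1/eps the sum contributes nothing: all images of w have height at most 1/eps'
    in the cusp coordinate, lower by a factor kap. So A and B bound gr itself there, and the bound
    extends up the cusp. *)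
Lemma green_outside c w x : cusp_complement Gamma sigma eps w ->
  ~ cusp_disc Gamma (sigma c) (eps' c) w -> (eps c)^-1 <= x.2 ->
  A <= gr w (mobius (sigma c) x) - vI * ln (eps c * x.2) <= B.
Proof.
move=> wY wD hx; have wu : upper w by case: wY.
have x0 : 0 < x.2 by apply: lt_le_trans hx; rewrite invr_gt0.
have off y : (eps' c)^-1 < y.2 -> offdiag Gamma (w, mobius (sigma c) y).
  move=> hy; have yu := upper_of_height (ltW hy); split => //=; first exact: upper_mobius.
  by move=> so; apply: wD; apply: (cusp_disc_orbit so); exact: cusp_disc_coord.
have bd a : A - vI * ln (eps c)^-1 <= cusp_green Gamma F (sigma c) gr w (a, (eps c)^-1) <= B - vI * ln (eps c)^-1.
  set y := (a, (eps c)^-1).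
  have hy : (eps' c)^-1 < y.2 by exact: elt.
  have yu := upper_of_height (ltW hy).
  have := hAB wY (band_in_complement (ltW hy) (lexx _)).
  have [_ _ no] := off y hy; rewrite /cont_ext asboolF//.
  (* Terms with u <= delta also have u >= delta, so each of them is zero. *)
  rewrite fsbig1 ?addr0; first by rewrite /cusp_green /= !lerD2r.
  move=> g [Gg ug]; apply/eqP; rewrite subr_eq0; apply/eqP; congr Lfn.
  apply/le_anti; rewrite ug/=; have dg := fuchsian_det fG Gg.
  set w' := mobius (invmx g) w; have w'u : upper w' by apply: upper_mobius => //; exact: det_invmx1.
  set u := mobius (invmx (sigma c)) w'; have uu : upper u by exact: upper_mobius.
  have ew : w = mobius g (mobius (sigma c) u) by rewrite mobiusKV// mobiusKV.
  have su := upper_mobius (ds c) uu; have sy := upper_mobius (ds c) yu.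
  rewrite {1}ew upt_mobius// upt_mobius// upt_sym// -kapE.
  apply: upt_ratio_ge => //; first exact: ltW.
  apply: (le_trans _ (kape c)); rewrite ler_pM2l; last by rewrite (lt_trans ltr01).
  rewrite leNgt; apply/negP => hu; apply: wD; split=> //.
  by exists (invmx g) => //; exact: (fuchsian_inv fG).
have := cusp_green_extend hG (ds c) (@hstab c) (m0 c) (@hmin c) hgr wu (ltW (mlt c)) (elt c) off bd hx.
rewrite /cusp_green -/vI lnM ?posrE// lnV ?posrE// => /andP[h1 h2]; apply/andP; split; lra.
Qed.

(** A point on the horocycle 1/eps of d lies in Y and outside the larger disc of c, so
    [green_outside] supplies the boundary values for extending the second variable into the disc of
    d. *)
Lemma green_two_cusps c d x v : c <> d -> (eps c)^-1 <= x.2 -> (eps d)^-1 <= v.2 ->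
  A <= gr (mobius (sigma c) x) (mobius (sigma d) v) - vI * ln (eps c * x.2) - vI * ln (eps d * v.2) <= B.
Proof.
move=> cd hx hv; have [_ sym _ _ _] := hgr.
have x0 : 0 < x.2 by apply: lt_le_trans hx; rewrite invr_gt0.
have v0 : 0 < v.2 by apply: lt_le_trans hv; rewrite invr_gt0.
have xD : cusp_disc Gamma (sigma c) (eps' c) (mobius (sigma c) x).
  by apply: cusp_disc_coord => //; exact: lt_le_trans (elt c) hx.
have off y : (eps' d)^-1 < y.2 -> offdiag Gamma (mobius (sigma c) x, mobius (sigma d) y).
  move=> hy; have yu := upper_of_height (ltW hy); split => /=; [exact: upper_mobius|exact: upper_mobius|].
  move=> so; apply: (disj cd xD); apply: (cusp_disc_orbit so); exact: cusp_disc_coord.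
have bd a : A + vI * ln (eps c * x.2) - vI * ln (eps d)^-1 <=
    cusp_green Gamma F (sigma d) gr (mobius (sigma c) x) (a, (eps d)^-1) <=
    B + vI * ln (eps c * x.2) - vI * ln (eps d)^-1.
  set y := (a, (eps d)^-1); have hy : (eps' d)^-1 < y.2 by exact: elt.
  have yu := upper_of_height (ltW hy).
  have yY := band_in_complement (ltW hy) (lexx _).
  have yD : ~ cusp_disc Gamma (sigma c) (eps' c) (mobius (sigma d) y).
    by apply: (@disj d c) => [e|]; [apply: cd|exact: cusp_disc_coord].
  have := green_outside yY yD hx; rewrite /cusp_green -(sym _ _ (off y hy)) -/vI /=.
  by move=> /andP[h1 h2]; apply/andP; split; lra.
have su := upper_mobius (ds c) (x0 : upper x).
have := cusp_green_extend hG (ds d) (@hstab d) (m0 d) (@hmin d) hgr su (ltW (mlt d)) (elt d) off bd hv.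
rewrite /cusp_green -/vI (lnM (x := eps d)) ?posrE// lnV ?posrE// => /andP[h1 h2]; apply/andP; split; lra.
Qed.

Lemma cusp_pair_bounds c x v : (eps' c)^-1 <= x.2 -> (eps' c)^-1 <= v.2 -> 0 < qd x v ->
  Atilde Gamma A delta (eps' c) <= cusp_pair Gamma F (sigma c) gr v x - 2 * (vI * ln (eps' c))
    <= Btilde Gamma B delta (eps' c).
Proof.
move=> hx hv q0; set y1 := (eps' c)^-1; have y10 : 0 < y1 by rewrite invr_gt0.
have ln1 : ln y1 = - ln (eps' c) by rewrite lnV ?posrE.
have bd x' v' : x'.2 = y1 -> v'.2 = y1 -> 0 < qd x' v' ->
    Atilde Gamma A delta y1^-1 - 2 * (vI * ln y1) <= cusp_pair Gamma F (sigma c) gr v' x'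
    <= Btilde Gamma B delta y1^-1 - 2 * (vI * ln y1).
  move=> xy vy q1.
  apply: (cusp_pair_boundary hG (ds c) (@hstab c) (m0 c) (@hmin c) hdelta (ltW kap1) kapE y10 _ xy vy q1).
    by rewrite m2E.
  have hx' : (m c)^-1 < x'.2 by rewrite xy; exact: mlt.
  have hv' : (m c)^-1 < v'.2 by rewrite vy; exact: mlt.
  have [_ _ no] := (offdiag_qd hG (ds c) (@hstab c) (m0 c) (@hmin c) hx' hv').2 q1.
  have Y t : t.2 = y1 -> cusp_complement Gamma sigma eps (mobius (sigma c) t).
    by move=> e; apply: band_in_complement; rewrite e// ltW// elt.
  by have := hAB (Y _ vy) (Y _ xy); rewrite /cont_ext asboolF.
have := cusp_pair_extend2 hG (ds c) (@hstab c) (m0 c) (@hmin c) hgr (mlt c) bd hx hv q0.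
rewrite ln1 invrK => /andP[h1 h2]; apply/andP; split; lra.
Qed.

Let n : R := (ncenter Gamma)%:R.
Let coord c g z := mobius (invmx (sigma c)) (mobius g z).

Definition disc_green c g h z w : R := gr z w
  - n * (2 * pi)^-1 * ln (ComplexField.Normc.normc (qcusp (sigma c) (mobius g z) - qcusp (sigma c) (mobius h w)))
  - vI * ln (eps' c * ycusp (sigma c) (mobius g z))
  - vI * ln (eps' c * ycusp (sigma c) (mobius h w)).

Let coordK c g z : Gamma g -> upper z -> mobius (sigma c) (coord c g z) = mobius g z.
Proof. by move=> Gg zu; rewrite mobiusKV//; apply: upper_mobius => //; exact: (fuchsian_det fG). Qed.

(** The invariance of gr moves z and w to their representatives; the two factors eps' inside the
    logarithms give the constant 2 vI ln eps'. *)
Lemma disc_greenE c g h z w : Gamma g -> Gamma h -> offdiag Gamma (z, w) ->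
  (eps' c)^-1 < (coord c g z).2 -> (eps' c)^-1 < (coord c h w).2 ->
  0 < qd (coord c h w) (coord c g z) /\
  disc_green c g h z w = cusp_pair Gamma F (sigma c) gr (coord c g z) (coord c h w) - 2 * (vI * ln (eps' c)).
Proof.
move=> Gg Gh o hz hw; have [/= zu wu no] := o; have [inv _ _ _ _] := hgr.
have gzu := upper_mobius (fuchsian_det fG Gg) zu; have hwu := upper_mobius (fuchsian_det fG Gh) wu.
have o1 : offdiag Gamma (mobius g z, w).
  split=> //= so; apply: no; apply: (same_orbit_trans fG wu _ so).
  by apply: (same_orbit_sym fG zu); exists g.
have o2 : offdiag Gamma (mobius g z, mobius h w).
  split=> //= so; have [_ _] := o1; apply; apply: (same_orbit_trans fG wu so).
  by exists h.
have e : gr z w = gr (mobius (sigma c) (coord c g z)) (mobius (sigma c) (coord c h w)).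
  by rewrite !coordK// (inv h _ _ Gh o1).2 (inv g _ _ Gg o).1.
have o3 : offdiag Gamma (mobius (sigma c) (coord c g z), mobius (sigma c) (coord c h w)) by rewrite !coordK.
have q0 : 0 < qd (coord c h w) (coord c g z).
  by apply: ((offdiag_qd hG (ds c) (@hstab c) (m0 c) (@hmin c) _ _).1 o3); exact: lt_trans (mlt c) _.
split=> //; rewrite /disc_green e /cusp_pair /cusp_green /ycusp -!/(coord _ _ _).
have := normc_qcusp (sigma c) (mobius g z) (mobius h w); rewrite -!/(coord _ _ _) qd_sym => nq.
have nc0 : 0 <= ComplexField.Normc.normc (qcusp (sigma c) (mobius g z) - qcusp (sigma c) (mobius h w)).
  by case: (_ - _) => a b; exact: sqrtr_ge0.
have nc : 0 < ComplexField.Normc.normc (qcusp (sigma c) (mobius g z) - qcusp (sigma c) (mobius h w)).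
  rewrite lt_def nc0 andbT; apply/eqP => nE; move: nq q0; rewrite nE expr0n/= => <-.
  by rewrite ltxx.
have z0 : 0 < (coord c g z).2 by apply: lt_trans hz; rewrite invr_gt0.
have w0 : 0 < (coord c h w).2 by apply: lt_trans hw; rewrite invr_gt0.
rewrite -nq lnXn// !lnM ?posrE// -/n -/vI -[_ *+ 2]mulr_natl.
move: (ln (ComplexField.Normc.normc _)) => L; rewrite !invfM; move: (pi^-1) => u; by field.
Qed.

(** What a bound for the continuous extension takes: pairs off the orbit exist near (z, w), the
    limit exists, and nearby pairs satisfy the conditions under which the bound is known. *)
Lemma disc_green_cvg c g h z w : Gamma g -> Gamma h -> upper z -> upper w ->
  same_orbit Gamma z w -> (eps' c)^-1 < (coord c g z).2 -> (eps' c)^-1 < (coord c h w).2 ->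
  [/\ ProperFilter (within (offdiag Gamma) (nbhs (z, w))),
   cvg (disc_green c g h p.1 p.2 @[p --> within (offdiag Gamma) (nbhs (z, w))]) &
   \forall p \near within (offdiag Gamma) (nbhs (z, w)),
     [/\ offdiag Gamma p, (eps' c)^-1 < (coord c g p.1).2 & (eps' c)^-1 < (coord c h p.2).2]].
Proof.
move=> Gg Gh zu wu so hz hw.
set W := within _ _; have FW : Filter W by exact: within_filter.
have dg := fuchsian_det fG Gg; have dh := fuchsian_det fG Gh.
have gzu := upper_mobius dg zu; have hwu := upper_mobius dh wu.
set v0 := coord c g z; set x0 := coord c h w.
have hv0 : (m c)^-1 < v0.2 by exact: lt_trans (mlt c) hz.
have hx0 : (m c)^-1 < x0.2 by exact: lt_trans (mlt c) hw.
have vu : upper v0 := upper_of_height (ltW hz); have xu : upper x0 := upper_of_height (ltW hw).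
have i0 : 0 < (m c)^-1 by rewrite invr_gt0.
have m2 (y y' : R * R) : (m c)^-1 < y.2 -> (m c)^-1 < y'.2 -> (m c ^+ 2)^-1 < y.2 * y'.2.
  by move=> h1 h2; rewrite -exprVn expr2; apply: ltr_pM => //; exact: ltW.
have so_zw z' : upper z' -> same_orbit Gamma z' w -> (m c)^-1 < (coord c g z').2 ->
    exists b, coord c g z' = hshift b x0.
  move=> z'u so' hz'; have gz'u := upper_mobius dg z'u.
  apply: (same_orbit_cusp hG (ds c) (@hstab c) (m0 c) (@hmin c) xu); [exact: upper_mobius|exact: m2|].
  rewrite !coordK//; apply: (same_orbit_trans fG hwu (w := w)); last first.
    by apply: (same_orbit_sym fG wu); exists h.
  by apply: (same_orbit_trans fG wu _ so'); exists g.
have [b eb] := so_zw z zu so hv0; rewrite -/v0 in eb.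
have cont k (y : R * R) : Gamma k -> upper y -> {for y, continuous (coord c k)}.
  move=> Gk yu; apply: (@continuous_comp _ _ _ (mobius k) (mobius (invmx (sigma c)))).
    by apply: mobius_continuous => //; exact: (fuchsian_det fG).
  by apply: mobius_continuous => //; apply: upper_mobius => //; exact: (fuchsian_det fG).
have WN : W --> nbhs (z, w) by exact: cvg_within.
have c1 : coord c g p.1 @[p --> W] --> v0.
  have h1 : p.1 @[p --> W] --> z by apply: cvg_trans (@cvg_fst _ _ (nbhs z) (nbhs w) _); exact: cvg_app.
  exact: (cvg_comp _ _ h1 (cont _ _ Gg zu)).
have c2 : coord c h p.2 @[p --> W] --> x0.
  have h1 : p.2 @[p --> W] --> w by apply: cvg_trans (@cvg_snd _ _ (nbhs z) (nbhs w) _); exact: cvg_app.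
  exact: (cvg_comp _ _ h1 (cont _ _ Gh wu)).
have snd_c (y : R * R) : {for y, continuous (fun t : R * R => t.2)}.
  by apply: (@cvg_snd _ _ (nbhs y.1) (nbhs y.2)).
have c12 : (coord c g p.1).2 @[p --> W] --> v0.2 by exact: (cvg_comp _ _ c1 (@snd_c _)).
have c22 : (coord c h p.2).2 @[p --> W] --> x0.2 by exact: (cvg_comp _ _ c2 (@snd_c _)).
have near_good : \forall p \near W,
     [/\ offdiag Gamma p, (eps' c)^-1 < (coord c g p.1).2 & (eps' c)^-1 < (coord c h p.2).2].
  near=> p; split; near: p; [exact: withinT|exact: cvgr_gt c12 _ hz|exact: cvgr_gt c22 _ hw].
split=> //.
(* Raising z vertically in the cusp coordinate leaves the orbit of w, since equivalent points at
   such heights have equal heights. *)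
- apply: Build_ProperFilter_ex => P WP.
  have nP : nbhs v0 [set y | offdiag Gamma (mobius (invmx g) (mobius (sigma c) y), w) ->
      P (mobius (invmx g) (mobius (sigma c) y), w)].
    have su := upper_mobius (ds c) vu; have dgi := det_invmx1 dg.
    have ck : {for v0, continuous (fun y => mobius (invmx g) (mobius (sigma c) y))}.
      apply: (@continuous_comp _ _ _ (mobius (sigma c)) (mobius (invmx g))); exact: mobius_continuous.
    have ez : mobius (invmx g) (mobius (sigma c) v0) = z by rewrite coordK// mobiusK.
    have cz : mobius (invmx g) (mobius (sigma c) y) @[y --> v0] --> z by rewrite -[X in _ --> X]ez.
    have cp : (mobius (invmx g) (mobius (sigma c) y), w) @[y --> v0] --> (z, w).
      by exact: (cvg_pair cz (cvg_cst w)).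
    exact: (cp _ WP).
  have [e e1 he] := nbhs_raise nP; set y := (_, _) in he; eexists; apply: he.
  have yu : upper y by rewrite /upper /= addr_gt0.
  have syu := upper_mobius (ds c) yu.
  have ku : upper (mobius (invmx g) (mobius (sigma c) y)) by apply: upper_mobius => //; exact: det_invmx1.
  have ey : coord c g (mobius (invmx g) (mobius (sigma c) y)) = y by rewrite /coord mobiusKV// mobiusK.
  split => //= so'; have hy : (m c)^-1 < y.2 by apply: (lt_trans hv0); rewrite /= ltrDl.
  have [b' eb'] := so_zw _ ku so' (ltac:(by rewrite ey)).
  have k1 : v0.2 + e = x0.2 := congr1 snd (etrans (esym ey) eb').
  have k2 : v0.2 = x0.2 := congr1 snd eb.
  by lra.
- have [l hl] := cusp_pair_diag hG (ds c) (@hstab c) (m0 c) (@hmin c) hgr hv0.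
  apply/cvg_ex; exists (l - 2 * (vI * ln (eps' c))).
  (* The coordinates of z and w may differ by a nontrivial translation b; undoing it brings both to
     v0, where [cusp_pair_diag] applies. *)
  have cs : hshift b (coord c h p.2) @[p --> W] --> v0.
    have k2 : (hshift b (coord c h p.2)).2 @[p --> W] --> v0.2 by rewrite eb; exact: c22.
    have k1 : (hshift b (coord c h p.2)).1 @[p --> W] --> v0.1.
      rewrite eb; apply: cvgD; last exact: cvg_cst.
      by apply: (cvg_comp _ _ c2); apply: (@cvg_fst _ _ (nbhs x0.1) (nbhs x0.2)).
    by rewrite [v0]surjective_pairing; exact: (cvg_pair k1 k2).
  have cl : cusp_pair Gamma F (sigma c) gr (coord c g p.1) (hshift b (coord c h p.2)) @[p --> W] --> l.
    have cw : (coord c g p.1, hshift b (coord c h p.2)) @[p --> W] -->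
        within [set p | 0 < qd p.2 p.1] (nbhs (v0, v0)).
      have cp : (coord c g p.1, hshift b (coord c h p.2)) @[p --> W] --> (v0, v0) by exact: (cvg_pair c1 cs).
      move=> U nU.
      have h1 : \forall p \near W, 0 < qd (hshift b (coord c h p.2)) (coord c g p.1) ->
        U (coord c g p.1, hshift b (coord c h p.2)) := cp _ nU.
      have : \forall p \near W, U (coord c g p.1, hshift b (coord c h p.2)); last by [].
      apply: filterS2 h1 near_good => p h1 [ho h2 h3]; apply: h1.
      by rewrite qd_shift; have [] := disc_greenE Gg Gh ho h2 h3.
    exact: (cvg_comp _ _ cw hl).
  have cl' : cusp_pair Gamma F (sigma c) gr (coord c g p.1) (hshift b (coord c h p.2)) - 2 * (vI * ln (eps' c)) @[p --> W]
     --> l - 2 * (vI * ln (eps' c)) by apply: cvgB => //; exact: cvg_cst.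
  apply: cvg_trans cl'; apply: near_eq_cvg; apply: filterS near_good => -[z' w'] [ho h2 h3].
  have [q0 ->] := disc_greenE Gg Gh ho h2 h3.
  by rewrite (cusp_pair_shift hG (ds c) (@hstab c) (m0 c) (@hmin c) hgr _ (lt_trans (mlt c) h3) (lt_trans (mlt c) h2) q0).
Unshelve. all: by end_near. Qed.

(** [green_outside] has the point of the disc as second argument. The equality gr z w = gr w z is
    kept in the conclusion so that both (a) and (a') can be read off. *)
Lemma green_one_disc c z w g : cusp_disc Gamma (sigma c) (eps c) z ->
  cusp_complement Gamma sigma eps w -> ~ cusp_disc Gamma (sigma c) (eps' c) w -> Gamma g ->
  (eps c)^-1 < ycusp (sigma c) (mobius g z) ->
  gr z w = gr w z /\ A <= gr z w - vI * ln (eps c * ycusp (sigma c) (mobius g z)) <= B.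
Proof.
move=> zD wY wD Gg hg; have zu : upper z by case: zD. have wu : upper w by case: wY.
have le' : eps c <= eps' c by have /andP[_ /ltW] := heps c.
have o : offdiag Gamma (z, w).
  split=> //= so; apply: wD; apply: (@cusp_disc_orbit _ _ z); first exact: (same_orbit_sym fG).
  exact: (cusp_disc_le (e0 c) le').
have [inv sym _ _ _] := hgr; split; first exact: sym.
have gzu := upper_mobius (fuchsian_det fG Gg) zu.
have o' : offdiag Gamma (mobius g z, w).
  split=> //= so; have [_ _] := o; apply; apply: (same_orbit_trans fG wu _ so).
  by apply: (same_orbit_sym fG zu); exists g.
rewrite -(inv g _ _ Gg o).1 (sym _ _ o').
by have := @green_outside c w (coord c g z) wY wD (ltW hg); rewrite coordK.
Qed.

Lemma green_two_discs c d z w g h : c <> d -> cusp_disc Gamma (sigma c) (eps c) z ->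
  cusp_disc Gamma (sigma d) (eps d) w -> Gamma g -> Gamma h ->
  (eps c)^-1 < ycusp (sigma c) (mobius g z) -> (eps d)^-1 < ycusp (sigma d) (mobius h w) ->
  A <= gr z w - vI * ln (eps c * ycusp (sigma c) (mobius g z))
    - vI * ln (eps d * ycusp (sigma d) (mobius h w)) <= B.
Proof.
move=> cd zD wD Gg Gh hg hh; have zu : upper z by case: zD. have wu : upper w by case: wD.
have le' e : eps e <= eps' e by have /andP[_ /ltW] := heps e.
have [inv _ _ _ _] := hgr.
have gzu := upper_mobius (fuchsian_det fG Gg) zu.
have no : ~ same_orbit Gamma z w.
  move=> so; apply: (disj cd (z := z)); first exact: (cusp_disc_le (e0 c) (le' c)).
  by apply: (cusp_disc_le (e0 d) (le' d)); exact: cusp_disc_orbit wD.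
have o : offdiag Gamma (z, w) by [].
have o' : offdiag Gamma (mobius g z, w).
  split=> //= so; apply: no; apply: (same_orbit_trans fG wu _ so).
  by apply: (same_orbit_sym fG zu); exists g.
rewrite -(inv g _ _ Gg o).1 -(inv h _ _ Gh o').2 -(coordK c Gg zu) -(coordK d Gh wu).
have := green_two_cusps cd (ltW hg) (ltW hh); rewrite -/(coord c g z) -/(coord d h w).
by rewrite /ycusp !mobiusK//; apply: upper_mobius => //; apply: upper_mobius => //; exact: (fuchsian_det fG).
Qed.

Lemma green_same_disc c z w g h : cusp_disc Gamma (sigma c) (eps' c) z ->
  cusp_disc Gamma (sigma c) (eps' c) w -> Gamma g -> Gamma h ->
  (eps' c)^-1 < ycusp (sigma c) (mobius g z) -> (eps' c)^-1 < ycusp (sigma c) (mobius h w) ->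
  Atilde Gamma A delta (eps' c) <= cont_ext Gamma (disc_green c g h) z w <= Btilde Gamma B delta (eps' c).
Proof.
move=> [zu _] [wu _] Gg Gh hg hh.
have bd z' w' : offdiag Gamma (z', w') -> (eps' c)^-1 < (coord c g z').2 ->
    (eps' c)^-1 < (coord c h w').2 ->
    Atilde Gamma A delta (eps' c) <= disc_green c g h z' w' <= Btilde Gamma B delta (eps' c).
  move=> o h1 h2; have [q0 ->] := disc_greenE Gg Gh o h1 h2.
  exact: (cusp_pair_bounds (ltW h2) (ltW h1) q0).
rewrite /cont_ext; case: asboolP => so; last by apply: bd.
have [PF cv ng] := disc_green_cvg Gg Gh zu wu so hg hh.
apply/andP; split.
  apply: limr_ge => //; apply: filterS ng => -[z' w'] /= [ho h1 h2].
  by have /andP[] := bd _ _ ho h1 h2.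
apply: limr_le => //; apply: filterS ng => -[z' w'] /= [ho h1 h2].
by have /andP[] := bd _ _ ho h1 h2.
Qed.

End CuspDiscs.

Theorem proposition5p5 (R : realType)
    (Gamma : set 'M[R]_2) (F : set (R * R))
    (hGamma : is_cofinite_fuchsian Gamma F)
    (gr : R * R -> R * R -> R) (hgr : is_green_function Gamma F gr)
    (C : Type) (par : C -> set 'M[R]_2) (sigma : C -> 'M[R]_2)
    (hcusp : is_cusp_system Gamma par sigma)
    (delta : R) (hdelta : 1 < delta)
    (eps eps' : C -> R)
    (heps : forall c, 0 < eps c < eps' c)
    (heps'_min : forall c g, Gamma g -> ~ cusp_stab Gamma (sigma c) g ->
       eps' c * Num.sqrt (delta + Num.sqrt (delta ^+ 2 - 1))
         <= Ccusp (sigma c) g)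
    (heps_eps' : forall c,
       (delta + Num.sqrt (delta ^+ 2 - 1)) * eps c <= eps' c)
    (hdisj : trivIset setT (fun c => cusp_disc Gamma (sigma c) (eps' c)))
    (A B : R)
    (hAB : forall z w,
       cusp_complement Gamma sigma eps z -> cusp_complement Gamma sigma eps w ->
       A <= cont_ext Gamma (fun z w => gr z w +
              \sum_(g \in [set g | Gamma g /\ upt z (mobius g w) <= delta])
                 (Lfn (upt z (mobius g w)) - Lfn delta)) z w <= B) :
  [/\
    (* (a) *)
    (forall c z w,
       cusp_disc Gamma (sigma c) (eps c) z ->
       cusp_complement Gamma sigma eps w ->
       ~ cusp_disc Gamma (sigma c) (eps' c) w ->
       forall g, Gamma g -> (eps c)^-1 < ycusp (sigma c) (mobius g z) ->
       A <= gr z w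
            - (qvol Gamma F)^-1 * ln (eps c * ycusp (sigma c) (mobius g z))
         <= B),
    (* (a') *)
    (forall c z w,
       cusp_disc Gamma (sigma c) (eps c) w ->
       cusp_complement Gamma sigma eps z ->
       ~ cusp_disc Gamma (sigma c) (eps' c) z ->
       forall g, Gamma g -> (eps c)^-1 < ycusp (sigma c) (mobius g w) ->
       A <= gr z w
            - (qvol Gamma F)^-1 * ln (eps c * ycusp (sigma c) (mobius g w))
         <= B),
    (* (b) *)
    (forall c d z w, c <> d ->
       cusp_disc Gamma (sigma c) (eps c) z ->
       cusp_disc Gamma (sigma d) (eps d) w ->
       forall g h, Gamma g -> Gamma h ->
       (eps c)^-1 < ycusp (sigma c) (mobius g z) ->
       (eps d)^-1 < ycusp (sigma d) (mobius h w) ->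
       A <= gr z w
            - (qvol Gamma F)^-1 * ln (eps c * ycusp (sigma c) (mobius g z))
            - (qvol Gamma F)^-1 * ln (eps d * ycusp (sigma d) (mobius h w))
         <= B)
  & (* (c) *)
    (forall c z w,
       cusp_disc Gamma (sigma c) (eps' c) z ->
       cusp_disc Gamma (sigma c) (eps' c) w ->
       forall g h, Gamma g -> Gamma h ->
       (eps' c)^-1 < ycusp (sigma c) (mobius g z) ->
       (eps' c)^-1 < ycusp (sigma c) (mobius h w) ->
       Atilde Gamma A delta (eps' c)
         <= cont_ext Gamma (fun z w => gr z w
              - (ncenter Gamma)%:R * (2 * pi)^-1 *
                ln (ComplexField.Normc.normc (qcusp (sigma c) (mobius g z)
                           - qcusp (sigma c) (mobius h w)))
              - (qvol Gamma F)^-1 * ln (eps' c * ycusp (sigma c) (mobius g z))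
              - (qvol Gamma F)^-1 * ln (eps' c * ycusp (sigma c) (mobius h w)))
              z w
         <= Btilde Gamma B delta (eps' c))].
Proof.
have [_ _ ds _ hst] := hcusp.
split.
- move=> c z w zD wY wD g Gg hg.
  exact: (green_one_disc hGamma hgr ds hst hdelta heps heps'_min heps_eps' hdisj hAB zD wY wD Gg hg).2.
- move=> c z w wD zY zD g Gg hg.
  have [<- h] := green_one_disc hGamma hgr ds hst hdelta heps heps'_min heps_eps' hdisj hAB wD zY zD Gg hg.
  exact: h.
- move=> c d z w cd zD wD g h Gg Gh hg hh.
  exact: (green_two_discs hGamma hgr ds hst hdelta heps heps'_min heps_eps' hdisj hAB cd zD wD Gg Gh hg hh).
- move=> c z w zD wD g h Gg Gh hg hh.
  exact: (green_same_disc hGamma hgr ds hst hdelta heps heps'_min hdisj hAB zD wD Gg Gh hg hh).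
Qed.
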